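(* Let $X=\Gamma\backslash\mathbb{D}$ be a compact Riemann surface of genus $g\ge 2$ with injectivity radius $r_X$, and let $$C(r_X)=\left\{\frac{4\pi}{3}\left[1-\left(\frac{4e^{r_X}}{(e^{r_X}+1)^2}\right)^3\right]\right\}^{-\frac12}.$$ At the point of the moduli space $\mathcal{M}_g$ of compact Riemann surfaces of genus $g$ corresponding to $X$: A. The Ricci curvature of the Weil--Petersson metric is bounded below by $-2C(r_X)^2$, i.e. $\mathcal{R}_{\alpha\bar\alpha}\ge -2C(r_X)^2$ for every $\nu_\alpha\in\Omega^{-1,1}(\mathbb{D},\Gamma)$ with $\|\nu_\alpha\|_{WP}=1$. B. The scalar curvature $S$ of the Weil--Petersson metric is bounded below by $-2(3g-3)C(r_X)^2$.
   Context: $\mathbb{D}$ is the open unit disc in $\mathbb{C}$, with hyperbolic metric density $\rho(z)=\frac{4}{(1-|z|^2)^2}$ (the metric $\rho(z)|dz|^2$ has constant curvature $-1$), and $d^2z$ is Lebesgue measure. A compact Riemann surface $X$ of genus $g\geq 2$ is written $X=\Gamma\backslash\mathbb{D}$ with $\Gamma\subset \mathrm{PSU}(1,1)$ a Fuchsian group (torsion-free, cocompact), and carries the induced hyperbolic metric with distance $d$. For $z\in X$, the injectivity radius $inj(X;z)$ is the supremum of all $r>0$ for which the open set $\{w\in X: d(z,w)<r\}$ is isometric to a disc (a hyperbolic disc of radius $r$ in $\mathbb{D}$). The injectivity radius of $X$ is $r_X=inj(X)=\inf_{z\in X} inj(X;z)$. $\Omega^{2,0}(\mathbb{D},\Gamma)$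 is the space of holomorphic functions $q$ on $\mathbb{D}$ with $q(\gamma(z))\gamma'(z)^2=q(z)$ for all $\gamma\in\Gamma$. The space of harmonic Beltrami differentials is $\Omega^{-1,1}(\mathbb{D},\Gamma)=\{\nu=\rho^{-1}\overline{q}: q\in\Omega^{2,0}(\mathbb{D},\Gamma)\}$; it has complex dimension $3g-3$ and is identified with the holomorphic tangent space, at the point corresponding to $X$, of Teichmüller space $T_g$ (of which $\mathcal{M}_g$ is the quotient by the mapping class group). The Weil--Petersson metric is the Hermitian metric $$\langle \nu_\alpha,\nu_\beta\rangle_{WP}=\iint_{\Gamma\backslash\mathbb{D}}\nu_\alpha\overline{\nu_\beta}\,\rho\, d^2z ,\qquad \|\nu\|_{WP}^2=\langle\nu,\nu\rangle_{WP},$$ which is modular invariant and descends to $\mathcal{M}_g$. Let $\Delta=-\rho^{-1}\partial\bar\partial$ be the (nonnegative) Laplace--Beltrami operator on $X$, where $\partial=\partial/\partial z$, $\bar\partial=\partial/\partial\bar z$, and $G=\frac12\left(\Delta+\frac12\right)^{-1}$ acting on $L^2(X,\rho\,d^2z)$. The Riemann curvature tensor of the Weil--Petersson metric at $X$ is (Wolpert's formula, in the sign convention used here) $$R_{\alpha\bar\beta\lambda\bar\delta}=-\iint_{\Gamma\backslash\mathbb{D}}G(\nu_\alpha\bar\nu_\beta)\,\nu_\lambda\bar\nu_\delta\,\rho\,d^2z-\iint_{\Gamma\backslash\mathbb{D}}G(\nu_\alpha\bar\nu_\delta)\,\nu_\lambda\bar\nu_\beta\,\rho\,d^2z .$$ Let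 $\{\nu_1,\dots,\nu_{3g-3}\}$ be an orthonormal basis of $\Omega^{-1,1}(\mathbb{D},\Gamma)$ for $\langle\cdot,\cdot\rangle_{WP}$. The Ricci curvature in the direction of $\nu_\alpha$ with $\|\nu_\alpha\|_{WP}=1$ is $$\mathcal{R}_{\alpha\bar\alpha}=\sum_{\beta=1}^{3g-3}R_{\alpha\bar\beta\beta\bar\alpha}=-\sum_{\beta=1}^{3g-3}\left\{\iint_{\Gamma\backslash\mathbb{D}}G(\nu_\alpha\bar\nu_\beta)\bar\nu_\alpha\nu_\beta\,\rho\,d^2z+\iint_{\Gamma\backslash\mathbb{D}}G(|\nu_\alpha|^2)|\nu_\beta|^2\rho\,d^2z\right\},$$ and the scalar curvature is the trace $S=\sum_{\alpha=1}^{3g-3}\mathcal{R}_{\alpha\bar\alpha}$ over the orthonormal basis. *)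

(* Defs.v *)
From HB Require Import structures.
From mathcomp Require Import all_boot all_order all_algebra.
From mathcomp Require Import all_classical all_reals all_analysis.
From mathcomp Require Import complex.

Set Implicit Arguments.
Unset Strict Implicit.
Unset Printing Implicit Defensive.

Import Order.TTheory GRing.Theory Num.Theory.
Import numFieldNormedType.Exports.
Local Open Scope classical_set_scope.
Local Open Scope ring_scope.

Local Notation re := complex.Re.
Local Notation im := complex.Im.

(** Norms, conjugation and the order on [R[i]] are those of [numClosedFieldType]:
    [`|z|] is itself an element of [R[i]], and [x <= y] means that [y - x] is a
    nonnegative real number.  Analysis over the field [R[i]] is done in
    [R[i]^o], the complex numbers as a normed module over themselves.  Functions
    on the disc are total functions on [R[i]]; only their values on [disc]
    matter. *)

Definition disc {R : realType} : set R[i] := [set z | `|z| < 1].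

Definition rho {R : realType} (z : R[i]) : R[i] := 4 / (1 - `|z| ^+ 2) ^+ 2.

(** The distance of [rho |dz|^2], that is [2 artanh (|z - w| / |1 - w^* z|)]. *)
Definition hdist {R : realType} (z w : R[i]) : R :=
  let t := re (`|z - w| / `|1 - Num.conj w * z|) in ln ((1 + t) / (1 - t)).

Definition su11 {R : realType} (A : 'M[R[i]]_2) : Prop :=
  [/\ A 1 1 = Num.conj (A 0 0), A 1 0 = Num.conj (A 0 1) & \det A = 1].

Definition moebius {R : realType} (A : 'M[R[i]]_2) (z : R[i]) : R[i] :=
  (A 0 0 * z + A 0 1) / (A 1 0 * z + A 1 1).

(** A subgroup of PSU(1,1) = SU(1,1)/{1,-1} is given by its preimage in SU(1,1),
    i.e. by a subgroup of SU(1,1) containing -1. *)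
Definition su11_subgroup {R : realType} (Gam : set 'M[R[i]]_2) : Prop :=
  [/\ Gam `<=` su11, Gam 1, Gam (- 1),
      forall A B, Gam A -> Gam B -> Gam (A * B)
    & forall A, Gam A -> Gam A^-1].

Definition discrete_group {R : realType} (Gam : set 'M[R[i]]_2) : Prop :=
  exists2 e : R, 0 < e &
    forall A, Gam A -> (forall i j, `|A i j - (1 : 'M[R[i]]_2) i j| < e%:C%C) ->
      A = 1.

Definition torsion_free {R : realType} (Gam : set 'M[R[i]]_2) : Prop :=
  forall A (n : nat), Gam A -> (0 < n)%N ->
    A ^+ n = 1 \/ A ^+ n = - 1 -> A = 1 \/ A = - 1.

Definition cocompact {R : realType} (Gam : set 'M[R[i]]_2) : Prop :=
  exists K : set R[i]^o, [/\ compact K, K `<=` disc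
    & forall z, disc z -> exists2 A, Gam A & K (moebius A z)].

Definition cocompact_fuchsian {R : realType} (Gam : set 'M[R[i]]_2) : Prop :=
  [/\ su11_subgroup Gam, discrete_group Gam, torsion_free Gam & cocompact Gam].

(** Points of X = Gam\disc are represented by points of the disc. *)
Definition same_orbit {R : realType} (Gam : set 'M[R[i]]_2) (z w : R[i]) : Prop :=
  exists2 A, Gam A & w = moebius A z.

Definition qdist {R : realType} (Gam : set 'M[R[i]]_2) (z w : R[i]) : R :=
  inf [set hdist z (moebius A w) | A in Gam].

Definition hball {R : realType} (r : R) : set R[i] :=
  [set p | disc p /\ hdist 0 p < r].

(** The open ball of radius [r] about [z] in X is isometric, as a Riemannian
    surface, to the hyperbolic disc of radius [r]: some [phi] induces a bijection
    from [hball r] onto that ball which is locally distance preserving.  (Global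
    preservation of [qdist] would be too strong: two points of an embedded disc
    can be joined by a shorter path leaving the disc.) *)
Definition ball_isometric_to_disc {R : realType} (Gam : set 'M[R[i]]_2)
    (z : R[i]) (r : R) : Prop :=
  exists phi : R[i] -> R[i],
    [/\ forall p, hball r p -> disc (phi p) /\ qdist Gam z (phi p) < r,
        forall w, disc w -> qdist Gam z w < r ->
          exists2 p, hball r p & same_orbit Gam (phi p) w,
        forall p q, hball r p -> hball r q ->
          same_orbit Gam (phi p) (phi q) -> p = q
      & forall p, hball r p -> exists2 e : R, 0 < e &
          forall u v, hball r u -> hball r v -> hdist p u < e -> hdist p v < e ->
            qdist Gam (phi u) (phi v) = hdist u v].

Definition inj_radius_at {R : realType} (Gam : set 'M[R[i]]_2) (z : R[i]) : R :=
  sup [set r | 0 < r /\ ball_isometric_to_disc Gam z r].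

Definition inj_radius {R : realType} (Gam : set 'M[R[i]]_2) : R :=
  inf [set inj_radius_at Gam z | z in disc].

Definition bound_const {R : realType} (r : R) : R :=
  (4 * pi / 3 * (1 - (4 * expR r / (expR r + 1) ^+ 2) ^+ 3)) `^ (- 2^-1).

Definition holomorphic_on_disc {R : realType} (q : R[i] -> R[i]) : Prop :=
  forall z : R[i], disc z -> derivable (q : R[i]^o -> R[i]^o) z 1.

Definition moebius_deriv {R : realType} (A : 'M[R[i]]_2) (z : R[i]) : R[i] :=
  derive1 (moebius A : R[i]^o -> R[i]^o) z.

(** The space Omega^{k,0}(disc, Gam). *)
Definition hol_form {R : realType} (Gam : set 'M[R[i]]_2) (k : nat)
    (q : R[i] -> R[i]) : Prop :=
  holomorphic_on_disc q /\
  forall A z, Gam A -> disc z -> q (moebius A z) * moebius_deriv A z ^+ k = q z.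

(** X has genus [g]: its holomorphic 1-forms have complex dimension [g]. *)
Definition has_genus {R : realType} (Gam : set 'M[R[i]]_2) (g : nat) : Prop :=
  exists b : 'I_g -> R[i] -> R[i],
    (forall i, hol_form Gam 1 (b i)) /\
    forall q, hol_form Gam 1 q -> exists! c : 'rV[R[i]]_g,
      forall z, disc z -> q z = \sum_(i < g) c 0 i * b i z.

(** Omega^{-1,1}(disc, Gam). *)
Definition beltrami {R : realType} (Gam : set 'M[R[i]]_2)
    (nu : R[i] -> R[i]) : Prop :=
  exists2 q, hol_form Gam 2 q &
    forall z, disc z -> nu z = (rho z)^-1 * Num.conj (q z).

Definition toC {R : realType} (p : R * R) : R[i] := Complex p.1 p.2.

Local Notation leb2 R :=
  ((@lebesgue_measure R \x @lebesgue_measure R)%E : set (R * R) -> \bar R).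

Definition fundamental_domain {R : realType} (Gam : set 'M[R[i]]_2)
    (F : set R[i]) : Prop :=
  [/\ F `<=` disc, measurable (toC @^-1` F),
      forall z, disc z -> exists2 w, F w & same_orbit Gam z w
    & forall z w, F z -> F w -> same_orbit Gam z w -> z = w].

(** The integral of [f d^2z] over X, computed on a fundamental domain [F]. *)
Definition integralX {R : realType} (F : set R[i]) (f : R[i] -> R[i]) : R[i] :=
  Complex (Rintegral (leb2 R) (toC @^-1` F) (fun p => re (f (toC p))))
          (Rintegral (leb2 R) (toC @^-1` F) (fun p => im (f (toC p)))).

Definition wp {R : realType} (F : set R[i]) (mu nu : R[i] -> R[i]) : R[i] :=
  integralX F (fun z => mu z * Num.conj (nu z) * rho z).

Definition wp_norm {R : realType} (F : set R[i]) (nu : R[i] -> R[i]) : R :=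
  Num.sqrt (re (wp F nu nu)).

Definition wp_orthonormal_basis {R : realType} (Gam : set 'M[R[i]]_2)
    (F : set R[i]) (n : nat) (e : 'I_n -> R[i] -> R[i]) : Prop :=
  [/\ forall i, beltrami Gam (e i),
      forall i j, wp F (e i) (e j) = (i == j)%:R
    & forall nu, beltrami Gam nu -> exists c : 'I_n -> R[i],
        forall z, disc z -> nu z = \sum_(i < n) c i * e i z].

Definition dx {R : realType} (f : R[i] -> R[i]) (z : R[i]) : R[i] :=
  Complex (derive1 (fun t : R => re (f (Complex t (im z)))) (re z))
          (derive1 (fun t : R => im (f (Complex t (im z)))) (re z)).

Definition dy {R : realType} (f : R[i] -> R[i]) (z : R[i]) : R[i] :=
  Complex (derive1 (fun t : R => re (f (Complex (re z) t))) (im z))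
          (derive1 (fun t : R => im (f (Complex (re z) t))) (im z)).

Definition continuous_on_disc {R : realType} (f : R[i] -> R[i]) : Prop :=
  forall z : R[i]^o, disc z -> {for z, continuous (f : R[i]^o -> R[i]^o)}.

(** C^1 in the real sense: [Re f] and [Im f] have continuous partials. *)
Definition C1_on_disc {R : realType} (f : R[i] -> R[i]) : Prop :=
  [/\ forall z, disc z ->
        [/\ derivable (fun t : R => re (f (Complex t (im z)))) (re z) 1,
            derivable (fun t : R => im (f (Complex t (im z)))) (re z) 1,
            derivable (fun t : R => re (f (Complex (re z) t))) (im z) 1
          & derivable (fun t : R => im (f (Complex (re z) t))) (im z) 1],
      continuous_on_disc (dx f) & continuous_on_disc (dy f)].

Definition C2_on_disc {R : realType} (f : R[i] -> R[i]) : Prop :=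
  [/\ C1_on_disc f, C1_on_disc (dx f) & C1_on_disc (dy f)].

Definition d_z {R : realType} (f : R[i] -> R[i]) (z : R[i]) : R[i] :=
  2^-1 * (dx f z - Complex 0 1 * dy f z).

Definition d_zbar {R : realType} (f : R[i] -> R[i]) (z : R[i]) : R[i] :=
  2^-1 * (dx f z + Complex 0 1 * dy f z).

Definition laplacian {R : realType} (f : R[i] -> R[i]) (z : R[i]) : R[i] :=
  - (rho z)^-1 * d_z (d_zbar f) z.

Definition invariant {R : realType} (Gam : set 'M[R[i]]_2)
    (f : R[i] -> R[i]) : Prop :=
  forall A z, Gam A -> disc z -> f (moebius A z) = f z.

Definition L2_normsq {R : realType} (F : set R[i]) (f : R[i] -> R[i]) : \bar R :=
  (\int[leb2 R]_(p in toC @^-1` F)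
     (re (`|f (toC p)| ^+ 2 * rho (toC p)))%:E)%E.

Definition inL2 {R : realType} (Gam : set 'M[R[i]]_2) (F : set R[i])
    (f : R[i] -> R[i]) : Prop :=
  [/\ invariant Gam f,
      measurable_fun (toC @^-1` disc) (fun p : R * R => re (f (toC p))),
      measurable_fun (toC @^-1` disc) (fun p : R * R => im (f (toC p)))
    & (L2_normsq F f < +oo)%E].

(** The graph of the operator Delta on L^2(X, rho d^2z): the closure in L^2 x L^2
    of the graph of the Laplacian on C^2(X).  As X is compact this closure is the
    self-adjoint Laplace-Beltrami operator. *)
Definition laplacian_graph {R : realType} (Gam : set 'M[R[i]]_2) (F : set R[i])
    (v h : R[i] -> R[i]) : Prop :=
  [/\ inL2 Gam F v, inL2 Gam F h
    & exists u : nat -> R[i] -> R[i],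
      [/\ forall n, C2_on_disc (u n) /\ invariant Gam (u n),
          L2_normsq F (fun z => u n z - v z) @[n --> \oo] --> 0%E
        & L2_normsq F (fun z => laplacian (u n) z - h z) @[n --> \oo] --> 0%E]].

(** [resolvent f] is (Delta + 1/2)^{-1} f, which is determined almost everywhere;
    the default value is never taken for [f] in L^2(X), as Delta + 1/2 is
    invertible there. *)
Definition resolvent {R : realType} (Gam : set 'M[R[i]]_2) (F : set R[i])
    (f : R[i] -> R[i]) : R[i] -> R[i] :=
  xget (fun=> 0)
    [set v | laplacian_graph Gam F v (fun z => f z - 2^-1 * v z)].

Definition Gop {R : realType} (Gam : set 'M[R[i]]_2) (F : set R[i])
    (f : R[i] -> R[i]) (z : R[i]) : R[i] :=
  2^-1 * resolvent Gam F f z.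

(** The Riemann tensor R_{a bbar l dbar} of the Weil-Petersson metric, given by
    Wolpert's formula. *)
Definition wp_riemann {R : realType} (Gam : set 'M[R[i]]_2) (F : set R[i])
    (a b l d : R[i] -> R[i]) : R[i] :=
  - integralX F (fun z => Gop Gam F (fun w => a w * Num.conj (b w)) z
                          * (l z * Num.conj (d z)) * rho z)
  - integralX F (fun z => Gop Gam F (fun w => a w * Num.conj (d w)) z
                          * (l z * Num.conj (b z)) * rho z).

Definition wp_ricci {R : realType} (Gam : set 'M[R[i]]_2) (F : set R[i])
    (n : nat) (e : 'I_n -> R[i] -> R[i]) (mu : R[i] -> R[i]) : R[i] :=
  \sum_(i < n) wp_riemann Gam F mu (e i) (e i) mu.

Definition wp_scalar {R : realType} (Gam : set 'M[R[i]]_2) (F : set R[i])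
    (n : nat) (e : 'I_n -> R[i] -> R[i]) : R[i] :=
  \sum_(i < n) wp_ricci Gam F e (e i).

(* Main.v *)
Require Import Defs.
From HB Require Import structures.
From mathcomp Require Import all_boot all_order all_algebra.
From mathcomp Require Import all_classical all_reals all_analysis.
From mathcomp Require Import complex.
From mathcomp Require Import measurable_realfun.
From mathcomp Require Import ring lra.

(** Two ingredients bound both terms of the Ricci curvature by [C^2].

    The first is a pointwise bound [B = sum_i |nu_i|^2 <= C^2].  A disc of radius
    [r_X] about any point of X is embedded, so the mean value property of
    holomorphic functions on it gives [|nu z|^2 <= C^2 |nu|_WP^2] for every
    harmonic Beltrami differential; take [nu = sum_i (nu_i z)^* nu_i].

    The second is that [int psi(v) . Delta v >= 0] for every Lipschitz monotone
    vector field [psi] of the plane.  For smooth [v] this is seen by writing Delta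
    as a limit of means over small hyperbolic discs, and it passes to the closure
    of Delta.  With [v = (Delta + 1/2)^{-1} f], so that [Delta v = f - v/2], various
    [psi] show that [<v/2, f>] is real and at most [|f|^2], and, for [f >= 0], that
    [v] is nonnegative almost everywhere with [int v/2 <= int f].  For
    [f = nu_alpha nu_i^*] the first fact bounds the sum over [i] of the first terms
    by [int |nu_alpha|^2 B]; for [f = |nu_alpha|^2] the second bounds that of the
    second terms by [C^2 int |nu_alpha|^2].

    That [Delta + 1/2] is onto is not needed: the default value [0] of the resolvent
    satisfies the same estimates. *)

Set Implicit Arguments.
Unset Strict Implicit.
Unset Printing Implicit Defensive.

Import Order.TTheory GRing.Theory Num.Theory.
Import numFieldNormedType.Exports.
Local Open Scope classical_set_scope.
Local Open Scope ring_scope.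

Local Notation re := complex.Re.
Local Notation im := complex.Im.
Local Notation plane R := (measurableTypeR R * measurableTypeR R)%type.

(** * Measures and substitutions in the plane *)

(** The quotient X is never built: functions on it are invariant functions on the disc, integrals
    are taken over [F], and integrals over different sets are compared by cutting one set into
    countably many measurable pieces, each moved by a disc isometry ([transport_le]). Green's
    inequality comes from exchanging the two variables of an invariant double integral in the same
    way.

    The operator is an L2 closure and its resolvent is known only almost everywhere, so no
    regularity of [v] is available. The estimates used are those which L2 limits preserve, and
    vanishing almost everywhere is expressed by a vanishing integral.

    Origin of the constant: the disc of hyperbolic radius [r] about 0 has Euclidean radius
    [t = tanh (r / 2)], with [1 - t^2 = 4 e^r / (e^r + 1)^2]. For [nu = rho^-1 q^*] one has
    [|nu|^2 rho = |q|^2 rho^-1], and [rho^-1 = (1 - |z|^2)^2 / 4] has integral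
    [pi / 12 * (1 - (1 - t^2)^3)] over that disc. As [rho 0 = 4], [|q 0|^2 = 16 |nu 0|^2], which
    turns [pi / 12] into [4 pi / 3]. *)

Section density_measure.
Local Open Scope ereal_scope.
Context d (T : measurableType d) (R : realType).
Context (m : {measure set T -> \bar R}) (w : T -> R).
Context (mw : measurable_fun setT w) (w0 : forall x, (0 <= w x)%R).

(** The proofs are parameters so that the measure structure can be inferred. *)
Definition density (_ : measurable_fun setT w) (_ : forall x, (0 <= w x)%R)
  (A : set T) : \bar R := \int[m]_(x in A) (w x)%:E.
Local Notation density_measure := (density mw w0).

Let density0 : density_measure set0 = 0.
Proof. by rewrite /density integral_set0. Qed.

Let density_ge0 A : 0 <= density_measure A.
Proof. by apply: integral_ge0 => x _; rewrite lee_fin. Qed.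

Let density_sigma_additive : semi_sigma_additive density_measure.
Proof.
move=> F mF tF mUF; rewrite /density ge0_integral_bigcup//=.
- by apply: is_cvg_ereal_nneg_natsum => k _; apply: integral_ge0 => x _; rewrite lee_fin.
- by apply/measurable_EFinP; exact: measurable_funTS.
- by move=> x _; rewrite lee_fin.
Qed.

HB.instance Definition _ := isMeasure.Build _ _ _ density_measure
  density0 density_ge0 density_sigma_additive.

Import HBNNSimple.

(** Simple functions increasing to [f] reduce both sides, by monotone convergence, to indicator
    functions, for which the identity is the definition of [density]. *)
Lemma ge0_integral_density (f : T -> \bar R) :
  measurable_fun setT f -> (forall x, 0 <= f x) ->
  \int[density_measure]_x f x = \int[m]_x (f x * (w x)%:E).
Proof.
move=> mf f0; pose f_ := nnsfun_approx measurableT mf.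
have mwE : measurable_fun setT (EFin \o w) by exact/measurable_EFinP.
transitivity (limn (fun n => \int[density_measure]_x (f_ n x)%:E)).
  rewrite -monotone_convergence//.
  - by apply: eq_integral => y _; apply/esym/cvg_lim => //; exact: cvg_nnsfun_approx.
  - by move=> n; exact/measurable_EFinP.
  - by move=> n y _; rewrite lee_fin.
  - by move=> y _ a b ab; rewrite lee_fin; exact/lefP/nd_nnsfun_approx.
rewrite [X in limn X](_ : _ = (fun n => \int[m]_x ((f_ n x)%:E * (w x)%:E))).
  rewrite -monotone_convergence//; last 3 first.
  - by move=> n; apply: emeasurable_funM => //; exact/measurable_EFinP.
  - by move=> n y _; rewrite -EFinM lee_fin mulr_ge0.
  - move=> y _ a b ab; rewrite -!EFinM lee_fin ler_wpM2r//.
    exact/lefP/nd_nnsfun_approx.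
  apply: eq_integral => y _; apply/cvg_lim => //.
  by apply: cvgeZr => //; exact: cvg_nnsfun_approx.
apply/funext => n.
have mA r : measurable (f_ n @^-1` [set r]).
  exact: measurable_funPTI.
under [LHS]eq_integral do rewrite fimfunE -fsumEFin//.
rewrite [LHS]ge0_integral_fsum//; last 2 first.
- by move=> r; apply/measurable_EFinP; apply: measurable_funM => //.
- by move=> r x _; rewrite nnfun_muleindic_ge0.
transitivity (\int[m]_x (\sum_(r \in range (f_ n))
    ((r * \1_(f_ n @^-1` [set r]) x)%:E * (w x)%:E))); last first.
  apply: eq_integral => x _; rewrite [in RHS]fimfunE -fsumEFin// ge0_mule_fsuml//.
  by move=> r; rewrite nnfun_muleindic_ge0.
rewrite [RHS]ge0_integral_fsum//; last 2 first.
- move=> r; apply: emeasurable_funM => //; apply/measurable_EFinP.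
  exact: measurable_funM.
- move=> r x _; apply: mule_ge0; last by rewrite lee_fin.
  exact: nnfun_muleindic_ge0.
apply: eq_fsbigr => r _.
rewrite integralZl_indic_nnsfun// integral_indic// setIT /=.
have [r0|r0] := ltP r 0%R.
  rewrite preimage_nnfun0// measure0 mule0.
  by rewrite integral0_eq// => x _; rewrite indic0 mulr0 mul0e.
rewrite /density integral_mkcond.
rewrite -ge0_integralZl ?lee_fin//; last 2 first.
- apply/(measurable_restrictT _ _).1 => //; exact: measurable_funTS.
- by move=> x _; rewrite /patch; case: ifPn => // _; rewrite lee_fin.
apply: eq_integral => x _; rewrite epatch_indic /= EFinM -!muleA; congr (_ * _).
by rewrite muleC.
Qed.

Lemma ge0_integral_density_in (D : set T) (f : T -> \bar R) :
  measurable D -> measurable_fun D f -> (forall x, D x -> 0 <= f x) ->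
  \int[density_measure]_(x in D) f x = \int[m]_(x in D) (f x * (w x)%:E).
Proof.
move=> mD mf f0.
rewrite [LHS]integral_mkcond ge0_integral_density.
- rewrite [RHS]integral_mkcond; apply: eq_integral => x _.
  by rewrite !patchE; case: ifP => // _; rewrite mul0e.
- by apply/(measurable_restrictT _ _).1.
- by move=> x; rewrite patchE; case: ifPn => // /set_mem /f0.
Qed.

End density_measure.

Section image_measure.
Context d1 d2 (X : measurableType d1) (Y : measurableType d2) (R : realType).

Definition image_measure (mu : {measure set X -> \bar R}) (phi : X -> Y)
  (mphi : measurable_fun setT phi) : {measure set Y -> \bar R} :=
  measure_function_pushforward__canonical__measure_function_Measure mu mphi.

Lemma ge0_integral_image_measure mu phi mphi (f : Y -> \bar R) :
  measurable_fun setT f -> (forall y, (0 <= f y)%E) ->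
  (\int[@image_measure mu phi mphi]_y f y = \int[mu]_x f (phi x))%E.
Proof.
move=> mf f0; rewrite -[RHS](ge0_integral_pushforward mphi mu measurableT mf)//.
Qed.

End image_measure.

Lemma measurable_funV d (T : measurableType d) (R : realType) (D : set T) (f : T -> R) :
  measurable_fun D f -> measurable_fun D (fun x => (f x)^-1).
Proof.
move=> mf.
(* The real power is measurable but wants a nonnegative base: the factor [f x] carries the sign, and
   both sides are [0] where [f] vanishes. *)
have -> : (fun x => (f x)^-1) = (fun x => f x * (f x ^+ 2) `^ (-1)).
  apply/funext => x; rewrite powR_inv1 ?sqr_ge0//.
  have [->|x0] := eqVneq (f x) 0; first by rewrite invr0 mul0r.
  by field.
apply: measurable_funM => //.
apply: (@measurableT_comp _ _ _ _ _ _ (fun x => x `^ (-1))).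
  exact: measurable_powR.
exact: measurable_funX.
Qed.

Lemma measurable_invr (R : realType) : measurable_fun setT (@GRing.inv R).
Proof. exact: (@measurable_funV _ _ _ _ id (@measurable_id _ _ _)). Qed.

Lemma measurable_normr_comp d (T : measurableType d) (R : realType) (D : set T) (f : T -> R) :
  measurable_fun D f -> measurable_fun D (fun x => `|f x|).
Proof. by move=> mf; apply: measurableT_comp. Qed.

Ltac mreal1 := lazymatch goal with
  | |- measurable_fun _ (fun x => (@?a x, @?b x)) => apply: measurable_fun_pair
  | |- measurable_fun _ (fun x => (@?a x + @?b x)%R) => apply: measurable_funD
  | |- measurable_fun _ (fun x => (@?a x * @?b x)%R) => apply: measurable_funM
  | |- measurable_fun _ (fun x => (- @?a x)%R) => apply: measurable_funN
  | |- measurable_fun _ (@GRing.inv _) => exact: measurable_invr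
  | |- measurable_fun _ (@Num.norm _ _) => exact: normr_measurable
  | |- measurable_fun _ (fun x => `|@?a x|%R) => apply: measurable_normr_comp
  | |- measurable_fun _ (fun x => ((@?a x)^-1)%R) => apply: measurable_funV
  | |- measurable_fun _ (fun x => (@?a x ^+ ?n)%R) => apply: measurable_funX
  | |- measurable_fun _ (fun x => (@?a x * @?b x)%E) => apply: emeasurable_funM
  | |- measurable_fun _ (fun x => (@?a x)%:E) => apply/measurable_EFinP
  end.
Ltac mreal := solve [rewrite /=; repeat first [done | mreal1; rewrite /=]].

(** * Substitutions on the real line *)

Section line_substitutions.
Local Open Scope ereal_scope.
Context (R : realType).
Local Notation leb := (@lebesgue_measure R).

(** The image of Lebesgue measure, scaled by [|c|], agrees with Lebesgue measure on half-open
    intervals, hence everywhere. For [c < 0] the preimage is half-open at the other end, with the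
    same length. *)
Lemma ge0_integral_affine (c b : R) (g : R -> \bar R) :
  (c != 0)%R -> measurable_fun setT g -> (forall x, 0 <= g x) ->
  \int[leb]_x (g (c * x + b)%R * `|c|%:E) = \int[leb]_x g x.
Proof.
move=> c0 mg g0; pose f x : measurableTypeR R := (c * x + b)%R.
have mf : measurable_fun setT f.
  by apply: measurable_funD => //; exact: measurable_funM.
have c0' : (0 <= `|c|)%R by [].
pose m' : {measure set (measurableTypeR R) -> \bar R} :=
  mscale (NngNum c0') (image_measure leb mf).
have E A : measurable A -> leb A = m' A.
  apply: lebesgue_measure_unique => // _ [[u v]] _ <-.
  have -> X : m' X = (`|c|%:E * leb (f @^-1` X))%E by [].
  rewrite /=.
  have [c1|c1] := ltP 0%R c.
    rewrite (_ : f @^-1` _ = `]((u - b) / c)%R, ((v - b) / c)%R]%classic); last first.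
      apply/seteqP; split => x /=; rewrite /f !in_itv/= ltr_pdivrMr// ler_pdivlMr//;
        by rewrite ltrBlDr lerBrDr mulrC.
    rewrite !lebesgue_measure_itv/= !lte_fin ltr_pM2r ?invr_gt0// ltrD2r.
    case: ifPn => _; last by rewrite mule0.
    rewrite -!EFinB -EFinM gtr0_norm//; congr (_%:E).
    by field.
  have c2 : (c < 0)%R by rewrite lt_neqAle c0.
  rewrite (_ : f @^-1` _ = `[((v - b) / c)%R, ((u - b) / c)%R[%classic); last first.
    apply/seteqP; split => x /=; rewrite /f !in_itv/= ltr_ndivlMr// ler_ndivrMr//;
      by rewrite ltrBlDr lerBrDr mulrC andbC.
  rewrite !lebesgue_measure_itv/= !lte_fin ltr_nM2r ?invr_lt0// ltrD2r.
  case: ifPn => _; last by rewrite mule0.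
  rewrite -!EFinB -EFinM ltr0_norm//; congr (_%:E).
  by field.
rewrite [RHS](eq_measure_integral m'); last by move=> A mA _; exact: E.
rewrite /m' ge0_integral_mscale// ge0_integral_image_measure// muleC.
by rewrite ge0_integralZr//; exact: measurableT_comp.
Qed.

Let expR_nd : nondecreasing (@expR R).
Proof. by move=> x y xy; rewrite ler_expR. Qed.
Let expR_rc : right_continuous (@expR R).
Proof. by move=> x; apply: cvg_at_right_filter; exact: continuous_expR. Qed.
HB.instance Definition _ := isCumulative.Build R _ R (@expR R) expR_nd expR_rc.

(** The measure with density [expR], and the image under [ln] of Lebesgue measure on the positive
    half-line, both agree on half-open intervals with the Stieltjes measure of [expR]. Equating them
    gives the substitution. *)
Lemma ge0_integral_expR (g : R -> \bar R) :
  measurable_fun setT g -> (forall x, 0 <= g x) ->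
  \int[leb]_(x in `]0%R, +oo[) g x = \int[leb]_x (g (expR x) * (expR x)%:E).
Proof.
move=> mg g0.
have mexp : measurable_fun setT (@expR R) by exact: measurable_expR.
have exp0 (x : R) : (0 <= expR x)%R by exact: expR_ge0.
pose nu := density leb mexp exp0.
pose lnp : R -> measurableTypeR R := @ln R.
have mln : measurable_fun setT lnp by exact: measurable_ln.
have mp : measurable (`]0%R, +oo[%classic : set R) by exact: measurable_itv.
have mi : measurable_fun setT (\1_(`]0%R, +oo[%classic) : R -> R) by exact: measurable_indic.
have i0 (x : R) : (0 <= \1_(`]0%R, +oo[%classic) x :> R)%R by [].
pose nu' := image_measure (density leb mi i0) mln.
have oc0 (u v : R) : (u < v)%R = false -> `]u, v]%classic = set0 :> set R.
  by move=> uv; apply: set_itv_ge; rewrite bnd_simp uv.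
have E1 A : measurable A -> lebesgue_stieltjes_measure (@expR R) A = nu A.
  apply: lebesgue_stieltjes_measure_unique => // _ [[u v]] _ <- /=.
  rewrite /lebesgue_stieltjes_measure /measure_extension measurable_mu_extE/=; last exact: is_ocitv.
  rewrite /nu /density; case/boolP: (u < v)%R => uv; last first.
    by rewrite oc0 ?wlength0 ?integral_set0//; exact/negbTE.
  rewrite wlength_itv_bnd ?ltW// integral_itv_obnd_cbnd; last first.
    by apply/measurable_EFinP; exact: measurable_funTS.
  rewrite (@continuous_FTC2 _ _ (@expR R))//.
  - by apply: continuous_subspaceT; exact: continuous_expR.
  - split.
    + by move=> x _; exact: derivable_expR.
    + by apply: cvg_at_right_filter; exact: continuous_expR.
    + by apply: cvg_at_left_filter; exact: continuous_expR.
  - by move=> x _; rewrite derive1E -[RHS](congr1 (fun h => h x) (@derive_expR R)).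
have E2 A : measurable A -> lebesgue_stieltjes_measure (@expR R) A = nu' A.
  apply: lebesgue_stieltjes_measure_unique => // _ [[u v]] _ <- /=.
  rewrite /lebesgue_stieltjes_measure /measure_extension measurable_mu_extE/=; last exact: is_ocitv.
  have -> X : nu' X = \int[leb]_(x in lnp @^-1` X) (\1_(`]0%R, +oo[%classic) x)%:E by [].
  rewrite integral_indic//; last by rewrite -[_ @^-1` _]setTI; exact: (mln).
  rewrite setIC.
  case/boolP: (u < v)%R => uv; last first.
    by rewrite oc0 ?wlength0 ?preimage_set0 ?set0I ?measure0//; exact/negbTE.
  rewrite wlength_itv_bnd ?ltW//.
  rewrite (_ : _ `&` _ = `]expR u, expR v]%classic); last first.
    apply/seteqP; split => x /=; rewrite /lnp !in_itv/= ?andbT.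
      by move=> [/andP[ux xv] x0]; rewrite -[x]lnK ?posrE// ltr_expR ler_expR ux.
    move=> /andP[ux xv]; have x0 : (0 < x)%R by exact: lt_trans (expR_gt0 _) ux.
    by move: ux xv; rewrite -{1 2}[x]lnK ?posrE// ltr_expR ler_expR => -> ->.
  rewrite [RHS](_ : _ = leb `](expR u), (expR v)]%classic)//.
  by rewrite lebesgue_measure_itv/= lte_fin ltr_expR uv.
rewrite -(ge0_integral_density leb mexp exp0); last 2 first.
- exact: measurableT_comp.
- by move=> x.
rewrite [RHS](eq_measure_integral nu'); last first.
  by move=> A mA _; rewrite -(E2 A mA); exact/esym/E1.
rewrite ge0_integral_image_measure//; last exact: measurableT_comp.
rewrite (ge0_integral_density leb mi i0); last 2 first.
- by apply: measurableT_comp => //; exact: measurableT_comp.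
- by move=> x.
rewrite [LHS]integral_mkcond; apply: eq_integral => x _.
rewrite patchE indicE; case: ifPn => [|_]; last by rewrite mule0.
by rewrite inE /= in_itv/= andbT mule1 => x0; rewrite lnK.
Qed.

Lemma ge0_integral_halves (g : R -> \bar R) :
  measurable_fun setT g -> (forall x, 0 <= g x) ->
  \int[leb]_x g x =
  \int[leb]_(x in `]0%R, +oo[) g x + \int[leb]_(x in `]0%R, +oo[) g (- x)%R.
Proof.
move=> mg g0.
have mi : measurable (`]0%R, +oo[%classic : set R) by exact: measurable_itv.
have mi' : measurable (`]-oo, 0%R[%classic : set R) by exact: measurable_itv.
rewrite -(setUv `]-oo, 0%R[%classic) setCitvl ge0_integral_setU//; last 2 first.
- by apply: measurable_funTS.
- by apply/disj_setPS => x [/=]; rewrite !in_itv/= andbT ltNge => /negP.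
rewrite addeC; congr (_ + _).
  rewrite [RHS]integral_itv_obnd_cbnd//; exact: measurable_funTS.
have m1 : (-1 != 0 :> R)%R by rewrite oppr_eq0 oner_eq0.
rewrite [LHS]integral_mkcond -(ge0_integral_affine 0 m1); last 2 first.
- by apply/(measurable_restrictT _ _).1 => //; exact: measurable_funTS.
- by move=> x; rewrite patchE; case: ifP.
rewrite [RHS]integral_mkcond; apply: eq_integral => x _.
rewrite normrN1 mule1 addr0 mulN1r !patchE.
have -> : ((- x)%R \in `]-oo, 0%R[%classic) = (x \in `]0%R, +oo[%classic).
  by apply/idP/idP; rewrite !inE/= !in_itv/= ?andbT oppr_lt0.
by [].
Qed.

(** In the exponential coordinate on a half-line, [y |-> c / y] becomes the affine map
    [x |-> ln c - x]. The two half-lines are treated separately. *)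
Lemma ge0_integral_inv (c : R) (h : R -> \bar R) : (0 < c)%R ->
  measurable_fun setT h -> (forall x, 0 <= h x) ->
  \int[leb]_y (h (c / y)%R * (c / y ^+ 2)%:E) = \int[leb]_x h x.
Proof.
move=> c0 mh h0.
have half (k : R -> \bar R) : measurable_fun setT k -> (forall x, 0 <= k x) ->
    \int[leb]_(y in `]0%R, +oo[) (k (c / y)%R * (c / y ^+ 2)%:E) =
    \int[leb]_(x in `]0%R, +oo[) k x.
  move=> mk k0.
  have mc : measurable_fun setT (fun y : R => c / y)%R.
    by mreal.
  rewrite !ge0_integral_expR//; last 2 first.
  - apply: emeasurable_funM; first exact: measurableT_comp.
    by mreal.
  - by move=> x; rewrite mule_ge0// lee_fin divr_ge0 ?sqr_ge0// ltW.
  have m1 : (-1 != 0 :> R)%R by rewrite oppr_eq0 oner_eq0.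
  rewrite -[RHS](ge0_integral_affine (ln c) m1); last 2 first.
  - apply: emeasurable_funM.
      by apply: measurableT_comp => //; exact: measurable_expR.
    by apply/measurable_EFinP; exact: measurable_expR.
  - by move=> x; rewrite mule_ge0// lee_fin expR_ge0.
  apply: eq_integral => x _; rewrite normrN1 mule1 mulN1r expRD lnK// expRN.
  rewrite [(_^-1 * c)%R]mulrC -muleA -EFinM; congr (_ * _%:E).
  have := expR_gt0 x; set e := expR x => e0; field.
  by rewrite gt_eqF.
have mc : measurable_fun setT (fun y : R => c / y)%R.
  by mreal.
rewrite [LHS]ge0_integral_halves//; last 2 first.
- apply: emeasurable_funM; first exact: measurableT_comp.
  by mreal.
- by move=> x; rewrite mule_ge0// lee_fin divr_ge0 ?sqr_ge0// ltW.
rewrite half// ge0_integral_halves//; congr (_ + _).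
rewrite -(half (fun x => h (- x)%R)) ?(fun x => h0 (- x)%R)//.
  by apply: eq_integral => x _; rewrite sqrrN invrN mulrN.
by apply: measurableT_comp => //; exact: measurable_oppr.
Qed.

End line_substitutions.

(** * Substitutions in the plane *)

Section plane.
Local Open Scope ereal_scope.
Context (R : realType).
Local Notation leb := (@lebesgue_measure R).

Definition leb2 : {measure set (measurableTypeR R * measurableTypeR R)%type -> \bar R} :=
  lebesgue_integral_fubini_product_measure1__canonical__measure_function_Measure leb leb.

Lemma leb2_tonelli (f : R * R -> \bar R) : measurable_fun setT f -> (forall z, 0 <= f z) ->
  \int[leb2]_z f z = \int[leb]_x \int[leb]_y f (x, y).
Proof. by move=> mf f0; rewrite /leb2 fubini_tonelli1. Qed.

Lemma leb2_tonelli_swap (f : R * R -> \bar R) : measurable_fun setT f -> (forall z, 0 <= f z) ->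
  \int[leb2]_z f z = \int[leb]_y \int[leb]_x f (x, y).
Proof. by move=> mf f0; rewrite /leb2 fubini_tonelli2. Qed.

Lemma ge0_integral_shear (a b c : R) (g : R * R -> \bar R) : (a != 0)%R ->
  measurable_fun setT g -> (forall z, 0 <= g z) ->
  \int[leb2]_z (g (a * z.1 + b * z.2 + c, z.2)%R * `|a|%:E) = \int[leb2]_z g z.
Proof.
move=> a0 mg g0.
have m1 : measurable_fun setT (fun z : R * R => (a * z.1 + b * z.2 + c, z.2)%R).
  apply: measurable_fun_pair => //=.
  apply: measurable_funD => //; apply: measurable_funD; apply: measurable_funM => //.
rewrite !leb2_tonelli_swap//; last 2 first.
- apply: emeasurable_funM => //; exact: measurableT_comp.
- by move=> z; rewrite mule_ge0.
apply: eq_integral => y _ /=.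
rewrite -[RHS](ge0_integral_affine (b * y + c) a0)//; last first.
  by apply: measurableT_comp => //; exact: measurable_pair2.
by apply: eq_integral => x _; rewrite addrA.
Qed.

Lemma ge0_integral_swap (g : R * R -> \bar R) :
  measurable_fun setT g -> (forall z, 0 <= g z) ->
  \int[leb2]_z g (z.2, z.1) = \int[leb2]_z g z.
Proof.
move=> mg g0; rewrite leb2_tonelli ?leb2_tonelli_swap//.
by apply: measurableT_comp => //; exact: measurable_fun_pair.
Qed.

Lemma ge0_integral_shear2 (a b c : R) (g : R * R -> \bar R) : (a != 0)%R ->
  measurable_fun setT g -> (forall z, 0 <= g z) ->
  \int[leb2]_z (g (z.1, a * z.2 + b * z.1 + c)%R * `|a|%:E) = \int[leb2]_z g z.
Proof.
move=> a0 mg g0; rewrite -[RHS]ge0_integral_swap//.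
rewrite -[RHS](ge0_integral_shear b c a0)//; last first.
  by apply: measurableT_comp => //; exact: measurable_fun_pair.
rewrite -[RHS]ge0_integral_swap//; last by move=> z; rewrite mule_ge0.
apply: emeasurable_funM => //; apply: measurableT_comp => //.
by mreal.
Qed.

(** The map [z -> alpha z + beta] of the complex plane, in real coordinates. *)
Lemma ge0_integral_similarity (a1 a2 b1 b2 : R) (g : R * R -> \bar R) :
  (a1 ^+ 2 + a2 ^+ 2 != 0)%R ->
  measurable_fun setT g -> (forall z, 0 <= g z) ->
  \int[leb2]_z (g (a1 * z.1 - a2 * z.2 + b1, a2 * z.1 + a1 * z.2 + b2)%R
     * (a1 ^+ 2 + a2 ^+ 2)%:E) = \int[leb2]_z g z.
Proof.
move=> N0 mg g0; set N := (a1 ^+ 2 + a2 ^+ 2)%R in N0 *.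
have Ngt0 : (0 < N)%R by rewrite lt_neqAle eq_sym N0/= addr_ge0 ?sqr_ge0.
(* For [a1 != 0] the matrix is a product of two shears with scaling factors [a1] and [N / a1]; for
   [a1 = 0] it is anti-diagonal and a swap of the coordinates is inserted. *)
have [a10|a10] := eqVneq a1 0%R.
  have a20 : a2 != 0%R by move: N0; rewrite /N a10 expr0n/= add0r sqrf_eq0.
  have Na20 : (- a2)%R != 0%R by rewrite oppr_eq0.
  rewrite -(ge0_integral_shear2 0 b2 a20 mg g0).
  rewrite -[in RHS](ge0_integral_shear 0 b1 Na20)//; last 2 first.
  - by apply: emeasurable_funM => //; apply: (measurableT_comp mg); mreal.
  - by move=> z; rewrite mule_ge0.
  rewrite -[RHS]ge0_integral_swap; last 2 first.
  - apply: emeasurable_funM => //; apply: emeasurable_funM => //=.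
    by apply: (measurableT_comp mg); mreal.
  - by move=> z; rewrite !mule_ge0.
  apply: eq_integral => z _ /=; rewrite -muleA -EFinM; congr (g (_, _) * _%:E).
  - by rewrite a10; ring.
  - by rewrite a10; ring.
  - by rewrite normrN /N a10 -normrM ger0_norm -?expr2 ?sqr_ge0//; ring.
have Na1 : (N / a1 != 0)%R by rewrite mulf_neq0// invr_neq0.
rewrite -(ge0_integral_shear2 (a2 / a1) (b2 - a2 / a1 * b1) Na1 mg g0).
rewrite -[in RHS](ge0_integral_shear (- a2) b1 a10)//; last 2 first.
- by apply: emeasurable_funM => //; apply: (measurableT_comp mg); mreal.
- by move=> z; rewrite mule_ge0.
apply: eq_integral => z _ /=; rewrite -muleA -EFinM; congr (g (_, _) * _%:E).
- by ring.
- by rewrite /N; field.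
- by rewrite -normrM divfK// ger0_norm// ltW.
Qed.

(** Coordinates [(s, y)] with [x = s * y]: lines through the origin are the fibres, so inversion and
    radial integration become problems in [y] alone. The degenerate value [y = 0] is a null set. *)
Lemma ge0_integral_cone (f : R * R -> \bar R) :
  measurable_fun setT f -> (forall z, 0 <= f z) ->
  \int[leb2]_z f z = \int[leb]_s \int[leb]_y (f (s * y, y)%R * `|y|%:E).
Proof.
move=> mf f0; rewrite (leb2_tonelli_swap mf f0).
have msy : measurable_fun setT (fun z : R * R => f (z.1 * z.2, z.2)%R * `|z.2|%:E).
  apply: emeasurable_funM.
    apply: measurableT_comp => //; apply: measurable_fun_pair => //=.
    exact: measurable_funM.
  by mreal.
rewrite -(leb2_tonelli (f := fun z => f (z.1 * z.2, z.2)%R * `|z.2|%:E))//; last first.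
  by move=> z; rewrite mule_ge0.
rewrite leb2_tonelli_swap//; last by move=> z; rewrite mule_ge0.
have D1 (F : R -> \bar R) : measurable_fun setT F ->
    \int[leb]_y F y = \int[leb]_(y in setT `\ 0%R) F y.
  by move=> mF; rewrite integral_setD1//; [exact: measurableD|exact: measurable_funTS].
rewrite D1; last exact: measurable_fun_fubini_tonelli_G.
rewrite [RHS]D1; last first.
  apply: (@measurable_fun_fubini_tonelli_G _ _ _ _ _ leb _ msy).
  by move=> z; rewrite mule_ge0.
apply: eq_integral => y; rewrite inE => -[_ /= /eqP y0].
rewrite -(ge0_integral_affine 0 y0)//; last first.
  by apply: measurableT_comp => //; exact: pair2_measurable.
by apply: eq_integral => s _; rewrite addr0 mulrC.
Qed.

(** Inversion preserves each line [x = s * y] and acts on it by [y |-> c / y] with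
    [c = (1 + s ^+ 2)^-1]. *)
Lemma ge0_integral_inversion (g : R * R -> \bar R) :
  measurable_fun setT g -> (forall z, 0 <= g z) ->
  \int[leb2]_z (g (z.1 / (z.1 ^+ 2 + z.2 ^+ 2), z.2 / (z.1 ^+ 2 + z.2 ^+ 2))%R
     * ((z.1 ^+ 2 + z.2 ^+ 2) ^- 2)%:E) = \int[leb2]_z g z.
Proof.
move=> mg g0; rewrite !ge0_integral_cone//; last 2 first.
- by apply: emeasurable_funM; [apply: (measurableT_comp mg); mreal|mreal].
- by move=> z; rewrite mule_ge0// lee_fin invr_ge0 exprn_ge0// addr_ge0 ?sqr_ge0.
apply: eq_integral => s _ /=.
have s1 : (0 < 1 + s ^+ 2)%R by rewrite ltr_pwDl// sqr_ge0.
have c0 : (0 < (1 + s ^+ 2)^-1)%R by rewrite invr_gt0.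
rewrite -[RHS](ge0_integral_inv c0); last 2 first.
- apply: emeasurable_funM; first by apply: (measurableT_comp mg); mreal.
  by mreal.
- by move=> z; rewrite mule_ge0.
apply: eq_integral => y _.
have [->|y0] := eqVneq y 0%R; first by rewrite normr0 mule0 expr0n/= invr0 !mulr0 ?normr0 !mule0.
have e : ((s * y) ^+ 2 + y ^+ 2 = y ^+ 2 * (1 + s ^+ 2))%R by ring.
have s0 : (1 + s ^+ 2 != 0)%R by rewrite gt_eqF.
rewrite e -!muleA -!EFinM; congr (g (_, _) * _%:E).
- by field; rewrite s0 y0.
- by field; rewrite s0 y0.
rewrite normrM !normfV (gtr0_norm s1) -(real_normK (num_real y)).
have w0 : `|y|%R != 0%R by rewrite normr_eq0.
by field; rewrite s0 w0.
Qed.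

(** On the line of slope parameter [s] the squared norm is [(1 + s^2) y^2], so rescaling [y] gives
    the same integral on every line, with weight [1 / (1 + s^2)]. The factor [pi] is the integral of
    this weight, and the 2 comes from the two halves of each line. *)
Lemma ge0_integral_radial (f : R -> \bar R) :
  measurable_fun setT f -> (forall z, 0 <= f z) ->
  \int[leb2]_z f (z.1 ^+ 2 + z.2 ^+ 2)%R =
  \int[leb]_(r in `]0%R, +oo[) (f (r ^+ 2)%R * (2 * pi * r)%:E).
Proof.
move=> mf f0; rewrite ge0_integral_cone//; last first.
  by apply: (measurableT_comp mf); mreal.
have oneDsqr_gt0 (t : R) : (0 < oneDsqr t)%R by rewrite /oneDsqr ltr_pwDl// sqr_ge0.
pose J := \int[leb]_r (f (r ^+ 2)%R * `|r|%:E).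
have mJ : measurable_fun setT (fun r : R => f (r ^+ 2)%R * `|r|%:E).
  apply: emeasurable_funM; first by apply: (measurableT_comp mf); mreal.
  by mreal.
have J0 (r : R) : 0 <= f (r ^+ 2)%R * `|r|%:E by rewrite mule_ge0.
transitivity (\int[leb]_s ((oneDsqr s)^-1%:E * J)).
  apply: eq_integral => s _ /=.
  have s1 : (0 < oneDsqr s)%R by rewrite oneDsqr_gt0.
  have c0 : Num.sqrt (oneDsqr s) != 0%R by rewrite gt_eqF// sqrtr_gt0.
  rewrite /J -(ge0_integral_affine 0 c0)//.
  rewrite -ge0_integralZl//; last 2 first.
  - by apply: emeasurable_funM => //; apply: (measurableT_comp mJ); mreal.
  - by move=> r _; rewrite mule_ge0.
  apply: eq_integral => y _.
  rewrite addr0 [in RHS]exprMn sqr_sqrtr ?ltW//.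
  rewrite muleCA -!muleA -!EFinM; congr (f _ * _%:E); first by rewrite /oneDsqr; ring.
  have cp : (0 < Num.sqrt (oneDsqr s))%R by rewrite sqrtr_gt0.
  have := esym (sqr_sqrtr (ltW s1)); rewrite normrM (gtr0_norm cp).
  move: (Num.sqrt _) c0 {cp} => c c0 ->; by field.
rewrite ge0_integralZr//; last 2 first.
- by rewrite /oneDsqr; mreal.
- by apply: integral_ge0 => x _.
have mo : measurable_fun setT (fun x : R => (oneDsqr x)^-1%:E) by rewrite /oneDsqr; mreal.
rewrite ge0_integral_halves//.
have -> : \int[leb]_(x in `]0%R, +oo[) (oneDsqr (- x))^-1%:E = (pi / 2)%:E.
  rewrite -(@integral0y_oneDsqr R) -integral_itv_obnd_cbnd; last exact: measurable_funTS.
  by apply: eq_integral => x _; rewrite /oneDsqr sqrrN.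
rewrite integral_itv_obnd_cbnd ?(@integral0y_oneDsqr R); last exact: measurable_funTS.
rewrite /J [X in _ * X]ge0_integral_halves//.
have -> : \int[leb]_(r in `]0%R, +oo[) (f ((- r) ^+ 2)%R * `|- r|%:E) =
    \int[leb]_(r in `]0%R, +oo[) (f (r ^+ 2)%R * `|r|%:E).
  by apply: eq_integral => x _; rewrite sqrrN normrN.
rewrite -EFinD -splitr -mule2n.
set K := integral _ _ _.
have K0 : 0 <= K by apply: integral_ge0 => x _.
rewrite -[K *+ 2]/(K + K) -[X in X + _]mul1e -[X in _ + X]mul1e -ge0_muleDl// muleA -EFinD -EFinM.
rewrite /K -ge0_integralZl//; [|exact: measurable_funTS|by rewrite lee_fin mulr_ge0// pi_ge0].
apply: eq_integral => x; rewrite inE/= in_itv/= andbT => x0.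
by rewrite muleCA -EFinM gtr0_norm//; congr (_ * _%:E); ring.
Qed.

End plane.

(** * SU(1,1) and its action on the disc *)

Section complex_coordinates.
Context (R : realType).
Implicit Types (z w a b : R[i]) (x : R).

Lemma complex_ext z w : re z = re w -> im z = im w -> z = w.
Proof. by case: z w => [? ?] [? ?] /= -> ->. Qed.

Lemma reD z w : re (z + w) = re z + re w. Proof. by case: z w => [? ?] []. Qed.
Lemma imD z w : im (z + w) = im z + im w. Proof. by case: z w => [? ?] []. Qed.
Lemma reN z : re (- z) = - re z. Proof. by case: z. Qed.
Lemma imN z : im (- z) = - im z. Proof. by case: z. Qed.
Lemma reM z w : re (z * w) = re z * re w - im z * im w. Proof. by case: z w => [? ?] []. Qed.
Lemma imM z w : im (z * w) = re z * im w + im z * re w. Proof. by case: z w => [? ?] []. Qed.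
Lemma reC x : re (x%:C)%C = x. Proof. by []. Qed.
Lemma imC x : im (x%:C)%C = 0. Proof. by []. Qed.
Lemma re1 : re (1 : R[i]) = 1. Proof. by []. Qed.
Lemma im1 : im (1 : R[i]) = 0. Proof. by []. Qed.
Lemma re0 : re (0 : R[i]) = 0. Proof. by []. Qed.
Lemma im0 : im (0 : R[i]) = 0. Proof. by []. Qed.
Lemma reJ z : re (Num.conj z) = re z. Proof. by case: z. Qed.
Lemma imJ z : im (Num.conj z) = - im z. Proof. by case: z. Qed.
Definition cxE := (reD, imD, reN, imN, reM, imM, reC, imC, re1, im1, re0, im0, reJ, imJ).

(** The squared modulus as an element of [R], where it is polynomial in the coordinates and open to
    real arithmetic. *)
Definition n2 z : R := re z ^+ 2 + im z ^+ 2.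

Lemma n2_ge0 z : 0 <= n2 z. Proof. by rewrite addr_ge0 ?sqr_ge0. Qed.
Lemma normc2 z : `|z| ^+ 2 = ((n2 z)%:C)%C. Proof. by rewrite -add_Re2_Im2. Qed.
Lemma normcC z : `|z| = ((Num.sqrt (n2 z))%:C)%C. Proof. exact: normc_def. Qed.
Lemma n2M z w : n2 (z * w) = n2 z * n2 w. Proof. by rewrite /n2 !cxE; ring. Qed.
Lemma n2N z : n2 (- z) = n2 z. Proof. by rewrite /n2 !cxE; ring. Qed.
Lemma n2J z : n2 (Num.conj z) = n2 z. Proof. by rewrite /n2 !cxE; ring. Qed.
Lemma n2B z w : n2 (z - w) = n2 (w - z). Proof. by rewrite -n2N opprB. Qed.
Lemma n2C x : n2 (x%:C)%C = x ^+ 2. Proof. by rewrite /n2 !cxE expr0n/= addr0. Qed.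
Lemma n2_0 : n2 0 = 0. Proof. by rewrite /n2 !cxE expr0n/= addr0. Qed.
Lemma n2_1 : n2 1 = 1. Proof. by rewrite /n2 !cxE expr0n/= addr0 expr1n. Qed.
Lemma n2_eq0 z : (n2 z == 0) = (z == 0).
Proof. by rewrite /n2 paddr_eq0 ?sqr_ge0// !sqrf_eq0 eq_complex. Qed.
Lemma n2_gt0 z : (0 < n2 z) = (z != 0).
Proof. by rewrite lt_neqAle n2_ge0 andbT eq_sym n2_eq0. Qed.
Lemma n2V z : n2 z^-1 = (n2 z)^-1.
Proof.
have [->|z0] := eqVneq z 0; first by rewrite invr0 n2_0 invr0.
have n0 : n2 z != 0 by rewrite n2_eq0.
by apply: (mulfI n0); rewrite -n2M mulfV// n2_1 mulfV.
Qed.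
Lemma mulJ z : z * Num.conj z = ((n2 z)%:C)%C.
Proof. by apply: complex_ext; rewrite /n2 !cxE; ring. Qed.
Lemma invc_n2 z : z^-1 = Complex (re z / n2 z) (- im z / n2 z).
Proof.
have [->|z0] := eqVneq z 0; first by rewrite invr0 re0 im0 oppr0 !mul0r.
have n0 : re z ^+ 2 + im z ^+ 2 != 0 by rewrite -/(n2 z) n2_eq0.
apply: (mulfI z0); rewrite mulfV//; apply: complex_ext.
  by rewrite reM re1 /n2 /=; field.
by rewrite imM im1 /n2 /=; field.
Qed.

Lemma normc_lt z x : 0 <= x -> (`|z| < (x%:C)%C) = (n2 z < x ^+ 2).
Proof.
move=> x0; rewrite normcC ltcR -[LHS](ltr_pXn2r (ltn0Sn 1)) ?nnegrE ?sqrtr_ge0//.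
by rewrite sqr_sqrtr// n2_ge0.
Qed.

Lemma discE z : disc z <-> n2 z < 1.
Proof. by rewrite /disc /= -[X in _ < X]/((1 : R)%:C)%C normc_lt// expr1n. Qed.

Definition ofC z : R * R := (re z, im z).
Lemma toCK (p : R * R) : ofC (toC p) = p. Proof. by case: p. Qed.
Lemma ofCK z : toC (ofC z) = z. Proof. by case: z. Qed.

Lemma re_mul_le z w : (re z * re w + im z * im w) ^+ 2 <= n2 z * n2 w.
Proof.
rewrite -subr_ge0 (_ : _ - _ = (re z * im w - im z * re w) ^+ 2) ?sqr_ge0//.
by rewrite /n2; ring.
Qed.

Lemma n2D_le z w : n2 (z + w) <= (Num.sqrt (n2 z) + Num.sqrt (n2 w)) ^+ 2.
Proof.
have -> : n2 (z + w) = n2 z + n2 w + (re z * re w + im z * im w) *+ 2.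
  by rewrite /n2 !cxE; ring.
have h : re z * re w + im z * im w <= Num.sqrt (n2 z) * Num.sqrt (n2 w).
  rewrite -sqrtrM ?n2_ge0//; apply: le_trans (ler_norm _) _.
  by rewrite -sqrtr_sqr ler_wsqrtr// re_mul_le.
rewrite sqrrD !sqr_sqrtr ?n2_ge0//; lra.
Qed.

End complex_coordinates.

Section su11.
Context (R : realType).
Implicit Types (z w a b : R[i]) (A B : 'M[R[i]]_2).

Lemma ord2P (P : 'I_2 -> Prop) : P 0 -> P 1 -> forall i, P i.
Proof.
move=> P0 P1; case=> [[|[|//]] h].
  by rewrite (_ : Ordinal h = 0)//; exact/val_inj.
by rewrite (_ : Ordinal h = 1)//; exact/val_inj.
Qed.

Lemma mx2_ext A B : A 0 0 = B 0 0 -> A 0 1 = B 0 1 -> A 1 0 = B 1 0 -> A 1 1 = B 1 1 -> A = B.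
Proof.
move=> h1 h2 h3 h4; apply/matrixP.
by apply: ord2P; apply: ord2P.
Qed.

Lemma mul2E A B i j : (A * B) i j = A i 0 * B 0 j + A i 1 * B 1 j.
Proof.
rewrite mxE big_ord_recl big_ord1; congr (_ + A i _ * B _ j); exact/val_inj.
Qed.

Lemma det2E A : \det A = A 0 0 * A 1 1 - A 0 1 * A 1 0.
Proof.
rewrite (expand_det_row _ 0) big_ord_recl big_ord1 /cofactor !det_mx11 !mxE /=.
have -> : lift 0 0 = 1 :> 'I_2 by exact/val_inj.
have -> : lift 1 0 = 0 :> 'I_2 by exact/val_inj.
transitivity (A 0 0 * ((-1) ^+ 0 * A 1 1) + A 0 1 * ((-1) ^+ 1 * A 1 0)) => //.
by rewrite expr0 mul1r expr1 mulN1r mulrN.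
Qed.

Definition su (a b : R[i]) : 'M[R[i]]_2 :=
  \matrix_(i, j) if i == 0 then (if j == 0 then a else b)
                 else (if j == 0 then Num.conj b else Num.conj a).

Lemma su00 a b : su a b 0 0 = a. Proof. by rewrite mxE. Qed.
Lemma su01 a b : su a b 0 1 = b. Proof. by rewrite mxE. Qed.
Lemma su10 a b : su a b 1 0 = Num.conj b. Proof. by rewrite mxE. Qed.
Lemma su11_ a b : su a b 1 1 = Num.conj a. Proof. by rewrite mxE. Qed.
Definition suE := (su00, su01, su10, su11_).

Lemma su11P A : su11 A <-> exists a b, A = su a b /\ n2 a - n2 b = 1.
Proof.
split=> [[h1 h2 d]|[a [b [-> ab]]]].
  exists (A 0 0), (A 0 1); split; first by apply: mx2_ext; rewrite suE.
  move: d; rewrite det2E h1 h2 !mulJ => /(congr1 (@complex.Re R)).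
  by rewrite !cxE.
split; rewrite ?det2E !suE// !mulJ; apply: complex_ext; rewrite !cxE//.
by rewrite subrr.
Qed.

Lemma su11M A B : su11 A -> su11 B -> su11 (A * B).
Proof.
move=> /su11P[a [b [-> ab]]] /su11P[c [d [-> cd]]]; apply/su11P.
exists (a * c + b * Num.conj d), (a * d + b * Num.conj c); split.
  apply: mx2_ext; rewrite mul2E !suE// !rmorphD !rmorphM/= !conjCK; by rewrite addrC.
rewrite -[RHS]mulr1 -{1}ab -cd /n2 !cxE; ring.
Qed.

Lemma su11_1 : su11 (1 : 'M[R[i]]_2).
Proof.
apply/su11P; exists 1, 0; split; last by rewrite n2_1 n2_0 subr0.
by apply: mx2_ext; rewrite !mxE/= ?conjC1 ?conjC0.
Qed.

Lemma su11V_ a b : n2 a - n2 b = 1 -> su a b * su (Num.conj a) (- b) = 1.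
Proof.
move=> ab; have e : a * Num.conj a - b * Num.conj b = 1.
  by rewrite !mulJ; apply: complex_ext; rewrite !cxE// subrr.
apply: mx2_ext; rewrite mul2E !suE !mxE/= ?conjCK ?rmorphN/= -?e; ring.
Qed.

Lemma su11_unit A : su11 A -> A \is a GRing.unit.
Proof. by move=> [_ _ dA]; rewrite unitmxE dA unitr1. Qed.

Lemma su11V a b : n2 a - n2 b = 1 -> (su a b)^-1 = su (Num.conj a) (- b).
Proof.
move=> ab; have u : su a b \is a GRing.unit by apply: su11_unit; apply/su11P; exists a, b.
by apply: (mulrI u); rewrite mulrV// su11V_.
Qed.

Lemma su11_inv A : su11 A -> su11 A^-1.
Proof.
move=> /su11P[a [b [-> ab]]]; rewrite su11V//; apply/su11P.
by exists (Num.conj a), (- b); rewrite n2J n2N.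
Qed.

(** The automorphy factor: the derivative of [moebius A] is its inverse square. *)
Definition den A z : R[i] := A 1 0 * z + A 1 1.

Lemma moebiusE A z : moebius A z = (A 0 0 * z + A 0 1) / den A z.
Proof. by []. Qed.

(** SU(1,1) preserves the Hermitian form of signature (1,1), evaluated here at the vector [(z, 1)].
    Invariance of the disc, of the distance and of the area all come from this identity. *)
Lemma den_num A z : su11 A -> n2 (den A z) - n2 (A 0 0 * z + A 0 1) = 1 - n2 z.
Proof.
move=> /su11P[a [b [-> ab]]]; rewrite /den !suE -{1}ab.
transitivity ((n2 a - n2 b) * (1 - n2 z)); last by rewrite ab; ring.
by rewrite /n2 !cxE; ring.
Qed.

Lemma den_gt0 A z : su11 A -> disc z -> 0 < n2 (den A z).
Proof.
move=> sA /discE z1; have := den_num z sA => /eqP; rewrite subr_eq => /eqP ->.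
by rewrite ltr_pwDl ?n2_ge0// subr_gt0.
Qed.

Lemma den_neq0 A z : su11 A -> disc z -> den A z != 0.
Proof. by move=> sA z1; rewrite -n2_gt0 den_gt0. Qed.

Lemma one_minus_moebius A z : su11 A -> den A z != 0 ->
  1 - n2 (moebius A z) = (1 - n2 z) / n2 (den A z).
Proof.
move=> sA d0; have n0 : n2 (den A z) != 0 by rewrite n2_eq0.
by rewrite moebiusE n2M n2V -(den_num z sA); field.
Qed.

Lemma moebius_disc A z : su11 A -> disc z -> disc (moebius A z).
Proof.
move=> sA z1; apply/discE; rewrite -subr_gt0 one_minus_moebius ?den_neq0//.
by rewrite divr_gt0 ?den_gt0// subr_gt0; exact/discE.
Qed.

Lemma denM A B z : su11 B -> disc z -> den (A * B) z = den A (moebius B z) * den B z.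
Proof.
move=> sB z1; have d0 := den_neq0 sB z1.
rewrite moebiusE; move: d0; rewrite /den !mul2E => d0; by field.
Qed.

Lemma moebiusM A B z : su11 A -> su11 B -> disc z ->
  moebius (A * B) z = moebius A (moebius B z).
Proof.
move=> sA sB z1; have d0 := den_neq0 sB z1.
have d1 : den A (moebius B z) != 0 by apply: den_neq0 => //; exact: moebius_disc.
rewrite [LHS]moebiusE denM// [RHS]moebiusE; apply/eqP; rewrite eqr_div ?mulf_neq0//; apply/eqP.
have -> : (A * B) 0 0 * z + (A * B) 0 1 = (A 0 0 * moebius B z + A 0 1) * den B z.
  rewrite moebiusE; move: d0; rewrite /den !mul2E => d0; by field.
by rewrite -mulrA [den B z * _]mulrC.
Qed.

Lemma moebius1 z : moebius 1 z = z.
Proof. by rewrite moebiusE /den !mxE/= mul1r mul0r add0r addr0 divr1. Qed.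

Lemma moebiusN A z : moebius (- A) z = moebius A z.
Proof. by rewrite !moebiusE /den !mxE !mulNr -!opprD invrN mulrNN. Qed.

Lemma moebiusK A z : su11 A -> disc z -> moebius A^-1 (moebius A z) = z.
Proof.
move=> sA z1; rewrite -moebiusM ?mulVr ?moebius1//; last exact: su11_inv.
exact: su11_unit.
Qed.

Lemma moebiusVK A z : su11 A -> disc z -> moebius A (moebius A^-1 z) = z.
Proof.
move=> sA z1; rewrite -moebiusM ?mulrV ?moebius1//; last exact: su11_inv.
exact: su11_unit.
Qed.

Lemma moebius_inj A z w : su11 A -> disc z -> disc w -> moebius A z = moebius A w -> z = w.
Proof. by move=> sA z1 w1 e; rewrite -[z](moebiusK sA z1) e moebiusK. Qed.

Lemma moebiusB A z w : su11 A -> disc z -> disc w ->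
  moebius A z - moebius A w = (z - w) / (den A z * den A w).
Proof.
move=> sA z1 w1; have d0 := den_neq0 sA z1; have d1 := den_neq0 sA w1.
have [_ _] := sA; rewrite det2E => dA.
transitivity ((A 0 0 * A 1 1 - A 0 1 * A 1 0) * (z - w) / (den A z * den A w)); last by rewrite dA mul1r.
rewrite !moebiusE; move: d0 d1; rewrite /den => d0 d1; field.
by rewrite d0 d1.
Qed.

(** The square of the pseudo-hyperbolic distance. *)
Definition ph2 z w : R := n2 (z - w) / n2 (1 - Num.conj w * z).

Lemma one_ph2_id z w :
  n2 (1 - Num.conj w * z) - n2 (z - w) = (1 - n2 z) * (1 - n2 w).
Proof. by rewrite /n2 !cxE; ring. Qed.

Lemma ph_den_gt0 z w : disc z -> disc w -> 0 < n2 (1 - Num.conj w * z).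
Proof.
move=> /discE z1 /discE w1; have /eqP := one_ph2_id z w; rewrite subr_eq => /eqP ->.
by rewrite ltr_pwDl ?n2_ge0// mulr_gt0// subr_gt0.
Qed.

Lemma one_ph2 z w : disc z -> disc w ->
  1 - ph2 z w = (1 - n2 z) * (1 - n2 w) / n2 (1 - Num.conj w * z).
Proof.
move=> z1 w1; have d0 := ph_den_gt0 z1 w1.
by rewrite -one_ph2_id /ph2; field; rewrite gt_eqF.
Qed.

Lemma ph2_ge0 z w : 0 <= ph2 z w.
Proof. by rewrite /ph2 divr_ge0 ?n2_ge0. Qed.

Lemma ph2_lt1 z w : disc z -> disc w -> ph2 z w < 1.
Proof.
move=> z1 w1; rewrite -subr_gt0 one_ph2// divr_gt0 ?ph_den_gt0// mulr_gt0// subr_gt0; exact/discE.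
Qed.

Lemma ph2C z w : ph2 z w = ph2 w z.
Proof.
rewrite /ph2 n2B -[X in _ / X]n2J rmorphB rmorphM/= conjCK conjC1.
by rewrite [Num.conj z * _]mulrC.
Qed.

Lemma ph2_0l w : ph2 0 w = n2 w.
Proof. by rewrite /ph2 mulr0 subr0 n2_1 sub0r n2N divr1. Qed.

(** In [1 - ph2 = (1 - |z|^2) (1 - |w|^2) / |1 - w^* z|^2] numerator and denominator acquire the
    same factor [1 / (|den A z|^2 |den A w|^2)]. *)
Lemma ph2_moebius A z w : su11 A -> disc z -> disc w ->
  ph2 (moebius A z) (moebius A w) = ph2 z w.
Proof.
move=> sA z1 w1; have d0 := den_gt0 sA z1; have d1 := den_gt0 sA w1.
have Az1 := moebius_disc sA z1; have Aw1 := moebius_disc sA w1.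
have e : 1 - ph2 (moebius A z) (moebius A w) =
    1 - ph2 z w; last by move: e => /(congr1 (fun x => 1 - x)); rewrite !subKr.
have p1 := ph_den_gt0 Az1 Aw1; have p2 := ph_den_gt0 z1 w1.
have h : ph2 (moebius A z) (moebius A w) * n2 (1 - Num.conj (moebius A w) * moebius A z) =
   n2 (z - w) / (n2 (den A z) * n2 (den A w)).
  by rewrite /ph2 divfK ?gt_eqF// moebiusB// !(n2M, n2V).
have k : n2 (1 - Num.conj (moebius A w) * moebius A z) =
    n2 (1 - Num.conj w * z) / (n2 (den A z) * n2 (den A w)).
  have /eqP := one_ph2_id (moebius A z) (moebius A w).
  rewrite subr_eq !one_minus_moebius ?den_neq0// moebiusB// !(n2M, n2V) => /eqP ->.
  have /eqP := one_ph2_id z w; rewrite subr_eq => /eqP ->.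
  by field; rewrite !gt_eqF.
rewrite !one_ph2// k !one_minus_moebius ?den_neq0//.
by field; rewrite !gt_eqF.
Qed.

End su11.

(** * The hyperbolic measure *)

Section hyperbolic_measure.
Context (R : realType).
Implicit Types (A B : 'M[R[i]]_2) (p q : R * R).

Definition nsq p : R := p.1 ^+ 2 + p.2 ^+ 2.
Definition DD : set (R * R) := [set p | nsq p < 1].
(** The density [rho], real-valued and cut off outside the disc: the measure [hmu] built from it
    lives on the whole plane and does not see the complement of the disc. *)
Definition omega p : R := \1_DD p * (4 / (1 - nsq p) ^+ 2).

Lemma nsqE p : nsq p = n2 (toC p). Proof. by []. Qed.
Lemma n2_ofC (z : R[i]) : n2 z = nsq (ofC z). Proof. by []. Qed.
Lemma DDE p : DD p <-> disc (toC p). Proof. by split=> [|/discE] // h; exact/discE. Qed.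
Lemma DD_preimage : toC @^-1` (@disc R) = DD.
Proof. by apply/seteqP; split=> p /DDE. Qed.

Lemma measurable_nsq : measurable_fun setT nsq.
Proof. by rewrite /nsq; mreal. Qed.

Lemma measurable_nsq_lt (t : R) : measurable [set p | nsq p < t].
Proof.
rewrite (_ : [set _ | _] = nsq @^-1` `]-oo, t[%classic); last first.
  by apply/seteqP; split => p /=; rewrite in_itv.
by rewrite -[X in measurable X]setTI; apply: measurable_nsq.
Qed.

Lemma measurable_DD : measurable DD. Proof. exact: measurable_nsq_lt. Qed.

Lemma omegaE p : DD p -> omega p = 4 / (1 - nsq p) ^+ 2.
Proof. by move=> Dp; rewrite /omega indicE mem_set// mul1r. Qed.

Lemma omega_out p : ~ DD p -> omega p = 0.
Proof. by move=> Dp; rewrite /omega indicE memNset// mul0r. Qed.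

Lemma omega_ge0 p : 0 <= omega p.
Proof. by rewrite mulr_ge0// ?divr_ge0 ?sqr_ge0. Qed.

Lemma omega_gt0 p : DD p -> 0 < omega p.
Proof. by move=> Dp; rewrite omegaE// divr_gt0// exprn_gt0// subr_gt0. Qed.

Lemma measurable_omega : measurable_fun setT omega.
Proof.
apply: measurable_funM; first exact: measurable_indic measurable_DD.
by rewrite /nsq; mreal.
Qed.

Lemma rho_omega p : DD p -> rho (toC p) = ((omega p)%:C)%C.
Proof.
move=> Dp; rewrite omegaE// /rho normc2 -nsqE.
by rewrite rmorphM/= fmorphV/= rmorphXn/= rmorphB/= rmorph1 rmorph_nat.
Qed.

Definition hmu : set (plane R) -> \bar R :=
  density (leb2 R) measurable_omega omega_ge0.
HB.instance Definition _ := Measure.on hmu.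

Lemma ge0_integral_hmu (D : set (R * R)) (f : R * R -> \bar R) :
  measurable D -> measurable_fun D f -> (forall p, D p -> (0 <= f p)%E) ->
  (\int[hmu]_(p in D) f p = \int[leb2 R]_(p in D) (f p * (omega p)%:E))%E.
Proof. exact: (@ge0_integral_density_in _ _ R (leb2 R) omega measurable_omega omega_ge0 D f). Qed.

Definition mz A p : R * R := ofC (moebius A (toC p)).

Lemma toC_mz A p : toC (mz A p) = moebius A (toC p).
Proof. by rewrite /mz ofCK. Qed.

Lemma mzE A p : mz A p =
  (let N := A 0 0 * toC p + A 0 1 in let D := den A (toC p) in
  ((re N * re D + im N * im D) / n2 D, (im N * re D - re N * im D) / n2 D)).
Proof.
by rewrite /mz moebiusE /ofC /= invc_n2 reM imM /=; congr (_, _); ring.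
Qed.

Lemma measurable_affineC (a b : R[i]) :
  measurable_fun setT (fun p => re (a * toC p + b)) /\
  measurable_fun setT (fun p => im (a * toC p + b)).
Proof.
split.
  rewrite (_ : (fun p => _) = (fun p => re a * p.1 - im a * p.2 + re b)); first by mreal.
  by apply/funext => p; rewrite !cxE.
rewrite (_ : (fun p => _) = (fun p => re a * p.2 + im a * p.1 + im b)); first by mreal.
by apply/funext => p; rewrite !cxE.
Qed.

Lemma measurable_mz A : measurable_fun setT (mz A).
Proof.
have [n1 n2_] := measurable_affineC (A 0 0) (A 0 1).
have [d1 d2] := measurable_affineC (A 1 0) (A 1 1).
rewrite (_ : mz A = (fun p =>
  (let N := A 0 0 * toC p + A 0 1 in let D := den A (toC p) in
  ((re N * re D + im N * im D) / n2 D, (im N * re D - re N * im D) / n2 D)))); last first.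
  by apply/funext => p; exact: mzE.
by rewrite /n2 /den; mreal.
Qed.

Lemma ge0_integral_conj (g : R * R -> \bar R) :
  measurable_fun setT g -> (forall z, (0 <= g z)%E) ->
  (\int[leb2 R]_p g (p.1, - p.2)%R = \int[leb2 R]_p g p)%E.
Proof.
move=> mg g0; have m1 : (-1 != 0 :> R)%R by rewrite oppr_eq0 oner_eq0.
rewrite -[RHS](ge0_integral_shear2 0 0 m1)//.
by apply: eq_integral => p _; rewrite normrN1 mule1 mul0r !addr0 mulN1r.
Qed.

Lemma ge0_integral_affineC (a b : R[i]) (g : R * R -> \bar R) : a != 0 ->
  measurable_fun setT g -> (forall z, (0 <= g z)%E) ->
  (\int[leb2 R]_p (g (ofC (a * toC p + b)%R) * (n2 a)%:E) = \int[leb2 R]_p g p)%E.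
Proof.
move=> a0 mg g0.
rewrite -[RHS](ge0_integral_similarity (a1 := re a) (a2 := im a) (re b) (im b))//; last first.
  by rewrite -/(n2 a) n2_eq0.
apply: eq_integral => p _; rewrite -/(n2 a) /ofC; congr (g (_, _) * _)%E.
  by rewrite !cxE.
by rewrite !cxE; ring.
Qed.

Lemma ge0_integral_invC (g : R * R -> \bar R) :
  measurable_fun setT g -> (forall z, (0 <= g z)%E) ->
  (\int[leb2 R]_p (g (ofC (toC p)^-1%R) * ((nsq p) ^- 2)%:E) = \int[leb2 R]_p g p)%E.
Proof.
move=> mg g0; rewrite -[RHS]ge0_integral_conj//.
rewrite -[RHS]ge0_integral_inversion//; last by apply: (measurableT_comp mg); mreal.
Qed.

(** If [c = A 1 0] is nonzero, [\det A = 1] gives [A z = a / c - 1 / (c * (c * z + d))], an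
    inversion between two affine maps. Otherwise [A] acts as a rotation. *)
Lemma ge0_integral_mz_leb A (g : R * R -> \bar R) : su11 A ->
  measurable_fun setT g -> (forall z, (0 <= g z)%E) ->
  (\int[leb2 R]_p (g (mz A p) * ((n2 (den A (toC p))) ^- 2)%:E) = \int[leb2 R]_p g p)%E.
Proof.
move=> sA mg g0.
have [c0|c0] := eqVneq (A 1 0) 0.
  have [a [b [eA ab]]] := (su11P A).1 sA.
  have b0 : b = 0 by apply/eqP; rewrite -n2_eq0 -n2J -(su10 a) -eA c0 n2_0.
  have a1 : n2 a = 1 by rewrite -ab b0 n2_0 subr0.
  have aa : a * a != 0 by rewrite -n2_eq0 n2M a1 mulr1 oner_eq0.
  rewrite -[RHS](ge0_integral_affineC 0 aa)//; apply: eq_integral => p _.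
  have eD : den A (toC p) = Num.conj a by rewrite /den eA !suE b0 conjC0 mul0r add0r.
  rewrite eD n2J n2M a1 mulr1 expr1n invr1; congr (g (ofC _) * _)%E.
  rewrite moebiusE eD eA !suE b0 !addr0.
  have aJ : a * Num.conj a = 1 by rewrite mulJ a1.
  have a0 : Num.conj a != 0 by rewrite -n2_eq0 n2J a1 oner_eq0.
  by apply: (mulIf a0); rewrite divfK// mulrAC -[a * a * _]mulrA aJ mulr1.
pose c := A 1 0; pose d := A 1 1; pose a := A 0 0; pose b := A 0 1.
have cc : c * c != 0 by rewrite mulf_neq0.
have N1 : (-1 : R[i]) != 0 by rewrite oppr_eq0 oner_eq0.
pose G p := g (ofC (-1 * toC p + a / c)).
pose H p := (G (ofC (toC p)^-1%R) * ((nsq p) ^- 2)%:E)%E.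
have mG : measurable_fun setT G.
  have [h1 h2] := measurable_affineC (-1) (a / c).
  by apply: (measurableT_comp mg); apply: measurable_fun_pair.
have mH : measurable_fun setT H.
  apply: emeasurable_funM; last by rewrite /nsq; mreal.
  apply: (measurableT_comp mG).
  rewrite (_ : (fun p => _) = (fun p => (p.1 / nsq p, - p.2 / nsq p))); first by rewrite /nsq; mreal.
  by apply/funext => p; rewrite invc_n2.
transitivity (\int[leb2 R]_p (H (ofC (c * c * toC p + c * d)%R) * (n2 (c * c)%R)%:E))%E.
  apply: eq_integral => p _; rewrite /H /G !ofCK -!muleA -!EFinM.
  have -> : c * c * toC p + c * d = c * den A (toC p) by rewrite /den -/c -/d; ring.
  rewrite -n2_ofC !n2M.
  (* At the pole both weights are [0], because [0^-1 = 0]. *)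
  have [D0|D0] := eqVneq (den A (toC p)) 0.
    by rewrite D0 n2_0 !mulr0 !expr0n/= !invr0 !mul0r !mule0.
  have D0' : n2 (den A (toC p)) != 0 by rewrite n2_eq0.
  have c0' : n2 c != 0 by rewrite n2_eq0.
  congr (g (ofC _) * _%:E)%E; last by field; rewrite D0' c0'.
  have [_ _] := sA; rewrite det2E -/a -/b -/c -/d => dA.
  rewrite moebiusE; transitivity (- (a * d - b * c) / (c * den A (toC p)) + a / c); last by rewrite dA mulN1r.
  by move: D0; rewrite /den -/a -/b -/c -/d => D0; field; rewrite D0 c0.
rewrite (ge0_integral_affineC (c * d) cc mH); last first.
  by move=> p; rewrite /H mule_ge0// ?g0// lee_fin invr_ge0 exprn_ge0// nsqE n2_ge0.
rewrite ge0_integral_invC//; last by move=> p; exact: g0.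
rewrite -[RHS](ge0_integral_affineC (a / c) N1)//.
by apply: eq_integral => p _; rewrite n2N n2_1 mule1.
Qed.

Lemma omega_mz A p : su11 A ->
  omega (mz A p) / (n2 (den A (toC p))) ^+ 2 = omega p.
Proof.
move=> sA; have := den_num (toC p) sA; set D := den A _ => dn.
have [D0|D0] := eqVneq D 0.
  rewrite D0 n2_0 expr0n/= invr0 mulr0 omega_out// => Dp.
  move: dn; rewrite D0 n2_0 sub0r => /eqP; rewrite -subr_eq0 opprB => /eqP h.
  have := n2_ge0 (A 0 0 * toC p + A 0 1); move: Dp; rewrite /DD/= nsqE => Dp.
  by apply/negP; rewrite -ltNge; lra.
have D1 : 0 < n2 D by rewrite n2_gt0.
have h : 1 - nsq (mz A p) = (1 - nsq p) / n2 D.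
  by rewrite -n2_ofC one_minus_moebius// nsqE.
have [Dp|Dp] := pselect (DD p).
  have DAp : DD (mz A p).
    rewrite /DD/= -subr_gt0 h divr_gt0// subr_gt0; exact: Dp.
  rewrite !omegaE// h.
  have : 1 - nsq p != 0 by rewrite gt_eqF// subr_gt0; exact: Dp.
  move: (1 - nsq p) (n2 D) D1 => x y y0 x0; field.
  by rewrite x0 gt_eqF.
rewrite !omega_out ?mul0r// => DAp; apply: Dp; rewrite /DD/= -subr_gt0.
have : 0 < 1 - nsq (mz A p) by rewrite subr_gt0; exact: DAp.
by rewrite h pmulr_lgt0// invr_gt0.
Qed.

Lemma ge0_integral_mz A (g : R * R -> \bar R) : su11 A ->
  measurable_fun setT g -> (forall z, (0 <= g z)%E) ->
  (\int[hmu]_p g (mz A p) = \int[hmu]_p g p)%E.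
Proof.
move=> sA mg g0.
have momE : measurable_fun setT (EFin \o omega) by apply/measurable_EFinP; exact: measurable_omega.
rewrite !ge0_integral_hmu//; last first.
  by apply: (measurableT_comp mg); exact: measurable_mz.
rewrite -[RHS](ge0_integral_mz_leb sA); last 2 first.
- exact: emeasurable_funM.
- by move=> p; rewrite mule_ge0// lee_fin omega_ge0.
by apply: eq_integral => p _; rewrite -muleA -EFinM omega_mz.
Qed.

Definition nball (t : R) : set (R * R) := [set p | nsq p < t].

Lemma measurable_nball t : measurable (nball t).
Proof. exact: measurable_nsq_lt. Qed.

Lemma nball_DD t p : t <= 1 -> nball t p -> DD p.
Proof. by move=> t1 /lt_le_trans; apply. Qed.

Lemma hmuE (D : set (R * R)) : measurable D ->
  (hmu D = \int[leb2 R]_(p in D) (omega p)%:E)%E.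
Proof. by []. Qed.

Lemma leb2X (A B : set R) : measurable A -> measurable B ->
  (leb2 R (A `*` B) = lebesgue_measure A * lebesgue_measure B)%E.
Proof.
move=> mA mB.
exact: (@product_measure1E _ _ _ _ R lebesgue_measure lebesgue_measure A B mA mB).
Qed.

Lemma hmu_nball_lty t : t < 1 -> (hmu (nball t) < +oo)%E.
Proof.
move=> t1; pose M := 4 / (1 - t) ^+ 2.
have t1' : 0 < 1 - t by rewrite subr_gt0.
have M0 : 0 <= M by rewrite divr_ge0// sqr_ge0.
have sq : nball t `<=` `[-1, 1]%classic `*` `[-1, 1]%classic.
  move=> p /lt_trans/(_ t1); rewrite /nsq => p1; split; rewrite /= in_itv/= -ler_norml.
    rewrite -(expr_le1 (n := 2))// real_normK ?num_real//.
    by apply: le_trans (ltW p1); rewrite lerDl sqr_ge0.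
  rewrite -(expr_le1 (n := 2))// real_normK ?num_real//.
  by apply: le_trans (ltW p1); rewrite lerDr sqr_ge0.
have mI : measurable (`[-1, 1]%classic : set R) by exact: measurable_itv.
have leb_fin : (leb2 R (nball t) < +oo)%E.
  apply: (@le_lt_trans _ _ (leb2 R (`[(-1)%R, 1%R]%classic `*` `[(-1)%R, 1%R]%classic))).
    apply: le_measure => //; rewrite inE; first exact: measurable_nball.
    exact: measurableX.
  rewrite leb2X// !lebesgue_measure_itv/=.
  by case: ifP => _; rewrite ?mul0e// -EFinB -EFinM ltry.
apply: (@le_lt_trans _ _ (\int[leb2 R]_(p in nball t) M%:E)%E).
  rewrite hmuE//; last exact: measurable_nball.
  apply: ge0_le_integral => //.
  - exact: measurable_nball.
  - by move=> p _; rewrite lee_fin omega_ge0.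
  - by apply/measurable_EFinP; apply: measurable_funTS; exact: measurable_omega.
  - move=> p pt; rewrite lee_fin omegaE; last exact: nball_DD (ltW t1) pt.
    rewrite ler_pM2l// lef_pV2 ?posrE ?exprn_gt0// ?subr_gt0; last 1 first.
      by apply: lt_trans t1; exact: pt.
    have : nsq p < t := pt; move: (nsq p) => x p1.
    by apply: lerXn2r; rewrite ?nnegrE; lra.
rewrite integral_cst; last exact: measurable_nball.
by rewrite lte_mul_pinfty// lee_fin.
Qed.

Lemma hmu_out : (hmu (~` DD) = 0)%E.
Proof.
rewrite hmuE; last exact: measurableC measurable_DD.
by apply: integral0_eq => p Dp; rewrite omega_out.
Qed.

Lemma ge0_integral_hmu_DD (g : R * R -> \bar R) :
  measurable_fun setT g -> (forall z, (0 <= g z)%E) ->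
  (\int[hmu]_(p in DD) g p = \int[hmu]_p g p)%E.
Proof.
move=> mg g0.
rewrite !ge0_integral_hmu//; [|exact: measurable_DD|exact: measurable_funTS].
rewrite [LHS]integral_mkcond; apply: eq_integral => p _; rewrite patchE.
by case: ifPn => // /negP; rewrite inE => Dp; rewrite omega_out// mule0.
Qed.

Lemma hmu_sigma_finite : sigma_finite setT hmu.
Proof.
exists (fun n => nball (1 - n.+1%:R^-1) `|` ~` DD).
  apply/esym; rewrite -subTset => p _.
  have [Dp|Dp] := pselect (DD p); last by exists 0%N => //; right.
  have e0 : 0 < 1 - nsq p by rewrite subr_gt0.
  have [n ne] := ltr_add_invr e0.
  by exists n => //; left; rewrite /nball/=; rewrite ltrBrDr -ltrBrDl -[ltLHS]add0r.
move=> n; split.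
  by apply: measurableU; [exact: measurable_nball|exact: measurableC measurable_DD].
apply: le_lt_trans (measureU2 _ _ _) _ => /=.
- exact: measurable_nball.
- exact: measurableC measurable_DD.
rewrite hmu_out adde0 hmu_nball_lty// ltrBlDr ltrDl invr_gt0 //.
Qed.

HB.instance Definition _ := Measure_isSigmaFinite.Build _ _ _ hmu hmu_sigma_finite.

End hyperbolic_measure.

(** * Comparison of integrals by piecewise transport *)

Section transport.
Local Open Scope ereal_scope.

(** The cover [S] is made disjoint; [tau j] moves the [j]-th piece of [E] into [E'] without changing
    its measure, and the images are disjoint by the joint injectivity of the [tau j] on [E]. It is
    applied to group elements acting on the disc, to the diagonal action on pairs of points, and to
    the local pieces of an isometry. *)
Lemma transport_le d (T : measurableType d) (R : realType)
    (m : {measure set T -> \bar R}) (D E E' : set T) (S : nat -> set T)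
    (tau sig : nat -> T -> T) (f f' : T -> \bar R) :
  measurable D -> measurable E -> measurable E' -> (forall j, measurable (S j)) ->
  E `<=` D -> E' `<=` D -> E `<=` \bigcup_j S j ->
  (forall j, measurable_fun setT (sig j)) ->
  (forall j x, D x -> D (tau j x)) -> (forall j x, D x -> D (sig j x)) ->
  (forall j x, D x -> sig j (tau j x) = x) -> (forall j x, D x -> tau j (sig j x) = x) ->
  (forall j (g : T -> \bar R), measurable_fun setT g -> (forall x, 0 <= g x) ->
     \int[m]_(x in D) g (tau j x) = \int[m]_(x in D) g x) ->
  (forall j x, E x -> S j x -> E' (tau j x)) ->
  (forall j k x y, E x -> S j x -> E y -> S k y -> tau j x = tau k y -> x = y) ->
  measurable_fun setT f -> (forall x, 0 <= f x) ->
  measurable_fun setT f' -> (forall x, 0 <= f' x) ->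
  (forall j x, E x -> S j x -> f x = f' (tau j x)) ->
  \int[m]_(x in E) f x <= \int[m]_(x in E') f' x.
Proof.
move=> mD mE mE' mS ED E'D ES msig tD sD st ts pres tE' tinj mf f0 mf' f'0 ff'.
pose Ej j := E `&` seqDU S j.
have mEj j : measurable (Ej j).
  by apply: measurableI => //; apply: measurableD => //; apply: bigsetU_measurable.
have EjS j x : Ej j x -> S j x by move=> [_ [? _]].
have EjE j x : Ej j x -> E x by move=> [].
have EE : E = \bigcup_j Ej j.
  by rewrite /Ej -setI_bigcupr -seqDU_bigcup_eq; apply/esym/setIidPl.
have tEj : trivIset setT Ej by apply: trivIset_setIl; exact: trivIset_seqDU.
(* The image of the piece under [tau j], written as a preimage under its inverse so that it is
   measurable. *)
pose Q j := D `&` (sig j @^-1` (Ej j)).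
have mQ j : measurable (Q j).
  by apply: measurableI => //; rewrite -[X in measurable X]setTI; exact: msig.
have QE j y : Q j y -> E' y.
  by move=> [Dy Ey]; rewrite -(ts j y Dy); apply: tE'; [exact: EjE Ey|exact: EjS Ey].
have tQ : trivIset setT Q.
  move=> j k _ _ [y [[Dy Ejy] [_ Eky]]].
  have e : sig j y = sig k y.
    apply: (tinj j k) => //; [exact: EjE Ejy|exact: EjS Ejy|exact: EjE Eky|exact: EjS Eky|].
    by rewrite !ts.
  by apply: tEj => //; exists (sig j y); split => //; rewrite e.
have mfE (B : set T) : measurable_fun B f by exact: measurable_funTS.
have mfE' (B : set T) : measurable_fun B f' by exact: measurable_funTS.
have step j : \int[m]_(x in Ej j) f x = \int[m]_(x in Q j) f' x.
  rewrite [LHS]integral_mkcond [RHS]integral_mkcond.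
  have patchD (h : T -> \bar R) (B : set T) : B `<=` D -> (forall x, 0 <= h x) ->
     \int[m]_x (h \_ B) x = \int[m]_(x in D) (h \_ B) x.
    move=> BD h0; rewrite [RHS]integral_mkcond; apply: eq_integral => x _.
    rewrite !patchE; case: ifPn => [/set_mem Bx|]; last by case: ifP.
    by rewrite mem_set//; exact: BD.
  rewrite patchD//; last by move=> x /EjE/ED.
  rewrite patchD//; last by move=> x [].
  rewrite -[RHS](pres j); last 2 first.
  - by apply/(measurable_restrictT _ _).1.
  - by move=> x; rewrite patchE; case: ifP.
  apply: eq_integral => x; rewrite inE => Dx; rewrite !patchE.
  have -> : (tau j x \in Q j) = (x \in Ej j).
    apply/idP/idP; rewrite !inE /Q/=; first by move=> [_]; rewrite st.
    by move=> Ex; split; [exact: tD|rewrite st].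
  by case: ifPn => // /set_mem Ex; apply: ff'; [exact: EjE Ex|exact: EjS Ex].
rewrite {1}EE ge0_integral_bigcup//.
under eq_eseriesr do rewrite step.
rewrite -ge0_integral_bigcup//; apply: ge0_subset_integral => //.
- exact: bigcup_measurable.
- by move=> y [j _ /QE].
Qed.

End transport.

Section modulus.
Context (R : realType).
Implicit Types (z w : R[i]).

Definition cabs z : R := Num.sqrt (n2 z).
Lemma cabs_ge0 z : 0 <= cabs z. Proof. exact: sqrtr_ge0. Qed.
Lemma sqr_cabs z : cabs z ^+ 2 = n2 z. Proof. by rewrite sqr_sqrtr ?n2_ge0. Qed.
Lemma cabsE z : `|z| = ((cabs z)%:C)%C. Proof. exact: normcC. Qed.
Lemma cabsM z w : cabs (z * w) = cabs z * cabs w.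
Proof. by rewrite /cabs n2M sqrtrM// n2_ge0. Qed.
Lemma cabsV z : cabs z^-1 = (cabs z)^-1.
Proof. by rewrite /cabs n2V sqrtrV// n2_ge0. Qed.
Lemma cabsN z : cabs (- z) = cabs z. Proof. by rewrite /cabs n2N. Qed.
Lemma cabsB z w : cabs (z - w) = cabs (w - z). Proof. by rewrite /cabs n2B. Qed.
Lemma cabs0 : cabs (0 : R[i]) = 0. Proof. by rewrite /cabs n2_0 sqrtr0. Qed.
Lemma cabs1 : cabs (1 : R[i]) = 1. Proof. by rewrite /cabs n2_1 sqrtr1. Qed.
Lemma cabsC (x : R) : cabs (x%:C)%C = `|x|. Proof. by rewrite /cabs n2C sqrtr_sqr. Qed.
Lemma cabsD z w : cabs (z + w) <= cabs z + cabs w.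
Proof.
rewrite -(ler_pXn2r (ltn0Sn 1)) ?nnegrE ?addr_ge0 ?cabs_ge0//.
by rewrite sqr_cabs n2D_le.
Qed.
Lemma cabs_eq0 z : (cabs z == 0) = (z == 0).
Proof. by rewrite /cabs sqrtr_eq0 -n2_eq0 eq_le n2_ge0 andbT. Qed.
Lemma re_le_cabs z : `|re z| <= cabs z.
Proof. by rewrite /cabs -sqrtr_sqr ler_wsqrtr// lerDl sqr_ge0. Qed.
Lemma im_le_cabs z : `|im z| <= cabs z.
Proof. by rewrite /cabs -sqrtr_sqr ler_wsqrtr// lerDr sqr_ge0. Qed.
Lemma cabs_le z : cabs z <= `|re z| + `|im z|.
Proof.
rewrite -(ler_pXn2r (ltn0Sn 1)) ?nnegrE ?addr_ge0 ?cabs_ge0//.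
rewrite sqr_cabs sqrrD !real_normK ?num_real// /n2 lerD2r lerDl mulrn_wge0//.
Qed.
Lemma disc_cabs z : disc z <-> cabs z < 1.
Proof.
by rewrite discE -sqr_cabs expr_lt1// ?cabs_ge0.
Qed.

End modulus.

(** * Measurability of continuous functions in the plane *)

Section plane_topology.
Context (R : realType).
Implicit Types (p q : R * R) (U : set (R * R)) (f : R * R -> R).

Definition square p (e : R) : set (R * R) :=
  [set q | `|q.1 - p.1| < e /\ `|q.2 - p.2| < e].

(** A countable base of squares with rational centre and radius. An index that decodes to nothing
    gives radius [0], hence the empty set. *)
Definition ratbox (n : nat) : set (R * R) :=
  let: (a, b, r) := odflt (0, 0, 0) (unpickle n : option (rat * rat * rat)) in
  square (ratr a, ratr b) (ratr r).

Lemma measurable_square p e : measurable (square p e).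
Proof.
have -> : square p e = ((fun x => x - p.1) @^-1` `]-e, e[%classic) `*`
    ((fun x => x - p.2) @^-1` `]-e, e[%classic).
  by apply/seteqP; split => q /=; rewrite /square/= !in_itv/= -!ltr_norml.
by apply: measurableX; rewrite -[X in measurable X]setTI; apply: measurable_funB.
Qed.

Lemma measurable_ratbox n : measurable (ratbox n).
Proof. by rewrite /ratbox; case: (odflt _ _) => [[a b] r]; exact: measurable_square. Qed.

Lemma ratbox_basis p (e : R) : 0 < e -> exists n, ratbox n p /\ ratbox n `<=` square p e.
Proof.
move=> e0.
have e4 : 0 < e / 4 by rewrite divr_gt0.
have e24 : e / 4 < e / 2 by rewrite ltr_pM2l// ltf_pV2 ?posrE// ltr_nat.
have [r] := rat_in_itvoo e24; rewrite in_itv/= => /andP[r1 r2].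
have near_rat (x : R) : exists a : rat, `|x - ratr a| < ratr r :> R.
  have xx : x - e / 4 < x + e / 4 by lra.
  have [a] := rat_in_itvoo xx; rewrite in_itv/= => /andP[a1 a2].
  by exists a; rewrite ltr_norml; apply/andP; split; lra.
have [a pa] := near_rat p.1; have [b pb] := near_rat p.2.
exists (pickle (a, b, r)); rewrite /ratbox pickleK /=; split => // q [/= qa qb].
move: pa pb qa qb; rewrite /square/= !ltr_norml => /andP[? ?] /andP[? ?] /andP[? ?] /andP[? ?].
by split; apply/andP; split; lra.
Qed.

(** An open set is the union of the rational squares that it contains, which are countably many.
    This ties the topology of the plane to the product sigma-algebra. *)
Lemma measurable_ratbox_open U :
  (forall p, U p -> exists2 e, 0 < e & square p e `<=` U) -> measurable U.
Proof.
move=> oU.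
have -> : U = \bigcup_(n in [set n | ratbox n `<=` U]) ratbox n.
  apply/seteqP; split => [p Up|p [n nU np]]; last exact: nU.
  have [e e0 eU] := oU _ Up; have [n [np ne]] := ratbox_basis p e0.
  by exists n => //= q /ne /eU.
by apply: bigcup_measurable => n _; exact: measurable_ratbox.
Qed.

Definition pcont f p := forall e : R, 0 < e ->
  exists2 d : R, 0 < d & forall q, square p d q -> `|f q - f p| < e.

Lemma pcontP f p : pcont f p <-> {for p, continuous f}.
Proof.
split=> [fp|fp e e0].
  apply/cvgrPdist_lt => e e0; have [d d0 dP] := fp _ e0.
  exists (ball p.1 d, ball p.2 d); first by split; exact: nbhsx_ballx.
  move=> q [/= q1 q2]; rewrite distrC; apply: dP.
  by split; rewrite distrC.
have /cvgrPdist_lt/(_ _ e0)[[A B] /= [/nbhs_ballP[d /= d0 dA] /nbhs_ballP[d' /= d'0 dB]] AB] := fp.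
exists (Num.min d d'); first by rewrite lt_min d0.
move=> q [/=]; rewrite !lt_min => /andP[? ?] /andP[? ?].
rewrite distrC; apply: (AB q); split => /=; [apply: dA|apply: dB]; by rewrite /ball/= distrC.
Qed.

Lemma measurable_pcont U f :
  (forall p, U p -> exists2 e, 0 < e & square p e `<=` U) ->
  (forall p, U p -> pcont f p) -> measurable_fun U f.
Proof.
move=> oU cf; apply: (measurability (@RGenOInfty.G R)).
  exact: RGenOInfty.measurableE.
move=> _ [_ [c ->] <-]; apply: measurable_ratbox_open => p [Up fp].
have [e e0 eU] := oU _ Up.
have fc : 0 < f p - c by rewrite subr_gt0; move: fp; rewrite /= in_itv/= andbT.
have [d d0 dP] := cf _ Up _ fc.
exists (Num.min e d); first by rewrite lt_min e0.
move=> q [/=]; rewrite !lt_min => /andP[q1e q1d] /andP[q2e q2d]; split; first exact: eU.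
have : `|f q - f p| < f p - c by apply: dP.
by rewrite /= in_itv/= andbT ltr_norml => /andP[? ?]; lra.
Qed.

Lemma DD_square p : DD p -> exists2 e, 0 < e & square p e `<=` @DD R.
Proof.
move=> Dp; have c1 : cabs (toC p) < 1 by apply/disc_cabs/DDE.
exists ((1 - cabs (toC p)) / 2); first by rewrite divr_gt0// subr_gt0.
move=> q [q1 q2]; apply/DDE/disc_cabs.
have -> : toC q = toC p + (toC q - toC p) by rewrite addrC subrK.
apply: le_lt_trans (cabsD _ _) _.
have := cabs_le (toC q - toC p); rewrite !cxE /=; lra.
Qed.

Lemma nball_bounded f (t : R) : t < 1 -> (forall p, DD p -> pcont f p) ->
  exists2 M, 0 <= M & forall p, nsq p <= t -> `|f p| <= M.
Proof.
move=> t1 cf; pose K := [set p : R * R | nsq p <= t].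
have cK : compact K.
  apply: (@subclosed_compact (R * R)%type K (`[-1, 1]%classic `*` `[-1, 1]%classic)).
  - have -> : K = @nsq R @^-1` [set x | x <= t] by [].
    apply: closed_comp; last exact: closed_le.
    move=> p _; rewrite /nsq; apply: cvgD.
      by apply: cvgM; exact: cvg_fst.
    by apply: cvgM; exact: cvg_snd.
  - by apply: compact_setX; exact: segment_compact.
  - move=> p; rewrite /K/= => pt; have p1 := le_lt_trans pt t1; move: p1; rewrite /nsq => p1.
    split; rewrite /= in_itv/= -ler_norml -(expr_le1 (n := 2))// real_normK ?num_real//.
      by apply: le_trans (ltW p1); rewrite lerDl sqr_ge0.
    by apply: le_trans (ltW p1); rewrite lerDr sqr_ge0.
have cfK : {within K, continuous f}.
  apply: continuous_in_subspaceT => p; rewrite inE => Kp.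
  by apply/pcontP; apply: cf; exact: le_lt_trans Kp t1.
have [M [_ MP]] := compact_bounded (continuous_compact cfK cK).
exists (Num.max 0 (M + 1)); first by rewrite le_max lexx.
move=> p Kp; rewrite le_max; apply/orP; right; apply: MP; first by rewrite ltrDl.
by exists p.
Qed.

Lemma pcontD f g p : pcont f p -> pcont g p -> pcont (fun q => f q + g q) p.
Proof. by move=> /pcontP cf /pcontP cg; apply/pcontP; exact: cvgD. Qed.

Lemma pcont_cst (c : R) p : pcont (fun=> c) p.
Proof. by move=> e e0; exists 1 => // q _; rewrite subrr normr0. Qed.

Lemma pcontM f g p : pcont f p -> pcont g p -> pcont (fun q => f q * g q) p.
Proof. by move=> /pcontP cf /pcontP cg; apply/pcontP; exact: cvgM. Qed.

Lemma pcontN f p : pcont f p -> pcont (fun q => - f q) p.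
Proof.
move=> cf e e0; have [d d0 dP] := cf _ e0; exists d => // q /dP.
by rewrite -opprD normrN.
Qed.

Lemma pcont_fst p : pcont fst p.
Proof. by move=> e e0; exists e => // q []. Qed.
Lemma pcont_snd p : pcont snd p.
Proof. by move=> e e0; exists e => // q []. Qed.

Lemma eq_pcont f g p : f =1 g -> pcont f p -> pcont g p.
Proof. by move=> /funext ->. Qed.

Lemma pcont_nsq p : pcont (@nsq R) p.
Proof.
by apply: pcontD; apply: pcontM; [exact: pcont_fst|exact: pcont_fst|exact: pcont_snd|exact: pcont_snd].
Qed.

End plane_topology.

(** * The mean value property of holomorphic functions *)

Section bisection.
Context (R : realType).
Implicit Types (Phi : R -> R -> R -> R -> R).

(** Goursat's quartering. If [Phi] were nonzero, some quarter of each rectangle would again exceed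
    [e] times its squared semi-perimeter; the nested rectangles shrink to a point [(s, t)], where
    the local smallness hypothesis is contradicted. *)
Lemma bisection_zero Phi (a0 b0 c0 d0 : R) : a0 <= b0 -> c0 <= d0 ->
  (forall a b c d, a0 <= a -> a <= b -> b <= b0 -> c0 <= c -> c <= d -> d <= d0 ->
     let m := (a + b) / 2 in let n := (c + d) / 2 in
     Phi a b c d = Phi a m c n + Phi m b c n + (Phi a m n d + Phi m b n d)) ->
  (forall s t e, a0 <= s <= b0 -> c0 <= t <= d0 -> 0 < e ->
     exists2 dl, 0 < dl & forall a b c d,
       a0 <= a -> a <= s -> s <= b -> b <= b0 -> c0 <= c -> c <= t -> t <= d -> d <= d0 ->
       b - a < dl -> d - c < dl -> `|Phi a b c d| <= e * ((b - a) + (d - c)) ^+ 2) ->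
  Phi a0 b0 c0 d0 = 0.
Proof.
move=> ab0 cd0 add small; apply/eqP; apply/negPn/negP => Phi0.
pose L0 := (b0 - a0) + (d0 - c0).
(* Chosen so that [e * L0 ^+ 2 < |Phi|] and the initial rectangle is big; the [+ 1] covers
   [L0 = 0]. *)
pose e := `|Phi a0 b0 c0 d0| / (L0 ^+ 2 + 1) / 2.
have L2 : 0 < L0 ^+ 2 + 1 by rewrite ltr_wpDl// sqr_ge0.
have e0 : 0 < e by rewrite !divr_gt0// normr_gt0.
pose big (r : R * R * R * R) :=
  e * ((r.1.1.2 - r.1.1.1) + (r.2 - r.1.2)) ^+ 2 < `|Phi r.1.1.1 r.1.1.2 r.1.2 r.2|.
pose ok (r : R * R * R * R) :=
  [&& a0 <= r.1.1.1, r.1.1.1 <= r.1.1.2, r.1.1.2 <= b0, c0 <= r.1.2, r.1.2 <= r.2 & r.2 <= d0].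
pose step (r : R * R * R * R) : R * R * R * R :=
  let: (a, b, c, d) := r in let m := (a + b) / 2 in let n := (c + d) / 2 in
  if big (a, m, c, n) then (a, m, c, n) else
  if big (m, b, c, n) then (m, b, c, n) else
  if big (a, m, n, d) then (a, m, n, d) else (m, b, n, d).
have stepP r : ok r -> big r ->
  [/\ ok (step r), big (step r),
      r.1.1.1 <= (step r).1.1.1 /\ (step r).1.1.2 <= r.1.1.2,
      r.1.2 <= (step r).1.2 /\ (step r).2 <= r.2 &
      (step r).1.1.2 - (step r).1.1.1 = (r.1.1.2 - r.1.1.1) / 2 /\
      (step r).2 - (step r).1.2 = (r.2 - r.1.2) / 2].
  move: r => [[[a b] c] d] /and5P[/= h1 h2 h3 h4 /andP[h5 h6]] hb.
  have hm : a <= (a + b) / 2 <= b by apply/andP; split; lra.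
  have hn : c <= (c + d) / 2 <= d by apply/andP; split; lra.
  move: hm hn => /andP[m1 m2] /andP[n1 n2].
  have okq (u v w z : R) : a0 <= u -> u <= v -> v <= b0 -> c0 <= w -> w <= z -> z <= d0 -> ok (u, v, w, z).
    by move=> *; apply/and5P; split => //; apply/andP.
  rewrite /step; case: ifPn => [B1|B1].
    split; [apply: okq|exact: B1|split=> /=|split=> /=|split=> /=];
      clear -h1 h2 h3 h4 h5 h6 m1 m2 n1 n2; lra.
  case: ifPn => [B2|B2].
    split; [apply: okq|exact: B2|split=> /=|split=> /=|split=> /=];
      clear -h1 h2 h3 h4 h5 h6 m1 m2 n1 n2; lra.
  case: ifPn => [B3|B3].
    split; [apply: okq|exact: B3|split=> /=|split=> /=|split=> /=];
      clear -h1 h2 h3 h4 h5 h6 m1 m2 n1 n2; lra.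
  split; [apply: okq| |split=> /=|split=> /=|split=> /=];
    try (clear -h1 h2 h3 h4 h5 h6 m1 m2 n1 n2; lra).
  (* With semi-perimeter [L], four quarters that are not big would give
     [|Phi| <= 4 * e * (L / 2)^2 = e * L^2]. So if the first three are not, the last one is big. *)
  move: hb B1 B2 B3; rewrite /big/= -!leNgt (add _ _ _ _ h1 h2 h3 h4 h5 h6) => hb B1 B2 B3.
  set P1 := Phi _ _ _ _ in hb B1; set P2 := Phi _ _ _ _ in hb B2.
  set P3 := Phi _ _ _ _ in hb B3; set P4 := Phi _ _ _ _ in hb *.
  have := ler_normD (P1 + P2) (P3 + P4); have := ler_normD P1 P2; have := ler_normD P3 P4.
  move: hb B1 B2 B3; rewrite !expr2; nra.
pose r_ n := iter n step (a0, b0, c0, d0).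
have rP n : ok (r_ n) /\ big (r_ n).
  elim: n => [|n [ih1 ih2]]; last by rewrite /r_ iterS; have [] := stepP _ ih1 ih2.
  split; first by apply/and5P; split => //=; apply/andP.
  rewrite /big/= -/L0 /e.
  have p0 : 0 < `|Phi a0 b0 c0 d0| by rewrite normr_gt0.
  rewrite -mulrA -mulrA mulrCA [ltRHS](_ : _ = `|Phi a0 b0 c0 d0| * 1) ?mulr1//.
  have -> : (L0 ^+ 2 + 1)^-1 * (`|Phi a0 b0 c0 d0| * (2^-1 * L0 ^+ 2)) =
     `|Phi a0 b0 c0 d0| * (L0 ^+ 2 / (L0 ^+ 2 + 1) / 2) by ring.
  rewrite -[ltRHS]mulr1 ltr_pM2l// ltr_pdivrMr// ltr_pdivrMr// mul1r.
  have := sqr_ge0 L0; lra.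
have mono n k : (n <= k)%N -> ((r_ n).1.1.1 <= (r_ k).1.1.1 /\ (r_ k).1.1.2 <= (r_ n).1.1.2) /\
    ((r_ n).1.2 <= (r_ k).1.2 /\ (r_ k).2 <= (r_ n).2).
  move=> /subnK <-; elim: (k - n)%N => [|j [[i1 i2] [i3 i4]]]; first by rewrite add0n.
  have [ih1 ih2] := rP (j + n)%N; have [_ _ [j1 j2] [j3 j4] _] := stepP _ ih1 ih2.
  by rewrite addSn /r_ iterS -/(r_ _); split; split;
    [exact: le_trans j1|exact: le_trans i2|exact: le_trans j3|exact: le_trans i4].
have len n : (r_ n).1.1.2 - (r_ n).1.1.1 = (b0 - a0) / 2 ^+ n /\
    (r_ n).2 - (r_ n).1.2 = (d0 - c0) / 2 ^+ n.
  elim: n => [|n [i1 i2]]; first by rewrite expr0 !divr1.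
  have [ih1 ih2] := rP n; have [_ _ _ _ [j1 j2]] := stepP _ ih1 ih2.
  by rewrite /r_ iterS -/(r_ _) j1 j2 i1 i2 exprS invfM; split; ring.
have le1 n k : (r_ n).1.1.1 <= (r_ k).1.1.2.
  have [[h1 h2] _] := mono _ _ (leq_maxl n k); have [[h3 h4] _] := mono _ _ (leq_maxr n k).
  have [/and5P[_ h5 _ _ _] _] := rP (maxn n k).
  by apply: le_trans h1 (le_trans h5 h4).
have le2 n k : (r_ n).1.2 <= (r_ k).2.
  have [_ [h1 h2]] := mono _ _ (leq_maxl n k); have [_ [h3 h4]] := mono _ _ (leq_maxr n k).
  have [/and5P[_ _ _ _ /andP[h5 _]] _] := rP (maxn n k).
  by apply: le_trans h1 (le_trans h5 h4).
pose s := sup (range (fun n => (r_ n).1.1.1)).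
pose t := sup (range (fun n => (r_ n).1.2)).
have hs1 : has_sup (range (fun n => (r_ n).1.1.1)).
  by split; [exists a0, 0%N|exists b0 => _ [n _ <-]; exact: (le1 n 0%N)].
have ht1 : has_sup (range (fun n => (r_ n).1.2)).
  by split; [exists c0, 0%N|exists d0 => _ [n _ <-]; exact: (le2 n 0%N)].
have sa n : (r_ n).1.1.1 <= s by apply: ub_le_sup; [case: hs1|exists n].
have tc n : (r_ n).1.2 <= t by apply: ub_le_sup; [case: ht1|exists n].
have sb n : s <= (r_ n).1.1.2 by apply: ge_sup; [case: hs1|move=> _ [k _ <-]; exact: le1].
have td n : t <= (r_ n).2 by apply: ge_sup; [case: ht1|move=> _ [k _ <-]; exact: le2].
have sin : a0 <= s <= b0 by apply/andP; split; [exact: (sa 0%N)|exact: (sb 0%N)].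
have tin : c0 <= t <= d0 by apply/andP; split; [exact: (tc 0%N)|exact: (td 0%N)].
have [dl dl0 H] := small s t e sin tin e0.
have [n nP] : exists n, L0 / 2 ^+ n < dl.
  have [n nL] : exists n, L0 / dl < n%:R.
    by exists (Num.bound (L0 / dl)); apply: archi_boundP; rewrite divr_ge0 ?(ltW dl0)// /L0; lra.
  exists n; rewrite ltr_pdivrMr ?exprn_gt0// mulrC -ltr_pdivrMr//.
  apply: lt_le_trans nL _; rewrite -natrX ler_nat; apply: ltnW; exact: ltn_expl.
have [/and5P[k1 k2 k3 k4 /andP[k5 k6]] kb] := rP n.
have [l1 l2] := len n.
have pn : 0 < 2 ^- n :> R by rewrite invr_gt0 exprn_gt0.
have := H _ _ _ _ k1 (sa n) (sb n) k3 k4 (tc n) (td n) k6.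
rewrite l1 l2.
have H1 : (b0 - a0) / 2 ^+ n < dl by apply: le_lt_trans nP; rewrite ler_pM2r// /L0; lra.
have H2 : (d0 - c0) / 2 ^+ n < dl by apply: le_lt_trans nP; rewrite ler_pM2r// /L0; lra.
move=> /(_ H1 H2).
by rewrite leNgt; move: kb; rewrite /big l1 l2 => ->.
Qed.

End bisection.

Section line_integral.
Context (R : realType).
Local Notation leb := (@lebesgue_measure R).
Implicit Types (f g : R -> R).

Definition lint f a b : R := (\int[leb]_(x in `[a, b]) f x)%R.

Definition lcont f a b := forall x, a <= x <= b -> {for x, continuous f}.

Lemma lcont_integrable f a b : lcont f a b -> leb.-integrable `[a, b] (EFin \o f).
Proof.
move=> cf; apply: continuous_compact_integrable; first exact: segment_compact.
by apply: continuous_in_subspaceT => x; rewrite inE/= in_itv/= => /cf.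
Qed.

Lemma lintD f g a b : lcont f a b -> lcont g a b ->
  lint (fun x => f x + g x) a b = lint f a b + lint g a b.
Proof. by move=> cf cg; rewrite /lint RintegralD//; exact: lcont_integrable. Qed.

Lemma lintB f g a b : lcont f a b -> lcont g a b ->
  lint (fun x => f x - g x) a b = lint f a b - lint g a b.
Proof. by move=> cf cg; rewrite /lint RintegralB//; exact: lcont_integrable. Qed.

Lemma lint_cst (k a b : R) : a <= b -> lint (fun=> k) a b = k * (b - a).
Proof.
move=> ab; rewrite /lint Rintegral_cst//= lebesgue_measure_itv/= lte_fin.
case: ltP => //= ba; have -> : a = b by apply/eqP; rewrite eq_le ab ba.
by rewrite subrr.
Qed.

Lemma lcontS f a b a' b' : a <= a' -> b' <= b -> lcont f a b -> lcont f a' b'.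
Proof.
by move=> aa bb cf x /andP[h1 h2]; apply: cf; rewrite (le_trans aa h1) (le_trans h2 bb).
Qed.

Lemma lint_chasles f a m b : a <= m -> m <= b -> lcont f a b ->
  lint f a b = lint f a m + lint f m b.
Proof.
move=> am mb cf; have := @Rintegral_itvB _ f (BLeft a) (BRight b) m (lcont_integrable cf).
rewrite !bnd_simp => /(_ am mb); rewrite /lint => h.
rewrite -[X in _ + X]Rintegral_itv_obnd_cbnd; first by rewrite -h addrC subrK.
apply: integrableS (lcont_integrable (lcontS am (lexx b) cf)) => //.
exact: subset_itv_oc_cc.
Qed.

Lemma lcontB f g a b : lcont f a b -> lcont g a b -> lcont (fun x => f x - g x) a b.
Proof. by move=> cf cg x xab; apply: cvgB; [exact: cf|exact: cg]. Qed.

Lemma lcont_cst (k : R) a b : lcont (fun=> k) a b.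
Proof. by move=> x _; exact: cvg_cst. Qed.

Lemma lint_approx f a b k e : a <= b -> lcont f a b ->
  (forall x, a <= x <= b -> `|f x - k| <= e) -> `|lint f a b - k * (b - a)| <= e * (b - a).
Proof.
move=> ab cf fk; rewrite -(lint_cst k ab) -lintB//; last exact: lcont_cst.
have ci := lcont_integrable (lcontB cf (@lcont_cst k a b)).
rewrite /lint; apply: le_trans (le_normr_Rintegral _ ci) _ => //.
rewrite -(lint_cst e ab) /lint; apply: le_Rintegral => //=.
- exact: (integrable_norm ci).
- by apply: lcont_integrable; exact: lcont_cst.
Qed.

End line_integral.

(** Goursat's argument for a real 1-form [P ds + Q dt] whose coefficients are merely
    differentiable at each point, with [dP/dt = dQ/ds] there. *)
Section closed_form.
Context (R : realType).
Implicit Types (P Q : R -> R -> R).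

(** The two expansions share the coefficient [r], which is both [dP/dt] and [dQ/ds]: closedness is
    part of the differentiability statement. *)
Definition closed_at P Q (s t : R) := exists p r q : R, forall e, 0 < e ->
  exists2 d : R, 0 < d & forall h k, `|h| < d -> `|k| < d ->
   `|P (s + h) (t + k) - P s t - p * h - r * k| <= e * (`|h| + `|k|) /\
   `|Q (s + h) (t + k) - Q s t - r * h - q * k| <= e * (`|h| + `|k|).

Lemma closed_at_cont P Q s t : closed_at P Q s t ->
  [/\ {for s, continuous (P ^~ t)}, {for t, continuous (P s)},
      {for s, continuous (Q ^~ t)} & {for t, continuous (Q s)}].
Proof.
have small (F : R -> R) x p : (exists2 d : R, 0 < d & forall h, `|h| < d -> `|F (x + h) - F x - p * h| <= 1 * `|h|) ->
    {for x, continuous F}.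
  move=> [d d0 H]; apply/cvgrPdist_lt => e e0; apply/nbhs_ballP.
  have p1 : 0 < `|p| + 2 by rewrite ltr_wpDl.
  exists (Num.min d (e / (`|p| + 2))); first by rewrite /= lt_min d0 divr_gt0.
  move=> y; rewrite /ball/= lt_min distrC => /andP[yd ye].
  have := H _ yd; rewrite (_ : x + (y - x) = y) ?mul1r => [Hy|]; last by ring.
  rewrite distrC; have -> : F y - F x = (F y - F x - p * (y - x)) + p * (y - x) by rewrite subrK.
  apply: le_lt_trans (ler_normD _ _) _; rewrite normrM.
  move: ye; rewrite ltr_pdivlMr// mulrDr; have := normr_ge0 (y - x); have := normr_ge0 p; nra.
move=> [p [r [q H]]]; have [d d0 Hd] := H _ ltr01; have n0 : `|0 : R| < d by rewrite normr0.
split.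
- apply: (small _ _ p); exists d => // h hd; have [+ _] := Hd h 0 hd n0.
  by rewrite addr0 mulr0 subr0 normr0 addr0.
- apply: (small _ _ r); exists d => // h hd; have [+ _] := Hd 0 h n0 hd.
  by rewrite addr0 mulr0 subr0 normr0 add0r.
- apply: (small _ _ r); exists d => // h hd; have [_ +] := Hd h 0 hd n0.
  by rewrite addr0 mulr0 subr0 normr0 addr0.
- apply: (small _ _ q); exists d => // h hd; have [_ +] := Hd 0 h n0 hd.
  by rewrite addr0 mulr0 subr0 normr0 add0r.
Qed.

Lemma closed_form_rect P Q (a0 b0 c0 d0 : R) : a0 <= b0 -> c0 <= d0 ->
  (forall s t, a0 <= s <= b0 -> c0 <= t <= d0 -> closed_at P Q s t) ->
  lint (fun s => P s c0 - P s d0) a0 b0 + lint (fun t => Q b0 t - Q a0 t) c0 d0 = 0.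
Proof.
move=> ab0 cd0 H.
pose Phi a b c d := lint (fun s => P s c - P s d) a b + lint (fun t => Q b t - Q a t) c d.
have cP c a b : c0 <= c <= d0 -> a0 <= a -> b <= b0 -> lcont (P ^~ c) a b.
  move=> cc aa bb x /andP[h1 h2]; have [] := @closed_at_cont P Q x c => //.
  by apply: H => //; rewrite (le_trans aa h1) (le_trans h2 bb).
have cQ a c d : a0 <= a <= b0 -> c0 <= c -> d <= d0 -> lcont (Q a) c d.
  move=> aa cc dd x /andP[h1 h2]; have [] := @closed_at_cont P Q a x => //.
  by apply: H => //; rewrite (le_trans cc h1) (le_trans h2 dd).
have PhiE a b c d : a0 <= a -> a <= b -> b <= b0 -> c0 <= c -> c <= d -> d <= d0 ->
  Phi a b c d = lint (P ^~ c) a b - lint (P ^~ d) a b + (lint (Q b) c d - lint (Q a) c d).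
  move=> h1 h2 h3 h4 h5 h6; rewrite /Phi !lintB//.
  - by apply: cQ => //; apply/andP; split; lra.
  - by apply: cQ => //; apply/andP; split; lra.
  - by apply: cP => //; apply/andP; split; lra.
  - by apply: cP => //; apply/andP; split; lra.
apply: (@bisection_zero _ Phi) => //.
  move=> a b c d h1 h2 h3 h4 h5 h6 m n.
  have m1 : a <= m by rewrite /m; lra.
  have m2 : m <= b by rewrite /m; lra.
  have n1 : c <= n by rewrite /n; lra.
  have n2 : n <= d by rewrite /n; lra.
  rewrite !PhiE; try (clear -h1 h2 h3 h4 h5 h6 m1 m2 n1 n2; lra).
  rewrite (lint_chasles m1 m2 (f := P ^~ c)); last by apply: cP => //; apply/andP; split; lra.
  rewrite (lint_chasles m1 m2 (f := P ^~ d)); last by apply: cP => //; apply/andP; split; lra.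
  rewrite (lint_chasles n1 n2 (f := Q b)); last by apply: cQ => //; apply/andP; split; lra.
  rewrite (lint_chasles n1 n2 (f := Q a)); last by apply: cQ => //; apply/andP; split; lra.
  ring.
move=> s t e sin tin e0; have [p [r [q HH]]] := H s t sin tin.
have e4 : 0 < e / 4 by rewrite divr_gt0.
have [dl dl0 Hdl] := HH _ e4; exists dl => // a b c d h1 h2 h3 h4 h5 h6 h7 h8 ba dc.
have ab : a <= b by lra.
have cd : c <= d by lra.
have B x y : a <= x <= b -> c <= y <= d ->
   `|P x y - P s t - p * (x - s) - r * (y - t)| <= e / 4 * ((b - a) + (d - c)) /\
   `|Q x y - Q s t - r * (x - s) - q * (y - t)| <= e / 4 * ((b - a) + (d - c)).
  move=> /andP[x1 x2] /andP[y1 y2].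
  have n1 : `|x - s| <= b - a by rewrite ler_norml; apply/andP; split; lra.
  have n2 : `|y - t| <= d - c by rewrite ler_norml; apply/andP; split; lra.
  have := Hdl (x - s) (y - t) (le_lt_trans n1 ba) (le_lt_trans n2 dc).
  rewrite (_ : s + (x - s) = x); last by ring.
  rewrite (_ : t + (y - t) = y); last by ring.
  move=> [A1 A2].
  by split; [apply: le_trans A1 _|apply: le_trans A2 _]; rewrite ler_pM2l// lerD.
set L := (b - a) + (d - c) in B *.
have I1 : `|lint (fun s => P s c - P s d) a b - (r * (c - d)) * (b - a)| <= (e / 2 * L) * (b - a).
  apply: lint_approx => //.
    by apply: lcontB; apply: cP => //; apply/andP; split; lra.
  have cc : c <= c <= d by rewrite lexx.
  have dd : c <= d <= d by rewrite lexx andbT.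
  move=> x xab; have [B1 _] := B x c xab cc; have [B2 _] := B x d xab dd.
  have := ler_normB (P x c - P s t - p * (x - s) - r * (c - t)) (P x d - P s t - p * (x - s) - r * (d - t)).
  rewrite (_ : _ - _ = P x c - P x d - r * (c - d)); last by ring.
  by move=> /le_trans; apply; move: B1 B2; clear; lra.
have I2 : `|lint (fun t => Q b t - Q a t) c d - (r * (b - a)) * (d - c)| <= (e / 2 * L) * (d - c).
  apply: lint_approx => //.
    by apply: lcontB; apply: cQ => //; apply/andP; split; lra.
  have aa : a <= a <= b by rewrite lexx.
  have bb : a <= b <= b by rewrite lexx andbT.
  move=> y ycd; have [_ B1] := B b y bb ycd; have [_ B2] := B a y aa ycd.
  have := ler_normB (Q b y - Q s t - r * (b - s) - q * (y - t)) (Q a y - Q s t - r * (a - s) - q * (y - t)).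
  rewrite (_ : _ - _ = Q b y - Q a y - r * (b - a)); last by ring.
  by move=> /le_trans; apply; move: B1 B2; clear; lra.
rewrite /Phi; move: I1 I2; set X := lint _ a b; set Y := lint _ c d => I1 I2.
(* The main terms of the two pairs of sides cancel because the same [r] occurs in both; only the
   error terms remain. *)
have -> : X + Y = (X - r * (c - d) * (b - a)) + (Y - r * (b - a) * (d - c)) by ring.
apply: le_trans (ler_normD _ _) _; apply: le_trans (lerD I1 I2) _.
have L0 : 0 <= L by rewrite /L; clear -ab cd; lra.
rewrite -mulrDr -/L expr2 mulrA ler_wpM2r// ler_wpM2r//; clear -e0; lra.
Qed.

End closed_form.

(** * Complex derivatives and means over circles *)

Section complex_derivative.
Context (R : realType).
Implicit Types (q : R[i] -> R[i]) (z w : R[i]).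

Definition cderiv_at q z l := forall e : R, 0 < e ->
  exists2 d : R, 0 < d & forall w, cabs w < d -> cabs (q (z + w) - q z - l * w) <= e * cabs w.

Lemma derivable_cderiv q z : derivable (q : R[i]^o -> R[i]^o) z 1 ->
  cderiv_at q z ('D_1 (q : R[i]^o -> R[i]^o) z).
Proof.
move=> dq e e0.
have eC : (0 : R[i]) < (e%:C)%C by rewrite ltcR.
have /cvgrPdist_lt/(_ _ eC) := dq.
move=> [d /= d0 H]; have dr : d = ((complex.Re d)%:C)%C.
  by case: d d0 {H} => x y; rewrite ltcE/= => /andP[/eqP -> _].
exists (re d); first by move: d0; rewrite dr ltcR.
move=> w wd; have [->|w0] := eqVneq w 0.
  by rewrite addr0 subrr mulr0 subr0 cabs0 mulr0.
have := H w; rewrite /= sub0r normrN cabsE dr ltcR => /(_ wd w0).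
rewrite /GRing.scale/= mulr1 cabsE ltcR => h.
have -> : q (z + w) - q z - 'D_1 (q : R[i]^o -> R[i]^o) z * w =
   - (('D_1 (q : R[i]^o -> R[i]^o) z - w^-1 * (q (w + z) - q z)) * w).
  by rewrite [w + z]addrC; field.
by rewrite cabsN cabsM ler_wpM2r ?cabs_ge0// ltW.
Qed.

Lemma cderiv_cont q z l : cderiv_at q z l -> forall e : R, 0 < e ->
  exists2 d : R, 0 < d & forall w, cabs w < d -> cabs (q (z + w) - q z) < e.
Proof.
move=> H e e0; have [d d0 Hd] := H _ ltr01.
have l1 : 0 < cabs l + 2 by rewrite ltr_wpDl// cabs_ge0.
exists (Num.min d (e / (cabs l + 2))); first by rewrite lt_min d0 divr_gt0.
move=> w; rewrite lt_min => /andP[/Hd h]; rewrite ltr_pdivlMr// => we.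
have -> : q (z + w) - q z = (q (z + w) - q z - l * w) + l * w by rewrite subrK.
apply: le_lt_trans (cabsD _ _) _; rewrite cabsM.
by have := cabs_ge0 w; have := cabs_ge0 l; move: h we; rewrite mul1r mulrDr; nra.
Qed.

Lemma cderiv_pcont q z l : cderiv_at q z l ->
  pcont (fun p => re (q (toC p))) (ofC z) /\ pcont (fun p => im (q (toC p))) (ofC z).
Proof.
move=> H; have H' := cderiv_cont H.
have sq (d : R) p : square (ofC z) (d / 2) p -> cabs (toC p - z) < d.
  move=> [h1 h2]; apply: le_lt_trans (cabs_le _) _; rewrite !cxE [ltRHS]splitr.
  by apply: ltrD.
split=> e e0; have [d d0 Hd] := H' _ e0; exists (d / 2); rewrite ?divr_gt0// => p /sq /Hd.
  rewrite (_ : z + (toC p - z) = toC p) ?ofCK => [h|]; last by rewrite addrC subrK.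
  apply: le_lt_trans h.
  by have := re_le_cabs (q (toC p) - q z); rewrite !cxE.
rewrite (_ : z + (toC p - z) = toC p) ?ofCK => [h|]; last by rewrite addrC subrK.
apply: le_lt_trans h.
by have := im_le_cabs (q (toC p) - q z); rewrite !cxE.
Qed.

Lemma derivable_eps (f : R -> R) (x l : R) : is_derive x 1 f l ->
  forall e, 0 < e -> exists2 d : R, 0 < d &
    forall h, `|h| < d -> `|f (x + h) - f x - l * h| <= e * `|h|.
Proof.
move=> [df lE] e e0; have /cvgrPdist_lt/(_ _ e0) := df.
move=> [d /= d0 H]; exists d => // h hd.
have [->|h0] := eqVneq h 0; first by rewrite addr0 subrr mulr0 subr0 normr0 mulr0.
have := H h; rewrite /= sub0r normrN => /(_ hd h0).
rewrite -/('D_1 f x) lE /GRing.scale/= mulr1 => k.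
have -> : f (x + h) - f x - l * h = - ((l - h^-1 * (f (h + x) - f x)) * h).
  by rewrite [h + x]addrC; field.
by rewrite normrN normrM ler_wpM2r// ltW.
Qed.

(** The exponential of [s + i t]. It maps the half-plane [s < 0] onto the punctured disc and
    vertical segments of length [2 pi] onto circles about 0, so that rectangles are enough for
    Goursat's argument. *)
Definition cexp (s t : R) : R[i] := Complex (expR s * cos t) (expR s * sin t).

Lemma cexpD s t h k : cexp (s + h) (t + k) = cexp s t * cexp h k.
Proof.
by apply: complex_ext; rewrite ?reM ?imM /= expRD ?cosD ?sinD; ring.
Qed.

Lemma cabs_cexp s t : cabs (cexp s t) = expR s.
Proof.
rewrite /cabs /n2 /= !exprMn -mulrDr cos2Dsin2 mulr1 sqrtr_sqr ger0_norm// expR_ge0.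
Qed.

Lemma cexp_deriv0 (e : R) : 0 < e -> exists2 d : R, 0 < d &
  forall h k, `|h| < d -> `|k| < d ->
    cabs (cexp h k - 1 - Complex h k) <= e * (`|h| + `|k|).
Proof.
move=> e0.
pose e1 := Num.min 1 (e / 16).
have e10 : 0 < e1 by rewrite lt_min ltr01 divr_gt0.
have e11 : e1 <= 1 by rewrite ge_min lexx.
have e12 : e1 <= e / 16 by rewrite ge_min lexx orbT.
clearbody e1.
have [d1 d10 H1] := derivable_eps (is_derive_expR (0 : R)) e10.
have [d2 d20 H2] := derivable_eps (is_derive_cos (0 : R)) e10.
have [d3 d30 H3] := derivable_eps (is_derive_sin (0 : R)) e10.
exists (Num.min (Num.min d1 d2) (Num.min d3 e1)).
  by rewrite !lt_min d10 d20 d30 e10.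
move=> h k; rewrite !lt_min => /andP[/andP[h1 h2] /andP[h3 h4]] /andP[/andP[k1 k2] /andP[k3 k4]].
have := H1 _ h1; rewrite add0r expR0 mul1r => E1.
have := H2 _ k2; rewrite add0r cos0 sin0 oppr0 mul0r subr0 => E2.
have := H3 _ k3; rewrite add0r cos0 sin0 subr0 mul1r => E3.
have ck : `|cos k| <= 1 by rewrite ler_norml cos_geN1 cos_le1.
apply: le_trans (cabs_le _) _; rewrite !cxE /= subr0.
have hh : `|h| <= 1 by apply: ltW; apply: lt_le_trans h4 e11.
have A : `|expR h * cos k - 1 - h| <= e1 * `|h| + 2 * (e1 * `|k|).
  have -> : expR h * cos k - 1 - h = (expR h - 1 - h) * cos k + (1 + h) * (cos k - 1) by ring.
  apply: le_trans (ler_normD _ _) _; rewrite !normrM; apply: lerD.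
    by rewrite -[leRHS]mulr1; apply: ler_pM.
  apply: ler_pM => //; apply: le_trans (ler_normD _ _) _; rewrite normr1; lra.
have B : `|expR h * sin k - k| <= 4 * (e1 * `|h|) + e1 * `|k|.
  have -> : expR h * sin k - k = (expR h - 1) * sin k + (sin k - k) by ring.
  apply: le_trans (ler_normD _ _) _; apply: lerD => //; rewrite normrM.
  have sk : `|sin k| <= 2 * e1.
    have -> : sin k = (sin k - k) + k by rewrite subrK.
    apply: le_trans (ler_normD _ _) _; have := normr_ge0 k; nra.
  have eh : `|expR h - 1| <= 2 * `|h|.
    have -> : expR h - 1 = (expR h - 1 - h) + h by rewrite subrK.
    apply: le_trans (ler_normD _ _) _; have := normr_ge0 h; nra.
  have -> : 4 * (e1 * `|h|) = (2 * `|h|) * (2 * e1) by ring.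
  exact: ler_pM.
apply: le_trans (lerD A B) _.
have u0 := normr_ge0 h; have v0 := normr_ge0 k.
have := ler_wpM2r u0 e12; have := ler_wpM2r v0 e12.
have := mulr_ge0 (ltW e0) u0; have := mulr_ge0 (ltW e0) v0.
move: (`|h|) (`|k|) => u v; clear; lra.
Qed.

Definition chol q := forall z, disc z -> exists l, cderiv_at q z l.

Lemma holomorphic_chol q : holomorphic_on_disc q -> chol q.
Proof. by move=> hq z /hq /derivable_cderiv; exists ('D_1 (q : R[i]^o -> R[i]^o) z). Qed.

Lemma cexp_disc s t : s < 0 -> disc (cexp s t).
Proof. by move=> s0; apply/disc_cabs; rewrite cabs_cexp expR_lt1. Qed.

Lemma chol_cexp q s t : chol q -> s < 0 -> exists b : R[i], forall e : R, 0 < e ->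
  exists2 d : R, 0 < d & forall h k, `|h| < d -> `|k| < d ->
   cabs (q (cexp (s + h) (t + k)) - q (cexp s t) - b * Complex h k) <= e * (`|h| + `|k|).
Proof.
move=> hq s0; set z := cexp s t; have [l H] := hq _ (cexp_disc t s0).
exists (l * z) => e e0.
have z1 : cabs z <= 1 by apply/ltW/disc_cabs/cexp_disc.
have l0 := cabs_ge0 l; have z0 := cabs_ge0 z.
pose e1 := e / 4.
have e10 : 0 < e1 by rewrite divr_gt0.
have [d d0 Hd] := H _ e10.
pose e2 := Num.min 1 (e / 4 / (cabs l + 1)).
have l1 : 0 < cabs l + 1 by rewrite ltr_wpDl.
have e20 : 0 < e2 by rewrite lt_min ltr01 !divr_gt0.
have e21 : e2 <= 1 by rewrite ge_min lexx.
have e22 : e2 * (cabs l + 1) <= e / 4 by rewrite -ler_pdivlMr// ge_min lexx orbT.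
clearbody e2.
have [d' d'0 Hd'] := cexp_deriv0 e20.
exists (Num.min d' (d / 8)); first by rewrite lt_min d'0 divr_gt0.
move=> h k; rewrite !lt_min => /andP[h1 h2] /andP[k1 k2].
have E := Hd' _ _ h1 k1; set r := cexp h k - 1 - Complex h k in E.
have hk : cabs (Complex h k) <= `|h| + `|k| by exact: cabs_le.
pose w := z * (cexp h k - 1).
have ch : cabs (cexp h k - 1) <= 2 * (`|h| + `|k|).
  have -> : cexp h k - 1 = r + Complex h k by rewrite /r subrK.
  apply: le_trans (cabsD _ _) _; have := normr_ge0 h; have := normr_ge0 k; nra.
have wE : cabs w <= 2 * (`|h| + `|k|).
  by rewrite /w cabsM; apply: le_trans ch; rewrite ler_piMl// cabs_ge0.
have wd : cabs w < d by apply: le_lt_trans wE _; lra.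
have -> : cexp (s + h) (t + k) = z + w by rewrite cexpD /w /z; ring.
have -> : q (z + w) - q z - l * z * Complex h k = (q (z + w) - q z - l * w) + l * z * r.
  by rewrite /w /r; ring.
apply: le_trans (cabsD _ _) _; apply: (@le_trans _ _ (e1 * cabs w + cabs l * (e2 * (`|h| + `|k|)))).
  apply: lerD; first exact: Hd.
  by rewrite !cabsM -mulrA ler_wpM2l//; apply: le_trans E; rewrite ler_piMl// cabs_ge0.
have n0 : 0 <= `|h| + `|k| by rewrite addr_ge0.
apply: (@le_trans _ _ (e1 * (2 * (`|h| + `|k|)) + (e / 4) * (`|h| + `|k|))).
  apply: lerD; first by rewrite ler_pM2l.
  rewrite mulrA ler_wpM2r//; apply: le_trans e22; rewrite mulrC ler_pM2l//; lra.
by rewrite /e1; nra.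
Qed.

(** With [w = s + i t], the two 1-forms are the imaginary part and minus the real part of
    [q (exp w) dw], and holomorphy of [q (exp w)] makes them closed. *)
Lemma chol_closed q s t : chol q -> s < 0 ->
  closed_at (fun s t => im (q (cexp s t))) (fun s t => re (q (cexp s t))) s t /\
  closed_at (fun s t => - re (q (cexp s t))) (fun s t => im (q (cexp s t))) s t.
Proof.
move=> hq s0; have [b Hb] := chol_cexp t hq s0; split.
  exists (im b), (re b), (- im b) => e e0; have [d d0 Hd] := Hb _ e0; exists d => // h k hd kd.
  have := Hd _ _ hd kd; set X := _ - b * _ => HX.
  have := le_trans (re_le_cabs X) HX; have := le_trans (im_le_cabs X) HX.
  rewrite /X !cxE /= => h1 h2; split.
    by rewrite (_ : _ - _ = im (q (cexp (s + h) (t + k))) - im (q (cexp s t)) - (re b * k + im b * h))//; ring.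
  by rewrite (_ : _ - _ = re (q (cexp (s + h) (t + k))) - re (q (cexp s t)) - (re b * h - im b * k))//; ring.
exists (- re b), (im b), (re b) => e e0; have [d d0 Hd] := Hb _ e0; exists d => // h k hd kd.
have := Hd _ _ hd kd; set X := _ - b * _ => HX.
have := le_trans (re_le_cabs X) HX; have := le_trans (im_le_cabs X) HX.
rewrite /X !cxE /= => h1 h2; split.
  have -> : - re (q (cexp (s + h) (t + k))) - - re (q (cexp s t)) - - re b * h - im b * k =
    - (re (q (cexp (s + h) (t + k))) - re (q (cexp s t)) - (re b * h - im b * k)) by ring.
  by rewrite normrN.
by rewrite (_ : _ - _ = im (q (cexp (s + h) (t + k))) - im (q (cexp s t)) - (re b * k + im b * h))//; ring.
Qed.

Lemma cexp_2pi s : cexp s (2 * pi) = cexp s 0.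
Proof. by rewrite /cexp mulr_natl cos2pi sin2pi cos0 sin0. Qed.

(** Around the rectangle [[s0, s1] x [0, 2 pi]] the horizontal sides cancel by periodicity, so the
    integrals over the two circles agree. *)
Lemma circle_const (P Q : R -> R -> R) (s0 s1 : R) : s0 < s1 -> s1 < 0 ->
  (forall s t, s < 0 -> closed_at P Q s t) -> (forall s, P s (2 * pi) = P s 0) ->
  lint (Q s1) 0 (2 * pi) = lint (Q s0) 0 (2 * pi).
Proof.
move=> s01 s10 cPQ per; have pi0 : 0 <= 2 * pi :> R by rewrite mulr_ge0// pi_ge0.
have : lint (fun s => P s 0 - P s (2 * pi)) s0 s1 +
    lint (fun t => Q s1 t - Q s0 t) 0 (2 * pi) = 0.
  apply: closed_form_rect (ltW s01) pi0 _ => s t /andP[_ sl] _.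
  by apply: cPQ; exact: le_lt_trans sl s10.
have -> : (fun s => P s 0 - P s (2 * pi)) = (fun=> 0) by apply/funext => s; rewrite per subrr.
rewrite lint_cst ?(ltW s01)// mul0r add0r lintB.
- by move/eqP; rewrite subr_eq0 => /eqP.
- by move=> t _; have [] := closed_at_cont (cPQ s1 t s10).
- by move=> t _; have [] := closed_at_cont (cPQ s0 t (lt_trans s01 s10)).
Qed.

(** The integral does not depend on the circle, and as [s] tends to minus infinity the circle
    shrinks to the centre, where [Q] tends uniformly to [c]. *)
Lemma circle_mean_aux (P Q : R -> R -> R) (c s1 : R) : s1 < 0 ->
  (forall s t, s < 0 -> closed_at P Q s t) -> (forall s, P s (2 * pi) = P s 0) ->
  (forall e, 0 < e -> exists s0, forall s t, s < s0 -> `|Q s t - c| <= e) ->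
  lint (Q s1) 0 (2 * pi) = c * (2 * pi).
Proof.
move=> s10 cPQ per lim; have pi0 : 0 < 2 * pi :> R by rewrite mulr_gt0// pi_gt0.
apply/eqP; rewrite -subr_eq0 -normr_le0; apply/ler_addgt0Pl => e e0; rewrite addr0.
have e1 : 0 < e / (2 * pi) by rewrite divr_gt0.
have [s0 H] := lim _ e1; pose s := Num.min s0 s1 - 1.
have ss0 : s < s0 by rewrite /s ltrBlDr; apply: le_lt_trans (_ : s0 < _); rewrite ?ge_min ?lexx// ltrDl.
have ss1 : s < s1 by rewrite /s ltrBlDr; apply: le_lt_trans (_ : s1 < _); rewrite ?ge_min ?lexx ?orbT// ltrDl.
rewrite (circle_const ss1 s10 cPQ per).
have := @lint_approx _ (Q s) 0 (2 * pi) c (e / (2 * pi)) (ltW pi0).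
rewrite subr0 divfK ?gt_eqF//; apply; last by move=> t _; exact: H.
by move=> t _; have [] := closed_at_cont (cPQ s t (lt_trans ss1 s10)).
Qed.

Lemma circle_mean q s : chol q -> s < 0 ->
  lint (fun t => re (q (cexp s t))) 0 (2 * pi) = re (q 0) * (2 * pi) /\
  lint (fun t => im (q (cexp s t))) 0 (2 * pi) = im (q 0) * (2 * pi).
Proof.
move=> hq s0; have d0 : disc (0 : R[i]) by apply/disc_cabs; rewrite cabs0.
have lim e : 0 < e -> exists s0 : R, forall s t, s < s0 -> cabs (q (cexp s t) - q 0) <= e.
  move=> e0; have [l /cderiv_cont/(_ _ e0)[d dd H]] := hq _ d0.
  exists (ln d) => s' t sd; have := H (cexp s' t); rewrite add0r cabs_cexp => /(_ _)/ltW; apply.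
  by rewrite -[ltRHS]lnK ?posrE// ltr_expR.
split.
  apply: (@circle_mean_aux (fun s t => im (q (cexp s t))) (fun s t => re (q (cexp s t))) (re (q 0)) s s0).
  - by move=> s' t /(chol_closed t hq)[].
  - by move=> s'; rewrite cexp_2pi.
  - move=> e /lim[s1 H]; exists s1 => s' t st; apply: le_trans (H _ t st).
    by have := re_le_cabs (q (cexp s' t) - q 0); rewrite !cxE.
apply: (@circle_mean_aux (fun s t => - re (q (cexp s t))) (fun s t => im (q (cexp s t))) (im (q 0)) s s0).
- by move=> s' t /(chol_closed t hq)[].
- by move=> s'; rewrite cexp_2pi.
- move=> e /lim[s1 H]; exists s1 => s' t st; apply: le_trans (H _ t st).
  by have := im_le_cabs (q (cexp s' t) - q 0); rewrite !cxE.
Qed.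

End complex_derivative.

(** * Means over discs with a radial weight *)

Section radial_mean.
Context (R : realType).
Local Notation leb := (@lebesgue_measure R).
Implicit Types (f : R * R -> R) (w : R -> R).

Definition rot (t : R) (p : R * R) : R * R :=
  (cos t * p.1 - sin t * p.2, cos t * p.2 + sin t * p.1).

Lemma rotE t p : rot t p = ofC (cexp 0 t * toC p).
Proof. by rewrite /rot /ofC reM imM /= expR0 !mul1r. Qed.

Lemma nsq_rot t p : nsq (rot t p) = nsq p.
Proof.
rewrite /nsq /rot /=; transitivity ((cos t ^+ 2 + sin t ^+ 2) * (p.1 ^+ 2 + p.2 ^+ 2)); first by ring.
by rewrite cos2Dsin2 mul1r.
Qed.

(** A diagonal element with unit entry [a] acts by [a / a^* = a^2], hence the half angle. Rotations
    thereby inherit the invariance of [hmu]. *)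
Lemma rot_mz t p : rot t p = mz (su (cexp 0 (t / 2)) 0) p.
Proof.
set a := cexp 0 (t / 2).
have a1 : n2 a = 1 by rewrite -sqr_cabs cabs_cexp expR0 expr1n.
have aJ : a * Num.conj a = 1 by rewrite mulJ a1.
have a0 : Num.conj a != 0 by rewrite -n2_eq0 n2J a1 oner_eq0.
rewrite rotE /mz moebiusE /den !suE conjC0 mul0r add0r addr0; congr ofC.
apply: (mulIf a0); rewrite divfK//.
have -> : cexp 0 t = a * a by rewrite -cexpD addr0 -splitr.
rewrite (_ : a * a * toC p * Num.conj a = a * (a * Num.conj a) * toC p); last by ring.
by rewrite aJ mulr1.
Qed.

Lemma su11_rot t : su11 (su (cexp 0 (t / 2)) (0 : R[i])).
Proof.
apply/su11P; exists (cexp 0 (t / 2)), 0; split => //.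
by rewrite -sqr_cabs cabs_cexp expR0 expr1n n2_0 subr0.
Qed.

Definition circle_mean_prop f := forall p, DD p ->
  lcont (fun t => f (rot t p)) 0 (2 * pi) /\
  lint (fun t => f (rot t p)) 0 (2 * pi) = f (0, 0) * (2 * pi).

Lemma measurable_rot : measurable_fun setT (fun x : R * (R * R) => rot x.1 x.2).
Proof.
have mc : measurable_fun setT (fun x : R * (R * R) => cos x.1).
  by apply: measurableT_comp => //; apply: continuous_measurable_fun; exact: continuous_cos.
have ms : measurable_fun setT (fun x : R * (R * R) => sin x.1).
  by apply: measurableT_comp => //; apply: continuous_measurable_fun; exact: continuous_sin.
have m1 : measurable_fun setT (fun x : R * (R * R) => x.2.1) by exact: measurableT_comp.
have m2 : measurable_fun setT (fun x : R * (R * R) => x.2.2) by exact: measurableT_comp.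
by rewrite /rot; mreal.
Qed.

(** The integrand is averaged over all rotations. Invariance of [hmu] under rotations gives [2 pi]
    times the left-hand side, the circle means give [2 pi] times the right-hand side, and Tonelli's
    theorem exchanges the two integrations. *)
Lemma radial_mean_ge0 f w (t : R) : t <= 1 ->
  (forall p, nball t p -> 0 <= f p) -> (forall x, 0 <= w x) ->
  measurable_fun (nball t) f -> measurable_fun setT w -> circle_mean_prop f -> 0 <= f (0, 0) ->
  (\int[@hmu R]_(p in nball t) (f p * w (nsq p))%:E =
   (f (0, 0))%:E * \int[@hmu R]_(p in nball t) (w (nsq p))%:E)%E.
Proof.
move=> t1 f0 w0 mf mw cm f00.
have mb := measurable_nball t.
pose G := ((fun p => (f p * w (nsq p))%:E) \_ (nball t))%E.
have mG : measurable_fun setT G.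
  apply/(measurable_restrictT _ _).1 => //; apply/measurable_EFinP.
  apply: measurable_funM => //; apply: measurable_funTS.
  by apply: measurableT_comp => //; exact: measurable_nsq.
have G0 p : (0 <= G p)%E.
  by rewrite /G patchE; case: ifPn => // /set_mem pt; rewrite lee_fin mulr_ge0// f0.
have rotI (s : R) : (\int[@hmu R]_p G (rot s p) = \int[@hmu R]_p G p)%E.
  rewrite -[RHS](ge0_integral_mz (su11_rot s))//.
  by apply: eq_integral => p _; rewrite rot_mz.
have mI : measurable (`[0, 2 * pi]%classic : set R) by exact: measurable_itv.
pose ind (s : R) : \bar R := (\1_(`[0, 2 * pi]%classic) s)%:E.
have mind : measurable_fun setT ind by apply/measurable_EFinP; exact: measurable_indic.
pose K (x : R * (R * R)) := (ind x.1 * G (rot x.1 x.2))%E.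
have mK : measurable_fun setT K.
  apply: emeasurable_funM; first exact: measurableT_comp.
  by apply: (measurableT_comp mG); exact: measurable_rot.
have K0 x : (0 <= K x)%E by rewrite mule_ge0// lee_fin.
have pi0 : 0 < 2 * pi :> R by rewrite mulr_gt0// pi_gt0.
have iind : (\int[leb]_s ind s = (2 * pi)%:E)%E.
  transitivity (leb (`[0, 2 * pi]%classic : set R)); first by rewrite /ind integral_indic// setIT.
  by rewrite lebesgue_measure_itv/= lte_fin pi0 oppr0 adde0.
have lhs : (\int[leb]_s \int[@hmu R]_p K (s, p) = (2 * pi)%:E * \int[@hmu R]_p G p)%E.
  under eq_integral => s _.
    rewrite (_ : (fun p => _) = (fun p => ind s * G (rot s p))%E)//.
    rewrite ge0_integralZl//; last 2 first.
    - apply: (measurableT_comp mG).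
      rewrite (_ : rot s = mz (su (cexp 0 (s / 2)) 0)); first exact: measurable_mz.
      by apply/funext => p; exact: rot_mz.
    - by rewrite lee_fin.
    rewrite rotI.
    over.
  rewrite ge0_integralZr//; first by rewrite iind.
  - by move=> s _; rewrite lee_fin.
  - exact: integral_ge0.
have rhs : (\int[@hmu R]_p \int[leb]_s K (s, p) =
    (f (0, 0) * (2 * pi))%:E * \int[@hmu R]_p (((fun p => (w (nsq p))%:E) \_ (nball t)) p))%E.
  rewrite -ge0_integralZl//; last 3 first.
  - apply/(measurable_restrictT _ _).1 => //; apply/measurable_EFinP.
    by apply: measurable_funTS; apply: measurableT_comp => //; exact: measurable_nsq.
  - by move=> p _; rewrite patchE; case: ifP => // _; rewrite lee_fin.
  - by rewrite lee_fin mulr_ge0// ltW.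
  apply: eq_integral => p _; rewrite /K/=.
  have inb s : (rot s p \in nball t) = (p \in nball t).
    by apply/idP/idP; rewrite !inE /nball/= nsq_rot.
  rewrite patchE; case: ifPn => pt; last first.
    rewrite mule0 integral0_eq// => s _.
    by rewrite /G patchE inb (negbTE pt) mule0.
  have Dp : DD p by apply: nball_DD t1 _; exact: set_mem.
  have [cf If] := cm _ Dp.
  have ci := lcont_integrable cf.
  transitivity (\int[leb]_(s in `[0%R, (2 * pi)%R]) ((w (nsq p))%:E * (f (rot s p))%:E))%E.
    rewrite [RHS]integral_mkcond; apply: eq_integral => s _.
    rewrite /ind /G patchE inb pt nsq_rot patchE indicE.
    by case: ifPn => _; rewrite ?mul1e ?mul0e // mulrC EFinM.
  rewrite integralZl// EFinM -EFinM -If /lint /Rintegral fineK; first by rewrite muleC.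
  exact: integrable_fin_num.
have sw : (\int[leb]_s \int[@hmu R]_p K (s, p) = \int[@hmu R]_p \int[leb]_s K (s, p))%E.
  exact: (@fubini_tonelli _ _ _ _ _ leb (@hmu R) _ mK K0).
move: sw; rewrite lhs rhs -!integral_mkcond => /(congr1 (fun x => ((2 * pi)^-1%:E * x)%E)).
rewrite !muleA -!EFinM mulVf ?gt_eqF// mul1e => ->.
by rewrite mulrCA mulVf ?gt_eqF// mulr1.
Qed.

Lemma bounded_integrable d (T : measurableType d) (m : {measure set T -> \bar R})
    (A : set T) (f : T -> R) (M : R) :
  measurable A -> (m A < +oo)%E -> measurable_fun A f -> (forall x, A x -> `|f x| <= M) ->
  m.-integrable A (EFin \o f).
Proof.
move=> mA Aoo mf fM; apply/integrableP; split; first exact/measurable_EFinP.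
have M0 : (0 <= (Num.max 0 M)%:E)%E by rewrite lee_fin le_max lexx.
apply: le_lt_trans (integral_le_bound (Num.max 0 M)%:E mA _ M0 _) _.
- exact/measurable_EFinP.
- by apply: aeW => x Ax; rewrite abse_EFin lee_fin le_max fM ?orbT.
- by rewrite lte_mul_pinfty.
Qed.

(** The nonnegative case is applied to [f + M], with [M] a bound of [|f|] on the disc; the
    contribution of the constant is then subtracted. *)
Lemma radial_mean f w (t B : R) : 0 < t -> t < 1 ->
  (forall p, DD p -> pcont f p) -> circle_mean_prop f ->
  measurable_fun setT w -> (forall x, 0 <= w x) -> (forall x, x < t -> w x <= B) ->
  (@hmu R).-integrable (nball t) (EFin \o (fun p => f p * w (nsq p))) /\
  (\int[@hmu R]_(p in nball t) (f p * w (nsq p)) =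
   f (0%R, 0%R) * \int[@hmu R]_(p in nball t) w (nsq p))%R.
Proof.
move=> t0 t1 cf cm mw w0 wB.
have mb := measurable_nball t; have fb := hmu_nball_lty t1.
have [M M0 fM] := nball_bounded t1 cf.
have mf : measurable_fun (nball t) f.
  apply: (measurable_funS (E := @DD R)) => //; first exact: measurable_DD.
    by move=> p; exact: nball_DD (ltW t1).
  by apply: measurable_pcont => // p; exact: DD_square.
have mwn : measurable_fun (nball t) (fun p => w (nsq p)).
  by apply: measurable_funTS; apply: measurableT_comp => //; exact: measurable_nsq.
have iw : (@hmu R).-integrable (nball t) (EFin \o (fun p => w (nsq p))).
  by apply: (@bounded_integrable _ _ _ _ _ B) => // p pt; rewrite ger0_norm// wB.
have B0 : 0 <= B by apply: le_trans (w0 0) (wB _ t0).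
have ifw : (@hmu R).-integrable (nball t) (EFin \o (fun p => f p * w (nsq p))).
  apply: (@bounded_integrable _ _ _ _ _ (M * B)) => //; first exact: measurable_funM.
  move=> p pt; rewrite normrM; apply: ler_pM => //; first by apply: fM; exact: ltW.
  by rewrite ger0_norm// wB.
split => //.
have f00 : `|f (0, 0)| <= M by apply: fM; rewrite /nsq/= expr0n/= addr0 ltW.
have cmM : circle_mean_prop (fun p => f p + M).
  move=> p Dp; have [c1 c2] := cm _ Dp; split.
    by move=> x xab; apply: cvgD; [exact: c1|exact: cvg_cst].
  rewrite lintD//; last exact: lcont_cst.
  have pi0 : 0 <= 2 * pi :> R by rewrite mulr_ge0// pi_ge0.
  rewrite c2 (lint_cst M pi0) subr0; ring.
have := radial_mean_ge0 (f := fun p => f p + M) (w := w) (ltW t1).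
move=> /(_ _ w0 _ mw cmM _) H.
have {}H : (\int[@hmu R]_(p in nball t) ((f p + M) * w (nsq p)) =
   (f (0%R, 0%R) + M) * \int[@hmu R]_(p in nball t) w (nsq p))%R.
  rewrite /Rintegral H.
  - rewrite fineM//; exact: integrable_fin_num.
  - by move=> p pt; have := fM p (ltW pt); rewrite ler_norml => /andP[]; lra.
  - exact: measurable_funD.
  - by move: f00; rewrite ler_norml => /andP[]; lra.
have : (\int[@hmu R]_(p in nball t) ((f p + M) * w (nsq p)) =
   \int[@hmu R]_(p in nball t) (f p * w (nsq p)) + M * \int[@hmu R]_(p in nball t) w (nsq p))%R.
  have iMw : (@hmu R).-integrable (nball t) (EFin \o (fun p => M * w (nsq p))).
    apply: (@bounded_integrable _ _ _ _ _ (M * B)) => //; first exact: measurable_funM.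
    by move=> p pt; rewrite normrM !ger0_norm// ler_wpM2l// wB.
  rewrite -RintegralZl// -RintegralD//.
  by apply: eq_Rintegral => p _; rewrite mulrDl.
by rewrite H mulrDl => /addIr.
Qed.

Lemma circle_mean_prop_chol (q : R[i] -> R[i]) : chol q ->
  circle_mean_prop (fun p => re (q (toC p))) /\ circle_mean_prop (fun p => im (q (toC p))).
Proof.
move=> hq.
have tc0 : toC (0, 0) = 0 :> R[i] by [].
suff H p : DD p ->
  (lcont (fun t => re (q (toC (rot t p)))) 0 (2 * pi) /\
  lint (fun t => re (q (toC (rot t p)))) 0 (2 * pi) = re (q (toC (0, 0))) * (2 * pi)) /\
  (lcont (fun t => im (q (toC (rot t p)))) 0 (2 * pi) /\
  lint (fun t => im (q (toC (rot t p)))) 0 (2 * pi) = im (q (toC (0, 0))) * (2 * pi)).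
  by split=> p /H[].
move=> Dp; have pi0 : 0 <= 2 * pi :> R by rewrite mulr_ge0// pi_ge0.
have [p0|p0] := eqVneq (toC p) 0.
  have e t : toC (rot t p) = 0 by rewrite rotE ofCK p0 mulr0.
  under eq_fun do rewrite e.
  under [X in _ /\ (lcont X _ _ /\ lint X _ _ = _)]eq_fun do rewrite e.
  by rewrite !lint_cst// subr0 tc0; split; split=> //; exact: lcont_cst.
have r0 : 0 < cabs (toC p) by rewrite lt_neqAle eq_sym cabs_eq0 p0 cabs_ge0.
have r1 : cabs (toC p) < 1 by apply/disc_cabs/DDE.
pose s := ln (cabs (toC p)).
have es : expR s = cabs (toC p) by rewrite lnK.
have s0 : s < 0 by rewrite -expR_lt1 es.
(* Rotating by the argument of [p] makes its orbit the circle through [exp s], and [q (u * z)] is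
   again holomorphic with the same value at 0. *)
pose u := toC p / ((cabs (toC p))%:C)%C.
have rC : ((cabs (toC p))%:C)%C != 0 by rewrite -n2_eq0 n2C sqrf_eq0 gt_eqF.
have u1 : cabs u = 1 by rewrite /u cabsM cabsV cabsC gtr0_norm// mulfV// gt_eqF.
have e t : toC (rot t p) = u * cexp s t.
  rewrite rotE ofCK (_ : cexp s t = ((cabs (toC p))%:C)%C * cexp 0 t); last first.
    by apply: complex_ext; rewrite ?reM ?imM /= expR0 es; ring.
  by rewrite mulrA divfK// mulrC.
have hq1 : chol (fun z => q (u * z)).
  move=> z /disc_cabs z1; have [|l Hl] := hq (u * z).
    by apply/disc_cabs; rewrite cabsM u1 mul1r.
  exists (l * u) => e' e0; have [d d0 Hd] := Hl _ e0; exists d => // w wd.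
  have := Hd (u * w); rewrite cabsM u1 mul1r => /(_ wd).
  by rewrite mulrDr mulrA.
have [m1 m2] := circle_mean hq1 s0; rewrite mulr0 in m1 m2.
under eq_fun do rewrite e.
under [X in _ /\ (lcont X _ _ /\ lint X _ _ = _)]eq_fun do rewrite e.
split; split => // t _; last first.
  by have [_ [_ _ _ c]] := conj I (closed_at_cont (chol_closed t hq1 s0).2).
by have [_ [_ _ _ c]] := conj I (closed_at_cont (chol_closed t hq1 s0).1).
Qed.

End radial_mean.

(** * Hyperbolic distance and Fuchsian groups *)

Section hyperbolic_distance.
Context (R : realType).
Implicit Types (z w x : R[i]) (A B : 'M[R[i]]_2).

Definition pd z w : R := Num.sqrt (ph2 z w).

Lemma pd_ge0 z w : 0 <= pd z w. Proof. exact: sqrtr_ge0. Qed.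
Lemma pd_lt1 z w : disc z -> disc w -> pd z w < 1.
Proof. by move=> z1 w1; rewrite -sqrtr1 ltr_sqrt// ph2_lt1. Qed.
Lemma sqr_pd z w : pd z w ^+ 2 = ph2 z w. Proof. by rewrite sqr_sqrtr// ph2_ge0. Qed.
Lemma pdC z w : pd z w = pd w z. Proof. by rewrite /pd ph2C. Qed.
Lemma pd_moebius A z w : su11 A -> disc z -> disc w ->
  pd (moebius A z) (moebius A w) = pd z w.
Proof. by move=> *; rewrite /pd ph2_moebius. Qed.
Lemma pd0l w : pd 0 w = cabs w. Proof. by rewrite /pd ph2_0l. Qed.
Lemma pd_eq0 z w : disc z -> disc w -> pd z w = 0 -> z = w.
Proof.
move=> z1 w1 /eqP; rewrite sqrtr_eq0 => h.
have : ph2 z w == 0 by rewrite eq_le h ph2_ge0.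
by rewrite /ph2 mulf_eq0 invr_eq0 (gt_eqF (ph_den_gt0 z1 w1)) orbF n2_eq0 subr_eq0 => /eqP.
Qed.

Lemma hdistE z w : hdist z w = ln ((1 + pd z w) / (1 - pd z w)).
Proof.
rewrite /hdist /pd /ph2 !cabsE.
have -> : re (((cabs (z - w))%:C)%C / ((cabs (1 - Num.conj w * z))%:C)%C) =
    Num.sqrt (n2 (z - w) / n2 (1 - Num.conj w * z)); last by [].
by rewrite -fmorphV -rmorphM/= sqrtrM ?n2_ge0// sqrtrV ?n2_ge0.
Qed.

(** [tanh (r / 2)], the Euclidean radius of the hyperbolic disc of radius [r] about the origin. *)
Definition th (r : R) : R := (expR r - 1) / (expR r + 1).

Lemma th_den (r : R) : 0 < expR r + 1. Proof. by rewrite addr_gt0// expR_gt0. Qed.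
Lemma th_lt1 r : th r < 1.
Proof. by rewrite ltr_pdivrMr ?th_den// mul1r; lra. Qed.
Lemma th_gt0 r : 0 < r -> 0 < th r.
Proof. by move=> r0; rewrite divr_gt0 ?th_den// subr_gt0 expR_gt1. Qed.
Lemma th_ge0 r : 0 <= r -> 0 <= th r.
Proof. by rewrite le_eqVlt => /orP[/eqP<-|/th_gt0/ltW//]; rewrite /th expR0 subrr mul0r. Qed.

Lemma pd_quot_gt0 z w : disc z -> disc w -> 0 < (1 + pd z w) / (1 - pd z w).
Proof.
move=> z1 w1; have := pd_lt1 z1 w1; have := pd_ge0 z w => h0 h1.
by rewrite divr_gt0 ?subr_gt0// ltr_pwDl.
Qed.

Lemma expR_hdist z w : disc z -> disc w -> expR (hdist z w) = (1 + pd z w) / (1 - pd z w).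
Proof. by move=> z1 w1; rewrite hdistE lnK// posrE pd_quot_gt0. Qed.

Lemma hdist_lt z w r : disc z -> disc w -> (hdist z w < r) = (pd z w < th r).
Proof.
move=> z1 w1; rewrite -ltr_expR expR_hdist// /th.
have := pd_lt1 z1 w1; have := th_den r => h0 h1.
rewrite ltr_pdivrMr ?subr_gt0// ltr_pdivlMr//.
by apply/idP/idP; move: h0 h1; nra.
Qed.

Lemma th_hdist z w : disc z -> disc w -> th (hdist z w) = pd z w.
Proof.
move=> z1 w1; rewrite /th expR_hdist//; have := pd_lt1 z1 w1 => h1.
have h0 : 1 - pd z w != 0 by rewrite gt_eqF// subr_gt0.
have h2 : (1 + pd z w) / (1 - pd z w) + 1 != 0.
  by rewrite gt_eqF// addr_gt0// pd_quot_gt0.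
rewrite (_ : (1 + pd z w) / (1 - pd z w) + 1 = 2 / (1 - pd z w)); last by field.
rewrite (_ : (1 + pd z w) / (1 - pd z w) - 1 = 2 * pd z w / (1 - pd z w)); last by field.
by field; rewrite h0.
Qed.

Lemma hdist_le z w r : disc z -> disc w -> (hdist z w <= r) = (pd z w <= th r).
Proof.
move=> z1 w1; rewrite -ler_expR expR_hdist// /th.
have := pd_lt1 z1 w1; have := th_den r => h0 h1.
rewrite ler_pdivrMr ?subr_gt0// ler_pdivlMr//.
by apply/idP/idP; move: h0 h1; nra.
Qed.

Lemma hdist_ge0 z w : disc z -> disc w -> 0 <= hdist z w.
Proof.
move=> z1 w1; rewrite leNgt hdist_lt// /th expR0 subrr mul0r -leNgt.
exact: pd_ge0.
Qed.

Lemma hdistC z w : hdist z w = hdist w z.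
Proof. by rewrite !hdistE pdC. Qed.

Lemma hdist_moebius A z w : su11 A -> disc z -> disc w ->
  hdist (moebius A z) (moebius A w) = hdist z w.
Proof. by move=> *; rewrite !hdistE pd_moebius. Qed.

Lemma hdist_eq0 z w : disc z -> disc w -> hdist z w = 0 -> z = w.
Proof.
move=> z1 w1 h; apply: pd_eq0 => //.
by rewrite -th_hdist// h /th expR0 subrr mul0r.
Qed.

Lemma hdistxx z : disc z -> hdist z z = 0.
Proof. by move=> z1; rewrite hdistE /pd /ph2 subrr n2_0 mul0r sqrtr0 subr0 addr0 divr1 ln1. Qed.

Lemma disc0 : disc (0 : R[i]). Proof. by apply/discE; rewrite n2_0. Qed.

(** The element of SU(1,1) carrying [0] to [z]. *)
Definition trans z : 'M[R[i]]_2 :=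
  let c := (((Num.sqrt (1 - n2 z))^-1)%:C)%C in su c (z * c).

Lemma trans_su11 z : disc z -> su11 (trans z).
Proof.
move=> /discE z1; apply/su11P; rewrite /trans; set c := (_%:C)%C.
exists c, (z * c); split => //.
have z0 : 0 < 1 - n2 z by rewrite subr_gt0.
rewrite n2M n2C exprVn sqr_sqrtr ?(ltW z0)//.
by rewrite -[X in X - _]mul1r -mulrBl mulfV// gt_eqF.
Qed.

Lemma trans0 z : disc z -> moebius (trans z) 0 = z.
Proof.
move=> /discE z1; rewrite moebiusE /den /trans !suE !mulr0 !add0r.
have c0 : (((Num.sqrt (1 - n2 z))^-1)%:C)%C != 0 :> R[i].
  by rewrite -n2_eq0 n2C sqrf_eq0 invr_eq0 gt_eqF// sqrtr_gt0 subr_gt0.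
have -> : Num.conj (((Num.sqrt (1 - n2 z))^-1)%:C)%C = (((Num.sqrt (1 - n2 z))^-1)%:C)%C.
  by apply: complex_ext; rewrite !cxE ?oppr0.
by rewrite mulfK.
Qed.

(** In the formula for [1 - ph2] the denominator is at most [(1 + |z| |w|)^2]. The right-hand side
    is the addition formula of [tanh], which turns the bound into the triangle inequality through
    the origin. *)
Lemma pd_triangle0 z w : disc z -> disc w ->
  pd z w <= (cabs z + cabs w) / (1 + cabs z * cabs w).
Proof.
move=> z1 w1; have zc := cabs_ge0 z; have wc := cabs_ge0 w.
have p0 : 0 < 1 + cabs z * cabs w by rewrite ltr_pwDl// mulr_ge0.
rewrite -(ler_pXn2r (ltn0Sn 1)) ?nnegrE ?pd_ge0//; last first.
  by apply: divr_ge0; [exact: addr_ge0|exact: ltW].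
rewrite sqr_pd -[leLHS](subKr 1) one_ph2//.
have d0 := ph_den_gt0 z1 w1.
have le1 : n2 (1 - Num.conj w * z) <= (1 + cabs z * cabs w) ^+ 2.
  rewrite -sqr_cabs ler_pXn2r ?nnegrE ?cabs_ge0 ?(ltW p0)//.
  apply: le_trans (cabsD _ _) _; rewrite cabs1 cabsN cabsM lerD2l.
  by rewrite /cabs n2J mulrC.
have e : ((cabs z + cabs w) / (1 + cabs z * cabs w)) ^+ 2 =
   1 - (1 - n2 z) * (1 - n2 w) / (1 + cabs z * cabs w) ^+ 2.
  by rewrite -!sqr_cabs; field; rewrite gt_eqF.
rewrite e lerD2l lerN2 ler_wpM2l//; last by rewrite lef_pV2 ?posrE// exprn_gt0.
by rewrite mulr_ge0// subr_ge0 ltW//; exact/discE.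
Qed.

Lemma hdist_triangle0 z w : disc z -> disc w -> hdist z w <= hdist 0 z + hdist 0 w.
Proof.
move=> z1 w1; rewrite hdist_le//; apply: le_trans (pd_triangle0 z1 w1) _.
rewrite /th expRD !expR_hdist//; try exact: disc0.
rewrite !pd0l; move/disc_cabs in z1; move/disc_cabs in w1.
have := cabs_ge0 z; have := cabs_ge0 w; move: (cabs z) (cabs w) z1 w1 => a b a1 b1 b0 a0.
have h1 : 0 < 1 - a by rewrite subr_gt0.
have h2 : 0 < 1 - b by rewrite subr_gt0.
have h3 : 0 < 1 + a * b by rewrite ltr_pwDl// mulr_ge0.
rewrite (_ : (1 + a) / (1 - a) * ((1 + b) / (1 - b)) - 1 = 2 * (a + b) / ((1 - a) * (1 - b))); last first.
  by field; rewrite !gt_eqF.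
rewrite (_ : (1 + a) / (1 - a) * ((1 + b) / (1 - b)) + 1 = 2 * (1 + a * b) / ((1 - a) * (1 - b))); last first.
  by field; rewrite !gt_eqF.
rewrite le_eqVlt; apply/orP; left; apply/eqP; field.
by rewrite !gt_eqF.
Qed.

Lemma hdist_triangle x z w : disc x -> disc z -> disc w -> hdist z w <= hdist z x + hdist x w.
Proof.
move=> x1 z1 w1; have sT := trans_su11 x1; have sV := su11_inv sT.
rewrite -(hdist_moebius sV z1 w1) -(hdist_moebius sV z1 x1) -(hdist_moebius sV x1 w1).
have -> : moebius (trans x)^-1 x = 0.
  by rewrite -[X in moebius _ X](trans0 x1) moebiusK//; exact: disc0.
by rewrite [hdist _ 0]hdistC; apply: hdist_triangle0; apply: moebius_disc.
Qed.

End hyperbolic_distance.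

(** * Displacement and countability in Fuchsian groups *)

Section fuchsian.
Context (R : realType).
Implicit Types (z w x : R[i]) (A B : 'M[R[i]]_2) (Gam : set 'M[R[i]]_2).

Lemma ph2_origin A : su11 A -> n2 (moebius A 0) = 1 - (n2 (A 0 0))^-1.
Proof.
move=> /su11P[a [b [-> ab]]]; rewrite moebiusE /den !suE !mulr0 !add0r n2M n2V n2J.
have a0 : n2 a != 0 by rewrite gt_eqF//; have := n2_ge0 b; lra.
by have -> : n2 b = n2 a - 1 by [lra]; field.
Qed.

(** Discreteness is a condition on matrix entries; [|A 0|^2 = 1 - |A 0 0|^-2], with the image of the
    origin on the left and the entry on the right, converts displacement of the origin into a bound
    on entries. *)
Lemma su11_bounded A (D : R) : su11 A -> hdist 0 (moebius A 0) <= D ->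
  n2 (A 0 0) <= (1 - th D ^+ 2)^-1.
Proof.
move=> sA; have d0 := disc0 R; have d1 := moebius_disc sA d0.
rewrite hdist_le// pd0l => h.
have t0 : 0 <= th D by apply: le_trans h; exact: cabs_ge0.
have a0 : 0 < n2 (A 0 0).
  by have /su11P[a [b [-> ab]]] := sA; rewrite suE; have := n2_ge0 b; lra.
have : n2 (moebius A 0) <= th D ^+ 2 by rewrite -sqr_cabs ler_pXn2r ?nnegrE ?cabs_ge0.
rewrite ph2_origin// => h2.
have p : 0 < 1 - th D ^+ 2.
  by rewrite subr_gt0 expr_lt1// th_lt1.
rewrite -[leLHS]invrK lef_pV2 ?posrE ?invr_gt0//; lra.
Qed.

Lemma discrete_close Gam (e M d : R) A B : su11_subgroup Gam ->
  (forall A, Gam A -> (forall i j, `|A i j - (1 : 'M[R[i]]_2) i j| < (e%:C)%C) -> A = 1) ->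
  0 <= M -> n2 (A 0 0) <= M ^+ 2 -> 2 * M * d < e ->
  Gam A -> Gam B -> cabs (A 0 0 - B 0 0) <= d -> cabs (A 0 1 - B 0 1) <= d -> A = B.
Proof.
move=> [sub G1 GN GM GV] disc_e M0 AM Mde GA GB d1 d2.
have sA := sub _ GA; have sB := sub _ GB; have uA := su11_unit sA.
suff h : A^-1 * B = 1 by rewrite -[LHS]mulr1 -h mulVKr.
apply: disc_e; first by apply: GM => //; exact: GV.
have /su11P[a [b [eA ab]]] := sA; have /su11P[c [f [eB cf]]] := sB.
have -> : 1 = A^-1 * A by rewrite mulVr.
rewrite eA eB su11V//; rewrite eA eB !suE in AM d1 d2.
have aM : cabs a <= M by rewrite -(ler_pXn2r (ltn0Sn 1)) ?nnegrE ?cabs_ge0// sqr_cabs.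
have bM : cabs b <= M.
  by rewrite -(ler_pXn2r (ltn0Sn 1)) ?nnegrE ?cabs_ge0// sqr_cabs; lra.
have cJ z : cabs (Num.conj z) = cabs z by rewrite /cabs n2J.
have bound u v x y : cabs u <= M -> cabs v <= M -> cabs x <= d -> cabs y <= d ->
    `|u * x + v * y| < (e%:C)%C.
  move=> uM vM xd yd; rewrite cabsE ltcR; apply: le_lt_trans Mde.
  apply: le_trans (cabsD _ _) _; rewrite !cabsM (_ : 2 * M * d = M * d + M * d); last by ring.
  by apply: lerD; apply: ler_pM => //; exact: cabs_ge0.
have d1' : cabs (c - a) <= d by rewrite cabsB.
have d2' : cabs (f - b) <= d by rewrite cabsB.
apply: ord2P; apply: ord2P; rewrite !mul2E !suE ?conjCK.
- rewrite (_ : _ - _ = Num.conj a * (c - a) + (- b) * (Num.conj (f - b))); last by rewrite rmorphB; ring.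
  by apply: bound; rewrite ?cabsN ?cJ.
- rewrite (_ : _ - _ = Num.conj a * (f - b) + (- b) * (Num.conj (c - a))); last by rewrite rmorphB; ring.
  by apply: bound; rewrite ?cabsN ?cJ.
- rewrite (_ : _ - _ = (- Num.conj b) * (c - a) + a * (Num.conj (f - b))); last by rewrite !rmorphB rmorphN; ring.
  by apply: bound; rewrite ?cabsN ?cJ.
- rewrite (_ : _ - _ = (- Num.conj b) * (f - b) + a * (Num.conj (c - a))); last by rewrite !rmorphB rmorphN; ring.
  by apply: bound; rewrite ?cabsN ?cJ.
Qed.

Lemma su11_expr A n : su11 A -> su11 (A ^+ n).
Proof.
move=> sA; elim: n => [|n ih]; first by rewrite expr0; exact: su11_1.
by rewrite exprS; apply: su11M.
Qed.

Lemma hdist_expr A z n : su11 A -> disc z ->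
  hdist z (moebius (A ^+ n) z) <= n%:R * hdist z (moebius A z).
Proof.
move=> sA z1; elim: n => [|n ih]; first by rewrite expr0 moebius1 hdistxx// mul0r.
have sAn := su11_expr n sA; have d1 := moebius_disc sAn z1; have d2 := moebius_disc sA z1.
rewrite exprSr moebiusM//; apply: (le_trans (hdist_triangle (x := moebius (A ^+ n) z) _ _ _)) => //.
  exact: moebius_disc.
by rewrite hdist_moebius// -natr1 mulrDl mul1r lerD2r.
Qed.

(** The cube of side [2 M] in dimension four is cut into finitely many cells of side [d]. The point
    of this form is that [N] depends only on [M] and [d]. *)
Lemma grid_pigeonhole (M d : R) : 0 < d -> exists N : nat, forall f : nat -> R * R * R * R,
  (forall n, (n <= N)%N -> [/\ `|(f n).1.1.1| <= M, `|(f n).1.1.2| <= M, `|(f n).1.2| <= M & `|(f n).2| <= M]) ->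
  exists i j, [/\ (i < j)%N, (j <= N)%N &
    [/\ `|(f i).1.1.1 - (f j).1.1.1| <= d, `|(f i).1.1.2 - (f j).1.1.2| <= d,
        `|(f i).1.2 - (f j).1.2| <= d & `|(f i).2 - (f j).2| <= d]].
Proof.
move=> d0; pose m := Num.bound ((M + M) / d).
pose cell (x : R) : 'I_m.+1 := inord (Num.truncn ((x + M) / d)).
have cellP (x y : R) : `|x| <= M -> `|y| <= M -> cell x = cell y -> `|x - y| <= d.
  move=> xM yM /(congr1 val); rewrite /cell.
  have M0 : 0 <= M by apply: le_trans xM.
  have bnd (u : R) : `|u| <= M -> [/\ 0 <= (u + M) / d & (Num.truncn ((u + M) / d) < m.+1)%N].
    rewrite ler_norml => /andP[u1 u2]; have p0 : 0 <= (u + M) / d by rewrite divr_ge0 ?(ltW d0)//; lra.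
    split => //; rewrite -(ltr_nat R); apply: (@le_lt_trans _ _ ((u + M) / d)); first by rewrite truncn_le.
    apply: (@le_lt_trans _ _ ((M + M) / d)); first by rewrite ler_pM2r ?invr_gt0// lerD2r.
    apply: lt_trans (archi_boundP _) _; first by rewrite divr_ge0 ?(ltW d0)// addr_ge0.
    by rewrite ltr_nat.
  have [p1 b1] := bnd _ xM; have [p2 b2] := bnd _ yM.
  rewrite /= !inordK// => e.
  have /andP[t1 t2] := truncn_itv p1; have /andP[t3 t4] := truncn_itv p2.
  rewrite -e in t3 t4.
  have : `|(x + M) / d - (y + M) / d| <= 1.
    rewrite ler_norml; move: t1 t2 t3 t4; rewrite -natr1.
    by set k := _%:R => *; apply/andP; split; lra.
  rewrite -mulrBl normrM normfV (gtr0_norm d0) ler_pdivrMr// mul1r.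
  by rewrite (_ : x + M - (y + M) = x - y)//; ring.
pose T : finType := ('I_m.+1 * 'I_m.+1 * 'I_m.+1 * 'I_m.+1)%type.
exists #|T| => f fM.
pose g (i : 'I_(#|T|.+1)) : T := (cell (f i).1.1.1, cell (f i).1.1.2, cell (f i).1.2, cell (f i).2).
have /injectivePn[i [j ij gij]] : ~~ injectiveb g.
  apply/injectiveP => /leq_card; by rewrite card_ord ltnn.
wlog lt_ij : i j ij gij / (i < j)%N.
  move=> H; have [h|h|h] := ltngtP i j; first exact: (H i j).
    by apply: (H j i) => //; rewrite eq_sym.
  by move: ij; rewrite (_ : i = j) ?eqxx//; exact/val_inj.
exists i, j; split => //; first by rewrite -ltnS.
have [a1 a2 a3 a4] := fM i (ltn_ord i); have [b1 b2 b3 b4] := fM j (ltn_ord j).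
by move: gij => [] g1 g2 g3 g4; split; apply: cellP.
Qed.

(** [1 / (1 - |w|)] is continuous, hence bounded, on the compact set of the hypothesis, which keeps
    that set away from the unit circle. *)
Lemma cocompact_ball Gam : cocompact Gam -> exists r : R, [/\ 0 <= r, r < 1 &
  forall z, disc z -> exists2 A, Gam A & cabs (moebius A z) <= r].
Proof.
move=> [K [cK KD cov]].
have cabs_cont (z : R[i]^o) : {for z, continuous (fun w : R[i]^o => cabs w : R)}.
  move=> U /= /nbhs_ballP[e /= e0 eU]; apply/nbhs_ballP; exists ((e%:C)%C); first by rewrite /= ltcR.
  move=> w zw; apply: eU; move: zw; rewrite -!ball_normE /= cabsE ltcR; apply: le_lt_trans.
  rewrite ler_norml; have := cabsD (z - w) w; rewrite subrK => h1.
  have := cabsD (w - z) z; rewrite subrK (cabsB w z) => h2.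
  by apply/andP; split; lra.
have cg : {within K, continuous (fun w : R[i]^o => (1 - cabs w)^-1 : R)}.
  apply: continuous_in_subspaceT => z; rewrite inE => Kz.
  have z1 : cabs z < 1 by apply/disc_cabs/KD.
  apply: (@continuous_comp _ _ _ (fun w : R[i]^o => cabs w) (fun x : R => (1 - x)^-1) z (cabs_cont z)).
  apply: cvgV; first by rewrite gt_eqF// subr_gt0.
  by apply: cvgB; [exact: cvg_cst|exact: cvg_id].
have [M [_ MP]] := compact_bounded (continuous_compact cg cK).
pose M' := Num.max 1 (M + 1).
have M1 : 1 <= M' by rewrite le_max lexx.
have M0 : 0 < M' by apply: lt_le_trans M1.
exists (1 - M'^-1); split.
- by rewrite subr_ge0 invf_le1.
- by rewrite ltrBlDr ltrDl invr_gt0.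
move=> z /cov[A GA KA]; exists A => //.
have MM : M < M' by rewrite lt_max ltrDl ltr01 orbT.
have := MP _ MM _ (ex_intro2 _ _ _ KA erefl); rewrite /=.
have A1 : cabs (moebius A z) < 1 by apply/disc_cabs/KD.
rewrite ger0_norm ?invr_ge0 ?subr_ge0 ?(ltW A1)// => h.
have : M'^-1 <= 1 - cabs (moebius A z) by rewrite -[leRHS]invrK lef_pV2 ?posrE ?invr_gt0 ?subr_gt0.
lra.
Qed.

(** If [A] moves [z] by less than [1 / (N + 1)], its powers up to [N + 1] move [z] by at most 1, so
    their entries stay bounded. By pigeonhole two of the powers are so close that discreteness makes
    them equal; then [A] has finite order and is [1] or [- 1]. *)
Lemma systole Gam : cocompact_fuchsian Gam -> exists2 e : R, 0 < e &
  forall A z, Gam A -> disc z -> hdist z (moebius A z) < e -> A = 1 \/ A = - 1.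
Proof.
move=> [sG [e e0 dG] tG /cocompact_ball[r [r0 r1 cov]]].
have [sub G1 GN GM GV] := sG.
pose D := 1 + 2 * ln ((1 + r) / (1 - r)).
pose M := Num.sqrt ((1 - th D ^+ 2)^-1) + 1.
have M0 : 0 <= M by rewrite addr_ge0// sqrtr_ge0.
pose d := e / (2 * M + 1) / 2 / 2.
have MM : 0 < 2 * M + 1 by rewrite ltr_wpDl// mulr_ge0.
have d0 : 0 < d by rewrite !divr_gt0.
have [N HN] := grid_pigeonhole M d0.
have N0 : 0 < (N.+1)%:R^-1 :> R by rewrite invr_gt0.
exists (N.+1%:R^-1) => //.
(* Conjugation by an element that carries [z] into the ball of radius [r] preserves the
   displacement, and it is the restriction to this ball that makes the bound uniform. *)
suff H A z : Gam A -> disc z -> cabs z <= r -> hdist z (moebius A z) < N.+1%:R^-1 -> A = 1 \/ A = - 1.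
  move=> A z GA z1 h; have [B GB Br] := cov _ z1.
  have sA := sub _ GA; have sB := sub _ GB; have uB := su11_unit sB.
  have Bz := moebius_disc sB z1.
  have eB : moebius (B * A * B^-1) (moebius B z) = moebius B (moebius A z).
    by rewrite moebiusM ?moebiusK ?moebiusM//; [exact: su11M|exact: su11_inv].
  have [] := H (B * A * B^-1) (moebius B z).
  - by apply: (GM _ _ (GM _ _ GB GA)); exact: GV.
  - exact: Bz.
  - exact: Br.
  - by rewrite eB hdist_moebius//; exact: moebius_disc.
  - move=> e1; left; rewrite -[A](mulKr uB) -[B * A](mulrVK uB) e1 mul1r mulVr//.
  - move=> e1; right; rewrite -[A](mulKr uB) -[B * A](mulrVK uB) e1 mulN1r mulrN mulVr//.
move=> GA z1 zr hA.
have sA := sub _ GA.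
have d00 := disc0 R.
have GAn n : Gam (A ^+ n) by elim: n => [|n ih]; rewrite ?expr0// exprS; exact: GM.
have h0z : hdist 0 z <= ln ((1 + r) / (1 - r)).
  rewrite hdist_le// pd0l /th lnK; last by rewrite posrE divr_gt0 ?subr_gt0// ltr_wpDr.
  apply: le_trans zr _; rewrite le_eqVlt; apply/orP; left; apply/eqP; field.
  by rewrite gt_eqF ?subr_gt0//= gt_eqF//; lra.
have dist0 n : (n <= N.+1)%N -> hdist 0 (moebius (A ^+ n) 0) <= D.
  move=> nN; have sn := su11_expr n sA.
  have d1 := moebius_disc sn d00; have d2 := moebius_disc sn z1.
  apply: (le_trans (hdist_triangle (x := z) _ _ _)) => //.
  apply: (le_trans (lerD (lexx _) (hdist_triangle (x := moebius (A ^+ n) z) _ _ _))) => //.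
  rewrite hdist_moebius// [hdist z 0]hdistC.
  have h1 : hdist z (moebius (A ^+ n) z) <= 1.
    apply: le_trans (hdist_expr n sA z1) _.
    apply: (@le_trans _ _ (N.+1%:R * N.+1%:R^-1)); last by rewrite mulfV// pnatr_eq0.
    by apply: ler_pM; rewrite ?ler_nat ?ler0n ?hdist_ge0 ?(ltW hA)//; exact: moebius_disc.
  by rewrite /D; lra.
have n2M n : (n <= N.+1)%N -> n2 ((A ^+ n) 0 0) <= M ^+ 2.
  move=> nN; apply: le_trans (su11_bounded (su11_expr n sA) (dist0 n nN)) _.
  set y := _^-1; have y0 : 0 <= y.
    have D0 : 0 <= D by apply: le_trans (dist0 0%N isT); rewrite expr0 moebius1 hdistxx.
    by rewrite invr_ge0 subr_ge0 expr_le1 ?(ltW (th_lt1 _))// th_ge0.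
  by rewrite -[leLHS](sqr_sqrtr y0) ler_pXn2r ?nnegrE ?sqrtr_ge0// /M lerDl.
have n2M' n : (n <= N.+1)%N -> n2 ((A ^+ n) 0 1) <= M ^+ 2.
  move=> nN; apply: le_trans (n2M n nN); have /su11P[a [b [-> ab]]] := su11_expr n sA.
  by rewrite !suE; lra.
have cM z' : n2 z' <= M ^+ 2 -> cabs z' <= M.
  by move=> h; rewrite -(ler_pXn2r (ltn0Sn 1)) ?nnegrE ?cabs_ge0// sqr_cabs.
have [|i [j [ij jN [e1 e2 e3 e4]]]] := HN (fun n => (re ((A ^+ n) 0 0), im ((A ^+ n) 0 0), re ((A ^+ n) 0 1), im ((A ^+ n) 0 1))).
  move=> n nN; have nN1 : (n <= N.+1)%N by apply: leq_trans nN _.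
  split => /=; [apply: le_trans (re_le_cabs _) (cM _ (n2M _ nN1))|apply: le_trans (im_le_cabs _) (cM _ (n2M _ nN1))
   |apply: le_trans (re_le_cabs _) (cM _ (n2M' _ nN1))|apply: le_trans (im_le_cabs _) (cM _ (n2M' _ nN1))].
rewrite /= in e1 e2 e3 e4.
have eij : A ^+ i = A ^+ j.
  apply: (@discrete_close Gam e M (d + d)) => //.
  - by apply: n2M; apply: leq_trans (ltnW ij) _; apply: leq_trans jN _.
  - rewrite (_ : 2 * M * (d + d) = e * (M / (2 * M + 1))); last by rewrite /d; field; rewrite gt_eqF.
    by rewrite gtr_pMr// ltr_pdivrMr//; lra.
  - by apply: le_trans (cabs_le _) _; rewrite !cxE lerD.
  - by apply: le_trans (cabs_le _) _; rewrite !cxE lerD.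
apply: (tG A (j - i)%N) => //; first by rewrite subn_gt0.
left; apply: (mulrI (su11_unit (su11_expr i sA))).
by rewrite -exprD subnKC 1?ltnW// mulr1 eij.
Qed.

(** A code is a bound [m] with rational approximations of the first row. By [discrete_close] at most
    one element of [Gam] has a given code, and every element has one; codes without element give
    [1]. *)
Lemma enumerate_group Gam : su11_subgroup Gam -> discrete_group Gam ->
  exists A_ : nat -> 'M[R[i]]_2, (forall n, Gam (A_ n)) /\
    forall A, Gam A -> exists n, A_ n = A.
Proof.
move=> sG [e e0 dG]; have [sub G1 GN GM GV] := sG.
pose d (m : nat) : R := e / (2 * m%:R + 1) / 2 / 2.
have d0 m : 0 < d m.
  by rewrite !divr_gt0// ltr_wpDl// mulr_ge0.
pose code (k : nat * (rat * rat) * (rat * rat)) : set 'M[R[i]]_2 :=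
  [set A | [/\ Gam A, n2 (A 0 0) <= k.1.1%:R ^+ 2,
     square (ratr k.1.2.1, ratr k.1.2.2) (d k.1.1 / 2) (ofC (A 0 0)) &
     square (ratr k.2.1, ratr k.2.2) (d k.1.1 / 2) (ofC (A 0 1))]].
exists (fun n => if unpickle n is Some k then xget 1 (code k) else 1); split.
  by move=> n; case: unpickle => [k|//]; case: xgetP => [A -> []|].
move=> A GA; pose m := Num.bound (cabs (A 0 0)).
have cm : cabs (A 0 0) < m%:R by apply: archi_boundP; exact: cabs_ge0.
have rat_close (x : R) : exists q : rat, `|x - ratr q| < d m / 2.
  have d2 : x - d m / 2 < x + d m / 2 by rewrite ltrBlDr -addrA ltrDl addr_gt0// divr_gt0.
  have [q] := rat_in_itvoo d2; rewrite in_itv/= => /andP[q1 q2]; exists q.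
  by rewrite ltr_norml; apply/andP; split; lra.
have [q1 h1] := rat_close (re (A 0 0)); have [q2 h2] := rat_close (im (A 0 0)).
have [q3 h3] := rat_close (re (A 0 1)); have [q4 h4] := rat_close (im (A 0 1)).
pose k := ((m, (q1, q2)), (q3, q4)).
have cA : code k A.
  split => //=; rewrite -sqr_cabs ler_pXn2r ?nnegrE ?cabs_ge0// ltW//.
exists (pickle k); rewrite pickleK.
case: xgetP => [B -> [GB B1 B2 B3]|/(_ A)//].
have [_ _ A2 A3] := cA; move: B1 B2 B3 A2 A3; rewrite /k /square /=.
move=> B1 [b1 b2] [b3 b4] [a1 a2] [a3 a4].
have tri (u v w : R) : `|u - w| < d m / 2 -> `|v - w| < d m / 2 -> `|u - v| <= d m.
  by rewrite !ltr_norml ler_norml => /andP[? ?] /andP[? ?]; apply/andP; split; lra.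
apply: (@discrete_close Gam e m%:R (d m + d m)) => //.
- rewrite (_ : 2 * _ * _ = e * (m%:R / (2 * m%:R + 1))); last first.
    by rewrite /d; field; rewrite gt_eqF// ltr_wpDl// mulr_ge0.
  by rewrite gtr_pMr// ltr_pdivrMr ?ltr_wpDl ?mulr_ge0//; have : 0 <= m%:R :> R by []; lra.
- by apply: le_trans (cabs_le _) _; rewrite !cxE lerD//; apply: tri; [exact: b1|exact: a1|exact: b2|exact: a2].
- by apply: le_trans (cabs_le _) _; rewrite !cxE lerD//; apply: tri; [exact: b3|exact: a3|exact: b4|exact: a4].
Qed.

End fuchsian.

Section group_transport.
Context (R : realType).
Implicit Types (p q : R * R).

Lemma disc_mz (A : 'M[R[i]]_2) p : su11 A -> DD p -> DD (mz A p).
Proof. by move=> sA /DDE Dp; apply/DDE; rewrite toC_mz; exact: moebius_disc. Qed.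

Lemma mzK (A : 'M[R[i]]_2) p : su11 A -> DD p -> mz A^-1 (mz A p) = p.
Proof. by move=> sA /DDE Dp; rewrite {1}/mz toC_mz moebiusK// toCK. Qed.

Lemma mzVK (A : 'M[R[i]]_2) p : su11 A -> DD p -> mz A (mz A^-1 p) = p.
Proof. by move=> sA /DDE Dp; rewrite {1}/mz toC_mz moebiusVK// toCK. Qed.

Lemma mzM (A B : 'M[R[i]]_2) p : su11 A -> su11 B -> DD p -> mz (A * B) p = mz A (mz B p).
Proof. by move=> sA sB /DDE Dp; rewrite /mz moebiusM// ofCK. Qed.

Lemma ge0_integral_mz_DD (A : 'M[R[i]]_2) (g : R * R -> \bar R) : su11 A ->
  measurable_fun setT g -> (forall p, (0 <= g p)%E) ->
  (\int[@hmu R]_(p in @DD R) g (mz A p) = \int[@hmu R]_(p in @DD R) g p)%E.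
Proof.
move=> sA mg g0.
have mgA : measurable_fun setT (g \o mz A).
  by apply: measurableT_comp => //; exact: measurable_mz.
have := ge0_integral_mz sA mg g0; rewrite -(@ge0_integral_hmu_DD _ g)// => <-.
by apply: (ge0_integral_hmu_DD mgA) => p; exact: g0.
Qed.

(** [E] meets an orbit at most once, and [E'] meets every orbit that [E] meets, so translates by
    countably many group elements carry [E] injectively into [E']. *)
Lemma group_transport (Gam : set 'M[R[i]]_2) (E E' : set (R * R)) (f : R * R -> \bar R) :
  su11_subgroup Gam -> discrete_group Gam ->
  measurable E -> measurable E' -> E `<=` @DD R -> E' `<=` @DD R ->
  (forall p, E p -> exists2 A, Gam A & E' (mz A p)) ->
  (forall A p, Gam A -> E p -> E (mz A p) -> mz A p = p) ->
  measurable_fun setT f -> (forall p, (0 <= f p)%E) ->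
  (forall A p, Gam A -> DD p -> f (mz A p) = f p) ->
  (\int[@hmu R]_(p in E) f p <= \int[@hmu R]_(p in E') f p)%E.
Proof.
move=> sG dG mE mE' ED E'D cov inj mf f0 fA.
have [sub G1 GN GM GV] := sG; have [A_ [GA_ enum]] := enumerate_group sG dG.
have sA j := sub _ (GA_ j).
apply: (@transport_le _ _ _ (@hmu R) (@DD R) E E' (fun j => mz (A_ j) @^-1` E')
  (fun j => mz (A_ j)) (fun j => mz (A_ j)^-1)) => //.
- exact: measurable_DD.
- by move=> j; rewrite -[X in measurable X]setTI; exact: measurable_mz.
- by move=> p /cov[A /enum[n <-] E'p]; exists n.
- by move=> j; exact: measurable_mz.
- by move=> j p; exact: disc_mz.
- by move=> j p; apply: disc_mz; exact: su11_inv.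
- by move=> j p; exact: mzK.
- by move=> j p; exact: mzVK.
- by move=> j g mg g0; exact: ge0_integral_mz_DD.
- move=> j k p q Ep _ Eq _ e.
  have e2 : mz ((A_ k)^-1 * A_ j) p = q.
    by rewrite mzM ?e ?mzK//; [exact: ED|exact/su11_inv|exact: ED].
  rewrite -e2 inj// ?e2//; by apply: GM => //; exact: GV.
- by move=> j p Ep _; rewrite fA//; exact: ED.
Qed.

Definition pball (z : R[i]) (s : R) : set (R * R) := [set p | DD p /\ ph2 z (toC p) < s].

Lemma pballE z s p : disc z -> DD p -> pball z s p <-> nball s (mz (trans z)^-1 p).
Proof.
move=> z1 Dp; have Dp' : disc (toC p) by exact/DDE.
have sT := trans_su11 z1; have sV := su11_inv sT.
rewrite /pball /nball /= nsqE toC_mz -ph2_0l.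
have <- : moebius (trans z)^-1 z = 0.
  by rewrite -[X in moebius _ X](trans0 z1) moebiusK//; exact: disc0.
by rewrite ph2_moebius//; split => [[]|].
Qed.

Lemma measurable_pball z s : disc z -> measurable (pball z s).
Proof.
move=> z1; rewrite (_ : pball z s = @DD R `&` mz (trans z)^-1 @^-1` (nball s)).
  apply: measurableI; first exact: measurable_DD.
  by rewrite -[X in measurable X]setTI; apply: measurable_mz => //; exact: measurable_nball.
apply/seteqP; split => p [Dp h]; split => //.
  by apply/(pballE _ z1 Dp).
by have /(pballE _ z1 Dp)[] := h.
Qed.

Lemma ge0_integral_pball z s (g : R * R -> \bar R) : disc z -> s <= 1 ->
  measurable_fun setT g -> (forall p, (0 <= g p)%E) ->
  (\int[@hmu R]_(p in pball z s) g p = \int[@hmu R]_(p in nball s) g (mz (trans z) p))%E.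
Proof.
move=> z1 s1 mg g0; have sT := trans_su11 z1.
have mp := measurable_pball s z1; have mn := measurable_nball s.
rewrite [LHS]integral_mkcond [RHS]integral_mkcond.
pose h := g \_ (pball z s).
have mh : measurable_fun setT h by apply/(measurable_restrictT _ _).1 => //; exact: measurable_funTS.
have h0 p : (0 <= h p)%E by rewrite /h patchE; case: ifP.
rewrite -(ge0_integral_mz sT mh h0).
have mgT : measurable_fun setT (g \o mz (trans z)).
  by apply: measurableT_comp => //; exact: measurable_mz.
have mhT : measurable_fun setT (h \o mz (trans z)).
  by apply: measurableT_comp => //; exact: measurable_mz.
have mk : measurable_fun setT ((g \o mz (trans z)) \_ (nball s)).
  by apply/(measurable_restrictT _ _).1 => //; exact: measurable_funTS.
have mk0 p : (0 <= ((g \o mz (trans z)) \_ (nball s)) p)%E.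
  by rewrite patchE; case: ifP => // _; exact: g0.
have := ge0_integral_hmu_DD mhT (fun p => h0 _); rewrite /= => <-.
rewrite -(ge0_integral_hmu_DD mk mk0).
apply: eq_integral => p; rewrite inE => Dp; rewrite /h !patchE.
have Dq := disc_mz sT Dp.
have e := pballE s z1 Dq; rewrite mzK// in e.
have -> : (mz (trans z) p \in pball z s) = (p \in nball s).
  by apply/idP/idP; rewrite !inE => /e.
by [].
Qed.

Lemma hmu_pball z s : disc z -> s <= 1 -> (hmu (pball z s) = hmu (nball s))%E.
Proof.
move=> z1 s1; have := ge0_integral_pball (g := cst 1%E) z1 s1 (measurable_cst _) (fun=> lee01).
by rewrite !integral_cst ?mul1e//; [exact: measurable_nball|exact: measurable_pball].
Qed.

Lemma hmu_nball_gt0 (s : R) : 0 < s -> s <= 1 -> (0 < hmu (nball s))%E.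
Proof.
move=> s0 s1; pose e := Num.min 1 (s / 2) / 2.
have e0 : 0 < e by rewrite divr_gt0// lt_min ltr01 divr_gt0.
have [es e1] : e <= s / 2 / 2 /\ e <= 1 / 2.
  by split; rewrite ler_pM2r// ge_min lexx ?orbT.
have sub : square (0, 0) e `<=` nball s.
  move=> p [/=]; rewrite !subr0 /nball/= /nsq => h1 h2.
  rewrite -[_ ^+ 2]real_normK ?num_real// -[X in _ + X]real_normK ?num_real//.
  have := normr_ge0 p.1; have := normr_ge0 p.2; nra.
have ms := @measurable_square R (0, 0) e.
apply: (@lt_le_trans _ _ (\int[leb2 R]_(p in square (0, 0)%R e) 4%:E)%E).
  rewrite integral_cst//.
  have -> : square (0, 0) e = `]-e, e[%classic `*` `]-e, e[%classic.
    by apply/seteqP; split => p /=; rewrite /square/= !subr0 !in_itv/= -!ltr_norml.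
  rewrite leb2X// lebesgue_measure_itv/= lte_fin.
  have -> : - e < e by lra.
  by rewrite -EFinB -!EFinM lte_fin !mulr_gt0// opprK addr_gt0.
rewrite hmuE; last exact: measurable_nball.
apply: (@le_trans _ _ (\int[leb2 R]_(p in square (0, 0)%R e) (omega p)%:E)%E).
  apply: ge0_le_integral => //.
  - by apply/measurable_EFinP; exact: measurable_funTS (@measurable_omega R).
  move=> p /sub Sp; rewrite lee_fin omegaE; last exact: nball_DD Sp.
  have := nball_DD s1 Sp; rewrite /DD/= => p1.
  have n0 : 0 <= nsq p by rewrite nsqE n2_ge0.
  rewrite ler_pdivlMr ?exprn_gt0 ?subr_gt0//; nra.
apply: ge0_subset_integral => //.
- exact: measurable_nball.
- by apply/measurable_EFinP; exact: measurable_funTS (@measurable_omega R).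
- by move=> p _; rewrite lee_fin omega_ge0.
Qed.

End group_transport.

(** * The distance of the quotient below the systole *)

Section quotient_distance.
Context (R : realType) (Gam : set 'M[R[i]]_2) (sG : su11_subgroup Gam).
Implicit Types (z w a b : R[i]) (A B : 'M[R[i]]_2).

Let sub A : Gam A -> su11 A. Proof. by case: sG => + _ _ _ _; apply. Qed.
Let G1 : Gam 1. Proof. by case: sG. Qed.
Let GM A B : Gam A -> Gam B -> Gam (A * B). Proof. by case: sG => _ _ _ + _; apply. Qed.
Let GV A : Gam A -> Gam A^-1. Proof. by case: sG => _ _ _ _; apply. Qed.

Let lbd z w : disc z -> disc w -> lbound [set hdist z (moebius A w) | A in Gam] 0.
Proof. by move=> z1 w1 _ [A GA <-]; apply: hdist_ge0 => //; exact/moebius_disc/w1/sub. Qed.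

Let ne z w : [set hdist z (moebius A w) | A in Gam] !=set0.
Proof. by exists (hdist z (moebius 1 w)); exists 1. Qed.

Lemma qdist_le A z w : disc z -> disc w -> Gam A -> qdist Gam z w <= hdist z (moebius A w).
Proof. by move=> z1 w1 GA; apply: ge_inf; [exists 0; exact: lbd|exists A]. Qed.

Lemma qdist_ge z w (r : R) : (forall A, Gam A -> r <= hdist z (moebius A w)) -> r <= qdist Gam z w.
Proof. by move=> h; apply: lb_le_inf; [exact: ne|move=> _ [A GA <-]; exact: h]. Qed.

Lemma qdist_lt z w (r : R) : disc z -> disc w -> qdist Gam z w < r ->
  exists2 A, Gam A & hdist z (moebius A w) < r.
Proof.
move=> z1 w1 h; have hi : has_inf [set hdist z (moebius A w) | A in Gam].
  by split; [exact: ne|exists 0; exact: lbd].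
have e0 : 0 < r - qdist Gam z w by rewrite subr_gt0.
have [_ [A GA <-]] := inf_adherent e0 hi.
by rewrite addrC subrK => hA; exists A.
Qed.

Lemma qdist_moebius A z w : Gam A -> disc z -> disc w ->
  qdist Gam z (moebius A w) = qdist Gam z w.
Proof.
move=> GA z1 w1; have sA := sub GA; have Aw := moebius_disc sA w1.
apply/eqP; rewrite eq_le; apply/andP; split; apply: qdist_ge => B GB; have sB := sub GB.
  have -> : moebius B w = moebius (B * A^-1) (moebius A w).
    by rewrite moebiusM ?moebiusK//; exact: su11_inv.
  by apply: qdist_le => //; apply: GM => //; exact: GV.
rewrite -moebiusM//; apply: qdist_le => //; exact: GM.
Qed.

Variables (e0 : R) (e0_gt0 : 0 < e0).
Hypothesis sys : forall A z, Gam A -> disc z -> hdist z (moebius A z) < e0 -> A = 1 \/ A = - 1.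

Lemma moebius_short A z w : Gam A -> disc z -> hdist z (moebius A z) < e0 -> moebius A w = w.
Proof. by move=> GA z1 /(sys GA z1)[->|->]; rewrite ?moebiusN moebius1. Qed.

(** If a translate of [b] were nearer to [a] than [b] is, it would lie within [e0] of [b], so the
    group element would fix [b]. *)
Lemma qdist_close a b : disc a -> disc b -> hdist a b < e0 / 2 -> qdist Gam a b = hdist a b.
Proof.
move=> a1 b1 h; apply/eqP; rewrite eq_le; apply/andP; split.
  by have := qdist_le a1 b1 G1; rewrite moebius1.
apply: qdist_ge => A GA; rewrite leNgt; apply/negP => h2.
have Ab := moebius_disc (sub GA) b1.
have e : moebius A b = b.
  apply: (moebius_short _ GA b1); apply: le_lt_trans (hdist_triangle a1 b1 Ab) _.
  by rewrite (hdistC b a); lra.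
by rewrite e ltxx in h2.
Qed.

Lemma qdist_near a b : disc a -> disc b -> qdist Gam a b < e0 / 2 ->
  exists2 A, Gam A & hdist a (moebius A b) = qdist Gam a b.
Proof.
move=> a1 b1 /(qdist_lt a1 b1)[A GA h]; exists A => //.
have Ab := moebius_disc (sub GA) b1.
by rewrite -(qdist_close a1 Ab h) qdist_moebius.
Qed.

(** Two points of the ball are less than [e0 / 2] apart, so no group element identifies them. This
    makes the set defining the injectivity radius nonempty, with a bound independent of [z]. *)
Lemma small_ball_isometric z r : disc z -> 0 < r -> r <= e0 / 4 ->
  ball_isometric_to_disc Gam z r.
Proof.
move=> z1 r0 re; have sT := trans_su11 z1; have d0 := disc0 R.
have hT p : disc p -> hdist z (moebius (trans z) p) = hdist 0 p.
  by move=> p1; rewrite -{1}(trans0 z1) hdist_moebius.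
exists (moebius (trans z)); split.
- move=> p [p1 hp]; have Tp := moebius_disc sT p1; split => //.
  apply: le_lt_trans (qdist_le z1 Tp G1) _; by rewrite moebius1 hT.
- move=> w w1 /(qdist_lt z1 w1)[A GA hA]; have Aw := moebius_disc (sub GA) w1.
  exists (moebius (trans z)^-1 (moebius A w)).
    have d := moebius_disc (su11_inv sT) Aw.
    by split => //; rewrite -hT// moebiusVK.
  rewrite moebiusVK//; exists A^-1; first exact: GV.
  by rewrite moebiusK//; exact: sub.
- move=> p q [p1 hp] [q1 hq] [A GA eA].
  have Tp := moebius_disc sT p1.
  apply: (moebius_inj sT) => //; rewrite eA; apply/esym.
  apply: (moebius_short _ GA Tp); rewrite -eA hdist_moebius//.
  by apply: le_lt_trans (hdist_triangle d0 p1 q1) _; rewrite (hdistC p 0); lra.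
- move=> p [p1 hp]; exists (e0 / 4); first by rewrite divr_gt0.
  move=> u v [u1 _] [v1 _] hu hv.
  rewrite qdist_close ?hdist_moebius//; try exact: moebius_disc.
  by apply: le_lt_trans (hdist_triangle p1 u1 v1) _; rewrite (hdistC u p); lra.
Qed.

End quotient_distance.

(** * The injectivity radius *)

Section rigidity.
Context (R : realType).
Implicit Types (z w u v : R[i]) (A B : 'M[R[i]]_2) (c : bool).

(** A local isometry may reverse orientation; the boolean records whether it does. *)
Definition cj c z : R[i] := if c then Num.conj z else z.

Lemma cj_disc c z : disc z -> disc (cj c z).
Proof. by case: c => // /discE h; apply/discE; rewrite n2J. Qed.

Lemma cinnerM z u v : re (Num.conj (z * u) * (z * v)) = n2 z * re (Num.conj u * v).
Proof. by rewrite /n2 !cxE; ring. Qed.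

(** Linearity is not assumed: the inner products of [g u] with the images of two orthogonal vectors
    determine it. After the rotation [e] that fixes the first of these vectors, only the sign of the
    second remains free. *)
Lemma inner_preserving (g : R[i] -> R[i]) (s : R) : 0 < s ->
  (forall u v, cabs u < s -> cabs v < s -> re (Num.conj (g u) * g v) = re (Num.conj u * v)) ->
  exists e c, n2 e = 1 /\ forall u, cabs u < s -> g u = e * cj c u.
Proof.
move=> s0 gI; pose x := s / 2; have x0 : 0 < x by rewrite divr_gt0.
have xn : x != 0 by rewrite gt_eqF.
pose u1 : R[i] := (x%:C)%C; pose u2 : R[i] := Complex 0 x.
have c1 : cabs u1 < s by rewrite cabsC gtr0_norm// /x; lra.
have c2 : cabs u2 < s.
  by rewrite /cabs /n2/= expr0n/= add0r sqrtr_sqr gtr0_norm// /x; lra.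
pose e := g u1 * ((x^-1)%:C)%C.
have n2g u : cabs u < s -> n2 (g u) = n2 u.
  by move=> us; have := gI _ _ us us; rewrite !cxE /n2 => h; nra.
have e1 : n2 e = 1 by rewrite n2M n2g// !n2C -exprMn mulfV// expr1n.
pose h u := Num.conj e * g u.
have gh u : g u = e * h u by rewrite /h mulrA mulJ e1 mul1r.
have hI u v : cabs u < s -> cabs v < s -> re (Num.conj (h u) * h v) = re (Num.conj u * v).
  move=> us vs; rewrite -(gI _ _ us vs).
  transitivity (n2 e * re (Num.conj (h u) * h v)); first by rewrite e1 mul1r.
  by rewrite [in RHS](gh u) [in RHS](gh v) cinnerM.
have hu1 : h u1 = u1.
  have eg : g u1 = e * u1 by rewrite /e -mulrA -rmorphM/= mulVf// mulr1.
  by rewrite /h eg mulrA [_ * e]mulrC mulJ e1 mul1r.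
clearbody h.
have reh u : cabs u < s -> re (h u) = re u.
  move=> us; have := hI _ _ us c1; rewrite hu1 !cxE /= !mulr0 !subr0.
  by move=> /(mulIf xn).
have h2 : im (h u2) = x \/ im (h u2) = - x.
  have := hI _ _ c2 c2; rewrite !cxE (reh _ c2) /= !mul0r !sub0r !mulNr !opprK => E.
  have : im (h u2) ^+ 2 == x ^+ 2 by rewrite !expr2 E.
  by rewrite eqf_sqr => /orP[]/eqP; [left|right].
have imh u : cabs u < s -> im (h u2) * im (h u) = x * im u.
  move=> us; have := hI _ _ c2 us; rewrite !cxE (reh _ c2) /= !mul0r !sub0r !mulNr !opprK.
  by [].
case: h2 => E; [exists e, false|exists e, true]; split=> // u us; rewrite gh; congr (_ * _);
  apply: complex_ext; rewrite /cj ?cxE ?reh//; have := imh _ us; rewrite E.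
  by move=> /(mulfI xn).
by rewrite mulNr -mulrN => /(mulfI xn) <-; rewrite opprK.
Qed.

Lemma moebius_unit_rot e : n2 e = 1 -> exists2 B, su11 B & forall z, moebius B z = e * z.
Proof.
move=> e1; pose a := sqrtC e.
have a2 : a * a = e by rewrite -expr2 sqrtCK.
have a1 : n2 a = 1.
  have : n2 a ^+ 2 = 1 by rewrite expr2 -n2M a2.
  by move=> /eqP; rewrite sqrf_eq1 => /orP[/eqP//|/eqP h]; have := n2_ge0 a; rewrite h; lra.
exists (su a 0); first by apply/su11P; exists a, 0; rewrite n2_0 subr0.
move=> z; rewrite moebiusE /den !suE rmorph0 mul0r add0r addr0.
have aJ : a * Num.conj a = 1 by rewrite mulJ a1.
have an : Num.conj a != 0 by apply/eqP => h; move: aJ; rewrite h mulr0 => /eqP; rewrite eq_sym oner_eq0.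
by apply: (mulIf an); rewrite mulfVK// -a2 mulrAC -[a * a * _]mulrA aJ mulr1.
Qed.

Lemma cj_moebius c A z : su11 A -> exists2 B, su11 B & forall z, cj c (moebius A z) = moebius B (cj c z).
Proof.
move=> sA; case: c; last by exists A.
have /su11P[a [b [-> ab]]] := sA; exists (su (Num.conj a) (Num.conj b)).
  by apply/su11P; exists (Num.conj a), (Num.conj b); rewrite !n2J.
by move=> w; rewrite /cj !moebiusE /den !suE rmorphM fmorphV !rmorphD !rmorphM.
Qed.

(** For given moduli, [1 - ph2] is a nonzero constant over [|1 - v^* u|^2], and the latter is affine
    in the real inner product of [u] and [v]. *)
Lemma ph2_cinner u v u' v' : disc u -> disc v -> disc u' -> disc v' ->
  n2 u = n2 u' -> n2 v = n2 v' -> ph2 u v = ph2 u' v' ->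
  re (Num.conj u * v) = re (Num.conj u' * v').
Proof.
move=> u1 v1 u'1 v'1 eu ev e.
have e1 : 1 - ph2 u v = 1 - ph2 u' v' by rewrite e.
have d := ph_den_gt0 u1 v1; have d' := ph_den_gt0 u'1 v'1.
move: e1; rewrite !one_ph2// -eu -ev => /mulfI H.
have {H}: (n2 (1 - Num.conj v * u))^-1 = (n2 (1 - Num.conj v' * u'))^-1.
  by apply: H; rewrite mulf_neq0// gt_eqF// subr_gt0; exact/discE.
move=> /invr_inj.
have E z w : n2 (1 - Num.conj w * z) = 1 - 2 * re (Num.conj z * w) + n2 z * n2 w.
  by rewrite /n2 !cxE; ring.
by rewrite !E -eu -ev; lra.
Qed.

(** Moving [p] and [f p] to the origin, the map preserves the distances to 0, hence moduli, hence
    real inner products by [ph2_cinner]; it is therefore a rotation, possibly after a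
    conjugation. *)
Lemma local_isometry (f : R[i] -> R[i]) p (e : R) : disc p -> 0 < e ->
  (forall u, disc u -> hdist p u < e -> disc (f u)) ->
  (forall u v, disc u -> disc v -> hdist p u < e -> hdist p v < e ->
     hdist (f u) (f v) = hdist u v) ->
  exists B c, su11 B /\ forall u, disc u -> hdist p u < e -> f u = moebius B (cj c u).
Proof.
move=> p1 e0 fD fI; have d0 := disc0 R.
have fp1 : disc (f p) by apply: fD; rewrite ?hdistxx.
have sP := trans_su11 p1; have sQ := trans_su11 fp1.
have sP' := su11_inv sP; have sQ' := su11_inv sQ.
pose g u := moebius (trans (f p))^-1 (f (moebius (trans p) u)).
have W u : cabs u < th e -> [/\ disc u, disc (moebius (trans p) u) & hdist p (moebius (trans p) u) < e].
  move=> ue; have u1 : disc u by apply/disc_cabs; apply: lt_trans ue (th_lt1 e).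
  split => //; first exact: moebius_disc.
  by rewrite -{1}(trans0 p1) hdist_moebius// hdist_lt// pd0l.
have gD u : cabs u < th e -> disc (g u).
  by move=> /W[u1 Pu1 h]; apply: moebius_disc => //; exact: fD.
have gI u v : cabs u < th e -> cabs v < th e -> ph2 (g u) (g v) = ph2 u v.
  move=> /W[u1 Pu1 hu] /W[v1 Pv1 hv]; rewrite ph2_moebius//; try exact: fD.
  have := fI _ _ Pu1 Pv1 hu hv; rewrite hdist_moebius// => E.
  by rewrite -!sqr_pd -!th_hdist//; [rewrite E|exact: fD|exact: fD].
have th0 : 0 < th e by exact: th_gt0.
have g0 : g 0 = 0.
  rewrite /g trans0// -[X in moebius _ X](trans0 fp1) moebiusK//.
have gn u : cabs u < th e -> n2 (g u) = n2 u.
  by move=> ue; rewrite -!(@ph2_0l R) -{1}g0 gI// cabs0.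
have [w [c [w1 gE]]] : exists w c, n2 w = 1 /\ forall u, cabs u < th e -> g u = w * cj c u.
  apply: inner_preserving th0 _ => u v ue ve; apply: ph2_cinner; rewrite ?gn ?gI//; try exact: gD.
  - by have [] := W _ ue.
  - by have [] := W _ ve.
have [T sT TE] := moebius_unit_rot w1.
have [P' sP'' PE] := @cj_moebius c (trans p)^-1 0 sP'.
exists (trans (f p) * T * P'), c; split; first by do 2 apply: su11M => //.
move=> u u1 hu; have cu1 := cj_disc c u1.
have v1 := moebius_disc sP' u1.
have ve : cabs (moebius (trans p)^-1 u) < th e.
  rewrite -pd0l -hdist_lt//.
  have <- : moebius (trans p)^-1 p = 0 by rewrite -[X in moebius _ X](trans0 p1) moebiusK.
  by rewrite hdist_moebius.
rewrite moebiusM//; last exact: su11M.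
rewrite moebiusM//; last exact: moebius_disc.
rewrite -PE TE -gE// /g moebiusVK// moebiusVK//; exact: fD.
Qed.

Lemma hball_square p (e : R) : disc p -> 0 < e -> exists2 d : R, 0 < d &
  forall q, square (ofC p) d q -> DD q /\ hdist p (toC q) < e.
Proof.
move=> p1 e0; have Dp : DD (ofC p) by apply/DDE; rewrite ofCK.
have [d1 d10 sD] := DD_square Dp.
have cp : 0 < 1 - cabs p by rewrite subr_gt0; exact/disc_cabs.
have t0 := th_gt0 e0; have t1 := th_lt1 e.
(* The denominator of [ph2] is at least [(1 - |p|)^2], while a square of half-side [d2] stays within
   [sqrt 2 * d2 < th e * (1 - |p|)] of its centre. *)
pose d2 := th e * (1 - cabs p) / 2.
have d20 : 0 < d2 by rewrite divr_gt0// mulr_gt0.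
exists (Num.min d1 d2); first by rewrite lt_min d10.
move=> q [/=]; rewrite !lt_min => /andP[q1 q2] /andP[q3 q4].
have Dq : DD q by apply: sD.
have q1' : disc (toC q) by exact/DDE.
split => //; rewrite hdist_lt//.
rewrite -(ltr_pXn2r (ltn0Sn 1)) ?nnegrE ?pd_ge0 ?(ltW t0)// sqr_pd.
rewrite /ph2 ltr_pdivrMr ?ph_den_gt0//.
have l1 : (1 - cabs p) ^+ 2 <= n2 (1 - Num.conj (toC q) * p).
  rewrite -sqr_cabs ler_pXn2r ?nnegrE ?cabs_ge0 ?(ltW cp)//.
  have := cabsD (1 - Num.conj (toC q) * p) (Num.conj (toC q) * p).
  rewrite subrK cabs1 cabsM.
  have : cabs (Num.conj (toC q)) <= 1 by rewrite /cabs n2J; apply/ltW; exact/disc_cabs.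
  have := cabs_ge0 p; have := cabs_ge0 (Num.conj (toC q)); nra.
have l2 : n2 (p - toC q) <= 2 * d2 ^+ 2.
  rewrite n2B /n2 !cxE /= -[(q.1 - _) ^+ 2]real_normK ?num_real// -[(q.2 - _) ^+ 2]real_normK ?num_real//.
  move: q2 q4; rewrite /ofC/=; have := normr_ge0 (q.1 - re p); have := normr_ge0 (q.2 - im p); nra.
apply: le_lt_trans l2 _; apply: lt_le_trans (_ : _ < th e ^+ 2 * (1 - cabs p) ^+ 2) _; last first.
  by rewrite ler_wpM2l// sqr_ge0.
have dE : th e * (1 - cabs p) = 2 * d2 by rewrite /d2; field.
have d22 : 0 < d2 ^+ 2 by rewrite exprn_gt0.
rewrite [ltRHS](_ : _ = 4 * d2 ^+ 2); last by rewrite -exprMn dE; ring.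
by rewrite ltr_pM2r//; lra.
Qed.

Definition mcj c (p : R * R) : R * R := if c then (p.1, - p.2) else p.

Lemma toC_mcj c p : toC (mcj c p) = cj c (toC p). Proof. by case: c. Qed.
Lemma mcjK c p : mcj c (mcj c p) = p. Proof. by case: c => //; case: p => a b; rewrite /mcj/= opprK. Qed.
Lemma nsq_mcj c p : nsq (mcj c p) = nsq p. Proof. by case: c => //; rewrite /nsq/= sqrrN. Qed.
Lemma DD_mcj c p : DD p -> DD (mcj c p). Proof. by rewrite /DD/= nsq_mcj. Qed.

Lemma measurable_mcj c : measurable_fun setT (mcj c).
Proof.
by case: c; rewrite /mcj//; mreal.
Qed.

Lemma ge0_integral_mcj c (g : R * R -> \bar R) :
  measurable_fun setT g -> (forall p, (0 <= g p)%E) ->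
  (\int[@hmu R]_(p in @DD R) g (mcj c p) = \int[@hmu R]_(p in @DD R) g p)%E.
Proof.
case: c => // mg g0.
have mgc : measurable_fun setT (g \o mcj true) by apply: measurableT_comp => //; exact: measurable_mcj.
have mo : measurable_fun setT (fun p : R * R => (omega p)%:E) by apply/measurable_EFinP; exact: measurable_omega.
have h := ge0_integral_hmu_DD mgc (fun p => g0 _); rewrite /= in h; rewrite h.
rewrite (ge0_integral_hmu_DD mg)//.
have oc p : omega (mcj true p) = omega p :> R.
  have [Dp|Dp] := pselect (DD p); first by rewrite !omegaE ?nsq_mcj//; exact: DD_mcj.
  by rewrite !omega_out//; move=> /(DD_mcj true); rewrite mcjK.
rewrite !ge0_integral_hmu// -[RHS]ge0_integral_conj//; last 2 first.
- by apply: emeasurable_funM.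
- by move=> p; rewrite mule_ge0// lee_fin omega_ge0.
by apply: eq_integral => p _; rewrite -(oc p).
Qed.

End rigidity.

(** * Area comparison and embedded balls *)

Section injectivity_radius.
Context (R : realType) (Gam : set 'M[R[i]]_2) (fG : cocompact_fuchsian Gam).
Implicit Types (z w a b : R[i]) (A B : 'M[R[i]]_2) (p q : R * R).

Let sG : su11_subgroup Gam. Proof. by case: fG. Qed.
Let dG : discrete_group Gam. Proof. by case: fG. Qed.
Let sub A : Gam A -> su11 A. Proof. by case: sG => + _ _ _ _; apply. Qed.
Let GM A B : Gam A -> Gam B -> Gam (A * B). Proof. by case: sG => _ _ _ + _; apply. Qed.
Let GV A : Gam A -> Gam A^-1. Proof. by case: sG => _ _ _ _; apply. Qed.

Lemma qdist_moebiusl A z w : Gam A -> disc z -> disc w ->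
  qdist Gam (moebius A z) w = qdist Gam z w.
Proof.
move=> GA z1 w1; have sA := sub GA; have Az := moebius_disc sA z1.
apply/eqP; rewrite eq_le; apply/andP; split; apply: (qdist_ge sG) => B GB; have sB := sub GB;
  have Bw := moebius_disc sB w1.
  rewrite -(hdist_moebius sA)// -moebiusM//; apply: (qdist_le sG) => //; exact: GM.
rewrite -(hdist_moebius (su11_inv sA))// moebiusK// -moebiusM//; last exact: su11_inv.
by apply: (qdist_le sG) => //; apply: GM => //; exact: GV.
Qed.

(** A local isometry from the disc to X is locally a disc automorphism, possibly
    precomposed with complex conjugation, followed by the projection. *)
Lemma local_isometry_quotient (phi : R[i] -> R[i]) p (r : R) : disc (toC p) -> hball r (toC p) ->
  (forall u, hball r u -> disc (phi u)) ->
  (exists2 e : R, 0 < e & forall u v, hball r u -> hball r v ->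
     hdist (toC p) u < e -> hdist (toC p) v < e ->
     qdist Gam (phi u) (phi v) = hdist u v) ->
  exists n B c, [/\ ratbox n p, su11 B & forall q, ratbox n q -> DD q -> hball r (toC q) ->
    exists2 A, Gam A & phi (toC q) = moebius A (moebius B (cj c (toC q)))].
Proof.
move=> p1 [_ pr] phiD [e e0 he].
have [e1 e10 sys] := systole fG.
have d0 := disc0 R.
pose d := Num.min (Num.min e (r - hdist 0 (toC p))) (e1 / 4).
have [d1 d2 d3] : [/\ d <= e, d <= r - hdist 0 (toC p) & d <= e1 / 4].
  by split; rewrite /d !ge_min lexx ?orbT.
have dp : 0 < d by rewrite !lt_min e0 subr_gt0 pr divr_gt0.
have W u : disc u -> hdist (toC p) u < d -> hball r u.
  move=> u1 hu; split => //; apply: le_lt_trans (hdist_triangle p1 d0 u1) _; lra.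
have pW : hball r (toC p) by [].
have phip := phiD _ pW.
(* [phi] may jump between points of an orbit. Replacing [phi u] by a translate nearest to the image
   of the centre gives a map into the disc whose values stay within half the systole of one another,
   so that [qdist] becomes [hdist]. *)
have ch u : exists A, disc u -> hdist (toC p) u < d -> Gam A /\ hdist (phi (toC p)) (moebius A (phi u)) = hdist (toC p) u.
  have [u1|] := pselect (disc u); last by exists 1.
  have [hu|] := pselect (hdist (toC p) u < d); last by exists 1.
  have Wu := W _ u1 hu.
  have E : qdist Gam (phi (toC p)) (phi u) = hdist (toC p) u.
    by apply: he => //; rewrite ?hdistxx//; lra.
  have [|A GA hA] := qdist_near sG sys phip (phiD _ Wu); first by rewrite E; lra.
  by exists A => _ _; rewrite hA E.
have [ga gaP] := choice ch.
pose f u := moebius (ga u) (phi u).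
have fD u : disc u -> hdist (toC p) u < d -> disc (f u).
  by move=> u1 hu; have [GA _] := gaP u u1 hu; apply: moebius_disc; [exact: sub|exact/phiD/W].
have [B [c [sB BE]]] : exists B c, su11 B /\ forall u, disc u -> hdist (toC p) u < d -> f u = moebius B (cj c u).
  apply: local_isometry => // u v u1 v1 hu hv.
  have [Gu eu] := gaP u u1 hu; have [Gv ev] := gaP v v1 hv.
  have Wu := W _ u1 hu; have Wv := W _ v1 hv.
  rewrite -(he u v)//; [|lra|lra].
  rewrite -(qdist_moebiusl Gu (phiD _ Wu) (phiD _ Wv)) -(qdist_moebius sG Gv)//; last 2 first.
  - exact: fD.
  - exact: phiD.
  rewrite (qdist_close sG sys)//; [exact: fD|exact: fD|].
  apply: le_lt_trans (hdist_triangle phip (fD _ u1 hu) (fD _ v1 hv)) _.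
  by rewrite hdistC eu ev; lra.
have [d4 d40 sq] := hball_square p1 dp; rewrite toCK in sq.
have [n [np nsub]] := ratbox_basis p d40.
exists n, B, c; split => // q /nsub/sq[Dq hq] _ Wq.
have q1 : disc (toC q) by exact/DDE.
have [Gq _] := gaP _ q1 hq; exists (ga (toC q))^-1; first exact: GV.
by rewrite -BE// /f moebiusK//; [exact: sub|exact: phiD].
Qed.

Lemma hball_nball (r : R) p : 0 < r -> hball r (toC p) <-> nball (th r ^+ 2) p.
Proof.
move=> r0; have t0 := th_gt0 r0; have t1 := th_lt1 r; rewrite /hball /nball /= nsqE.
have E : disc (toC p) -> (hdist 0 (toC p) < r) = (n2 (toC p) < th r ^+ 2).
  move=> p1; rewrite hdist_lt//; last exact: disc0.
  by rewrite pd0l -sqr_cabs ltr_pXn2r// ?nnegrE ?cabs_ge0// ltW.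
split => [[p1]|h]; first by rewrite E.
have p1 : disc (toC p) by apply/discE; apply: lt_trans h _; rewrite expr_lt1// ltW.
by rewrite E.
Qed.

Lemma pball_hdist z (r : R) p : disc z -> 0 < r -> DD p ->
  pball z (th r ^+ 2) p <-> hdist z (toC p) < r.
Proof.
move=> z1 r0 Dp; have p1 : disc (toC p) by exact/DDE.
have t0 := th_gt0 r0.
rewrite hdist_lt// -(ltr_pXn2r (ltn0Sn 1)) ?nnegrE ?pd_ge0 ?(ltW t0)// sqr_pd.
by split => [[]|].
Qed.

(** A non-injective ball would have area strictly less than the hyperbolic disc
    of the same radius, whereas an isometry preserves areas. *)
Lemma ball_isometric_inj z (r : R) A a : ball_isometric_to_disc Gam z r ->
  disc z -> disc a -> Gam A -> hdist z a < r -> hdist z (moebius A a) < r ->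
  moebius A a = a.
Proof.
move=> [phi [phiD phiS phiI phiL]] z1 a1 GA ha hb; set b := moebius A a in hb *.
have sA := sub GA; have b1 : disc b by exact: moebius_disc.
have [e1 e10 sys] := systole fG.
have r0 : 0 < r by apply: le_lt_trans ha; exact: hdist_ge0.
apply/eqP/negPn/negP => /eqP ab.
have hab : 0 < hdist a b.
  rewrite lt_neqAle hdist_ge0// andbT; apply/eqP => /esym h.
  by apply: ab; rewrite (hdist_eq0 a1 b1 h).
(* The discs of radius [eta] about [a] and [b] are disjoint and lie in the ball about [z], yet [A]
   identifies them in X: removing the second one from the ball loses no point of X. *)
pose eta := Num.min (Num.min (r - hdist z a) (r - hdist z b)) (hdist a b / 2).
have [l1 l2 l3] : [/\ eta <= r - hdist z a, eta <= r - hdist z b & eta <= hdist a b / 2].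
  by split; rewrite /eta !ge_min lexx ?orbT.
have eta0 : 0 < eta by rewrite !lt_min !subr_gt0 ha hb divr_gt0.
have thr (t : R) : 0 < t -> th t ^+ 2 < 1 by move=> t0; rewrite expr_lt1 ?th_lt1// ltW// th_gt0.
pose Bs := pball z (th r ^+ 2); pose U := pball b (th eta ^+ 2).
have mB : measurable Bs := measurable_pball _ z1.
have mU : measurable U := measurable_pball _ b1.
have UB : U `<=` Bs.
  move=> p [Dp hp]; have p1 : disc (toC p) by exact/DDE.
  apply/(pball_hdist z1 r0 Dp); apply: le_lt_trans (hdist_triangle b1 z1 p1) _.
  have : hdist b (toC p) < eta by apply/(pball_hdist b1 eta0 Dp).
  lra.
(* Nothing is known about the measurability of [phi]. On a small rational square it agrees, up to
   the group, with one disc isometry; countably many squares suffice, and these isometries are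
   measurable. *)
pose G (n : nat) (k : 'M[R[i]]_2 * bool) := su11 k.1 /\ forall q, ratbox n q -> DD q -> hball r (toC q) ->
    exists2 A, Gam A & phi (toC q) = moebius A (moebius k.1 (cj k.2 (toC q))).
pose Bc n := xget (1 : 'M[R[i]]_2, false) [set k | G n k].
have sB n : su11 (Bc n).1.
  by rewrite /Bc; case: xgetP => [k _ []//|_]; exact: su11_1.
have [A_ [GA_ enum]] := enumerate_group sG dG.
pose ix (j : nat) : nat * nat := odflt (0, 0)%N (unpickle j).
pose M j := A_ (ix j).2 * (Bc (ix j).1).1.
have sM j : su11 (M j) by apply: su11M => //; exact: sub.
pose tau j p := mz (M j) (mcj (Bc (ix j).1).2 p).
pose sig j p := mcj (Bc (ix j).1).2 (mz (M j)^-1 p).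
have mtau j : measurable_fun setT (tau j).
  by apply: (@measurableT_comp _ _ _ _ _ _ (mz (M j))); [exact: measurable_mz|exact: measurable_mcj].
have msig j : measurable_fun setT (sig j).
  by apply: (@measurableT_comp _ _ _ _ _ _ (mcj _)); [exact: measurable_mcj|exact: measurable_mz].
pose E := nball (th r ^+ 2); pose E' := Bs `\` U.
have mE : measurable E := measurable_nball _.
have mE' : measurable E' by exact: measurableD.
have ED : E `<=` @DD R by move=> p; apply: nball_DD; exact/ltW/thr.
have BD : Bs `<=` @DD R by move=> p [].
(* The index [j] codes a square and a group element. The first factor, everything or nothing,
   discards the squares without a valid isometry, where [Bc] is only a default. *)
pose S j := [set p | G (ix j).1 (Bc (ix j).1)] `&` (ratbox (ix j).1 `&` tau j @^-1` E').
have mS j : measurable (S j).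
  have [g|g] := pselect (G (ix j).1 (Bc (ix j).1)).
    rewrite /S (_ : [set p | _] = setT); last by apply/seteqP; split.
    rewrite setTI; apply: measurableI; first exact: measurable_ratbox.
    by rewrite -[X in measurable X]setTI; exact: mtau.
  by rewrite /S (_ : [set p | _] = set0) ?set0I//; apply/seteqP; split.
have tauE j p : DD p -> toC (tau j p) =
    moebius (A_ (ix j).2) (moebius (Bc (ix j).1).1 (cj (Bc (ix j).1).2 (toC p))).
  move=> /DDE p1; rewrite /tau toC_mz toC_mcj /M moebiusM//; [exact: sub|exact: cj_disc].
have hbE p : E p -> hball r (toC p) by move=> Ep; apply/(hball_nball p r0).
have phiE j p : E p -> S j p -> exists2 C, Gam C & toC (tau j p) = moebius C (phi (toC p)).
  move=> Ep [[_ gP] [rp _]]; have [C GC hC] := gP _ rp (ED _ Ep) (hbE _ Ep).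
  have p1 : disc (cj (Bc (ix j).1).2 (toC p)) by apply/cj_disc/DDE/ED.
  have p2 := moebius_disc (sB (ix j).1) p1.
  exists (A_ (ix j).2 * C^-1); first by apply: GM => //; exact: GV.
  rewrite tauE; last exact: ED.
  rewrite hC moebiusM; first by rewrite moebiusK//; exact: sub.
  - exact: sub.
  - exact/su11_inv/sub.
  - by apply: moebius_disc => //; exact: sub.
have le1 : (\int[@hmu R]_(p in E) 1 <= \int[@hmu R]_(p in E') 1)%E.
  apply: (@transport_le _ _ _ (@hmu R) (@DD R) E E' S tau sig) => //.
  - exact: measurable_DD.
  - by move=> p [/BD].
  - move=> p Ep; have hp := hbE _ Ep; have Dp := ED _ Ep; have p1 : disc (toC p) by exact/DDE.
    have [n [B [c [np sB' BP]]]] := local_isometry_quotient p1 hp (fun u hu => (phiD u hu).1) (phiL _ hp).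
    have gn : G n (Bc n).
      by rewrite /Bc; case: xgetP => [//|/(_ (B, c))]; case.
    have [C GC hC] := gn.2 _ np Dp hp.
    have [phi1 phir] := phiD _ hp.
    have [C1 GC1 hC1] := qdist_lt sG z1 phi1 phir.
    pose x := moebius C1 (phi (toC p)).
    have x1 : disc x by apply: moebius_disc => //; exact: sub.
    have Dx : DD (ofC x) by apply/DDE; rewrite ofCK.
    have Bx : Bs (ofC x) by apply/(pball_hdist z1 r0 Dx); rewrite ofCK.
    (* A translate of the image that falls in the removed disc [U] about [b] is carried by [A^-1] to
       the disc about [a], which is still present. *)
    have [C2 GC2 hC2] : exists2 C2, Gam C2 & E' (ofC (moebius C2 (phi (toC p)))).
      have [Ux|] := pselect (U (ofC x)); last by exists C1.
      have bx : hdist b x < eta by move: Ux => /(pball_hdist b1 eta0 Dx); rewrite ofCK.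
      pose y := moebius A^-1 x; have sV := su11_inv sA.
      have y1 : disc y by exact: moebius_disc.
      have Dy : DD (ofC y) by apply/DDE; rewrite ofCK.
      have ay : hdist a y = hdist b x by rewrite -(hdist_moebius sA)// moebiusVK.
      exists (A^-1 * C1); first by apply: GM => //; exact: GV.
      rewrite moebiusM//; last exact: sub.
      split; first by apply/(pball_hdist z1 r0 Dy); rewrite ofCK; apply: le_lt_trans (hdist_triangle a1 z1 y1) _; lra.
      move=> /(pball_hdist b1 eta0 Dy); rewrite ofCK => byy.
      have := hdist_triangle y1 a1 b1; rewrite (hdistC y b); lra.
    have [m hm] := enum (C2 * C) (GM GC2 GC).
    exists (pickle (n, m)) => //; split; first by rewrite /= /ix pickleK.
    split; first by rewrite /= /ix pickleK.
    have cp1 : disc (cj (Bc n).2 (toC p)) by exact: cj_disc.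
    have Bcp1 := moebius_disc (sB n) cp1.
    rewrite /= -[tau _ p]toCK tauE// /ix pickleK /= hm moebiusM -?hC//; exact: sub.
  - by move=> j p Dp; apply: disc_mz => //; exact: DD_mcj.
  - by move=> j p Dp; apply/DD_mcj/disc_mz => //; exact: su11_inv.
  - by move=> j p Dp; rewrite /sig /tau mzK ?mcjK//; exact: DD_mcj.
  - by move=> j p Dp; rewrite /sig /tau mcjK mzVK.
  - move=> j g mg g0; rewrite -(ge0_integral_mz_DD (sM j) mg g0).
    have mgM : measurable_fun setT (g \o mz (M j)) by apply: measurableT_comp => //; exact: measurable_mz.
    by rewrite -(ge0_integral_mcj (Bc (ix j).1).2 mgM (fun p => g0 _)).
  - by move=> j p _ [_ []].
  - move=> j k p q Ep Sp Eq Sq e.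
    have [C GC hC] := phiE j p Ep Sp; have [C' GC' hC'] := phiE k q Eq Sq.
    rewrite -[p]toCK -[q]toCK; congr ofC.
    have [p1 _] := phiD _ (hbE _ Ep); have [q1 _] := phiD _ (hbE _ Eq).
    apply: phiI; [exact: hbE|exact: hbE|].
    exists (C'^-1 * C); first by apply: GM => //; exact: GV.
    rewrite moebiusM; [|exact/su11_inv/sub|exact: sub|exact: p1].
    by rewrite -hC e hC' moebiusK; [|exact: sub|].
move: le1; rewrite !integral_cst// !mul1e.
have fB : (hmu Bs < +oo)%E.
  by rewrite hmu_pball ?hmu_nball_lty//; [exact: thr|exact/ltW/thr].
rewrite (measureD (mu := @hmu R) mB mU fB).
have -> : Bs `&` U = U by apply/setIidPr.
have U0 : (0 < hmu U)%E.
  by rewrite hmu_pball// ?hmu_nball_gt0 ?exprn_gt0 ?th_gt0//; exact/ltW/thr.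
have BE : (hmu Bs = hmu E)%E by rewrite hmu_pball//; exact/ltW/thr.
have fU : (hmu U < +oo)%E by apply: le_lt_trans fB; apply: le_measure; rewrite ?inE.
move=> h; have {h}: (hmu E <= hmu Bs - hmu U)%E by exact: h.
rewrite -BE leNgt => /negP; apply.
have fnB : (hmu Bs \is a fin_num)%E by rewrite ge0_fin_numE; [exact: fB|exact: measure_ge0].
by rewrite lteBlDr ?ge0_fin_numE// lteDl.
Qed.

(** A point outside the ball provided by cocompactness must be moved into it, so some element acts
    nontrivially; a fixed point would make it [1] or [- 1] by the systole. *)
Lemma nontrivial_element : exists2 A, Gam A & forall z, disc z -> moebius A z <> z.
Proof.
have [_ _ _ cc] := fG; have [r [r0 r1 cov]] := cocompact_ball cc.
have [e1 e10 sys] := systole fG.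
pose x : R := (1 + r) / 2; have x1 : disc ((x%:C)%C).
  by apply/disc_cabs; rewrite cabsC ger0_norm /x; lra.
have [A GA hA] := cov _ x1; exists A => // z z1 Az.
have nx : moebius A (x%:C)%C <> (x%:C)%C.
  by move=> h; move: hA; rewrite h cabsC ger0_norm /x; lra.
apply: nx; apply: (moebius_short sys _ GA z1); by rewrite Az hdistxx.
Qed.

(** The real [sup] has its meaning only for nonempty bounded sets. The bound is the displacement of
    [z] by a fixed-point-free element: a larger ball contains [z] and its translate. *)
Lemma inj_radius_at_has_sup z : disc z ->
  has_sup [set r | 0 < r /\ ball_isometric_to_disc Gam z r].
Proof.
move=> z1; have [e1 e10 sys] := systole fG; split.
  exists (e1 / 4); have e4 : 0 < e1 / 4 by rewrite divr_gt0.
  by split => //; exact: (small_ball_isometric sG e10 sys).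
have [A GA hA] := nontrivial_element; exists (hdist z (moebius A z)) => r [r0 hr].
rewrite leNgt; apply/negP => h; apply: (hA z) => //.
by apply: (ball_isometric_inj hr) => //; rewrite hdistxx.
Qed.

Lemma inj_radius_lbound : exists2 e : R, 0 < e & forall z, disc z -> e <= inj_radius_at Gam z.
Proof.
have [e1 e10 sys] := systole fG; have e4 : 0 < e1 / 4 by rewrite divr_gt0.
exists (e1 / 4) => // z z1; apply: (ub_le_sup (inj_radius_at_has_sup z1).2).
by split => //; exact: (small_ball_isometric sG e10 sys).
Qed.

Lemma inj_radius_gt0 : 0 < inj_radius Gam.
Proof.
have [e e0 he] := inj_radius_lbound; apply: lt_le_trans e0 _.
apply: lb_le_inf; first by exists (inj_radius_at Gam 0), 0 => //; exact: disc0.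
by move=> _ [z z1 <-]; exact: he.
Qed.

(** Both distances being strictly below the supremum at [z], some admissible radius exceeds them,
    and [ball_isometric_inj] applies to it. The supremum itself need not be known to be attained. *)
Lemma inj_radius_inj z a A : disc z -> disc a -> Gam A ->
  hdist z a < inj_radius Gam -> hdist z (moebius A a) < inj_radius Gam -> moebius A a = a.
Proof.
move=> z1 a1 GA h1 h2; have [e e0 he] := inj_radius_lbound.
have le1 : inj_radius Gam <= inj_radius_at Gam z.
  by apply: ge_inf; [exists e => _ [w w1 <-]; exact: he|exists z].
pose m := Num.max (hdist z a) (hdist z (moebius A a)).
have m1 : m < inj_radius_at Gam z by apply: lt_le_trans le1; rewrite gt_max h1.
have m0 : 0 < inj_radius_at Gam z - m by rewrite subr_gt0.
have [r [r0 hr] mr] := sup_adherent m0 (inj_radius_at_has_sup z1).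
rewrite -/(inj_radius_at Gam z) opprB addrC subrK in mr.
by apply: (ball_isometric_inj hr) => //; apply: le_lt_trans mr; rewrite le_max lexx ?orbT.
Qed.

End injectivity_radius.

(** * Complex derivatives and Taylor expansion *)

Section complex_derivatives.
Context (R : realType).
Implicit Types (q f g : R[i] -> R[i]) (z w l m : R[i]).

Lemma cderiv_is_derive q z l : cderiv_at q z l ->
  is_derive (z : R[i]^o) (1 : R[i]^o) (q : R[i]^o -> R[i]^o) l.
Proof.
move=> H; suff cv : (fun h : R[i]^o => h^-1 *: ((q : R[i]^o -> R[i]^o) (h *: (1 : R[i]^o) + z) - q z)) @ 0^' --> (l : R[i]^o).
  by apply: DeriveDef; [apply/cvg_ex; exists l|exact: cvg_lim].
apply/cvgrPdist_lt => e e0.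
have eE : e = ((re e)%:C)%C by case: e e0 => x y; rewrite ltcE/= => /andP[/eqP -> _].
have re0 : 0 < re e by move: e0; rewrite eE ltcR.
have [d d0 Hd] := H (re e / 2) (divr_gt0 re0 (ltr0Sn _ _)).
exists ((d%:C)%C); first by rewrite /= ltcR.
move=> w /=; rewrite sub0r normrN cabsE ltcR => /Hd h w0.
rewrite /GRing.scale/= mulr1 cabsE eE ltcR.
have cw : 0 < cabs w by rewrite lt_neqAle cabs_ge0 eq_sym cabs_eq0 w0.
rewrite -(ltr_pM2r cw) -cabsM.
have -> : (l - w^-1 * (q (w + z) - q z)) * w = - (q (z + w) - q z - l * w).
  by rewrite [w + z]addrC; field.
by rewrite cabsN; apply: le_lt_trans h _; rewrite ltr_pM2r//; lra.
Qed.

Lemma is_derive_cderiv q z l : is_derive (z : R[i]^o) (1 : R[i]^o) (q : R[i]^o -> R[i]^o) l ->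
  cderiv_at q z l.
Proof. by move=> [dq <-]; exact: derivable_cderiv. Qed.

Lemma cderivM f g z l m : cderiv_at f z l -> cderiv_at g z m ->
  cderiv_at (fun w => f w * g w) z (f z * m + g z * l).
Proof.
by move=> /cderiv_is_derive df /cderiv_is_derive dg; apply: is_derive_cderiv.
Qed.

Lemma cderiv_comp f g z l m : cderiv_at g z m -> cderiv_at f (g z) l ->
  cderiv_at (fun w => f (g w)) z (l * m).
Proof.
move=> Hg Hf e e0; have cm := cabs_ge0 m; have cl := cabs_ge0 l.
pose k := cabs m + 1; have k0 : 0 < k by rewrite ltr_wpDl.
have [df df0 Hdf] := Hf (e / 2 / k) (divr_gt0 (divr_gt0 e0 (ltr0Sn _ _)) k0).
pose k' := cabs l + 1; have k'0 : 0 < k' by rewrite ltr_wpDl.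
have e1 : 0 < Num.min 1 (e / 2 / k') by rewrite lt_min ltr01 !divr_gt0.
have [dg dg0 Hdg] := Hg _ e1.
exists (Num.min dg (df / k)); first by rewrite lt_min dg0 divr_gt0.
move=> w; rewrite lt_min => /andP[/Hdg h]; rewrite ltr_pdivlMr// => wk.
pose u := g (z + w) - g z.
have cw := cabs_ge0 w.
have h1 : cabs (u - m * w) <= cabs w.
  by apply: le_trans h _; rewrite -[leRHS]mul1r ler_wpM2r// ge_min lexx.
have h2 : cabs (u - m * w) <= e / 2 / k' * cabs w.
  by apply: le_trans h _; rewrite ler_wpM2r// ge_min lexx orbT.
have uk : cabs u <= k * cabs w.
  have := cabsD (u - m * w) (m * w); rewrite subrK cabsM /k; lra.
have := Hdf u; rewrite (_ : g z + u = g (z + w)); last by rewrite /u addrC subrK.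
move=> /(_ (le_lt_trans uk _)).
rewrite mulrC => /(_ wk) h3.
have -> : f (g (z + w)) - f (g z) - l * m * w =
    (f (g (z + w)) - f (g z) - l * u) + l * (u - m * w) by ring.
apply: le_trans (cabsD _ _) _; rewrite cabsM.
have h4 : cabs (f (g (z + w)) - f (g z) - l * u) <= e / 2 * cabs w.
  rewrite /u in h3 *; apply: le_trans h3 _; rewrite -/u -[leLHS]mulrA [leLHS]mulrA.
  rewrite -mulrA ler_wpM2l ?divr_ge0 ?(ltW e0)//.
  by rewrite mulrC ler_pdivrMr// mulrC.
have h5 : cabs l * cabs (u - m * w) <= e / 2 * cabs w.
  apply: (@le_trans _ _ (k' * (e / 2 / k' * cabs w))).
    by apply: ler_pM => //; rewrite ?cabs_ge0// /k' lerDl.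
  by rewrite le_eqVlt; apply/orP; left; apply/eqP; field; rewrite gt_eqF.
by apply: le_trans (lerD h4 h5) _; rewrite -mulrDl -splitr.
Qed.

Lemma cderiv_homography (a b c d z : R[i]) : c * z + d != 0 ->
  cderiv_at (fun w => (a * w + b) / (c * w + d)) z ((a * d - b * c) / (c * z + d) ^+ 2).
Proof.
move=> D0; apply: is_derive_cderiv.
have dl (u v : R[i]) : is_derive (z : R[i]^o) (1 : R[i]^o) (fun w : R[i]^o => u * w + v : R[i]^o) u.
  apply: cderiv_is_derive => e e0; exists 1 => // w _.
  by rewrite (_ : _ - _ = 0) ?cabs0 ?mulr_ge0 ?cabs_ge0 ?(ltW e0)//; ring.
have [dc cE] := dl c d; have dd := derivableV (f := fun w : R[i]^o => c * w + d : R[i]^o) D0 dc.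
have dV := DeriveDef dd (deriveV (f := fun w : R[i]^o => c * w + d : R[i]^o) D0 dc).
rewrite cE in dV.
have := is_deriveM (dl a b) dV; rewrite /GRing.scale/=.
by move=> /is_derive_eq; apply; field.
Qed.

Lemma moebius_derivE (A : 'M[R[i]]_2) z : su11 A -> disc z ->
  moebius_deriv A z = (den A z) ^- 2.
Proof.
move=> sA z1; have D0 := den_neq0 sA z1; have [_ _ dA] := sA.
have /cderiv_is_derive H := @cderiv_homography (A 0 0) (A 0 1) (A 1 0) (A 1 1) z D0.
rewrite /moebius_deriv derive1E (@derive_val _ _ _ _ _ _ _ H).
by rewrite -det2E dA mul1r.
Qed.

Lemma chol_moebius (A : 'M[R[i]]_2) : su11 A -> chol (moebius A).
Proof.
by move=> sA z z1; eexists; apply: cderiv_homography; exact: (den_neq0 sA z1).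
Qed.

Lemma cholM f g : chol f -> chol g -> chol (fun z => f z * g z).
Proof.
by move=> hf hg z z1; have [l fl] := hf _ z1; have [m gm] := hg _ z1; eexists; exact: cderivM fl gm.
Qed.

Lemma chol_comp f g : chol f -> chol g -> (forall z, disc z -> disc (g z)) -> chol (fun z => f (g z)).
Proof.
move=> hf hg gD z z1; have [m gm] := hg _ z1; have [l fl] := hf _ (gD _ z1).
by eexists; exact: cderiv_comp gm fl.
Qed.

Lemma chol_den_inv (A : 'M[R[i]]_2) : su11 A -> chol (fun z => (den A z)^-1).
Proof.
move=> sA z z1; exists ((0 * A 1 1 - 1 * A 1 0) / (A 1 0 * z + A 1 1) ^+ 2).
have := @cderiv_homography 0 1 (A 1 0) (A 1 1) z (den_neq0 sA z1).
rewrite (_ : (fun w => _) = (fun z => (den A z)^-1))//.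
by apply/funext => w; rewrite mul0r add0r div1r.
Qed.

End complex_derivatives.

(** * Second-order Taylor expansion in the plane *)

Section taylor.
Context (R : realType).
Implicit Types (a : R * R -> R) (p q h : R * R).

Lemma increment_le (f df : R -> R) (x h B : R) :
  (forall y, `|y - x| <= `|h| -> is_derive y 1 f (df y)) ->
  (forall y, `|y - x| <= `|h| -> `|df y| <= B) ->
  `|f (x + h) - f x| <= B * `|h|.
Proof.
move=> fd dB.
have cont (y : R) : `|y - x| <= `|h| -> {for y, continuous f}.
  by move=> /fd d; apply/differentiable_continuous/derivable1_diffP; exact: ex_derive.
have key (u v : R) : u <= v -> (forall y, u <= y <= v -> `|y - x| <= `|h|) ->
    `|f v - f u| <= B * (v - u).
  move=> uv H; have [||c cuv ->] := @MVT_segment R f df u v uv.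
  - by move=> y; rewrite in_itv/= => /andP[/ltW y1 /ltW y2]; apply/fd/H; rewrite y1.
  - apply: continuous_in_subspaceT => y; rewrite inE/= in_itv/= => /H; exact: cont.
  rewrite normrM (ger0_norm (x := v - u)) ?subr_ge0// ler_wpM2r ?subr_ge0//.
  by apply/dB/H; move: cuv; rewrite in_itv.
have [h0|h0] := leP 0 h.
  have := key x (x + h); rewrite [x + h - x]addrC addKr (ger0_norm h0); apply; first by rewrite lerDl.
  by move=> y /andP[y1 y2]; rewrite ler_norml; apply/andP; split; lra.
have := key (x + h) x; rewrite distrC opprD addNKr (ltr0_norm h0); apply; first by rewrite gerDl ltW.
by move=> y /andP[y1 y2]; rewrite ler_norml; apply/andP; split; lra.
Qed.

(** Two applications of the mean value inequality. The second derivative is compared with a constant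
    [c], so closeness to [c] on the segment is all that is asked of it. *)
Lemma taylor_line (f f1 f2 : R -> R) (x h c K : R) :
  (forall y, `|y - x| <= `|h| -> is_derive y 1 f (f1 y)) ->
  (forall y, `|y - x| <= `|h| -> is_derive y 1 f1 (f2 y)) ->
  (forall y, `|y - x| <= `|h| -> `|f2 y - c| <= K) ->
  `|f (x + h) - f x - f1 x * h - 2^-1 * c * h ^+ 2| <= K * h ^+ 2.
Proof.
move=> d1 d2 b; pose phi y := f y - f1 x * y - 2^-1 * c * (y - x) ^+ 2.
have H1 y : `|y - x| <= `|h| -> is_derive y 1 phi (f1 y - f1 x - c * (y - x)).
  move=> yx; have d := d1 _ yx; apply: is_derive_eq.
  by rewrite /GRing.scale/=; field.
have H2 y : `|y - x| <= `|h| -> `|f1 y - f1 x - c * (y - x)| <= K * `|h|.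
  move=> yx; have := @increment_le (fun t => f1 t - c * t) (fun t => f2 t - c) x (y - x) K.
  rewrite (_ : x + (y - x) = y); last by rewrite addrC subrK.
  move=> H; apply: le_trans (_ : _ <= K * `|y - x|) _.
    rewrite (_ : f1 y - f1 x - c * (y - x) = f1 y - c * y - (f1 x - c * x)); last by ring.
    apply: H => t tx; have tx' := le_trans tx yx; last exact: b.
    have d := d2 _ tx'; apply: is_derive_eq; by rewrite /GRing.scale/=; ring.
  by apply: ler_wpM2l => //; apply: le_trans (b x _); rewrite ?subrr ?normr0.
have := increment_le H1 H2; rewrite -mulrA -expr2 real_normK ?num_real//; congr (`|_| <= _).
by rewrite /phi subrr; ring.
Qed.

Definition partial1 a a1 := forall p, DD p -> is_derive p.1 1 (fun t : R => a (t, p.2)) (a1 p).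
Definition partial2 a a2 := forall p, DD p -> is_derive p.2 1 (fun t : R => a (p.1, t)) (a2 p).

Definition rect p h : set (R * R) :=
  [set q | `|q.1 - p.1| <= `|h.1| /\ `|q.2 - p.2| <= `|h.2|].

(** The increment is taken along the vertical side and then the upper horizontal one; the mixed
    derivative enters through the variation of [a1] along the vertical side, hence only as [a12]. *)
Lemma taylor2 a a1 a2 a11 a12 a22 p h (c11 c12 c22 K : R) :
  partial1 a a1 -> partial2 a a2 -> partial1 a1 a11 -> partial2 a1 a12 -> partial2 a2 a22 ->
  rect p h `<=` @DD R ->
  (forall q, rect p h q -> [/\ `|a11 q - c11| <= K, `|a12 q - c12| <= K & `|a22 q - c22| <= K]) ->
  `|a (p.1 + h.1, p.2 + h.2) - a p - (a1 p * h.1 + a2 p * h.2) -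
    (2^-1 * c11 * h.1 ^+ 2 + c12 * (h.1 * h.2) + 2^-1 * c22 * h.2 ^+ 2)| <= 2 * K * (h.1 ^+ 2 + h.2 ^+ 2).
Proof.
case: p h => x y [s t] /= d1 d2 d11 d12 d22 sub bd.
have rc u v : `|u - x| <= `|s| -> `|v - y| <= `|t| -> rect (x, y) (s, t) (u, v) by [].
have tt : `|y + t - y| <= `|t| by rewrite [y + t]addrC addrK.
have t0 : `|y - y| <= `|t| by rewrite subrr normr0.
have x0 : `|x - x| <= `|s| by rewrite subrr normr0.
have K0 : 0 <= K by have [+ _ _] := bd _ (rc _ _ x0 t0); apply: le_trans.
have e1 := @taylor_line (fun u => a (u, y + t)) (fun u => a1 (u, y + t)) (fun u => a11 (u, y + t)) x s c11 K.
have {}e1 : `|a (x + s, y + t) - a (x, y + t) - a1 (x, y + t) * s - 2^-1 * c11 * s ^+ 2| <= K * s ^+ 2.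
  apply: e1 => u us; have r := rc _ _ us tt.
  - exact: (d1 _ (sub _ r)).
  - exact: (d11 _ (sub _ r)).
  - by have [] := bd _ r.
have e3 := @taylor_line (fun v => a (x, v)) (fun v => a2 (x, v)) (fun v => a22 (x, v)) y t c22 K.
have {}e3 : `|a (x, y + t) - a (x, y) - a2 (x, y) * t - 2^-1 * c22 * t ^+ 2| <= K * t ^+ 2.
  apply: e3 => v vt; have r := rc _ _ x0 vt.
  - exact: (d2 _ (sub _ r)).
  - exact: (d22 _ (sub _ r)).
  - by have [] := bd _ r.
have e2 := @increment_le (fun v => a1 (x, v) - c12 * v) (fun v => a12 (x, v) - c12) y t K.
have {}e2 : `|a1 (x, y + t) - c12 * (y + t) - (a1 (x, y) - c12 * y)| <= K * `|t|.
  apply: e2 => v vt; have r := rc _ _ x0 vt; last by have [] := bd _ r.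
  have d := d12 _ (sub _ r); rewrite /= in d.
  by apply: is_derive_eq; rewrite /GRing.scale/=; ring.
set E1 := (X in `|X| <= K * s ^+ 2) in e1; set E3 := (X in `|X| <= K * t ^+ 2) in e3.
set E2 := (X in `|X| <= K * `|t|) in e2.
have -> : a (x + s, y + t) - a (x, y) - (a1 (x, y) * s + a2 (x, y) * t) -
   (2^-1 * c11 * s ^+ 2 + c12 * (s * t) + 2^-1 * c22 * t ^+ 2) = E1 + E3 + E2 * s.
  by rewrite /E1 /E2 /E3; ring.
have e4 : `|E2 * s| <= K * (s ^+ 2 + t ^+ 2).
  rewrite normrM -[s ^+ 2]real_normK ?num_real// -[t ^+ 2]real_normK ?num_real//.
  have u0 := normr_ge0 s; have v0 := normr_ge0 t.
  apply: le_trans (ler_wpM2r u0 e2) _; rewrite -mulrA ler_wpM2l//.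
  have := sqr_ge0 (`|s| - `|t|); have := sqr_ge0 (`|s|); have := sqr_ge0 (`|t|); nra.
apply: le_trans (ler_normD _ _) _; apply: le_trans (lerD (ler_normD _ _) (lexx _)) _.
by move: e1 e3 e4; lra.
Qed.

(** [taylor2] is applied to the same increment along the two orders of the coordinates. The
    expansions differ by [(a12 - a21) * d ^+ 2] at [p], which is therefore at most [e * d ^+ 2]. *)
Lemma mixed_partials a a1 a2 a11 a12 a21 a22 p :
  partial1 a a1 -> partial2 a a2 -> partial1 a1 a11 -> partial2 a1 a12 ->
  partial1 a2 a21 -> partial2 a2 a22 -> DD p ->
  pcont a11 p -> pcont a12 p -> pcont a21 p -> pcont a22 p -> a12 p = a21 p.
Proof.
move=> d1 d2 d11 d12 d21 d22 Dp k11 k12 k21 k22.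
apply/eqP; rewrite -subr_eq0 -normr_le0; apply/ler_addgt0Pl => e e0; rewrite addr0.
have e8 : 0 < e / 8 by rewrite divr_gt0.
have [b0 b00 B0] := DD_square Dp.
have [b1 b10 B1] := k11 _ e8; have [b2 b20 B2] := k12 _ e8.
have [b3 b30 B3] := k21 _ e8; have [b4 b40 B4] := k22 _ e8.
pose d := Num.min b0 (Num.min (Num.min b1 b2) (Num.min b3 b4)) / 2.
have d0 : 0 < d by rewrite divr_gt0// !lt_min b00 b10 b20 b30 b40.
have sq b : Num.min b0 (Num.min (Num.min b1 b2) (Num.min b3 b4)) <= b -> rect p (d, d) `<=` square p b.
  have dd : d < Num.min b0 (Num.min (Num.min b1 b2) (Num.min b3 b4)).
    by rewrite /d; move: d0; rewrite /d; lra.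
  move=> mb q [/=]; rewrite (gtr0_norm d0) => q1 q2.
  by split; [apply: le_lt_trans q1 _|apply: le_lt_trans q2 _]; apply: lt_le_trans dd mb.
have sD : rect p (d, d) `<=` @DD R by move=> q /(sq b0)/B0; apply; rewrite ge_min lexx.
have s1 : rect p (d, d) `<=` square p b1 by apply: sq; rewrite !ge_min lexx !orbT.
have s2 : rect p (d, d) `<=` square p b2 by apply: sq; rewrite !ge_min lexx !orbT.
have s3 : rect p (d, d) `<=` square p b3 by apply: sq; rewrite !ge_min lexx !orbT.
have s4 : rect p (d, d) `<=` square p b4 by apply: sq; rewrite !ge_min lexx !orbT.
have := @taylor2 a a1 a2 a11 a12 a22 p (d, d) (a11 p) (a12 p) (a22 p) (e / 8) d1 d2 d11 d12 d22 sD.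
move=> /(_ _)/=T1.
have {}T1 := T1 (fun q r => And3 (ltW (B1 _ (s1 _ r))) (ltW (B2 _ (s2 _ r))) (ltW (B4 _ (s4 _ r)))).
pose sw (f : R * R -> R) q := f (q.2, q.1).
have DS q : DD q -> DD (q.2, q.1) by rewrite /DD/= /nsq/= addrC.
have := @taylor2 (sw a) (sw a2) (sw a1) (sw a22) (sw a21) (sw a11) (p.2, p.1) (d, d) (a22 p) (a21 p) (a11 p) (e / 8).
rewrite /sw /= -surjective_pairing => T2.
have rS q : rect (p.2, p.1) (d, d) q -> rect p (d, d) (q.2, q.1) by move=> [].
have {}T2 := T2 (fun q Dq => d2 _ (DS _ Dq)) (fun q Dq => d1 _ (DS _ Dq)) (fun q Dq => d22 _ (DS _ Dq))
  (fun q Dq => d21 _ (DS _ Dq)) (fun q Dq => d11 _ (DS _ Dq)).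
have rD q : rect (p.2, p.1) (d, d) q -> DD q.
  by move=> /rS/sD/DS; rewrite -surjective_pairing.
have {}T2 := T2 rD (fun q r => And3 (ltW (B4 _ (s4 _ (rS _ r)))) (ltW (B3 _ (s3 _ (rS _ r)))) (ltW (B1 _ (s1 _ (rS _ r))))).
have dd0 : 0 < d ^+ 2 by rewrite exprn_gt0.
rewrite -(ler_pM2r dd0) -[X in _ * X]ger0_norm ?(ltW dd0)// -normrM.
set X := (X in `|X| <= _) in T1; set Y := (X in `|X| <= _) in T2.
have -> : (a12 p - a21 p) * d ^+ 2 = Y - X by rewrite /X /Y; ring.
apply: le_trans (ler_normB _ _) _; apply: le_trans (lerD T2 T1) _.
by rewrite le_eqVlt; apply/orP; left; apply/eqP; field.
Qed.

End taylor.

(** * Local means and the Laplacian *)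

Section real_integrable.
Context d (T : measurableType d) (R : realType) (m : {measure set T -> \bar R}).
Context (D : set T) (mD : measurable D).
Implicit Types (f g : T -> R).
Local Notation rint f := (m.-integrable D (EFin \o f)).

Lemma rintD f g : rint f -> rint g -> rint (fun x => f x + g x).
Proof.
move=> hf hg; rewrite (_ : EFin \o _ = (EFin \o f) \+ (EFin \o g))%E//.
exact: integrableD.
Qed.

Lemma rintZ (k : R) f : rint f -> rint (fun x => k * f x).
Proof.
move=> hf; rewrite (_ : EFin \o _ = (fun x => k%:E * (f x)%:E))%E//.
exact: integrableZl.
Qed.

Lemma rintN f : rint f -> rint (fun x => - f x).
Proof.
move=> /(rintZ (-1)); rewrite (_ : (fun x => -1 * f x) = (fun x => - f x))//.
by apply/funext => x; rewrite mulN1r.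
Qed.

Lemma rintB f g : rint f -> rint g -> rint (fun x => f x - g x).
Proof. by move=> hf hg; apply: rintD => //; exact: rintN. Qed.

Lemma le_rint f g : measurable_fun D f -> (forall x, D x -> `|f x| <= g x) -> rint g -> rint f.
Proof.
move=> mf fg; apply: le_integrable => //; first exact/measurable_EFinP.
by move=> x Dx /=; rewrite lee_fin (ger0_norm (le_trans (normr_ge0 _) (fg _ Dx))) fg.
Qed.

Lemma rint_abs f : rint f -> rint (fun x => `|f x|).
Proof. by move=> /integrable_abse. Qed.

End real_integrable.

Section local_mean.
Context (R : realType).
Implicit Types (z w : R[i]) (p q : R * R) (a : R * R -> R).

Lemma pcont_integrable a (s : R) : s < 1 -> (forall p, DD p -> pcont a p) ->
  (@hmu R).-integrable (nball s) (EFin \o a).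
Proof.
move=> s1 ca; have [M M0 aM] := nball_bounded s1 ca.
apply: (@bounded_integrable _ _ _ _ _ _ M); first exact: measurable_nball.
- exact: hmu_nball_lty.
- apply: (measurable_funS (E := @DD R)) => //; first exact: measurable_DD.
    by move=> p; exact: nball_DD (ltW s1).
  by apply: measurable_pcont => // p; exact: DD_square.
- by move=> p sp; apply: aM; exact: ltW sp.
Qed.

Lemma chol_pcont (q : R[i] -> R[i]) : chol q -> forall p, DD p ->
  pcont (fun p => re (q (toC p))) p /\ pcont (fun p => im (q (toC p))) p.
Proof.
move=> hq p /DDE p1; have [l H] := hq _ p1.
by have := cderiv_pcont H; rewrite toCK.
Qed.

Lemma chol_mean0 (q : R[i] -> R[i]) (s : R) : chol q -> q 0 = 0 -> 0 < s -> s < 1 ->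
  \int[@hmu R]_(p in nball s) re (q (toC p)) = 0 /\
  \int[@hmu R]_(p in nball s) im (q (toC p)) = 0.
Proof.
move=> hq q0 s0 s1; have [c1 c2] := circle_mean_prop_chol hq.
have t0 : toC (0, 0) = 0 :> R[i] by [].
have [_ e1] := radial_mean (w := cst 1) (B := 1) s0 s1 (fun p Dp => (chol_pcont hq Dp).1) c1 (measurable_cst _) (fun=> ler01) (fun _ _ => lexx _).
have [_ e2] := radial_mean (w := cst 1) (B := 1) s0 s1 (fun p Dp => (chol_pcont hq Dp).2) c2 (measurable_cst _) (fun=> ler01) (fun _ _ => lexx _).
rewrite t0 q0 mul0r in e1; rewrite t0 q0 mul0r in e2.
split; [rewrite -[RHS]e1|rewrite -[RHS]e2];
  by apply: eq_Rintegral => p _; rewrite mulr1.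
Qed.

(** The displacement of [z] when the disc is recentred at [z]. It is holomorphic in [w] and zero at
    [w = 0], so [eta] and its square have mean zero over discs about 0. *)
Definition eta z w : R[i] := moebius (trans z) w - z.

Lemma transE z w : disc z -> moebius (trans z) w = (w + z) / (Num.conj z * w + 1).
Proof.
move=> /discE z1; rewrite moebiusE /den /trans !suE.
set c := (((Num.sqrt (1 - n2 z))^-1)%:C)%C.
have c0 : c != 0.
  by rewrite -n2_eq0 n2C sqrf_eq0 invr_eq0 gt_eqF// sqrtr_gt0 subr_gt0.
have -> : Num.conj c = c by apply: complex_ext; rewrite !cxE ?oppr0.
rewrite rmorphM/= (_ : Num.conj c = c); last by apply: complex_ext; rewrite !cxE ?oppr0.
have -> : c * w + z * c = c * (w + z) by ring.
have -> : Num.conj z * c * w + c = c * (Num.conj z * w + 1) by ring.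
by rewrite invfM mulrACA mulfV// mul1r.
Qed.

Lemma etaE z w : disc z -> disc w ->
  eta z w = ((1 - n2 z)%:C)%C * w / (1 + Num.conj z * w).
Proof.
move=> z1 w1; rewrite /eta transE// addrC.
have d0 : 1 + Num.conj z * w != 0.
  rewrite -n2_eq0; have /discE zN : disc (- z) by apply/discE; rewrite n2N; exact/discE.
  have := ph_den_gt0 w1 (iffRL (discE (- z)) zN).
  by rewrite rmorphN mulNr opprK => /gt_eqF ->.
rewrite [_ * w + 1]addrC rmorphB/= -mulJ rmorph1; field.
exact: d0.
Qed.

Lemma n2_eta z w : disc z -> disc w ->
  n2 (eta z w) = (1 - n2 z) ^+ 2 * n2 w / n2 (1 + Num.conj z * w).
Proof. by move=> z1 w1; rewrite etaE// !n2M n2V n2C. Qed.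

Lemma eta_den_bounds z w (t : R) : disc z -> cabs w < t -> t < 1 ->
  (1 - t) ^+ 2 <= n2 (1 + Num.conj z * w) <= (1 + t) ^+ 2.
Proof.
move=> /disc_cabs z1 wt t1; have zw : cabs (Num.conj z * w) <= t.
  rewrite cabsM /cabs n2J -/(cabs z) -/(cabs w).
  have := cabs_ge0 z; have := cabs_ge0 w; nra.
have t0 : 0 < t by apply: le_lt_trans (cabs_ge0 w) wt.
rewrite -sqr_cabs; have c0 := cabs_ge0 (1 + Num.conj z * w); apply/andP; split.
  rewrite ler_pXn2r ?nnegrE ?subr_ge0 ?(ltW t1)//.
  have := cabsD (1 + Num.conj z * w) (- (Num.conj z * w)); rewrite addrK cabs1 cabsN; lra.
rewrite ler_pXn2r ?nnegrE ?addr_ge0 ?(ltW t0)//.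
by apply: le_trans (cabsD _ _) _; rewrite cabs1 lerD2l.
Qed.

Lemma eta_small z w (t : R) : disc z -> cabs w < t -> t <= 8^-1 ->
  cabs (eta z w) <= 4 * t * (1 - cabs z).
Proof.
move=> z1 wt t8; have t1 : t < 1 by lra.
have t0 : 0 < t by apply: le_lt_trans (cabs_ge0 w) wt.
have w1 : disc w by apply/disc_cabs; lra.
have /andP[b1 b2] := eta_den_bounds z1 wt t1.
have z1' : cabs z < 1 by exact/disc_cabs.
have cz := cabs_ge0 z; have cw := cabs_ge0 w.
have r0 : 0 <= 4 * t * (1 - cabs z) by rewrite !mulr_ge0 ?subr_ge0// ltW.
rewrite -(ler_pXn2r (ltn0Sn 1)) ?nnegrE ?cabs_ge0// sqr_cabs n2_eta//.
have d0 : 0 < n2 (1 + Num.conj z * w) by apply: lt_le_trans b1; rewrite exprn_gt0// subr_gt0.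
rewrite ler_pdivrMr// -!sqr_cabs.
have e1 : (1 - cabs z ^+ 2) ^+ 2 <= 4 * (1 - cabs z) ^+ 2.
  rewrite -[4](_ : 2 ^+ 2 = _); last by ring.
  rewrite -exprMn ler_pXn2r ?nnegrE ?subr_ge0 ?mulr_ge0 ?subr_ge0 ?(ltW z1')//; nra.
have e2 : cabs w ^+ 2 <= t ^+ 2 by rewrite ler_pXn2r ?nnegrE// ltW.
have e3 : 2^-1 <= cabs (1 + Num.conj z * w) ^+ 2.
  rewrite sqr_cabs; apply: le_trans b1; clear -t8 t0; nra.
apply: (@le_trans _ _ (4 * (1 - cabs z) ^+ 2 * t ^+ 2)).
  by apply: ler_pM => //; exact: sqr_ge0.
apply: (@le_trans _ _ ((4 * t * (1 - cabs z)) ^+ 2 * 2^-1)); last first.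
  by rewrite ler_wpM2l ?sqr_ge0.
have X0 : 0 <= t ^+ 2 * (1 - cabs z) ^+ 2 by rewrite mulr_ge0// sqr_ge0.
rewrite (_ : (4 * t * _) ^+ 2 * _ = 8 * (t ^+ 2 * (1 - cabs z) ^+ 2)); last by field.
rewrite (_ : 4 * _ * _ = 4 * (t ^+ 2 * (1 - cabs z) ^+ 2)); last by ring.
by rewrite ler_wpM2r// ler_nat.
Qed.

Lemma n2_nball w (t : R) : 0 < t -> (n2 w < t ^+ 2) = (cabs w < t).
Proof. by move=> t0; rewrite -sqr_cabs ltr_pXn2r ?nnegrE ?cabs_ge0 ?(ltW t0). Qed.

Lemma rect_eta z w (t : R) q : disc z -> cabs w < t -> t <= 8^-1 ->
  rect (ofC z) (ofC (eta z w)) q -> cabs (toC q - z) <= 8 * t * (1 - cabs z) /\ cabs (toC q) <= cabs z + 4 * t * (1 - cabs z).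
Proof.
move=> z1 wt t8 [/= q1 q2]; have es := eta_small z1 wt t8.
have h : cabs (toC q - z) <= cabs (eta z w).
  rewrite -(ler_pXn2r (ltn0Sn 1)) ?nnegrE ?cabs_ge0// !sqr_cabs.
  move: (eta z w) q1 q2 {es} => E q1 q2; rewrite /n2 !cxE /=.
  apply: lerD; rewrite -[leLHS]real_normK ?num_real// -[leRHS]real_normK ?num_real//;
    by rewrite ler_pXn2r ?nnegrE.
have t0 : 0 < t by apply: le_lt_trans (cabs_ge0 w) wt.
have z1' : cabs z < 1 by exact/disc_cabs.
have X0 : 0 <= t * (1 - cabs z) by rewrite mulr_ge0 ?subr_ge0// ltW.
have := cabsD (toC q - z) z; rewrite subrK; split; first by move: es h X0; rewrite -!mulrA; lra.
by lra.
Qed.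

Lemma chol_eta z : disc z -> chol (eta z).
Proof.
move=> z1 w w1; have [l H] := chol_moebius (trans_su11 z1) w1; exists l.
move=> e e0; have [d d0 Hd] := H e e0; exists d => // u /Hd; congr (cabs _ <= _).
by rewrite /eta; ring.
Qed.

Lemma eta0 z : disc z -> eta z 0 = 0.
Proof. by move=> z1; rewrite /eta trans0// subrr. Qed.

Lemma pcont_comp_mz a A p : su11 A -> (forall p, DD p -> pcont a p) -> DD p ->
  pcont (fun q => a (mz A q)) p.
Proof.
move=> sA ca Dp e e0; have Dq := disc_mz sA Dp.
have [d d0 Hd] := ca _ Dq _ e0.
have [c1 c2] := chol_pcont (chol_moebius sA) Dp.
have [b1 b10 H1] := c1 _ d0; have [b2 b20 H2] := c2 _ d0.
exists (Num.min b1 b2); first by rewrite lt_min b10.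
move=> q [/=]; rewrite !lt_min => /andP[q1 q2] /andP[q3 q4]; apply: Hd.
by split; [apply: H1|apply: H2].
Qed.

(** An integral over the disc of squared Euclidean radius [s] recentred at [z], not yet divided by
    anything: the quotient that converges to the Laplacian is the one by the second moment
    [disc_norm]. *)
Definition local_mean a z (s : R) : R :=
  \int[@hmu R]_(p in nball s) (a (ofC z) - a (mz (trans z) p)).
Definition eta_norm z (s : R) : R := \int[@hmu R]_(p in nball s) n2 (eta z (toC p)).
Definition disc_norm (s : R) : R := \int[@hmu R]_(p in nball s) nsq p.

Lemma eta_integrable z (s : R) : disc z -> s < 1 ->
  [/\ (@hmu R).-integrable (nball s) (EFin \o (fun p => re (eta z (toC p)))),
      (@hmu R).-integrable (nball s) (EFin \o (fun p => im (eta z (toC p)))),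
      (@hmu R).-integrable (nball s) (EFin \o (fun p => re (eta z (toC p) * eta z (toC p)))),
      (@hmu R).-integrable (nball s) (EFin \o (fun p => im (eta z (toC p) * eta z (toC p)))) &
      (@hmu R).-integrable (nball s) (EFin \o (fun p => n2 (eta z (toC p))))].
Proof.
move=> z1 s1; have c1 := chol_eta z1; have c2 := cholM c1 c1.
split; apply: pcont_integrable => // p Dp.
- by have [] := chol_pcont c1 Dp.
- by have [] := chol_pcont c1 Dp.
- by have [] := chol_pcont c2 Dp.
- by have [] := chol_pcont c2 Dp.
- have [k1 k2] := chol_pcont c1 Dp.
  by apply: pcontD; apply: pcontM.
Qed.

(** The quadratic Taylor term is [(c11 + c22) / 4 * |eta|^2 + (c11 - c22) / 4 * Re eta^2 + c12 / 2 *
    Im eta^2]. The linear term and the last two have mean zero, as [eta] and [eta^2] are holomorphic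
    and vanish at the centre. *)
Lemma mean_expansion a a1 a2 a11 a12 a22 z (t c11 c12 c22 K : R) :
  partial1 a a1 -> partial2 a a2 -> partial1 a1 a11 -> partial2 a1 a12 -> partial2 a2 a22 ->
  (forall p, DD p -> pcont a p) -> disc z -> 0 < t -> t <= 8^-1 ->
  (forall w q, cabs w < t -> rect (ofC z) (ofC (eta z w)) q ->
     [/\ `|a11 q - c11| <= K, `|a12 q - c12| <= K & `|a22 q - c22| <= K]) ->
  `|local_mean a z (t ^+ 2) + 4^-1 * (c11 + c22) * eta_norm z (t ^+ 2)|
     <= 2 * K * eta_norm z (t ^+ 2).
Proof.
move=> d1 d2 d11 d12 d22 ca z1 t0 t8 bd.
have t1 : t < 1 by lra.
have s0 : 0 < t ^+ 2 by rewrite exprn_gt0.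
have s1 : t ^+ 2 < 1 by rewrite expr_lt1// ltW.
have [i1 i2 i3 i4 i5] := eta_integrable z1 s1.
have mb := @measurable_nball R (t ^+ 2).
have c1 := chol_eta z1; have c2 := cholM c1 c1.
have [m1 m2] := chol_mean0 c1 (eta0 z1) s0 s1.
have [m3 m4] : _ /\ _ := chol_mean0 c2 (etrans (congr1 (fun x => x * x) (eta0 z1)) (mulr0 0)) s0 s1.
have sT := trans_su11 z1.
have ia : (@hmu R).-integrable (nball (t ^+ 2)) (EFin \o (fun p => a (ofC z) - a (mz (trans z) p))).
  apply: pcont_integrable => // p Dp; apply: pcontD; first exact: pcont_cst.
  by apply: pcontN; exact: pcont_comp_mz.
pose e p := eta z (toC p).
pose L p := a1 (ofC z) * re (e p) + a2 (ofC z) * im (e p) + 4^-1 * (c11 - c22) * re (e p * e p) + 2^-1 * c12 * im (e p * e p).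
have iL : (@hmu R).-integrable (nball (t ^+ 2)) (EFin \o L).
  by do 3 (apply: rintD => //; last exact: rintZ); exact: rintZ.
have L0 : \int[@hmu R]_(p in nball (t ^+ 2)) L p = 0.
  rewrite /L RintegralD//; [|do 2 (apply: rintD => //; last exact: rintZ); exact: rintZ|exact: rintZ].
  rewrite RintegralD//; [|apply: rintD => //; exact: rintZ|exact: rintZ].
  rewrite RintegralD//; [|exact: rintZ|exact: rintZ].
  by rewrite !RintegralZl// m1 m2 m3 m4 !mulr0 !addr0.
pose f p := a (ofC z) - a (mz (trans z) p) + L p + 4^-1 * (c11 + c22) * n2 (e p).
have i_f : (@hmu R).-integrable (nball (t ^+ 2)) (EFin \o f).
  by apply: rintD => //; [exact: rintD|exact: rintZ].
have -> : local_mean a z (t ^+ 2) + 4^-1 * (c11 + c22) * eta_norm z (t ^+ 2) = \int[@hmu R]_(p in nball (t ^+ 2)) f p.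
  rewrite /f RintegralD//; [|exact: rintD|exact: rintZ].
  by rewrite RintegralD// L0 addr0 RintegralZl.
apply: le_trans (le_normr_Rintegral _ i_f) _ => //.
rewrite -RintegralZl//; apply: le_Rintegral => //; [exact: rint_abs|exact: rintZ|].
move=> p; rewrite /nball/= nsqE n2_nball// => pt.
have rD : rect (ofC z) (ofC (e p)) `<=` @DD R.
  move=> q /(rect_eta z1 pt t8)[_ h]; apply/DDE/disc_cabs.
  have := iffLR (disc_cabs z) z1; have := cabs_ge0 z; nra.
have := taylor2 d1 d2 d11 d12 d22 rD (fun q => bd _ q pt).
have -> : (((ofC z).1 + (ofC (e p)).1, (ofC z).2 + (ofC (e p)).2) : R * R) = mz (trans z) p.
  by rewrite /mz /ofC /= /e /eta !cxE; congr pair; ring.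
rewrite -/(e p) /f /L /=; move: (e p) => E; rewrite -[n2 E]/(re E ^+ 2 + im E ^+ 2) -normrN => h.
apply: le_trans h; rewrite le_eqVlt; apply/orP; left; apply/eqP; congr (`|_|).
by rewrite !cxE; field.
Qed.

Lemma eta_norm_bounds z (t : R) : disc z -> 0 < t -> t < 1 ->
  (1 - n2 z) ^+ 2 / (1 + t) ^+ 2 * disc_norm (t ^+ 2) <= eta_norm z (t ^+ 2) <=
  (1 - n2 z) ^+ 2 / (1 - t) ^+ 2 * disc_norm (t ^+ 2).
Proof.
move=> z1 t0 t1; have s1 : t ^+ 2 < 1 by rewrite expr_lt1// ltW.
have mb := @measurable_nball R (t ^+ 2).
have [_ _ _ _ ie] := eta_integrable z1 s1.
have i_n : (@hmu R).-integrable (nball (t ^+ 2)) (EFin \o @nsq R).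
  by apply: pcont_integrable => // p _; exact: pcont_nsq.
have bd p : nball (t ^+ 2) p ->
    (1 - n2 z) ^+ 2 / (1 + t) ^+ 2 * nsq p <= n2 (eta z (toC p)) <= (1 - n2 z) ^+ 2 / (1 - t) ^+ 2 * nsq p.
  rewrite /nball/= nsqE n2_nball// => pt.
  have p1 : disc (toC p) by apply/disc_cabs; exact: lt_trans t1.
  have /andP[b1 b2] := eta_den_bounds z1 pt t1.
  have t1' : 0 < 1 - t by rewrite subr_gt0.
  have d0 : 0 < n2 (1 + Num.conj z * toC p) by apply: lt_le_trans b1; rewrite exprn_gt0.
  have X0 : 0 <= (1 - n2 z) ^+ 2 * n2 (toC p) by rewrite mulr_ge0 ?sqr_ge0 ?n2_ge0.
  rewrite n2_eta// mulrAC [X in _ <= _ <= X]mulrAC.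
  by apply/andP; split; apply: (ler_wpM2l X0); rewrite lef_pV2 ?posrE// exprn_gt0// addr_gt0.
apply/andP; split; rewrite -RintegralZl//; apply: le_Rintegral => //; try exact: rintZ;
  by move=> p /bd/andP[].
Qed.

Lemma disc_norm_gt0 (t : R) : 0 < t -> t < 1 -> 0 < disc_norm (t ^+ 2).
Proof.
move=> t0 t1; have s1 : t ^+ 2 < 1 by rewrite expr_lt1// ltW.
have mb := @measurable_nball R (t ^+ 2).
have i_n : (@hmu R).-integrable (nball (t ^+ 2)) (EFin \o @nsq R).
  by apply: pcont_integrable => // p _; exact: pcont_nsq.
(* The integrand vanishes at the centre, so positivity is read off a small disc about [t / 2], on
   which the modulus is at least [3 t / 8]. *)
pose z : R[i] := ((t / 2)%:C)%C; have cz : cabs z = t / 2 by rewrite cabsC gtr0_norm// divr_gt0.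
have z1 : disc z by apply/disc_cabs; rewrite cz; lra.
pose s := (t / 8) ^+ 2 / 4.
have s0 : 0 < s by rewrite !divr_gt0// exprn_gt0// divr_gt0.
have sl1 : s < 1 by rewrite /s; nra.
have U_near p : pball z s p -> 3 * t / 8 <= cabs (toC p) < t.
  move=> [/DDE p1]; rewrite /ph2 ltr_pdivrMr ?ph_den_gt0// => h.
  have : cabs (z - toC p) < t / 8.
    rewrite -(ltr_pXn2r (ltn0Sn 1)) ?nnegrE ?cabs_ge0 ?divr_ge0 ?(ltW t0)// sqr_cabs.
    apply: lt_le_trans h _; rewrite (_ : (t / 8) ^+ 2 = s * 4); last by rewrite /s; field.
    rewrite ler_pM2l//; have : cabs (1 - Num.conj (toC p) * z) <= 2.
      apply: le_trans (cabsD _ _) _; rewrite cabs1 cabsN cabsM cz /cabs n2J -/(cabs (toC p)).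
      have := iffLR (disc_cabs _) p1; have := cabs_ge0 (toC p); nra.
    rewrite -sqr_cabs; have := cabs_ge0 (1 - Num.conj (toC p) * z); nra.
  have := cabsD (z - toC p) (toC p); rewrite subrK cz.
  have := cabsD (toC p - z) z; rewrite subrK cz cabsB => *; apply/andP; split; lra.
have UB : pball z s `<=` nball (t ^+ 2).
  by move=> p /U_near/andP[_]; rewrite /nball/= nsqE n2_nball.
have mU := measurable_pball s z1.
have U0 : (0 < hmu (pball z s))%E by rewrite hmu_pball ?hmu_nball_gt0//; exact: ltW.
rewrite -lte_fin /disc_norm /Rintegral fineK; last exact: integrable_fin_num.
apply: (@lt_le_trans _ _ (\int[@hmu R]_(p in pball z s) (((3 * t / 8) ^+ 2)%:E))%E).
  rewrite integral_cst// mule_gt0// lte_fin exprn_gt0// divr_gt0// mulr_gt0//.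
apply: (@le_trans _ _ (\int[@hmu R]_(p in pball z s) (nsq p)%:E)%E).
  apply: ge0_le_integral => //.
  - by move=> p _; rewrite lee_fin sqr_ge0.
  - by apply/measurable_EFinP; apply: measurable_funTS; exact: measurable_nsq.
  - move=> p /U_near/andP[h _]; rewrite lee_fin nsqE -sqr_cabs ler_pXn2r ?nnegrE ?cabs_ge0//.
    by rewrite divr_ge0// mulr_ge0// ltW.
apply: ge0_subset_integral => //.
- by apply/measurable_EFinP; apply: measurable_funTS; exact: measurable_nsq.
- by move=> p _; rewrite lee_fin nsqE n2_ge0.
Qed.

End local_mean.

(** * The Laplacian as a limit of local means *)

Section laplacian_of_means.
Context (R : realType).
Implicit Types (z w : R[i]) (p q : R * R) (a : R * R -> R).

Definition C2_data a (a1 a2 a11 a12 a22 : R * R -> R) :=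
  [/\ partial1 a a1, partial2 a a2, partial1 a1 a11, partial2 a1 a12 & partial2 a2 a22] /\
  forall p, DD p -> [/\ pcont a p, pcont a11 p, pcont a12 p & pcont a22 p].

(** Four times the Laplace-Beltrami operator of Defs. *)
Definition lap (a11 a22 : R * R -> R) p : R :=
  - 4^-1 * (a11 p + a22 p) * (1 - nsq p) ^+ 2.

Lemma rect_square z w (t : R) q : disc z -> cabs w < t -> t <= 8^-1 ->
  rect (ofC z) (ofC (eta z w)) q -> `|q.1 - re z| <= 8 * t /\ `|q.2 - im z| <= 8 * t.
Proof.
move=> z1 wt t8 /(rect_eta z1 wt t8)[h _].
have t0 : 0 < t by apply: le_lt_trans (cabs_ge0 w) wt.
have {}h : cabs (toC q - z) <= 8 * t.
  apply: le_trans h _; have := cabs_ge0 z; have := iffLR (disc_cabs z) z1; nra.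
have := re_le_cabs (toC q - z); have := im_le_cabs (toC q - z); rewrite !cxE /=.
by move=> h1 h2; split; [apply: le_trans h2 h|apply: le_trans h1 h].
Qed.

(** [mean_expansion] around zero second derivatives, bounded on a slightly larger disc. The bound
    does not depend on [t] and serves for dominated convergence. *)
Lemma local_mean_bound a a1 a2 a11 a12 a22 (r : R) : C2_data a a1 a2 a11 a12 a22 -> r < 1 ->
  exists2 M, 0 <= M & forall z (t : R), cabs z <= r -> 0 < t -> t <= 8^-1 ->
    `|local_mean a z (t ^+ 2)| <= M * @disc_norm R (t ^+ 2).
Proof.
move=> [[d1 d2 d11 d12 d22] cc] r1; pose r' := (1 + Num.max 0 r) / 2.
have r0 : 0 <= Num.max 0 r by rewrite le_max lexx.
have rr : r <= Num.max 0 r by rewrite le_max lexx orbT.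
have mr1 : Num.max 0 r < 1 by rewrite gt_max ltr01.
have r'0 : 0 <= r' by rewrite /r'; lra.
have r'1 : r' < 1 by rewrite /r'; lra.
have r'2 : r' ^+ 2 < 1 by rewrite expr_lt1.
have [M1 M10 H1] := nball_bounded r'2 (fun p Dp => let: And4 _ h _ _ := cc p Dp in h).
have [M2 M20 H2] := nball_bounded r'2 (fun p Dp => let: And4 _ _ h _ := cc p Dp in h).
have [M3 M30 H3] := nball_bounded r'2 (fun p Dp => let: And4 _ _ _ h := cc p Dp in h).
pose K := M1 + M2 + M3.
exists (4 * K); first by rewrite mulr_ge0// !addr_ge0.
move=> z t zr t0 t8; have z1 : disc z by apply/disc_cabs; exact: le_lt_trans r1.
have t1 : t < 1 by lra.
have bd w q : cabs w < t -> rect (ofC z) (ofC (eta z w)) q ->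
    [/\ `|a11 q - 0| <= K, `|a12 q - 0| <= K & `|a22 q - 0| <= K].
  move=> wt /(rect_eta z1 wt t8)[_ h].
  have qr : nsq q <= r' ^+ 2.
    rewrite nsqE -sqr_cabs ler_pXn2r ?nnegrE ?cabs_ge0//; apply: le_trans h _.
    have := cabs_ge0 z; rewrite /r'; move: (Num.max 0 r) rr r0 mr1 => x *; nra.
  have := H1 _ qr; have := H2 _ qr; have := H3 _ qr; rewrite !subr0 /K => *.
  by split; lra.
have := mean_expansion d1 d2 d11 d12 d22 (fun p Dp => let: And4 h _ _ _ := cc p Dp in h) z1 t0 t8 bd.
rewrite addr0 mulr0 mul0r addr0 => h; apply: le_trans h _.
have /andP[_ h] := eta_norm_bounds z1 t0 t1.
rewrite (_ : 4 * K = 2 * K * 2); last by ring.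
rewrite -[leRHS]mulrA ler_wpM2l// ?mulr_ge0 ?addr_ge0//.
apply: le_trans h _; apply: ler_wpM2r; first exact/ltW/disc_norm_gt0.
rewrite ler_pdivrMr ?exprn_gt0 ?subr_gt0//.
have : (1 - n2 z) ^+ 2 <= 1.
  have := n2_ge0 z; have /discE := z1; nra.
nra.
Qed.

(** [eta_norm / disc_norm] lies between [(1 - |z|^2)^2 / (1 + t)^2] and [(1 - |z|^2)^2 / (1 - t)^2];
    its limit is the conformal factor in [lap]. *)
Lemma local_mean_limit a a1 a2 a11 a12 a22 z (e : R) : C2_data a a1 a2 a11 a12 a22 ->
  disc z -> 0 < e -> exists2 t0 : R, 0 < t0 & forall t : R, 0 < t -> t <= t0 ->
    `|local_mean a z (t ^+ 2) / disc_norm (t ^+ 2) - lap a11 a22 (ofC z)| <= e.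
Proof.
move=> [[d1 d2 d11 d12 d22] cc] z1 e0.
have Dz : DD (ofC z) by apply/DDE; rewrite ofCK.
have [_ k11 k12 k22] := cc _ Dz.
have e8 : 0 < e / 8 by rewrite divr_gt0.
have [b1 b10 B1] := k11 _ e8; have [b2 b20 B2] := k12 _ e8; have [b3 b30 B3] := k22 _ e8.
pose S := a11 (ofC z) + a22 (ofC z).
(* The Taylor rectangles stay within [8 * t] of [z] in each coordinate, hence the 16; the last bound
   keeps [|S| * t] at most [e / 2]. *)
pose t0 := Num.min (Num.min 8^-1 (Num.min b1 (Num.min b2 b3) / 16)) (e / (2 * (`|S| + 1))).
have S1 : 0 < `|S| + 1 by rewrite ltr_wpDl.
have b0 : 0 < Num.min b1 (Num.min b2 b3) by rewrite !lt_min b10 b20.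
exists t0; first by rewrite !lt_min invr_gt0 ltr0n/= !divr_gt0// mulr_gt0.
move=> t tp; rewrite /t0 !le_min => /andP[/andP[t8 tb] tS].
have t1 : t < 1 by lra.
have bd w q : cabs w < t -> rect (ofC z) (ofC (eta z w)) q ->
    [/\ `|a11 q - a11 (ofC z)| <= e / 8, `|a12 q - a12 (ofC z)| <= e / 8 & `|a22 q - a22 (ofC z)| <= e / 8].
  move=> wt /(rect_square z1 wt t8)[q1 q2].
  have sq b : Num.min b1 (Num.min b2 b3) <= b -> square (ofC z) b q.
    move=> mb; split; [apply: le_lt_trans q1 _|apply: le_lt_trans q2 _]; lra.
  by split; apply/ltW; [apply: B1|apply: B2|apply: B3]; apply: sq; rewrite !ge_min lexx ?orbT.
have := mean_expansion d1 d2 d11 d12 d22 (fun p Dp => let: And4 h _ _ _ := cc p Dp in h) z1 tp t8 bd.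
have /andP[l u] := eta_norm_bounds z1 tp t1.
have c0 := disc_norm_gt0 tp t1.
rewrite -/S; move: (local_mean _ _ _) (eta_norm _ _) (disc_norm _) l u c0 => L N c l u c0 h.
pose J2 := (1 - n2 z) ^+ 2.
have J0 : 0 <= J2 by exact: sqr_ge0.
have J1 : J2 <= 1 by rewrite /J2; have := n2_ge0 z; have /discE := z1; nra.
have lapE : lap a11 a22 (ofC z) = - 4^-1 * S * J2 by [].
have tl : 1 - 2 * t <= (1 + t) ^- 2.
  rewrite -[leRHS]mul1r ler_pdivlMr ?exprn_gt0 ?addr_gt0// -subr_ge0.
  rewrite (_ : 1 - _ = t ^+ 2 * (3 + 2 * t)); last by ring.
  by rewrite mulr_ge0 ?sqr_ge0// addr_ge0// mulr_ge0// ltW.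
have tu : (1 - t) ^- 2 <= 1 + 3 * t.
  by rewrite -[leLHS]mul1r ler_pdivrMr ?exprn_gt0 ?subr_gt0//; nra.
have Nl : J2 * (1 - 2 * t) * c <= N.
  by apply: le_trans l; rewrite ler_wpM2r ?(ltW c0)// ler_wpM2l.
have Nu : N <= J2 * (1 + 3 * t) * c.
  by apply: le_trans u _; rewrite ler_wpM2r ?(ltW c0)// ler_wpM2l.
have NJ : `|N - J2 * c| <= 3 * t * c.
  have X0 : 0 <= t * c by rewrite mulr_ge0 ?ltW.
  have X1 : J2 * (t * c) <= t * c by rewrite ler_piMl.
  have X2 : 0 <= J2 * (t * c) by rewrite mulr_ge0.
  by rewrite ler_norml; apply/andP; split; lra.
have N2 : N <= 2 * c.
  apply: le_trans Nu _; rewrite ler_wpM2r ?(ltW c0)//; nra.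
rewrite lapE -(ler_pM2r c0) -[X in `|_| * X](gtr0_norm c0) -normrM.
have -> : (L / c - - 4^-1 * S * J2) * c = (L + 4^-1 * S * N) - 4^-1 * S * (N - J2 * c).
  by field; rewrite gt_eqF.
apply: le_trans (ler_normB _ _) _.
have h1 : 2 * (e / 8) * N <= e / 2 * c by nra.
have h2 : `|4^-1 * S * (N - J2 * c)| <= e / 2 * c.
  rewrite !normrM (ger0_norm (x := 4^-1)) ?invr_ge0//.
  apply: (@le_trans _ _ (4^-1 * `|S| * (3 * t * c))).
    by apply: ler_wpM2l => //; rewrite mulr_ge0// invr_ge0.
  rewrite (_ : 4^-1 * `|S| * (3 * t * c) = 3 / 4 * (`|S| * t) * c); last by ring.
  rewrite ler_wpM2r ?(ltW c0)//.
  have : t * (2 * (`|S| + 1)) <= e by rewrite -ler_pdivlMr// mulr_gt0.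
  have := normr_ge0 S; nra.
by apply: le_trans (lerD (le_trans h h1) h2) _; rewrite -mulrDl -splitr.
Qed.

Lemma eq_local_mean a b z (s : R) : disc z -> s <= 1 -> (forall p, DD p -> a p = b p) ->
  local_mean a z s = local_mean b z s.
Proof.
move=> z1 s1 ab; apply: eq_Rintegral => p; rewrite inE => sp.
have Dp := nball_DD s1 sp; rewrite !ab//; first exact: (disc_mz (trans_su11 z1)).
by apply/DDE; rewrite ofCK.
Qed.

Lemma local_meanE a z (s M : R) : disc z -> s < 1 -> (forall p, DD p -> pcont a p) ->
  measurable_fun setT a -> (forall p, `|a p| <= M) ->
  local_mean a z s = (a (ofC z) + M) * fine (hmu (nball s)) -
    fine (\int[@hmu R]_(p in pball z s) (a p + M)%:E).
Proof.
move=> z1 s1 ca ma aM.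
have sT := trans_su11 z1.
have ia : (@hmu R).-integrable (nball s) (EFin \o (fun p => a (mz (trans z) p))).
  by apply: pcont_integrable => // p Dp; exact: pcont_comp_mz.
have ic (c : R) : (@hmu R).-integrable (nball s) (EFin \o (fun p => c)).
  by apply: pcont_integrable => // p Dp; exact: pcont_cst.
have mb := @measurable_nball R s.
rewrite (ge0_integral_pball z1 (ltW s1)); last 2 first.
- by apply/measurable_EFinP; apply: measurable_funD.
- by move=> p; rewrite lee_fin; have := aM p; rewrite ler_norml; lra.
rewrite -[fine (\int[hmu (R:=R)]_(p in nball s) _)]/(\int[@hmu R]_(p in nball s) (a (mz (trans z) p) + M)).
rewrite /local_mean RintegralB// RintegralD// !Rintegral_cst//; ring.
Qed.

Lemma pball_moebius A z s p : su11 A -> disc z -> DD p ->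
  pball (moebius A z) s (mz A p) <-> pball z s p.
Proof.
move=> sA z1 Dp; have /DDE p1 := Dp; rewrite /pball/= toC_mz ph2_moebius//.
by split=> -[_ h]; split => //; exact: disc_mz.
Qed.

Lemma integral_pball_invariant A z (s : R) (g : R * R -> \bar R) : su11 A -> disc z ->
  measurable_fun setT g -> (forall p, (0 <= g p)%E) -> (forall p, DD p -> g (mz A p) = g p) ->
  (\int[@hmu R]_(p in pball (moebius A z) s) g p = \int[@hmu R]_(p in pball z s) g p)%E.
Proof.
move=> sA z1 mg g0 gA; have Az := moebius_disc sA z1.
rewrite [LHS]integral_mkcond [RHS]integral_mkcond.
pose h w := g \_ (pball w s).
have mh w : disc w -> measurable_fun setT (h w).
  by move=> w1; apply/(measurable_restrictT _ _).1; [exact: measurable_pball|exact: measurable_funTS].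
have h0 w p : (0 <= h w p)%E by rewrite /h patchE; case: ifP.
rewrite -(ge0_integral_hmu_DD (mh _ Az) (h0 _)) -(ge0_integral_hmu_DD (mh _ z1) (h0 _)).
rewrite -(ge0_integral_mz_DD sA (mh _ Az) (h0 _)).
apply: eq_integral => p; rewrite inE => Dp; rewrite /h !patchE.
have e := pball_moebius s sA z1 Dp.
have -> : (mz A p \in pball (moebius A z) s) = (p \in pball z s).
  by apply/idP/idP; rewrite !inE => /e.
by rewrite gA.
Qed.

Lemma local_mean_moebius a A z (s M : R) : su11 A -> disc z -> s < 1 ->
  (forall p, DD p -> pcont a p) -> measurable_fun setT a -> (forall p, `|a p| <= M) ->
  (forall p, DD p -> a (mz A p) = a p) ->
  local_mean a (moebius A z) s = local_mean a z s.
Proof.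
move=> sA z1 s1 ca ma aM aA; have Az := moebius_disc sA z1.
rewrite !(@local_meanE a _ s M)//.
rewrite integral_pball_invariant//; last 3 first.
- by apply/measurable_EFinP; apply: measurable_funD.
- by move=> p; rewrite lee_fin; have := aM p; rewrite ler_norml; lra.
- by move=> p Dp; rewrite aA.
have -> : ofC (moebius A z) = mz A (ofC z) by rewrite /mz ofCK.
by rewrite aA//; apply/DDE; rewrite ofCK.
Qed.

Lemma pcont_measurable a : (forall p, DD p -> pcont a p) -> measurable_fun (@DD R) a.
Proof. by move=> ca; apply: measurable_pcont => // p; exact: DD_square. Qed.

Lemma pcont_patch a p : DD p -> pcont a p -> pcont (a \_ (@DD R)) p.
Proof.
move=> Dp ca e e0; have [d d0 Hd] := ca _ e0; have [b b0 Hb] := DD_square Dp.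
exists (Num.min d b); first by rewrite lt_min d0.
move=> q [/=]; rewrite !lt_min => /andP[q1 q2] /andP[q3 q4].
have Dq : DD q by apply: Hb.
by rewrite !patchE !mem_set//; apply: Hd.
Qed.

End laplacian_of_means.

(** * Mass transport and Green's inequality *)

Section product_integrals.
Context (R : realType).
Local Open Scope ereal_scope.
Local Notation plane2 := (plane R * plane R)%type.
Implicit Types (f : plane2 -> \bar R) (A B : set (R * R)).

Definition hmu2 : {measure set plane2 -> \bar R} :=
  lebesgue_integral_fubini_product_measure1__canonical__measure_function_Measure (@hmu R) (@hmu R).

Let patchX f A B p q : (f \_ (A `*` B)) (p, q) =
  if p \in A then ((fun q => f (p, q)) \_ B) q else 0.
Proof.
rewrite !patchE; case: ifPn => [|/negP h].
  by rewrite !inE => -[/= Ap Bq]; rewrite !mem_set.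
case: ifPn => // Ap; case: ifPn => // Bq; exfalso; apply: h.
by rewrite inE in Ap; rewrite inE in Bq; rewrite inE.
Qed.

Lemma hmu2_tonelli f A B : measurable A -> measurable B ->
  measurable_fun setT f -> (forall x, 0 <= f x) ->
  \int[hmu2]_(x in A `*` B) f x = \int[@hmu R]_(p in A) \int[@hmu R]_(q in B) f (p, q).
Proof.
move=> mA mB mf f0; rewrite integral_mkcond [RHS]integral_mkcond.
rewrite /hmu2 fubini_tonelli1//; last 2 first.
- by apply/(measurable_restrictT _ _).1; [exact: measurableX|exact: measurable_funTS].
- by move=> x; rewrite patchE; case: ifP.
apply: eq_integral => p _; rewrite /fubini_F patchE.
case: ifPn => Ap; last first.
  by apply: integral0_eq => q _; rewrite patchX (negbTE Ap).
rewrite [RHS]integral_mkcond; apply: eq_integral => q _.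
by rewrite patchX Ap.
Qed.

Lemma hmu2_swap f A B : measurable A -> measurable B ->
  measurable_fun setT f -> (forall x, 0 <= f x) ->
  \int[hmu2]_(x in A `*` B) f x = \int[@hmu R]_(q in B) \int[@hmu R]_(p in A) f (p, q).
Proof.
move=> mA mB mf f0; rewrite integral_mkcond [RHS]integral_mkcond.
have mfp : measurable_fun setT (f \_ (A `*` B)).
  by apply/(measurable_restrictT _ _).1; [exact: measurableX|exact: measurable_funTS].
have fp0 x : 0 <= (f \_ (A `*` B)) x by rewrite patchE; case: ifP.
rewrite /hmu2 fubini_tonelli2//.
apply: eq_integral => q _; rewrite /fubini_G patchE.
case: ifPn => Bq; last first.
  apply: integral0_eq => p _; rewrite patchX; case: ifP => // _.
  by rewrite patchE (negbTE Bq).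
rewrite [RHS]integral_mkcond; apply: eq_integral => p _.
by rewrite patchX !patchE Bq.
Qed.

Lemma measurable_inner f B : measurable B -> measurable_fun setT f -> (forall x, 0 <= f x) ->
  measurable_fun setT (fun p => \int[@hmu R]_(q in B) f (p, q)).
Proof.
move=> mB mf f0; rewrite (_ : (fun p => _) = fubini_F (@hmu R) (f \_ (setT `*` B))).
  apply: measurable_fun_fubini_tonelli_F.
    by apply/(measurable_restrictT _ _).1; [exact: measurableX|exact: measurable_funTS].
  by move=> x; rewrite patchE; case: ifP.
apply/funext => p; rewrite /fubini_F [LHS]integral_mkcond; apply: eq_integral => q _.
by rewrite patchX mem_set.
Qed.

End product_integrals.

Section fundamental_domain.
Context (R : realType) (Gam : set 'M[R[i]]_2) (fG : cocompact_fuchsian Gam).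
Context (F : set R[i]) (FD : fundamental_domain Gam F).
Implicit Types (A B : 'M[R[i]]_2) (p q : R * R).

Let sG : su11_subgroup Gam. Proof. by case: fG. Qed.
Let dG : discrete_group Gam. Proof. by case: fG. Qed.
Let sub A : Gam A -> su11 A. Proof. by case: sG => + _ _ _ _; apply. Qed.
Let GM A B : Gam A -> Gam B -> Gam (A * B). Proof. by case: sG => _ _ _ + _; apply. Qed.
Let GV A : Gam A -> Gam A^-1. Proof. by case: sG => _ _ _ _; apply. Qed.

Definition fdom : set (R * R) := toC @^-1` F.

Lemma fdom_DD : fdom `<=` @DD R.
Proof. by move=> p Fp; apply/DDE; have [sD _ _ _] := FD; exact: sD. Qed.

Lemma measurable_fdom : measurable fdom.
Proof. by have [_ mF _ _] := FD. Qed.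

Lemma fdom_cover p : DD p -> exists2 A, Gam A & fdom (mz A p).
Proof.
move=> /DDE p1; have [_ _ cov _] := FD; have [w Fw [A GA e]] := cov _ p1.
by exists A => //; rewrite /fdom/= toC_mz -e.
Qed.

Lemma fdom_inj A p : Gam A -> fdom p -> fdom (mz A p) -> mz A p = p.
Proof.
move=> GA Fp FAp; have [_ _ _ inj] := FD; rewrite -[RHS]toCK.
rewrite (inj (toC p) (moebius A (toC p)))//; last by exists A.
by move: FAp; rewrite /fdom/= toC_mz.
Qed.

Lemma nball_cover : exists2 t : R, t < 1 &
  forall p, DD p -> exists2 A, Gam A & nball t (mz A p).
Proof.
have [_ _ _ cc] := fG; have [r [r0 r1 cov]] := cocompact_ball cc.
have h1 : 0 <= (1 + r) / 2 by lra.
have h2 : (1 + r) / 2 < 1 by lra.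
exists (((1 + r) / 2) ^+ 2); first by rewrite expr_lt1.
move=> p /DDE /cov[A GA h]; exists A => //.
rewrite /nball/= nsqE toC_mz -sqr_cabs ltr_pXn2r ?nnegrE ?cabs_ge0//; lra.
Qed.

Lemma hmu_fdom_lty : (hmu fdom < +oo)%E.
Proof.
have [t t1 cov] := nball_cover.
have mF := measurable_fdom; have mb := @measurable_nball R t.
have le : (\int[@hmu R]_(p in fdom) 1 <= \int[@hmu R]_(p in nball t) 1)%E.
  apply: (@group_transport _ Gam) => //.
  - exact: fdom_DD.
  - by move=> p; exact: nball_DD (ltW t1).
  - by move=> p /fdom_DD/cov.
  - by move=> A p GA; exact: fdom_inj.
rewrite !integral_cst// !mul1e in le.
by apply: le_lt_trans le (hmu_nball_lty t1).
Qed.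

Definition ginv (a : R * R -> R) := forall A p, Gam A -> DD p -> a (mz A p) = a p.

Lemma ginv_bounded a : ginv a -> (forall p, DD p -> pcont a p) ->
  exists2 M, 0 <= M & forall p, DD p -> `|a p| <= M.
Proof.
move=> ai ca; have [t t1 cov] := nball_cover.
have [M M0 aM] := nball_bounded t1 ca; exists M => // p Dp.
by have [A GA /ltW h] := cov _ Dp; rewrite -(ai A p GA Dp); exact: aM.
Qed.

(** [F x D] and [D x F], with [D] the disc, are both fundamental domains for the diagonal action on
    pairs, and [Phi] is invariant under it. *)
Lemma mass_transport_le (Phi : (R * R) * (R * R) -> \bar R) :
  measurable_fun setT Phi -> (forall x, (0 <= Phi x)%E) ->
  (forall A p q, Gam A -> DD p -> DD q -> Phi (mz A p, mz A q) = Phi (p, q)) ->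
  (\int[@hmu R]_(p in fdom) \int[@hmu R]_(q in @DD R) Phi (p, q) <=
   \int[@hmu R]_(p in fdom) \int[@hmu R]_(q in @DD R) Phi (q, p))%E.
Proof.
move=> mPhi Phi0 PhiA.
have mF := measurable_fdom; have mD := @measurable_DD R.
have [A_ [GA_ enum]] := enumerate_group sG dG.
have sA j := sub (GA_ j).
have [e1 e10 sys] := systole fG.
rewrite -hmu2_tonelli// -(hmu2_swap mD mF mPhi Phi0).
pose tau j (x : (R * R) * (R * R)) := (mz (A_ j) x.1, mz (A_ j) x.2).
pose sig j (x : (R * R) * (R * R)) := (mz (A_ j)^-1 x.1, mz (A_ j)^-1 x.2).
have mpair B : measurable_fun setT (fun x : plane R * plane R => (mz B x.1, mz B x.2)).
  apply: measurable_fun_pair; apply: measurableT_comp; try exact: measurable_mz.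
    exact: measurable_fst.
  exact: measurable_snd.
apply: (@transport_le _ _ _ (@hmu2 R) (@DD R `*` @DD R) (fdom `*` @DD R) (@DD R `*` fdom)
  (fun j => tau j @^-1` (@DD R `*` fdom)) tau sig) => //.
- exact: measurableX.
- exact: measurableX.
- exact: measurableX.
- by move=> j; rewrite -[X in measurable X]setTI; apply: mpair => //; exact: measurableX.
- by move=> [p q] [/= /fdom_DD].
- by move=> [p q] [/= Dp /fdom_DD].
- move=> [p q] [/= Fp Dq]; have [A /enum[j <-] h] := fdom_cover Dq.
  by exists j => //; split => //=; apply: disc_mz => //; exact: fdom_DD.
- by move=> j; exact: mpair.
- by move=> j [p q] [/= Dp Dq]; split; exact: disc_mz.
- by move=> j [p q] [/= Dp Dq]; split; apply: disc_mz => //; exact: su11_inv.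
- by move=> j [p q] [/= Dp Dq]; rewrite /sig /tau /= !mzK.
- by move=> j [p q] [/= Dp Dq]; rewrite /sig /tau /= !mzVK.
- move=> j g mg g0.
  have mgt : measurable_fun setT (g \o tau j) by apply: measurableT_comp => //; exact: mpair.
  have := hmu2_tonelli mD mD mgt (fun x => g0 _); rewrite /= => ->.
  rewrite (hmu2_tonelli mD mD mg g0).
  have inner p : (\int[@hmu R]_(q in @DD R) g (mz (A_ j) p, mz (A_ j) q) =
      \int[@hmu R]_(q in @DD R) g (mz (A_ j) p, q))%E.
    apply: (ge0_integral_mz_DD (g := fun q => g (mz (A_ j) p, q)) (sA j)) => //.
    by apply: (measurableT_comp mg); exact: measurable_pair1.
  rewrite /tau /=; under eq_integral do rewrite inner.
  apply: (ge0_integral_mz_DD (g := fun p => \int[@hmu R]_(q in @DD R) g (p, q))%E (sA j)).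
    exact: measurable_inner.
  by move=> p; exact: integral_ge0.
- move=> j k [p q] [p' q'] [/= Fp Dq] _ [/= Fp' Dq'] _ e.
  have ep := congr1 fst e; have eq_ := congr1 snd e; rewrite /tau /= in ep eq_ {e}.
  have Dp := fdom_DD Fp; have Dp' := fdom_DD Fp'.
  (* This element sends [p] to [p'] and [q] to [q']. As [p] and [p'] both lie in [F] it fixes [p],
     so it is [1] or [- 1] by the systole and fixes [q] too. *)
  have GB : Gam ((A_ k)^-1 * A_ j) by apply: GM => //; exact: GV.
  have BE r r' : DD r -> DD r' -> mz (A_ j) r = mz (A_ k) r' -> mz ((A_ k)^-1 * A_ j) r = r'.
    by move=> Dr Dr' e; rewrite mzM ?e ?mzK//; exact: su11_inv.
  have Bp := BE _ _ Dp Dp' ep; have Bq := BE _ _ Dq Dq' eq_.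
  have pp : mz ((A_ k)^-1 * A_ j) p = p by apply: fdom_inj => //; rewrite Bp.
  rewrite -{}Bp -{}Bq pp; congr pair.
  have p1 : disc (toC p) by exact/DDE.
  have e : moebius ((A_ k)^-1 * A_ j) (toC p) = toC p by rewrite -toC_mz pp.
  rewrite /mz (moebius_short sys _ GB p1) ?toCK// e hdistxx//.
- by move=> j [p q] [/= Fp Dq] _; rewrite PhiA//; exact: fdom_DD.
Qed.

End fundamental_domain.

Lemma ge0_opp_le (R : realDomainType) (x : R) : - x <= x -> 0 <= x.
Proof. by move=> h; lra. Qed.

(** * Green's inequality from symmetrised local means *)

Section green.
Context (R : realType) (Gam : set 'M[R[i]]_2) (fG : cocompact_fuchsian Gam).
Context (F : set R[i]) (FD : fundamental_domain Gam F).
Implicit Types (A B : 'M[R[i]]_2) (p q : R * R) (a b c d : R * R -> R).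

Let sG : su11_subgroup Gam. Proof. by case: fG. Qed.
Let sub A : Gam A -> su11 A. Proof. by case: sG => + _ _ _ _; apply. Qed.
Local Notation FF := (@fdom R F).

Definition near_pairs (s : R) : set ((R * R) * (R * R)) :=
  [set x | [/\ DD x.1, DD x.2 & ph2 (toC x.1) (toC x.2) < s]].

Lemma measurable_near_pairs s : measurable (near_pairs s : set (plane R * plane R)).
Proof.
pose f (x : plane R * plane R) : R := ph2 (toC x.1) (toC x.2).
have mf : measurable_fun setT f.
  rewrite (_ : f = (fun x : plane R * plane R =>
    ((x.1.1 - x.2.1) ^+ 2 + (x.1.2 - x.2.2) ^+ 2) /
    ((1 - (x.2.1 * x.1.1 + x.2.2 * x.1.2)) ^+ 2 + (x.2.2 * x.1.1 - x.2.1 * x.1.2) ^+ 2))); last first.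
    by apply/funext => x; rewrite /f /ph2 /n2 !cxE /=; congr (_ / _); ring.
  have m11 : measurable_fun setT (fun x : plane R * plane R => x.1.1).
    by apply: (measurableT_comp (f := fst)); [exact: measurable_fst|exact: measurable_fst].
  have m12 : measurable_fun setT (fun x : plane R * plane R => x.1.2).
    by apply: (measurableT_comp (f := snd)); [exact: measurable_snd|exact: measurable_fst].
  have m21 : measurable_fun setT (fun x : plane R * plane R => x.2.1).
    by apply: (measurableT_comp (f := fst)); [exact: measurable_fst|exact: measurable_snd].
  have m22 : measurable_fun setT (fun x : plane R * plane R => x.2.2).
    by apply: (measurableT_comp (f := snd)); [exact: measurable_snd|exact: measurable_snd].
  by mreal.
rewrite (_ : near_pairs s = (@DD R `*` @DD R) `&` f @^-1` `]-oo, s[%classic).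
  apply: measurableI; first by apply: measurableX; exact: measurable_DD.
  by rewrite -[X in measurable X]setTI; exact: mf.
apply/seteqP; split => x /=; rewrite /near_pairs/= in_itv/=; first by move=> [].
by move=> [[]].
Qed.

Lemma near_pairs_pball s p q : DD p -> near_pairs s (p, q) <-> pball (toC p) s q.
Proof. by move=> Dp; split => [[]|[]]. Qed.

Lemma near_pairsC s p q : near_pairs s (p, q) -> near_pairs s (q, p).
Proof. by move=> [/= ? ? ?]; split => //=; rewrite ph2C. Qed.

Section bounded_data.
Variables (a b c d : R * R -> R) (N : R).
Hypothesis data : forall f, f \in [:: a; b; c; d] ->
  [/\ measurable_fun setT f, (forall p, `|f p| <= N), (forall p, DD p -> pcont f p) & ginv Gam f].

Let H p q := c p * (a p - a q) + d p * (b p - b q).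
Hypothesis Hpos : forall p q, DD p -> DD q -> 0 <= H p q + H q p.

Let Ha := data (mem_head _ _).
Let Hb : [/\ measurable_fun setT b, (forall p, `|b p| <= N), (forall p, DD p -> pcont b p) & ginv Gam b].
Proof. by apply: data; rewrite !inE eqxx !orbT. Qed.
Let Hc : [/\ measurable_fun setT c, (forall p, `|c p| <= N), (forall p, DD p -> pcont c p) & ginv Gam c].
Proof. by apply: data; rewrite !inE eqxx !orbT. Qed.
Let Hd : [/\ measurable_fun setT d, (forall p, `|d p| <= N), (forall p, DD p -> pcont d p) & ginv Gam d].
Proof. by apply: data; rewrite !inE eqxx !orbT. Qed.

(** A bound of [|H|]: [M + e * H] is nonnegative for [|e| <= 1], as Tonelli's theorem and mass
    transport require. *)
Let M : R := 4 * N ^+ 2.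

Let H_le p q : `|H p q| <= M.
Proof.
have [_ ha _ _] := Ha; have [_ hb _ _] := Hb; have [_ hc _ _] := Hc; have [_ hd _ _] := Hd.
apply: le_trans (ler_normD _ _) _; rewrite !normrM.
have h1 : `|a p - a q| <= 2 * N by apply: le_trans (ler_normB _ _) _; have := ha p; have := ha q; lra.
have h2 : `|b p - b q| <= 2 * N by apply: le_trans (ler_normB _ _) _; have := hb p; have := hb q; lra.
rewrite (_ : M = N * (2 * N) + N * (2 * N)); last by rewrite /M; ring.
by apply: lerD; apply: ler_pM.
Qed.

Let mH (e : R) : measurable_fun setT (fun x : plane R * plane R => (M + e * H x.1 x.2)%:E).
Proof.
have [ma _ _ _] := Ha; have [mb _ _ _] := Hb; have [mc _ _ _] := Hc; have [md _ _ _] := Hd.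
have m1 (f : R * R -> R) : measurable_fun setT f -> measurable_fun setT (fun x : plane R * plane R => f x.1).
  by move=> mf; apply: (measurableT_comp mf); exact: measurable_fst.
have m2 (f : R * R -> R) : measurable_fun setT f -> measurable_fun setT (fun x : plane R * plane R => f x.2).
  by move=> mf; apply: (measurableT_comp mf); exact: measurable_snd.
have := m1 _ ma; have := m2 _ ma; have := m1 _ mb; have := m2 _ mb; have := m1 _ mc; have := m1 _ md.
by move=> *; rewrite /H; mreal.
Qed.

Let MH_ge0 (e : R) p q : `|e| <= 1 -> 0 <= M + e * H p q.
Proof.
move=> e1; have : `|e * H p q| <= M.
  rewrite normrM -[M]mul1r; apply: ler_pM => //; exact: H_le.
by rewrite ler_norml; lra.
Qed.

Definition mean_pair p (s : R) : R := c p * local_mean a (toC p) s + d p * local_mean b (toC p) s.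

Let inner (e : R) p (s : R) : `|e| <= 1 -> s < 1 -> DD p ->
  (\int[@hmu R]_(q in pball (toC p) s) (M + e * H p q)%:E =
   (M * fine (hmu (nball s)) + e * mean_pair p s)%:E)%E.
Proof.
move=> e1 s1 Dp; have p1 : disc (toC p) by exact/DDE.
have [ma ha ca ia] := Ha; have [mb hb cb ib] := Hb.
have sT := trans_su11 p1; have mn := @measurable_nball R s.
rewrite (ge0_integral_pball (g := fun q => (M + e * H p q)%:E) p1 (ltW s1)); last 2 first.
- exact: (measurableT_comp (mH e) (measurable_pair1 p)).
- by move=> q; rewrite lee_fin MH_ge0.
have ii f : (forall p, DD p -> pcont f p) -> (@hmu R).-integrable (nball s) (EFin \o (fun q => f p - f (mz (trans (toC p)) q))).
  move=> cf; apply: pcont_integrable => // q Dq; apply: pcontD; first exact: pcont_cst.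
  by apply: pcontN; exact: pcont_comp_mz.
have ic (k : R) : (@hmu R).-integrable (nball s) (EFin \o (fun=> k)).
  by apply: pcont_integrable => // q Dq; exact: pcont_cst.
pose h (f : R * R -> R) q : R := f p - f (mz (trans (toC p)) q).
have i1 : (@hmu R).-integrable (nball s) (EFin \o (fun q => c p * h a q)) by apply: rintZ => //; exact: ii.
have i2 : (@hmu R).-integrable (nball s) (EFin \o (fun q => d p * h b q)) by apply: rintZ => //; exact: ii.
have iH : (@hmu R).-integrable (nball s) (EFin \o (fun q => H p (mz (trans (toC p)) q))) by exact: rintD.
have iMH : (@hmu R).-integrable (nball s) (EFin \o (fun q => M + e * H p (mz (trans (toC p)) q))).
  by apply: rintD => //; exact: rintZ.
rewrite -[LHS]fineK; last exact: integrable_fin_num.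
congr EFin; rewrite -[LHS]/(\int[@hmu R]_(q in nball s) (M + e * H p (mz (trans (toC p)) q))).
rewrite RintegralD//; last exact: rintZ.
rewrite Rintegral_cst// RintegralZl// RintegralD// !RintegralZl//; [|exact: ii|exact: ii].
by rewrite /mean_pair /local_mean toCK.
Qed.

Let Phi (e : R) s (x : plane R * plane R) : \bar R :=
  (\1_(near_pairs s) x * (M + e * H x.1 x.2))%:E.

Let mPhi e s : measurable_fun setT (Phi e s).
Proof.
have /measurable_EFinP mh := mH e.
apply/measurable_EFinP; apply: measurable_funM; last exact: mh.
by apply: measurable_indic; exact: measurable_near_pairs.
Qed.

Let Phi_ge0 e s x : `|e| <= 1 -> (0 <= Phi e s x)%E.
Proof. by move=> e1; rewrite lee_fin mulr_ge0// MH_ge0. Qed.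

Let Phi_int e s p : `|e| <= 1 -> s < 1 -> DD p ->
  (\int[@hmu R]_(q in @DD R) Phi e s (p, q) = (M * fine (hmu (nball s)) + e * mean_pair p s)%:E)%E.
Proof.
move=> e1 s1 Dp; rewrite -(inner e1 s1 Dp) [LHS]integral_mkcond [RHS]integral_mkcond.
apply: eq_integral => q _; rewrite !patchE.
have [Dq|Dq] := pselect (DD q); last by rewrite !memNset// => -[].
rewrite (mem_set Dq) /Phi indicE; have E := near_pairs_pball s q Dp.
have -> : ((p, q) \in near_pairs s) = (q \in pball (toC p) s).
  by apply/idP/idP; rewrite !inE => /E.
by case: ifP => _; rewrite ?mul1r ?mul0r.
Qed.

(** By hypothesis [M - H p q <= M + H q p]. Integrated over the near pairs with [p] in [F], mass
    transport exchanges [p] and [q] on the right, so the integral of [M - H] is at most that of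
    [M + H]. *)
Lemma mean_green s : s < 1 ->
  (@hmu R).-integrable FF (EFin \o (fun p => mean_pair p s)) /\
  0 <= \int[@hmu R]_(p in FF) mean_pair p s.
Proof.
move=> s1; have mF := measurable_fdom FD.
have FDD := fdom_DD FD; have Flty := hmu_fdom_lty fG FD.
pose m := fine (@hmu R (nball s)).
have one : `|1 : R| <= 1 by rewrite normr1.
have mone : `|-1 : R| <= 1 by rewrite normrN1.
have Qb p : DD p -> `|mean_pair p s| <= M * m.
  move=> Dp; have h1 := Phi_int one s1 Dp; have h2 := Phi_int mone s1 Dp.
  have : (0 <= \int[@hmu R]_(q in @DD R) Phi 1 s (p, q))%E by apply: integral_ge0 => q _; exact: Phi_ge0.
  have : (0 <= \int[@hmu R]_(q in @DD R) Phi (-1) s (p, q))%E by apply: integral_ge0 => q _; exact: Phi_ge0.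
  by rewrite h1 h2 !lee_fin -/m ler_norml => *; apply/andP; split; lra.
have mQ : measurable_fun FF (fun p => mean_pair p s).
  have mI : measurable_fun FF (fun p => \int[@hmu R]_(q in @DD R) Phi 1 s (p, q))%E.
    apply: measurable_funTS; apply: measurable_inner; [exact: measurable_DD|exact: mPhi|].
    by move=> x; exact: Phi_ge0.
  have mI' : measurable_fun FF (fun p => (M * m + mean_pair p s)%:E).
    apply: eq_measurable_fun mI => p; rewrite inE => Fp; rewrite Phi_int ?mul1r//; exact: FDD.
  rewrite (_ : (fun p => _) = (fun p => (M * m + mean_pair p s) - M * m)); last first.
    by apply/funext => p; ring.
  by apply: measurable_funB => //; exact/measurable_EFinP.
have iQ : (@hmu R).-integrable FF (EFin \o (fun p => mean_pair p s)).
  by apply: (@bounded_integrable _ _ _ _ _ _ (M * m)) => // p /FDD; exact: Qb.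
split => //.
have iMm : (@hmu R).-integrable FF (EFin \o (fun=> M * m)).
  by apply: (@bounded_integrable _ _ _ _ _ _ `|M * m|).
have le1 : (\int[@hmu R]_(p in FF) \int[@hmu R]_(q in @DD R) Phi (-1) s (p, q) <=
    \int[@hmu R]_(p in FF) \int[@hmu R]_(q in @DD R) Phi 1 s (p, q))%E.
  apply: (@le_trans _ _ (\int[@hmu R]_(p in FF) \int[@hmu R]_(q in @DD R) Phi 1 s (q, p))%E).
    have mD := @measurable_DD R.
    have mPhi' : measurable_fun setT (fun x : plane R * plane R => Phi 1 s (x.2, x.1)).
      apply: (measurableT_comp (mPhi 1 s)); apply: measurable_fun_pair; [exact: measurable_snd|exact: measurable_fst].
    apply: ge0_le_integral => //.
    - by move=> p _; apply: integral_ge0 => q _; exact: Phi_ge0.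
    - by apply: measurable_funTS; apply: measurable_inner => // x; exact: Phi_ge0.
    - apply: measurable_funTS; apply: (measurable_inner (f := fun x : plane R * plane R => Phi 1 s (x.2, x.1))) => // x; exact: Phi_ge0.
    move=> p Fp; have Dp := FDD _ Fp; apply: ge0_le_integral => //.
    - by move=> q _; exact: Phi_ge0.
    - by apply: measurable_funTS; apply: (measurableT_comp (mPhi (-1) s)); exact: measurable_pair1.
    - by apply: measurable_funTS; apply: (measurableT_comp (mPhi 1 s)); exact: measurable_pair2.
    move=> q Dq; rewrite /Phi lee_fin !indicE.
    have -> : ((q, p) \in near_pairs s) = ((p, q) \in near_pairs s).
      by apply/idP/idP; rewrite !inE; exact: near_pairsC.
    apply: ler_wpM2l => //=; have := Hpos Dp Dq; lra.
  apply: (mass_transport_le fG FD (Phi := fun x => Phi 1 s (x.2, x.1))) => //.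
  - apply: (measurableT_comp (mPhi 1 s)); apply: measurable_fun_pair; [exact: measurable_snd|exact: measurable_fst].
  - by move=> x; exact: Phi_ge0.
  - move=> A p q GA Dp Dq /=; rewrite /Phi /=.
    have [_ _ _ ia] := Ha; have [_ _ _ ib] := Hb; have [_ _ _ ic] := Hc; have [_ _ _ id_] := Hd.
    have -> : \1_(near_pairs s) (mz A q, mz A p) = \1_(near_pairs s) (q, p) :> R.
      rewrite !indicE; congr (nat_of_bool _)%:R; apply/idP/idP; rewrite !inE /near_pairs /= !toC_mz.
        by rewrite ph2_moebius; [move=> [_ _]|exact: sub|exact/DDE|exact/DDE].
      rewrite ph2_moebius; [move=> [_ _]|exact: sub|exact/DDE|exact/DDE].
      by split => //; apply: disc_mz => //; exact: sub.
    by rewrite /H !ia// !ib// !ic// !id_.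
have E (e : R) : `|e| <= 1 -> (\int[@hmu R]_(p in FF) \int[@hmu R]_(q in @DD R) Phi e s (p, q) =
    (\int[@hmu R]_(p in FF) (M * m + e * mean_pair p s))%:E)%E.
  move=> e1; rewrite /Rintegral fineK; last first.
    by apply: integrable_fin_num => //; apply: rintD => //; exact: rintZ.
  by apply: eq_integral => p; rewrite inE => /FDD Dp; exact: Phi_int.
have V (e : R) : \int[@hmu R]_(p in FF) (M * m + e * mean_pair p s) =
    \int[@hmu R]_(p in FF) (M * m) + e * \int[@hmu R]_(p in FF) mean_pair p s.
  have ie : (@hmu R).-integrable FF (EFin \o (fun p => e * mean_pair p s)) by apply: rintZ.
  rewrite (RintegralD (f1 := fun=> M * m) _ iMm ie)//; congr (_ + _).
  by apply: (RintegralZl (mu := @hmu R) (f := fun p => mean_pair p s)) => //.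
by move: le1; rewrite !E// lee_fin !V lerD2l mulN1r mul1r; exact: ge0_opp_le.
Qed.

End bounded_data.

End green.

Section green_formula.
Context (R : realType) (Gam : set 'M[R[i]]_2) (fG : cocompact_fuchsian Gam).
Context (F : set R[i]) (FD : fundamental_domain Gam F).
Implicit Types (A B : 'M[R[i]]_2) (p q : R * R) (a b c d : R * R -> R).

Let sG : su11_subgroup Gam. Proof. by case: fG. Qed.
Let sub A : Gam A -> su11 A. Proof. by case: sG => + _ _ _ _; apply. Qed.
Local Notation FF := (@fdom R F).

(** Radii tending to 0, never above [1 / 8], where the Taylor estimates hold. *)
Let mesh (n : nat) : R := (n + 8)%:R^-1.
Let mesh_gt0 n : 0 < mesh n. Proof. by rewrite invr_gt0 ltr0n addn_gt0 orbT. Qed.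
Let mesh_le n : mesh n <= 8^-1.
Proof. by rewrite lef_pV2 ?posrE ?ltr0n ?addn_gt0 ?orbT// ler_nat leq_addl. Qed.
Let mesh_small (t0 : R) : 0 < t0 -> exists N, forall n, (N <= n)%N -> mesh n <= t0.
Proof.
move=> t00; exists (Num.bound t0^-1) => n Nn; rewrite -[t0]invrK lef_pV2 ?posrE ?invr_gt0 ?ltr0n ?addn_gt0 ?orbT//.
have : t0^-1 < (Num.bound t0^-1)%:R by apply: archi_boundP; rewrite invr_ge0 ltW.
move=> /ltW h; apply: le_trans h _; rewrite ler_nat; exact: leq_trans Nn (leq_addr _ _).
Qed.

(** Values off the disc are arbitrary; extension by zero makes the function measurable and bounded
    on the whole plane. *)
Definition dext a : R * R -> R := a \_ (@DD R).

Lemma dextE a p : DD p -> dext a p = a p.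
Proof. by move=> Dp; rewrite /dext patchE mem_set. Qed.

Lemma dext_data a : ginv Gam a -> (forall p, DD p -> pcont a p) ->
  exists N, [/\ measurable_fun setT (dext a), (forall p, `|dext a p| <= N),
    (forall p, DD p -> pcont (dext a) p) & ginv Gam (dext a)].
Proof.
move=> ia ca; have [N N0 hN] := ginv_bounded fG ia ca; exists N; split.
- apply/(measurable_restrictT _ _).1; [exact: measurable_DD|exact: pcont_measurable].
- move=> p; rewrite /dext patchE; case: ifPn => [|_]; last by rewrite normr0.
  by rewrite inE; exact: hN.
- by move=> p Dp; apply: pcont_patch => //; exact: ca.
- by move=> A p GA Dp; rewrite !dextE ?ia//; apply: disc_mz => //; exact: sub.
Qed.

(** The local means are invariant as [a] is, so [z] may be moved into the ball of radius [r < 1]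
    that meets every orbit, where [local_mean_bound] is uniform. *)
Lemma local_mean_le a a1 a2 a11 a12 a22 : C2_data a a1 a2 a11 a12 a22 -> ginv Gam a ->
  exists2 M, 0 <= M & forall z (t : R), disc z -> 0 < t -> t <= 8^-1 ->
    `|local_mean a z (t ^+ 2) / disc_norm (t ^+ 2)| <= M.
Proof.
move=> C ia; have [_ cc] := C; have ca p (Dp : DD p) : pcont a p by case: (cc p Dp).
have [_ _ _ cK] := fG; have [r [r0 r1 cov]] := cocompact_ball cK.
have [M M0 HM] := local_mean_bound C r1; exists M => // z t z1 t0 t8.
have t1 : t < 1 by lra.
have s1 : t ^+ 2 < 1 by rewrite expr_lt1// ltW.
have c0 := disc_norm_gt0 t0 t1.
rewrite normrM normfV (gtr0_norm c0) ler_pdivrMr//.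
have [A GA /HM h] := cov _ z1; have sA := sub GA; have Az := moebius_disc sA z1.
have [N [m1 m2 m3 m4]] := dext_data ia ca.
have e w : disc w -> local_mean a w (t ^+ 2) = local_mean (dext a) w (t ^+ 2).
  by move=> w1; apply: eq_local_mean => //; [exact: ltW|move=> p Dp; rewrite dextE].
rewrite e// -(local_mean_moebius sA z1 s1 m3 m1 m2) -?e//; first exact: h.
by move=> p Dp; exact: m4.
Qed.

Lemma local_mean_cvg a a1 a2 a11 a12 a22 p : C2_data a a1 a2 a11 a12 a22 -> DD p ->
  (fun n => local_mean a (toC p) (mesh n ^+ 2) / disc_norm (mesh n ^+ 2)) @ \oo --> lap a11 a22 p.
Proof.
move=> C Dp; apply/cvgrPdist_le => e e0; have p1 : disc (toC p) by exact/DDE.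
have [t0 t00 H] := local_mean_limit C p1 e0; have [N HN] := mesh_small t00.
exists N => // n /= /HN h; rewrite distrC -{2}[p]toCK; exact: H.
Qed.

Lemma lap_bounded a a1 a2 a11 a12 a22 : C2_data a a1 a2 a11 a12 a22 -> ginv Gam a ->
  exists2 M, 0 <= M & forall p, DD p -> `|lap a11 a22 p| <= M.
Proof.
move=> C ia; have [M M0 HM] := local_mean_le C ia; exists M => // p Dp.
apply/ler_addgt0Pl => e e0; have p1 : disc (toC p) by exact/DDE.
have [t0 t00 H] := local_mean_limit C p1 e0; rewrite toCK in H.
pose t := Num.min t0 8^-1; have tp : 0 < t by rewrite lt_min t00 invr_gt0 ltr0n.
have t8 : t <= 8^-1 by rewrite ge_min lexx orbT.
have tt0 : t <= t0 by rewrite ge_min lexx.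
have := H t tp tt0; have := HM _ t p1 tp t8; move: (_ / _) => x h1 h2.
have := ler_normB x (x - lap a11 a22 p); rewrite opprB addrC subrK; lra.
Qed.

Lemma lap_pcont a a1 a2 a11 a12 a22 p : C2_data a a1 a2 a11 a12 a22 -> DD p ->
  pcont (lap a11 a22) p.
Proof.
move=> [_ cc] Dp; have [_ k1 _ k2] := cc _ Dp.
have h : pcont (fun q => 1 - nsq q) p.
  by apply: pcontD; [exact: pcont_cst|apply: pcontN; exact: pcont_nsq].
apply: (eq_pcont (f := fun q => (- 4^-1 * (a11 q + a22 q)) * ((1 - nsq q) * (1 - nsq q)))).
  by move=> q; rewrite /lap expr2.
by apply: pcontM; [apply: pcontM; [exact: pcont_cst|exact: pcontD]|exact: pcontM].
Qed.

(** The multipliers [c] and [d] need not be differentiable: the Laplacian is the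
    limit of [a z - a w] averaged over small hyperbolic discs about [z], and mass
    transport on X symmetrises the resulting double integral in [z] and [w]. *)
Lemma green a a1 a2 a11 a12 a22 b b1 b2 b11 b12 b22 c d :
  C2_data a a1 a2 a11 a12 a22 -> C2_data b b1 b2 b11 b12 b22 ->
  ginv Gam a -> ginv Gam b -> ginv Gam c -> ginv Gam d ->
  (forall p, DD p -> pcont c p) -> (forall p, DD p -> pcont d p) ->
  (forall p q, DD p -> DD q ->
     0 <= c p * (a p - a q) + d p * (b p - b q) + (c q * (a q - a p) + d q * (b q - b p))) ->
  0 <= \int[@hmu R]_(p in FF) (c p * lap a11 a22 p + d p * lap b11 b22 p).
Proof.
move=> Ca Cb ia ib ic id_ cc cd Hpos.
have mF := measurable_fdom FD; have FDD := fdom_DD FD; have Flty := hmu_fdom_lty fG FD.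
have ca p (Dp : DD p) : pcont a p by case: Ca => _ /(_ p Dp)[].
have cb p (Dp : DD p) : pcont b p by case: Cb => _ /(_ p Dp)[].
have [Na [ma1 ma2 ma3 ma4]] := dext_data ia ca.
have [Nb [mb1 mb2 mb3 mb4]] := dext_data ib cb.
have [Nc [mc1 mc2 mc3 mc4]] := dext_data ic cc.
have [Nd [md1 md2 md3 md4]] := dext_data id_ cd.
have ge0 (f : R * R -> R) (N : R) : (forall p, `|f p| <= N) -> 0 <= N by move=> h; apply: le_trans (normr_ge0 _) (h (0, 0)).
have Na0 := ge0 _ _ ma2; have Nb0 := ge0 _ _ mb2; have Nc0 := ge0 _ _ mc2; have Nd0 := ge0 _ _ md2.
pose N := Na + Nb + Nc + Nd.
have data f : f \in [:: dext a; dext b; dext c; dext d] ->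
  [/\ measurable_fun setT f, (forall p, `|f p| <= N), (forall p, DD p -> pcont f p) & ginv Gam f].
  rewrite !inE => /or4P[]/eqP->; split => // p.
  - by apply: le_trans (ma2 p) _; rewrite /N; lra.
  - by apply: le_trans (mb2 p) _; rewrite /N; lra.
  - by apply: le_trans (mc2 p) _; rewrite /N; lra.
  - by apply: le_trans (md2 p) _; rewrite /N; lra.
have Hpos' p q : DD p -> DD q ->
  0 <= (dext c p * (dext a p - dext a q) + dext d p * (dext b p - dext b q)) +
       (dext c q * (dext a q - dext a p) + dext d q * (dext b q - dext b p)).
  by move=> Dp Dq; rewrite !dextE//; exact: Hpos.
have mesh1 n : mesh n < 1 by apply: le_lt_trans (mesh_le n) _; rewrite invf_lt1 ?ltr1n.
have s1 n : mesh n ^+ 2 < 1 by rewrite expr_lt1// ltW// mesh_gt0.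
have MG n := mean_green fG FD data Hpos' (s1 n).
pose f n p := (disc_norm (mesh n ^+ 2))^-1 * mean_pair (dext a) (dext b) (dext c) (dext d) p (mesh n ^+ 2).
have fE n p : DD p -> f n p = c p * (local_mean a (toC p) (mesh n ^+ 2) / disc_norm (mesh n ^+ 2)) +
    d p * (local_mean b (toC p) (mesh n ^+ 2) / disc_norm (mesh n ^+ 2)).
  move=> Dp; have p1 : disc (toC p) by exact/DDE.
  rewrite /f /mean_pair !dextE// (@eq_local_mean _ (dext a) a)//; [|exact/ltW/s1|by move=> r Dr; rewrite dextE].
  rewrite (@eq_local_mean _ (dext b) b)//; [|exact/ltW/s1|by move=> r Dr; rewrite dextE].
  by ring.
have [Ma Ma0 HMa] := local_mean_le Ca ia; have [Mb Mb0 HMb] := local_mean_le Cb ib.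
have i_f n : (@hmu R).-integrable FF (EFin \o f n) by apply: rintZ => //; have [] := MG n.
have f0 n : 0 <= \int[@hmu R]_(p in FF) f n p.
  have [i0 h0] := MG n; rewrite /f RintegralZl// mulr_ge0// invr_ge0 ltW//.
  exact: disc_norm_gt0 (mesh_gt0 n) (mesh1 n).
pose g p := c p * lap a11 a22 p + d p * lap b11 b22 p.
have mg : measurable_fun FF g.
  apply: (measurable_funS (E := @DD R)) => //; first exact: measurable_DD.
  apply: pcont_measurable => p Dp; apply: pcontD; apply: pcontM;
    [exact: cc|exact: lap_pcont Ca Dp|exact: cd|exact: lap_pcont Cb Dp].
have iK : (@hmu R).-integrable FF (EFin \o (fun=> Nc * Ma + Nd * Mb)).
  by apply: (@bounded_integrable _ _ _ _ _ _ `|Nc * Ma + Nd * Mb|).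
have f_cvg p : FF p -> f n p @[n --> \oo] --> g p.
  move=> /FDD Dp; rewrite (_ : (fun n => f n p) = (fun n =>
      c p * (local_mean a (toC p) (mesh n ^+ 2) / disc_norm (mesh n ^+ 2)) +
      d p * (local_mean b (toC p) (mesh n ^+ 2) / disc_norm (mesh n ^+ 2)))); last first.
    by apply/funext => n; exact: fE.
  by apply: cvgD; apply: cvgM; [exact: cvg_cst|exact: local_mean_cvg Ca Dp|exact: cvg_cst|exact: local_mean_cvg Cb Dp].
have ae1 : {ae @hmu R, forall p, FF p -> (EFin \o f n) p @[n --> \oo] --> (EFin \o g) p}.
  by apply: aeW => p Fp; apply: cvg_EFin; [exact: nearW|exact: f_cvg].
have ae2 : {ae @hmu R, forall p n, FF p -> (`|(EFin \o f n) p| <= (EFin \o (fun=> Nc * Ma + Nd * Mb)%R) p)%E}.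
  apply: aeW => p n /FDD Dp; rewrite /= lee_fin fE//; have p1 : disc (toC p) by exact/DDE.
  apply: le_trans (ler_normD _ _) _; rewrite !normrM.
  apply: lerD; apply: ler_pM => //.
  - by rewrite -(dextE c Dp).
  - by rewrite -normrM; apply: HMa => //; exact: mesh_gt0.
  - by rewrite -(dextE d Dp).
  - by rewrite -normrM; apply: HMb => //; exact: mesh_gt0.
have mf n : measurable_fun FF (EFin \o f n) := measurable_int _ (i_f n).
have mg' : measurable_fun FF (EFin \o g) by exact/measurable_EFinP.
have cv : [sequence (\int[@hmu R]_(x in FF) (EFin \o f n) x)%E]_n @ \oo --> (\int[@hmu R]_(x in FF) (EFin \o g) x)%E.
  by have [] := @dominated_convergence _ _ _ (@hmu R) FF _ (fun n => EFin \o f n) (EFin \o g)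
    (EFin \o (fun=> Nc * Ma + Nd * Mb)) _ _ ae1 iK ae2.
have h : (0 <= \int[@hmu R]_(p in FF) (EFin \o g) p)%E.
  apply: (cvge_to_ge cv); apply: nearW => n /=.
  have fin : (\int[@hmu R]_(p in FF) (EFin \o f n) p \is a fin_num)%E.
    by apply: integrable_fin_num => //; exact: i_f.
  by have := f0 n; rewrite /Rintegral -lee_fin fineK.
exact: fine_ge0.
Qed.

End green_formula.

(** * The closure of the Laplacian *)

Section smooth_functions.
Context (R : realType).
Implicit Types (p q : R * R) (a : R * R -> R) (u h : R[i] -> R[i]).

Definition rpart u p : R := re (u (toC p)).
Definition ipart u p : R := im (u (toC p)).

Lemma C1_pcont a a1 a2 p : partial1 a a1 -> partial2 a a2 -> pcont a1 p -> pcont a2 p ->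
  DD p -> pcont a p.
Proof.
move=> d1 d2 c1 c2 Dp e e0.
have [b0 b00 B0] := DD_square Dp; have [b1 b10 B1] := c1 _ ltr01; have [b2 b20 B2] := c2 _ ltr01.
pose M := `|a1 p| + `|a2 p| + 2.
have M0 : 0 < M by rewrite ltr_wpDl// addr_ge0.
have M1 : `|a1 p| + 1 <= M by have := normr_ge0 (a2 p); rewrite /M; lra.
have M2 : `|a2 p| + 1 <= M by have := normr_ge0 (a1 p); rewrite /M; lra.
exists (Num.min (Num.min b0 (Num.min b1 b2)) (e / 2 / M)).
  by rewrite !lt_min b00 b10 b20 !divr_gt0.
case=> x y [/=]; rewrite !lt_min => /andP[/andP[x0 /andP[x1 x2]] x3] /andP[/andP[y0 /andP[y1 y2]] y3].
case: p Dp c1 c2 B0 B1 B2 M M0 M1 M2 x0 x1 x2 x3 y0 y1 y2 y3 => s t /= Dp c1 c2 B0 B1 B2 M M0 M1 M2 x0 x1 x2 x3 y0 y1 y2 y3.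
have h1 (X : R) : `|X - s| <= `|x - s| -> square (s, t) b0 (X, y) /\ square (s, t) b1 (X, y).
  by move=> h; split; split => //=; apply: le_lt_trans h _.
have h2 (Y : R) : `|Y - t| <= `|y - t| -> square (s, t) b0 (s, Y) /\ square (s, t) b2 (s, Y).
  by move=> h; split; split => //=; rewrite ?subrr ?normr0//; apply: le_lt_trans h _.
have e1 : `|a (s + (x - s), y) - a (s, y)| <= M * `|x - s|.
  apply: (@increment_le _ (fun X => a (X, y)) (fun X => a1 (X, y))) => X /h1[k0 k1].
    exact: (d1 (X, y) (B0 _ k0)).
  have := B1 _ k1; have := ler_normD (a1 (X, y) - a1 (s, t)) (a1 (s, t)); rewrite subrK; lra.
have e2 : `|a (s, t + (y - t)) - a (s, t)| <= M * `|y - t|.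
  apply: (@increment_le _ (fun Y => a (s, Y)) (fun Y => a2 (s, Y))) => Y /h2[k0 k1].
    exact: (d2 (s, Y) (B0 _ k0)).
  have := B2 _ k1; have := ler_normD (a2 (s, Y) - a2 (s, t)) (a2 (s, t)); rewrite subrK; lra.
rewrite (_ : s + (x - s) = x) in e1; last by ring.
rewrite (_ : t + (y - t) = y) in e2; last by ring.
rewrite (_ : a (x, y) - a (s, t) = (a (x, y) - a (s, y)) + (a (s, y) - a (s, t))); last by ring.
apply: le_lt_trans (ler_normD _ _) _.
rewrite ltr_pdivlMr// in x3; rewrite ltr_pdivlMr// in y3; lra.
Qed.

Lemma continuous_disc_pcont h p : continuous_on_disc h -> DD p ->
  pcont (rpart h) p /\ pcont (ipart h) p.
Proof.
move=> ch Dp; have p1 : disc (toC p) by exact/DDE.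
have key (e : R) : 0 < e -> exists2 d : R, 0 < d &
    forall q, square p d q -> cabs (h (toC q) - h (toC p)) < e.
  move=> e0; have eC : (0 : R[i]) < (e%:C)%C by rewrite ltcR.
  have /cvgrPdist_lt/(_ _ eC) := ch _ p1.
  move=> /nbhs_ballP[d /= d0 H]; have dr : d = ((complex.Re d)%:C)%C.
    by case: d d0 {H} => x y; rewrite ltcE/= => /andP[/eqP -> _].
  have rd : 0 < re d by move: d0; rewrite dr ltcR.
  exists (re d / 2); first by rewrite divr_gt0.
  move=> q [q1 q2]; have := H (toC q); rewrite -ball_normE /= !cabsE dr !ltcR.
  move=> Hq; rewrite cabsB; apply: Hq; rewrite cabsB.
  apply: le_lt_trans (cabs_le _) _; rewrite !cxE /=; lra.
split=> e e0; have [d d0 H] := key e e0; exists d => // q /H; apply: le_lt_trans.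
  by have := re_le_cabs (h (toC q) - h (toC p)); rewrite !cxE.
by have := im_le_cabs (h (toC q) - h (toC p)); rewrite !cxE.
Qed.

Lemma C1_partials u : C1_on_disc u ->
  [/\ partial1 (rpart u) (rpart (dx u)), partial2 (rpart u) (rpart (dy u)),
      partial1 (ipart u) (ipart (dx u)) & partial2 (ipart u) (ipart (dy u))].
Proof.
move=> [d _ _]; split => p /DDE p1; have [h1 h2 h3 h4] := d _ p1.
- by apply: DeriveDef; [exact: h1|rewrite -derive1E].
- by apply: DeriveDef; [exact: h3|rewrite -derive1E].
- by apply: DeriveDef; [exact: h2|rewrite -derive1E].
- by apply: DeriveDef; [exact: h4|rewrite -derive1E].
Qed.

Lemma C2_on_disc_data u : C2_on_disc u ->
  C2_data (rpart u) (rpart (dx u)) (rpart (dy u)) (rpart (dx (dx u))) (rpart (dy (dx u))) (rpart (dy (dy u))) /\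
  C2_data (ipart u) (ipart (dx u)) (ipart (dy u)) (ipart (dx (dx u))) (ipart (dy (dx u))) (ipart (dy (dy u))).
Proof.
move=> [c0 c1 c2].
have [p1 p2 p3 p4] := C1_partials c0; have [q1 q2 q3 q4] := C1_partials c1.
have [r1 r2 r3 r4] := C1_partials c2.
have [_ k1 k2] := c0; have [_ k11 k12] := c1; have [_ k21 k22] := c2.
split; split => // p Dp.
- split; [|exact: (continuous_disc_pcont k11 Dp).1|exact: (continuous_disc_pcont k12 Dp).1|exact: (continuous_disc_pcont k22 Dp).1].
  by apply: (C1_pcont p1 p2 _ _ Dp); [exact: (continuous_disc_pcont k1 Dp).1|exact: (continuous_disc_pcont k2 Dp).1].
- split; [|exact: (continuous_disc_pcont k11 Dp).2|exact: (continuous_disc_pcont k12 Dp).2|exact: (continuous_disc_pcont k22 Dp).2].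
  by apply: (C1_pcont p3 p4 _ _ Dp); [exact: (continuous_disc_pcont k1 Dp).2|exact: (continuous_disc_pcont k2 Dp).2].
Qed.

Lemma mixed_dxdy u p : C2_on_disc u -> DD p ->
  rpart (dy (dx u)) p = rpart (dx (dy u)) p /\ ipart (dy (dx u)) p = ipart (dx (dy u)) p.
Proof.
move=> [c0 c1 c2] Dp.
have [p1 p2 p3 p4] := C1_partials c0; have [q1 q2 q3 q4] := C1_partials c1.
have [r1 r2 r3 r4] := C1_partials c2.
have [_ k11 k12] := c1; have [_ k21 k22] := c2.
split.
  apply: (mixed_partials p1 p2 q1 q2 r1 r2 Dp);
    [exact: (continuous_disc_pcont k11 Dp).1|exact: (continuous_disc_pcont k12 Dp).1|
     exact: (continuous_disc_pcont k21 Dp).1|exact: (continuous_disc_pcont k22 Dp).1].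
apply: (mixed_partials p3 p4 q3 q4 r3 r4 Dp);
  [exact: (continuous_disc_pcont k11 Dp).2|exact: (continuous_disc_pcont k12 Dp).2|
   exact: (continuous_disc_pcont k21 Dp).2|exact: (continuous_disc_pcont k22 Dp).2].
Qed.

Let half : (2^-1 : R[i]) = ((2^-1 : R)%:C)%C.
Proof. by rewrite fmorphV/= rmorph_nat. Qed.

Let re_cx (x y : R) : re (Complex x y) = x. Proof. by []. Qed.
Let im_cx (x y : R) : im (Complex x y) = y. Proof. by []. Qed.

Lemma wirtinger_bar (z w : R[i]) : 2^-1 * (z + Complex 0 1 * w) =
  Complex (2^-1 * (re z - im w)) (2^-1 * (im z + re w)).
Proof.
rewrite half; apply: complex_ext; rewrite ?reM ?imM !reD !imD !reM !imM reC imC ?re_cx ?im_cx; ring.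
Qed.

Lemma wirtinger (z w : R[i]) : 2^-1 * (z - Complex 0 1 * w) =
  Complex (2^-1 * (re z + im w)) (2^-1 * (im z - re w)).
Proof.
rewrite half; apply: complex_ext; rewrite ?reM ?imM !reD !imD !reN !imN !reM !imM reC imC ?re_cx ?im_cx; ring.
Qed.

Let derive1_halfB (f g : R -> R) (x l m : R) : is_derive x 1 f l -> is_derive x 1 g m ->
  derive1 (fun t => 2^-1 * (f t - g t)) x = 2^-1 * (l - m).
Proof. by move=> hf hg; rewrite derive1E; apply: derive_val. Qed.

Let derive1_halfD (f g : R -> R) (x l m : R) : is_derive x 1 f l -> is_derive x 1 g m ->
  derive1 (fun t => 2^-1 * (f t + g t)) x = 2^-1 * (l + m).
Proof. by move=> hf hg; rewrite derive1E; apply: derive_val. Qed.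

Let re_dx f p : re (dx f (toC p)) = derive1 (fun t : R => rpart f (t, p.2)) p.1. Proof. by []. Qed.
Let im_dx f p : im (dx f (toC p)) = derive1 (fun t : R => ipart f (t, p.2)) p.1. Proof. by []. Qed.
Let re_dy f p : re (dy f (toC p)) = derive1 (fun t : R => rpart f (p.1, t)) p.2. Proof. by []. Qed.
Let im_dy f p : im (dy f (toC p)) = derive1 (fun t : R => ipart f (p.1, t)) p.2. Proof. by []. Qed.

Let r_dzbar u : rpart (d_zbar u) = fun p => 2^-1 * (rpart (dx u) p - ipart (dy u) p).
Proof. by apply/funext => p; rewrite /rpart /d_zbar wirtinger_bar. Qed.
Let i_dzbar u : ipart (d_zbar u) = fun p => 2^-1 * (ipart (dx u) p + rpart (dy u) p).
Proof. by apply/funext => p; rewrite /ipart /d_zbar wirtinger_bar. Qed.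

Lemma omega_inv p : DD p -> (omega p)^-1 = (1 - nsq p) ^+ 2 / 4.
Proof. by move=> Dp; rewrite omegaE// invfM invrK mulrC. Qed.

Lemma laplacian_parts u p : DD p ->
  rpart (laplacian u) p = - ((1 - nsq p) ^+ 2 / 4) *
    (2^-1 * (re (dx (d_zbar u) (toC p)) + im (dy (d_zbar u) (toC p)))) /\
  ipart (laplacian u) p = - ((1 - nsq p) ^+ 2 / 4) *
    (2^-1 * (im (dx (d_zbar u) (toC p)) - re (dy (d_zbar u) (toC p)))).
Proof.
move=> Dp.
have -> : rpart (laplacian u) p = re (laplacian u (toC p)) by [].
have -> : ipart (laplacian u) p = im (laplacian u (toC p)) by [].
rewrite -(omega_inv Dp) /laplacian (rho_omega Dp) /d_z wirtinger.
move: (dx _ _) (dy _ _) => x y; rewrite -fmorphV -rmorphN.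
by rewrite reM imM reC imC re_cx im_cx; split; ring.
Qed.

Let lap_algebra (n A1 A2 B1 B2 x1 x2 x3 x4 x5 x6 y1 y2 : R) :
  A1 = 2^-1 * (x1 - x4) -> A2 = 2^-1 * (x3 + x2) ->
  B1 = 2^-1 * (y1 - x6) -> B2 = 2^-1 * (y2 + x5) -> y1 = x2 -> y2 = x4 ->
  - (n / 4) * (2^-1 * (A1 + B2)) = 4^-1 * (- 4^-1 * (x1 + x5) * n) /\
  - (n / 4) * (2^-1 * (A2 - B1)) = 4^-1 * (- 4^-1 * (x3 + x6) * n).
Proof. by move=> -> -> -> -> -> ->; split; field. Qed.

(** Four times [d_z (d_zbar u)] is the sum of the pure second derivatives plus [i] times the
    difference of the mixed ones, which vanishes by [mixed_partials]. *)
Lemma laplacian_lap u p : C2_on_disc u -> DD p ->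
  rpart (laplacian u) p = 4^-1 * lap (rpart (dx (dx u))) (rpart (dy (dy u))) p /\
  ipart (laplacian u) p = 4^-1 * lap (ipart (dx (dx u))) (ipart (dy (dy u))) p.
Proof.
move=> c Dp; have [c0 c1 c2] := c; have [m1 m2] := mixed_dxdy c Dp.
have [q1 q2 q3 q4] := C1_partials c1; have [r1 r2 r3 r4] := C1_partials c2.
have X1 : re (dx (d_zbar u) (toC p)) = 2^-1 * (rpart (dx (dx u)) p - ipart (dx (dy u)) p).
  by rewrite re_dx r_dzbar; exact: derive1_halfB (q1 _ Dp) (r3 _ Dp).
have X2 : im (dx (d_zbar u) (toC p)) = 2^-1 * (ipart (dx (dx u)) p + rpart (dx (dy u)) p).
  by rewrite im_dx i_dzbar; exact: derive1_halfD (q3 _ Dp) (r1 _ Dp).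
have Y1 : re (dy (d_zbar u) (toC p)) = 2^-1 * (rpart (dy (dx u)) p - ipart (dy (dy u)) p).
  by rewrite re_dy r_dzbar; exact: derive1_halfB (q2 _ Dp) (r4 _ Dp).
have Y2 : im (dy (d_zbar u) (toC p)) = 2^-1 * (ipart (dy (dx u)) p + rpart (dy (dy u)) p).
  by rewrite im_dy i_dzbar; exact: derive1_halfD (q4 _ Dp) (r2 _ Dp).
have [-> ->] := laplacian_parts u Dp.
exact: lap_algebra X1 X2 Y1 Y2 m1 m2.
Qed.

End smooth_functions.

Section plane_measurable_structures.
Context (R : realType).
Local Notation dleb2 :=
  ((@lebesgue_measure R \x @lebesgue_measure R)%E : set (R * R) -> \bar R).

Let plane_id : plane R -> (R * R)%type := id.

(** The two sides differ by the (provably equal, not convertible) displays of the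
    measurable structures put on the plane. *)
Lemma ge0_integral_dleb2 (D : set (R * R)) (f : R * R -> \bar R) : measurable D ->
  measurable_fun D f -> (forall p, D p -> (0 <= f p)%E) ->
  (\int[dleb2]_(p in D) f p = \int[leb2 R]_(p in D) f p)%E.
Proof.
move=> mD mf f0.
have mphi : measurable_fun setT plane_id by move=> _ Y mY; rewrite setTI.
have f0' : {in D, forall y, (0 <= f y)%E} by move=> y; rewrite inE; exact: f0.
have e := ge0_integral_pushforward mphi (leb2 R) mD mf f0'.
by apply: (etrans _ e).
Qed.

End plane_measurable_structures.

Lemma eq_rint d (T : measurableType d) (R : realType) (m : {measure set T -> \bar R})
    (D : set T) (f g : T -> R) : measurable D -> (forall x, D x -> f x = g x) ->
  m.-integrable D (EFin \o f) -> m.-integrable D (EFin \o g).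
Proof.
move=> mD fg; apply: eq_integrable => // x; rewrite inE => Dx /=.
by rewrite fg.
Qed.

Lemma n2_sub (R : realType) (z w : R[i]) : n2 (z - w) = (re z - re w) ^+ 2 + (im z - im w) ^+ 2.
Proof. by rewrite /n2 !cxE. Qed.

(** * Monotone fields against the closed Laplacian *)

Section laplacian_closure.
Context (R : realType) (Gam : set 'M[R[i]]_2) (fG : cocompact_fuchsian Gam).
Context (F : set R[i]) (FD : fundamental_domain Gam F).
Implicit Types (p q : R * R) (f u v h : R[i] -> R[i]).
Local Notation FF := (@fdom R F).

Definition cmeasurable f := measurable_fun (@DD R) (rpart f) /\ measurable_fun (@DD R) (ipart f).

Lemma cmeasurable_sub f h : cmeasurable f -> cmeasurable h -> cmeasurable (fun z => f z - h z).
Proof.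
move=> [f1 f2] [h1 h2]; split.
  rewrite (_ : rpart _ = (fun p => rpart f p - rpart h p)); first exact: measurable_funB.
  by apply/funext => p; rewrite /rpart !cxE.
rewrite (_ : ipart _ = (fun p => ipart f p - ipart h p)); first exact: measurable_funB.
by apply/funext => p; rewrite /ipart !cxE.
Qed.

Lemma measurable_n2 f : cmeasurable f -> measurable_fun FF (fun p => n2 (f (toC p))).
Proof.
move=> [f1 f2]; have FDD := fdom_DD FD.
have g1 : measurable_fun FF (rpart f) by apply: (measurable_funS (E := @DD R)) => //; exact: measurable_DD.
have g2 : measurable_fun FF (ipart f) by apply: (measurable_funS (E := @DD R)) => //; exact: measurable_DD.
by rewrite /n2; apply: measurable_funD; apply: measurable_funX.
Qed.

Lemma L2_normsqE f : cmeasurable f ->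
  (L2_normsq F f = \int[@hmu R]_(p in FF) (n2 (f (toC p)))%:E)%E.
Proof.
move=> mf; have mF := measurable_fdom FD; have FDD := fdom_DD FD.
have m1 : measurable_fun FF (fun p => (n2 (f (toC p)))%:E) by apply/measurable_EFinP; exact: measurable_n2.
have m2 : measurable_fun FF (fun p => (n2 (f (toC p)))%:E * (omega p)%:E)%E.
  by apply: emeasurable_funM => //; apply/measurable_EFinP; apply: measurable_funTS; exact: measurable_omega.
rewrite ge0_integral_hmu//; last by move=> p _; rewrite lee_fin n2_ge0.
have E p : FF p -> ((re (`|f (toC p)| ^+ 2 * rho (toC p)))%:E = (n2 (f (toC p)))%:E * (omega p)%:E)%E.
  by move=> /FDD Dp; rewrite normc2 (rho_omega Dp) -rmorphM/= EFinM.
have m3 : measurable_fun FF (fun p => (re (`|f (toC p)| ^+ 2 * rho (toC p)))%:E).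
  by apply: eq_measurable_fun m2 => p; rewrite inE => /E.
apply: (etrans (ge0_integral_dleb2 mF m3 _)) => [p Fp|].
  by rewrite E// mule_ge0 ?lee_fin ?n2_ge0 ?omega_ge0.
by apply: eq_integral => p; rewrite inE => /E.
Qed.

Lemma L2_integrable f : cmeasurable f -> (L2_normsq F f < +oo)%E ->
  (@hmu R).-integrable FF (EFin \o (fun p => n2 (f (toC p)))).
Proof.
move=> mf; rewrite L2_normsqE// => lty; apply/integrableP; split.
  by apply/measurable_EFinP; exact: measurable_n2.
apply: le_lt_trans lty; apply: ge0_le_integral => //.
- exact: (measurable_fdom FD).
- by apply: measurableT_comp => //; apply/measurable_EFinP; exact: measurable_n2.
- by apply/measurable_EFinP; exact: measurable_n2.
- by move=> p _ /=; rewrite lee_fin ger0_norm ?n2_ge0.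
Qed.

Lemma cvg0_small (x : nat -> \bar R) (e : R) : x @ \oo --> 0%E -> 0 < e ->
  \forall n \near \oo, (x n < e%:E)%E.
Proof.
move=> cx e0; apply: (cx [set y | (y < e%:E)%E]).
by apply: open_nbhs_nbhs; split; [exact: open_ereal_lt_ereal|rewrite /= lte_fin].
Qed.

Lemma L2_small f (e : R) : cmeasurable f -> (L2_normsq F f < e%:E)%E ->
  (@hmu R).-integrable FF (EFin \o (fun p => n2 (f (toC p)))) /\
  \int[@hmu R]_(p in FF) n2 (f (toC p)) <= e.
Proof.
move=> mf h; have i_f := L2_integrable mf (lt_le_trans h (leey _)); split => //.
have mF := measurable_fdom FD.
rewrite L2_normsqE// in h.
rewrite -lee_fin /Rintegral fineK; first exact: ltW.
exact: integrable_fin_num.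
Qed.

Definition lipschitz2 (psi : R -> R -> R) := forall x y x' y',
  `|psi x y - psi x' y'| <= `|x - x'| + `|y - y'|.

Lemma lipschitz2_pcont psi p : lipschitz2 psi -> pcont (fun q => psi q.1 q.2) p.
Proof.
move=> L e e0; exists (e / 2); first by rewrite divr_gt0.
by move=> q [q1 q2]; apply: le_lt_trans (L _ _ _ _) _; lra.
Qed.

Lemma pcont_comp2 psi (a b : R * R -> R) p : lipschitz2 psi -> pcont a p -> pcont b p ->
  pcont (fun q => psi (a q) (b q)) p.
Proof.
move=> L ca cb e e0; have e2 : 0 < e / 2 by rewrite divr_gt0.
have [d1 d10 H1] := ca _ e2; have [d2 d20 H2] := cb _ e2.
exists (Num.min d1 d2); first by rewrite lt_min d10.
move=> q [/=]; rewrite !lt_min => /andP[a1 a2] /andP[b1 b2].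
apply: le_lt_trans (L _ _ _ _) _.
have : `|a q - a p| < e / 2 by apply: H1.
have : `|b q - b p| < e / 2 by apply: H2.
lra.
Qed.

Lemma lipschitz2_measurable psi (D : set (R * R)) (a b : R * R -> R) : lipschitz2 psi ->
  measurable D -> measurable_fun D a -> measurable_fun D b -> measurable_fun D (fun p => psi (a p) (b p)).
Proof.
move=> L mD ma mb.
have mpsi : measurable_fun setT (fun q : R * R => psi q.1 q.2).
  by apply: measurable_pcont => q _; [exists 1|exact: lipschitz2_pcont].
have ma' : measurable_fun setT (a \_ D) by apply/(measurable_restrictT _ _).1.
have mb' : measurable_fun setT (b \_ D) by apply/(measurable_restrictT _ _).1.
have mab := measurableT_comp mpsi (measurable_fun_pair ma' mb').
apply: (eq_measurable_fun (fun p => psi ((a \_ D) p) ((b \_ D) p))).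
  by move=> p Dp; rewrite !patchE Dp.
exact: measurable_funTS.
Qed.

Definition monotone2 (psi1 psi2 : R -> R -> R) := forall x y x' y',
  0 <= (psi1 x y - psi1 x' y') * (x - x') + (psi2 x y - psi2 x' y') * (y - y').

Definition pairing (psi1 psi2 : R -> R -> R) v h p : R :=
  psi1 (rpart v p) (ipart v p) * rpart h p + psi2 (rpart v p) (ipart v p) * ipart h p.

Lemma sum_mul_integrable (c l d m : R * R -> R) (Mc Ml Md Mm : R) :
  (forall p, DD p -> pcont c p) -> (forall p, DD p -> pcont l p) ->
  (forall p, DD p -> pcont d p) -> (forall p, DD p -> pcont m p) ->
  (forall p, DD p -> `|c p| <= Mc) -> (forall p, DD p -> `|l p| <= Ml) ->
  (forall p, DD p -> `|d p| <= Md) -> (forall p, DD p -> `|m p| <= Mm) ->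
  (@hmu R).-integrable FF (EFin \o (fun p => c p * l p + d p * m p)).
Proof.
move=> cc cl cd cm hc hl hd hm.
have mF := measurable_fdom FD; have FDD := fdom_DD FD; have Flty := hmu_fdom_lty fG FD.
apply: (@bounded_integrable _ _ _ _ _ _ (Mc * Ml + Md * Mm)) => //.
  apply: (measurable_funS (E := @DD R)) => //; first exact: measurable_DD.
  apply: pcont_measurable => p Dp; apply: pcontD; apply: pcontM;
    [exact: cc|exact: cl|exact: cd|exact: cm].
move=> p /FDD Dp; apply: le_trans (ler_normD _ _) _; rewrite !normrM.
by apply: lerD; apply: ler_pM => //; [exact: hc|exact: hl|exact: hd|exact: hm].
Qed.

(** [green] with [a], [b] the real and imaginary parts of [u] and multipliers [psi1 u], [psi2 u]:
    its positivity hypothesis is then exactly monotonicity. The multipliers are merely continuous,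
    as with the negative part. *)
Lemma smooth_monotone psi1 psi2 u : lipschitz2 psi1 -> lipschitz2 psi2 -> monotone2 psi1 psi2 ->
  C2_on_disc u -> Defs.invariant Gam u ->
  [/\ cmeasurable u, cmeasurable (laplacian u),
      (@hmu R).-integrable FF (EFin \o pairing psi1 psi2 u (laplacian u)) &
      0 <= \int[@hmu R]_(p in FF) pairing psi1 psi2 u (laplacian u) p].
Proof.
move=> L1 L2 mono c2 inv; have [dr di] := C2_on_disc_data c2.
have mF := measurable_fdom FD; have FDD := fdom_DD FD; have Flty := hmu_fdom_lty fG FD.
have cr p (Dp : DD p) : pcont (rpart u) p by case: dr => _ /(_ p Dp)[].
have ci p (Dp : DD p) : pcont (ipart u) p by case: di => _ /(_ p Dp)[].
have ir : ginv Gam (rpart u) by move=> A p GA /DDE Dp; rewrite /rpart toC_mz inv.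
have ii : ginv Gam (ipart u) by move=> A p GA /DDE Dp; rewrite /ipart toC_mz inv.
pose c p := psi1 (rpart u p) (ipart u p); pose d p := psi2 (rpart u p) (ipart u p).
have ic : ginv Gam c by move=> A p GA Dp; rewrite /c ir// ii.
have id_ : ginv Gam d by move=> A p GA Dp; rewrite /d ir// ii.
have cc p : DD p -> pcont c p by move=> Dp; apply: pcont_comp2 => //; [exact: cr|exact: ci].
have cd p : DD p -> pcont d p by move=> Dp; apply: pcont_comp2 => //; [exact: cr|exact: ci].
have H := green fG FD dr di ir ii ic id_ cc cd.
pose lr := lap (rpart (dx (dx u))) (rpart (dy (dy u))).
pose li := lap (ipart (dx (dx u))) (ipart (dy (dy u))).
have {}H : 0 <= \int[@hmu R]_(p in FF) (c p * lr p + d p * li p).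
  apply: H => p q _ _; have := mono (rpart u p) (ipart u p) (rpart u q) (ipart u q).
  rewrite -/(c p) -/(d p) -/(c q) -/(d q); congr (_ <= _); ring.
have lrE p : DD p -> rpart (laplacian u) p = 4^-1 * lr p by exact: (fun Dp => (laplacian_lap c2 Dp).1).
have liE p : DD p -> ipart (laplacian u) p = 4^-1 * li p by exact: (fun Dp => (laplacian_lap c2 Dp).2).
have clr p : DD p -> pcont lr p by exact: lap_pcont dr.
have cli p : DD p -> pcont li p by exact: lap_pcont di.
have [Mr Mr0 HMr] := lap_bounded fG dr ir; have [Mi Mi0 HMi] := lap_bounded fG di ii.
have [Mc Mc0 HMc] := ginv_bounded fG ic cc; have [Md Md0 HMd] := ginv_bounded fG id_ cd.
have pE p : DD p -> pairing psi1 psi2 u (laplacian u) p = 4^-1 * (c p * lr p + d p * li p).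
  by move=> Dp; rewrite /pairing lrE// liE// -/(c p) -/(d p); ring.
have i0 := sum_mul_integrable cc clr cd cli HMc HMr HMd HMi.
split.
- by split; exact: pcont_measurable.
- split.
    apply: (eq_measurable_fun (fun p => 4^-1 * lr p)); first by move=> p; rewrite inE => /lrE.
    by apply: measurable_funM => //; exact: pcont_measurable.
  apply: (eq_measurable_fun (fun p => 4^-1 * li p)); first by move=> p; rewrite inE => /liE.
  by apply: measurable_funM => //; exact: pcont_measurable.
- have i4 : (@hmu R).-integrable FF (EFin \o (fun p => 4^-1 * (c p * lr p + d p * li p))) by exact: rintZ.
  by apply: (eq_rint _ _ i4) => // p /FDD Dp; rewrite pE.
- have -> : \int[@hmu R]_(p in FF) pairing psi1 psi2 u (laplacian u) p =
      \int[@hmu R]_(p in FF) (4^-1 * (c p * lr p + d p * li p)).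
    by apply: eq_Rintegral => p; rewrite inE => /FDD Dp; rewrite pE.
  by rewrite RintegralZl// mulr_ge0// invr_ge0.
Qed.

Lemma young (x y k : R) : 0 < k -> `|x * y| <= 2^-1 * (k * x ^+ 2 + y ^+ 2 / k).
Proof.
move=> k0; have := sqr_ge0 (k * `|x| - `|y|).
rewrite normrM -[x ^+ 2]real_normK ?num_real// -[y ^+ 2]real_normK ?num_real//.
move: (`|x|) (`|y|) => a b h.
rewrite (_ : k * a ^+ 2 + b ^+ 2 / k = 2 * (a * b) + (k * a - b) ^+ 2 / k); last first.
  by field; rewrite gt_eqF.
have : 0 <= (k * a - b) ^+ 2 / k by rewrite divr_ge0// ltW.
lra.
Qed.

Lemma perturbed_product (X x Y y k : R) : 0 < k ->
  (X + x) * (Y + y) <= X * Y + 2^-1 * (1 + k^-1) * (x ^+ 2 + y ^+ 2) + 2^-1 * k * (X ^+ 2 + Y ^+ 2).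
Proof.
move=> k0.
have /andP[_ e1] : - (2^-1 * (1 * x ^+ 2 + y ^+ 2 / 1)) <= x * y <= 2^-1 * (1 * x ^+ 2 + y ^+ 2 / 1).
  by rewrite -ler_norml; exact: young.
have /andP[_ e2] : - (2^-1 * (k * X ^+ 2 + y ^+ 2 / k)) <= X * y <= 2^-1 * (k * X ^+ 2 + y ^+ 2 / k).
  by rewrite -ler_norml; exact: young.
have /andP[_ e3] : - (2^-1 * (k * Y ^+ 2 + x ^+ 2 / k)) <= Y * x <= 2^-1 * (k * Y ^+ 2 + x ^+ 2 / k).
  by rewrite -ler_norml; exact: young.
rewrite mul1r divr1 in e1.
have -> : (X + x) * (Y + y) = X * Y + X * y + Y * x + x * y by ring.
have -> : 2^-1 * (1 + k^-1) * (x ^+ 2 + y ^+ 2) = 2^-1 * (x ^+ 2 + y ^+ 2) + 2^-1 * (x ^+ 2 / k) + 2^-1 * (y ^+ 2 / k).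
  by field; rewrite gt_eqF.
lra.
Qed.

(** Continuity of the pairing in L2, pointwise: squared errors carry the large factor [1 + k^-1],
    and the data of the limit the small factor [k]. The Lipschitz condition turns errors in [psi]
    into errors in its argument. *)
Lemma pairing_perturb psi1 psi2 (k a b a' b' y1 y2 z1 z2 : R) : 0 < k ->
  lipschitz2 psi1 -> lipschitz2 psi2 ->
  psi1 a' b' * z1 + psi2 a' b' * z2 <= psi1 a b * y1 + psi2 a b * y2 +
   ((1 + k^-1) * (2 * ((a' - a) ^+ 2 + (b' - b) ^+ 2) + ((z1 - y1) ^+ 2 + (z2 - y2) ^+ 2)) +
    2^-1 * k * (psi1 a b ^+ 2 + psi2 a b ^+ 2 + (y1 ^+ 2 + y2 ^+ 2))).
Proof.
move=> k0 L1 L2.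
have sq psi : lipschitz2 psi -> (psi a' b' - psi a b) ^+ 2 <= 2 * ((a' - a) ^+ 2 + (b' - b) ^+ 2).
  move=> L; have := L a' b' a b.
  rewrite -[(psi _ _ - _) ^+ 2]real_normK ?num_real// -[(a' - a) ^+ 2]real_normK ?num_real// -[(b' - b) ^+ 2]real_normK ?num_real//.
  move: (`|_|) (`|_|) (`|_|) (normr_ge0 (psi a' b' - psi a b)) (normr_ge0 (a' - a)) (normr_ge0 (b' - b)) => x y z x0 y0 z0 h.
  have : z ^+ 2 <= (y + x) ^+ 2 by rewrite ler_pXn2r ?nnegrE ?addr_ge0.
  have := sqr_ge0 (y - x); nra.
have := perturbed_product (psi1 a b) (psi1 a' b' - psi1 a b) y1 (z1 - y1) k0.
have := perturbed_product (psi2 a b) (psi2 a' b' - psi2 a b) y2 (z2 - y2) k0.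
have e (u w : R) : u + (w - u) = w by ring.
rewrite !e.
have := sq _ L1; have := sq _ L2.
have K0 : 0 < 1 + k^-1 by rewrite ltr_wpDr// ?invr_ge0 ltW.
set K := 1 + k^-1 in K0 *.
set A := 2 * _; set X := (_ - psi2 a b) ^+ 2; set Y := (_ - psi1 a b) ^+ 2.
move=> h1 h2.
have : K * X <= K * A by rewrite ler_wpM2l// ltW.
have : K * Y <= K * A by rewrite ler_wpM2l// ltW.
have : 0 <= K * ((z1 - y1) ^+ 2 + (z2 - y2) ^+ 2) by apply: mulr_ge0 (ltW K0) _; apply: addr_ge0; exact: sqr_ge0.
set Z1 := (z1 - y1) ^+ 2; set Z2 := (z2 - y2) ^+ 2.
move: X Y A Z1 Z2 K {h1 h2 K0} (psi1 a b) (psi2 a b) (psi1 a' b') (psi2 a' b') => X Y A Z1 Z2 K p1 p2 p3 p4.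
move=> h0 h1 h2 h3 h4; lra.
Qed.

(** The inequality holds for the smooth approximants [u n], and [pairing_perturb] bounds the pairing
    of [u n] above by that of the limit, up to an arbitrarily small integral. Linear growth of [psi]
    gives integrability. *)
Lemma graph_monotone psi1 psi2 v h : lipschitz2 psi1 -> lipschitz2 psi2 -> monotone2 psi1 psi2 ->
  laplacian_graph Gam F v h ->
  (@hmu R).-integrable FF (EFin \o pairing psi1 psi2 v h) /\
  0 <= \int[@hmu R]_(p in FF) pairing psi1 psi2 v h p.
Proof.
move=> L1 L2 mono [[_ v1 v2 vlty] [_ h1 h2 hlty] [u [uC cu clu]]].
have mF := measurable_fdom FD; have FDD := fdom_DD FD; have Flty := hmu_fdom_lty fG FD.
have mD := @measurable_DD R.
have mv : cmeasurable v by split; rewrite -(DD_preimage R).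
have mh : cmeasurable h by split; rewrite -(DD_preimage R).
have iv := L2_integrable mv vlty; have ih := L2_integrable mh hlty.
pose X1 p := psi1 (rpart v p) (ipart v p); pose X2 p := psi2 (rpart v p) (ipart v p).
have sub (f : R * R -> R) : measurable_fun (@DD R) f -> measurable_fun FF f.
  by move=> mf; apply: (measurable_funS (E := @DD R)).
have [[mv1 mv2] [mh1 mh2]] := (mv, mh).
have mX1 : measurable_fun FF X1 by apply: sub; exact: lipschitz2_measurable.
have mX2 : measurable_fun FF X2 by apply: sub; exact: lipschitz2_measurable.
have ic (k : R) : (@hmu R).-integrable FF (EFin \o (fun=> k)).
  by apply: (@bounded_integrable _ _ _ _ _ _ `|k|).
have Xsq psi : lipschitz2 psi -> (@hmu R).-integrable FF (EFin \o (fun p => psi (rpart v p) (ipart v p) ^+ 2)).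
  move=> L; pose g p := 4 * psi 0 0 ^+ 2 + 4 * n2 (v (toC p)).
  have ig : (@hmu R).-integrable FF (EFin \o g) by apply: rintD => //; exact: rintZ.
  apply: (le_rint _ _ _ ig) => //.
  - by apply: measurable_funX; apply: sub; exact: lipschitz2_measurable.
  - move=> p _; rewrite ger0_norm ?sqr_ge0// /g.
    have := L (rpart v p) (ipart v p) 0 0; rewrite !subr0 -[n2 _]/(rpart v p ^+ 2 + ipart v p ^+ 2).
    rewrite -[rpart v p ^+ 2]real_normK ?num_real// -[ipart v p ^+ 2]real_normK ?num_real//.
    move: (psi _ _) (psi 0 0) (`|rpart v p|) (`|ipart v p|) (normr_ge0 (rpart v p)) (normr_ge0 (ipart v p)) => x c a b a0 b0 hx.
    have xl : `|x| <= `|c| + (a + b).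
      by have := ler_normD (x - c) c; rewrite subrK; lra.
    rewrite -[x ^+ 2]real_normK ?num_real// -[c ^+ 2]real_normK ?num_real//.
    move: (`|x|) (`|c|) (normr_ge0 x) (normr_ge0 c) xl => y d y0 d0 yl.
    have y2 : y ^+ 2 <= (d + (a + b)) ^+ 2 by rewrite ler_pXn2r ?nnegrE ?addr_ge0.
    have := sqr_ge0 (d - a); have := sqr_ge0 (d - b); have := sqr_ge0 (a - b); nra.
have iX1 := Xsq _ L1; have iX2 := Xsq _ L2.
pose W p := (X1 p ^+ 2 + X2 p ^+ 2) + n2 (h (toC p)).
have iW : (@hmu R).-integrable FF (EFin \o W) by apply: rintD => //; exact: rintD.
have mG : measurable_fun FF (pairing psi1 psi2 v h).
  by apply: measurable_funD; apply: measurable_funM => //; exact: sub.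
have iG : (@hmu R).-integrable FF (EFin \o pairing psi1 psi2 v h).
  apply: (le_rint _ _ _ iW) => // p _.
  have y1 := young (X1 p) (rpart h p) (@ltr01 R); have y2 := young (X2 p) (ipart h p) (@ltr01 R).
  apply: le_trans (ler_normD _ _) _; apply: le_trans (lerD y1 y2) _.
  rewrite /W -[n2 _]/(rpart h p ^+ 2 + ipart h p ^+ 2) !mul1r !divr1.
  have := sqr_ge0 (X1 p); have := sqr_ge0 (X2 p); have := sqr_ge0 (rpart h p); have := sqr_ge0 (ipart h p).
  by move: (X1 p ^+ 2) (X2 p ^+ 2) (rpart h p ^+ 2) (ipart h p ^+ 2) => *; lra.
split => //; apply/ler_addgt0Pl => e e0.
have W0 : 0 <= \int[@hmu R]_(p in FF) W p.
  by apply: Rintegral_ge0 => p _; rewrite /W !addr_ge0 ?sqr_ge0 ?n2_ge0.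
(* [k] is fixed first and makes the term in [W] at most [e / 2]; only then is [n] chosen, with L2
   errors below [e1], so that the factor [1 + k^-1] is harmless. *)
pose C := \int[@hmu R]_(p in FF) W p; pose k := e / (C + 1).
have C1 : 0 < C + 1 by rewrite ltr_wpDl.
have k0 : 0 < k by rewrite divr_gt0.
pose e1 := e / (6 * (1 + k^-1)).
have K0 : 0 < 1 + k^-1 by rewrite ltr_wpDr// ?invr_ge0 ltW.
have e10 : 0 < e1 by rewrite divr_gt0// mulr_gt0.
have [n [nu nl]] : exists n, (L2_normsq F (fun z => u n z - v z)%R < e1%:E)%E /\
    (L2_normsq F (fun z => laplacian (u n) z - h z)%R < e1%:E)%E.
  have [n _ H] : \forall n \near \oo, (L2_normsq F (fun z => u n z - v z)%R < e1%:E)%E /\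
    (L2_normsq F (fun z => laplacian (u n) z - h z)%R < e1%:E)%E.
    by apply: filterI; [exact: cvg0_small cu e10|exact: cvg0_small clu e10].
  by exists n; exact: (H n (leqnn n)).
have [uC2 uinv] := uC n.
have [mu ml iU U0] := smooth_monotone L1 L2 mono uC2 uinv.
have [iA lA] := L2_small (cmeasurable_sub mu mv) nu.
have [iB lB] := L2_small (cmeasurable_sub ml mh) nl.
pose A p := n2 (u n (toC p) - v (toC p)); pose B p := n2 (laplacian (u n) (toC p) - h (toC p)).
pose E p := (1 + k^-1) * (2 * A p + B p) + 2^-1 * k * W p.
have iAB : (@hmu R).-integrable FF (EFin \o (fun p => 2 * A p + B p)) by apply: rintD => //; exact: rintZ.
have i1 : (@hmu R).-integrable FF (EFin \o (fun p => (1 + k^-1) * (2 * A p + B p))) by exact: rintZ.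
have i2 : (@hmu R).-integrable FF (EFin \o (fun p => 2^-1 * k * W p)) by exact: rintZ.
have iE : (@hmu R).-integrable FF (EFin \o E) by exact: rintD.
have i3 : (@hmu R).-integrable FF (EFin \o (fun p => 2 * A p)) by exact: rintZ.
have IE : \int[@hmu R]_(p in FF) E p <= e.
  rewrite /E RintegralD// RintegralZl// RintegralZl// RintegralD// RintegralZl// -/C.
  have h3 : (1 + k^-1) * (2 * \int[@hmu R]_(p in FF) A p + \int[@hmu R]_(p in FF) B p) <= e / 2.
    apply: (@le_trans _ _ ((1 + k^-1) * (3 * e1))); first by rewrite ler_wpM2l ?(ltW K0)//; rewrite /A /B; lra.
    rewrite /e1; move: (1 + k^-1) K0 => K K0.
    by rewrite le_eqVlt; apply/orP; left; apply/eqP; field; rewrite gt_eqF.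
  have h4 : 2^-1 * k * C <= e / 2.
    rewrite /k (_ : 2^-1 * (e / (C + 1)) * C = e / 2 * (C / (C + 1))); last by field; rewrite gt_eqF.
    by rewrite ler_piMr ?divr_ge0 ?(ltW e0)// ler_pdivrMr// mul1r lerDl.
  by apply: le_trans (lerD h3 h4) _; rewrite -splitr.
have le1 : \int[@hmu R]_(p in FF) pairing psi1 psi2 (u n) (laplacian (u n)) p <=
    \int[@hmu R]_(p in FF) (pairing psi1 psi2 v h p + E p).
  apply: le_Rintegral => //; first exact: rintD.
  move=> p _; have := pairing_perturb (rpart v p) (ipart v p) (rpart (u n) p) (ipart (u n) p)
    (rpart h p) (ipart h p) (rpart (laplacian (u n)) p) (ipart (laplacian (u n)) p) k0 L1 L2.
  have := n2_sub (u n (toC p)) (v (toC p)); have := n2_sub (laplacian (u n) (toC p)) (h (toC p)).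
  rewrite -/(A p) -/(B p) => Be Ae.
  by rewrite /E Ae Be /W; exact.
rewrite RintegralD// in le1.
by apply: le_trans U0 (le_trans le1 _); rewrite addrC lerD2r.
Qed.

End laplacian_closure.

(** * The Bergman bound *)

Section bergman_disc.
Context (R : realType).
Implicit Types (p : R * R) (q : R[i] -> R[i]) (z : R[i]).
Local Notation leb := (@lebesgue_measure R).

(** The factor [rho^-2] in [|nu|^2 = |q|^2 * rho^-2], as a function of [x = |z|^2]. *)
Definition bweight (x : R) : R := ((1 - x) ^+ 2 / 4) ^+ 2.

Lemma bweight_omega p : DD p -> bweight (nsq p) = omega p ^- 2.
Proof. by move=> Dp; rewrite -exprVn omega_inv. Qed.

Lemma bweight_ge0 x : 0 <= bweight x.
Proof. exact: sqr_ge0. Qed.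

Lemma measurable_bweight : measurable_fun setT bweight.
Proof. by rewrite /bweight; mreal. Qed.

(** The integrand is [bweight * omega = (1 - r^2)^2 / 4] with the circumference [2 pi r]. Its
    primitive [- pi / 12 * (1 - r^2)^3] is the source of the cube in [bound_const]. *)
Lemma quintic_primitive (t : R) : 0 < t ->
  (\int[leb]_(r in `[0%R, t]) ((1 - r ^+ 2) ^+ 2 / 4 * (2 * pi * r))%:E =
   (pi / 12 * (1 - (1 - t ^+ 2) ^+ 3))%:E)%E.
Proof.
move=> t0; pose F (r : R) : R := - (pi / 12) * (1 - r ^+ 2) ^+ 3.
have dF (r : R) : is_derive r 1 F ((1 - r ^+ 2) ^+ 2 / 4 * (2 * pi * r)).
  by rewrite /F; apply: is_derive_eq; rewrite /GRing.scale/=; field.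
have cF (r : R) : {for r, continuous F}.
  by apply/differentiable_continuous/derivable1_diffP; case: (dF r).
rewrite (@continuous_FTC2 _ _ F)//.
- by rewrite -EFinB /F expr0n/= subr0 expr1n; congr (_%:E); ring.
- apply: continuous_subspaceT => r.
  by apply/differentiable_continuous/derivable1_diffP; apply: ex_derive.
- split; first by move=> r _; case: (dF r).
  + by apply: cvg_at_right_filter; exact: cF.
  + by apply: cvg_at_left_filter; exact: cF.
- by move=> r _; rewrite derive1E; exact: derive_val.
Qed.

Lemma bweight_mass (t : R) : 0 < t -> t < 1 ->
  (\int[@hmu R]_(p in nball (t ^+ 2)) (bweight (nsq p))%:E =
   (pi / 12 * (1 - (1 - t ^+ 2) ^+ 3))%:E)%E.
Proof.
move=> t0 t1; have mn := measurable_nball (t ^+ 2).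
have t21 : t ^+ 2 < 1 by rewrite expr_lt1// ltW.
have mw : measurable_fun setT (fun p => bweight (nsq p)).
  by apply: measurableT_comp; [exact: measurable_bweight|exact: measurable_nsq].
rewrite ge0_integral_hmu//; last 2 first.
- by apply/measurable_EFinP; exact: measurable_funTS.
- by move=> p _; rewrite lee_fin bweight_ge0.
pose f (x : R) : \bar R := (((fun x => (1 - x) ^+ 2 / 4) \_ [set x | x < t ^+ 2]) x)%:E.
have f0 x : (0 <= f x)%E.
  by rewrite /f lee_fin patchE; case: ifP => // _; rewrite divr_ge0// sqr_ge0.
have ml : measurable [set x : R | x < t ^+ 2].
  by rewrite (_ : [set _ | _] = `]-oo, t ^+ 2[%classic)//; apply/seteqP; split => x /=; rewrite in_itv.
have mf : measurable_fun setT f.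
  apply/measurable_EFinP; apply/(measurable_restrictT _ _).1 => //.
  by apply: measurable_funTS; mreal.
rewrite -quintic_primitive// [LHS]integral_mkcond.
transitivity (\int[leb2 R]_p f (p.1 ^+ 2 + p.2 ^+ 2)%R)%E.
  apply: eq_integral => p _; rewrite /f !patchE -/(nsq p).
  have -> : (p \in nball (t ^+ 2)) = (nsq p \in [set x | x < t ^+ 2]).
    by apply/idP/idP; rewrite !inE.
  case: ifPn => // /set_mem pt; have Dp : DD p by exact: nball_DD (ltW t21) pt.
  rewrite -EFinM omegaE// /bweight; congr (_%:E).
  have : 1 - nsq p != 0 by rewrite gt_eqF// subr_gt0; exact: Dp.
  by move: (1 - nsq p) => x x0; field.
rewrite ge0_integral_radial// [LHS]integral_mkcond [RHS]integral_mkcond.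
rewrite -[RHS]integral_mkcond -integral_itv_obnd_cbnd; last first.
  by apply/measurable_EFinP; apply: measurable_funTS; mreal.
rewrite -integral_itv_bndo_bndc; last first.
  by apply/measurable_EFinP; apply: measurable_funTS; mreal.
rewrite [RHS]integral_mkcond; apply: eq_integral => r _.
rewrite !patchE /f patchE.
have -> : (r \in `]0, t[%classic) = (r \in `]0, +oo[%classic) && (r ^+ 2 \in [set x | x < t ^+ 2]).
  apply/idP/andP; rewrite !inE/= !in_itv/= ?andbT.
    by move=> /andP[r0 rt]; split => //; rewrite ltr_pXn2r// nnegrE ltW.
  by move=> [r0]; rewrite ltr_pXn2r ?nnegrE ?(ltW t0) ?(ltW r0)// => ->; rewrite r0.
by case: (r \in _) => //=; case: ifP => //; rewrite ?mul0e // EFinM.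
Qed.

Lemma square_completion (x y X Y v : R) : 0 <= v ->
  2 * X * (x * v) + 2 * Y * (y * v) - (X ^+ 2 + Y ^+ 2) * v <= (x ^+ 2 + y ^+ 2) * v.
Proof.
move=> v0; have := mulr_ge0 v0 (sqr_ge0 (x - X)); have := mulr_ge0 v0 (sqr_ge0 (y - Y)); nra.
Qed.

Lemma bergman_disc q (t : R) : chol q -> 0 < t -> t < 1 ->
  ((n2 (q 0) * (pi / 12 * (1 - (1 - t ^+ 2) ^+ 3)))%:E <=
   \int[@hmu R]_(p in nball (t ^+ 2)) (n2 (q (toC p)) * bweight (nsq p))%:E)%E.
Proof.
move=> hq t0 t1; have mn := measurable_nball (t ^+ 2).
have t20 : 0 < t ^+ 2 by rewrite exprn_gt0.
have t21 : t ^+ 2 < 1 by rewrite expr_lt1// ltW.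
have cq := chol_pcont hq; have [mr mi] := circle_mean_prop_chol hq.
(* [radial_mean] asks for a bound on the weight at all [x < t ^+ 2], negative ones included, where
   [bweight] is unbounded. The cut-off changes nothing at values of [nsq] in the disc. *)
pose w (x : R) := \1_(`[0, 1]%classic) x * bweight x.
have mI : measurable (`[0, 1]%classic : set R) by exact: measurable_itv.
have mw : measurable_fun setT w.
  by apply: measurable_funM; [exact: measurable_indic|exact: measurable_bweight].
have w0 x : 0 <= w x by rewrite mulr_ge0// bweight_ge0.
have w1 x : w x <= 1.
  rewrite /w indicE; case: (boolP (x \in _)) => [|_]; last by rewrite mul0r.
  rewrite inE/= in_itv/= => /andP[x0 x1]; rewrite mul1r /bweight expr_le1//; last first.
    by rewrite divr_ge0// sqr_ge0.
  by nra.
have wE p : nball (t ^+ 2) p -> w (nsq p) = bweight (nsq p).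
  move=> /(nball_DD (ltW t21)) Dp; rewrite /w indicE mem_set ?mul1r//= in_itv/=.
  by rewrite nsqE n2_ge0 -nsqE ltW.
have wB x : x < t ^+ 2 -> w x <= 1 by [].
have [ir Ir] := radial_mean t20 t21 (fun p Dp => (cq p Dp).1) mr mw w0 wB.
have [ii Ii] := radial_mean t20 t21 (fun p Dp => (cq p Dp).2) mi mw w0 wB.
have c1 : forall p : R * R, DD p -> pcont (fun=> 1 : R) p by move=> p _; exact: pcont_cst.
have mb := mn; have fb := hmu_nball_lty t21.
have mwn : measurable_fun (nball (t ^+ 2)) (fun p => w (nsq p)).
  by apply: measurable_funTS; apply: measurableT_comp => //; exact: measurable_nsq.
have iw : (@hmu R).-integrable (nball (t ^+ 2)) (EFin \o (fun p => w (nsq p))).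
  by apply: (@bounded_integrable _ _ _ _ _ _ 1) => // p pt; rewrite ger0_norm.
have cn p : DD p -> pcont (fun p => n2 (q (toC p))) p.
  by move=> /cq[c d]; rewrite /n2; apply: pcontD; apply: pcontM.
have [M M0 HM] := nball_bounded t21 cn.
have mq : measurable_fun (nball (t ^+ 2)) (fun p => n2 (q (toC p))).
  apply: (measurable_funS (E := @DD R)) => //; first exact: measurable_DD.
    by move=> p; exact: nball_DD (ltW t21).
  exact: pcont_measurable.
have inw : (@hmu R).-integrable (nball (t ^+ 2)) (EFin \o (fun p => n2 (q (toC p)) * w (nsq p))).
  apply: (@bounded_integrable _ _ _ _ _ _ (M * 1)) => //; first exact: measurable_funM.
  by move=> p pt; rewrite normrM ler_pM// ?HM ?(ltW pt)// ger0_norm.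
have W : \int[@hmu R]_(p in nball (t ^+ 2)) w (nsq p) = pi / 12 * (1 - (1 - t ^+ 2) ^+ 3).
  rewrite /Rintegral -[RHS]/(fine (_%:E)) -bweight_mass//; congr fine.
  by apply: eq_integral => p; rewrite inE => pt; rewrite wE.
pose X := re (q 0); pose Y := im (q 0).
have irZ : (@hmu R).-integrable (nball (t ^+ 2)) (EFin \o (fun p => 2 * X * (re (q (toC p)) * w (nsq p)))) by exact: rintZ.
have iiZ : (@hmu R).-integrable (nball (t ^+ 2)) (EFin \o (fun p => 2 * Y * (im (q (toC p)) * w (nsq p)))) by exact: rintZ.
have iwZ : (@hmu R).-integrable (nball (t ^+ 2)) (EFin \o (fun p => (X ^+ 2 + Y ^+ 2) * w (nsq p))) by exact: rintZ.
have isum : (@hmu R).-integrable (nball (t ^+ 2)) (EFin \o (fun p => 2 * X * (re (q (toC p)) * w (nsq p)) + 2 * Y * (im (q (toC p)) * w (nsq p)))) by exact: rintD.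
have H : \int[@hmu R]_(p in nball (t ^+ 2)) (2 * X * (re (q (toC p)) * w (nsq p)) +
    2 * Y * (im (q (toC p)) * w (nsq p)) - (X ^+ 2 + Y ^+ 2) * w (nsq p)) <=
    \int[@hmu R]_(p in nball (t ^+ 2)) (n2 (q (toC p)) * w (nsq p)).
  apply: le_Rintegral => //; first exact: rintB.
  move=> p _; rewrite /n2; move: (re (q (toC p))) (im (q (toC p))) (w (nsq p)) (w0 (nsq p)) => x y v v0.
  exact: square_completion.
rewrite RintegralB// RintegralD// !RintegralZl// Ir Ii W /= -/X -/Y in H.
have -> : (\int[@hmu R]_(p in nball (t ^+ 2)) (n2 (q (toC p)) * bweight (nsq p))%:E =
   (\int[@hmu R]_(p in nball (t ^+ 2)) (n2 (q (toC p)) * w (nsq p)))%:E)%E.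
  rewrite /Rintegral fineK; last exact: integrable_fin_num.
  by apply: eq_integral => p; rewrite inE => pt; rewrite wE.
rewrite lee_fin; apply: le_trans H; rewrite /n2 -/X -/Y.
by rewrite le_eqVlt; apply/orP; left; apply/eqP; ring.
Qed.

End bergman_disc.

Section beltrami_differentials.
Context (R : realType) (Gam : set 'M[R[i]]_2) (fG : cocompact_fuchsian Gam).
Implicit Types (A : 'M[R[i]]_2) (p : R * R) (z : R[i]) (nu : R[i] -> R[i]).
Let sG : su11_subgroup Gam. Proof. by case: fG. Qed.
Let sub A : Gam A -> su11 A. Proof. by case: sG => s _ _ _ _ /s. Qed.

Lemma beltrami_holomorphic nu : beltrami Gam nu -> exists q,
  [/\ chol q, forall z, disc z -> nu z = (rho z)^-1 * Num.conj (q z) &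
   forall A z, Gam A -> disc z -> q (moebius A z) = q z * den A z ^+ 4].
Proof.
move=> [q [hq inv] nuE]; exists q; split => //; first exact: holomorphic_chol.
move=> A z GA z1; have sA := sub GA; rewrite -[q z](inv A)// moebius_derivE//.
rewrite exprVn -exprM -mulrA mulVf ?mulr1//.
by rewrite expf_neq0// den_neq0.
Qed.

Lemma n2_beltrami q p : DD p -> n2 ((rho (toC p))^-1 * Num.conj (q (toC p))) =
  n2 (q (toC p)) / omega p ^+ 2.
Proof. by move=> Dp; rewrite n2M n2V n2J rho_omega// n2C mulrC. Qed.

Lemma n2_expr z n : n2 (z ^+ n) = n2 z ^+ n.
Proof. by elim: n => [|n IH]; rewrite ?expr0 ?n2_1// !exprS n2M IH. Qed.

(** Under [A], both [|q|^2] and [omega^2] acquire the fourth power of [n2 (den A z)]. *)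
Lemma beltrami_ginv nu : beltrami Gam nu -> ginv Gam (fun p => n2 (nu (toC p))).
Proof.
move=> /beltrami_holomorphic[q [hq nuE qA]] A p GA Dp; have sA := sub GA.
have Dq := disc_mz sA Dp; have p1 : disc (toC p) by exact/DDE.
have D0 := den_gt0 sA p1.
rewrite !nuE; [|exact: p1|exact/DDE].
rewrite !n2_beltrami// toC_mz qA// n2M n2_expr -(omega_mz p sA).
have : omega (mz A p) != 0 by rewrite gt_eqF// omega_gt0.
by move: (omega _) (n2 (den _ _)) D0 => x y /gt_eqF y0 x0; field; rewrite x0 y0.
Qed.

Lemma beltrami_pcont nu p : beltrami Gam nu -> DD p -> pcont (rpart nu) p /\ pcont (ipart nu) p.
Proof.
move=> /beltrami_holomorphic[q [hq nuE qA]] Dp; have [c1 c2] := chol_pcont hq Dp.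
pose k p := (1 - nsq p) ^+ 2 / 4.
have ck : pcont k p.
  have c0 : pcont (fun p => 1 + - nsq p) p by apply: pcontD; [exact: pcont_cst|exact/pcontN/pcont_nsq].
  by apply: pcontM; [exact: pcontM|exact: pcont_cst].
have kE a : DD a -> nu (toC a) = ((k a)%:C)%C * Num.conj (q (toC a)).
  by move=> Da; rewrite nuE ?rho_omega//; [rewrite -fmorphV omega_inv|exact/DDE].
have loc (f g : R * R -> R) : (forall a, DD a -> f a = g a) -> pcont g p -> pcont f p.
  move=> fg cg e e0; have [d d0 Hd] := cg e e0; have [b b0 Hb] := DD_square Dp.
  exists (Num.min d b); first by rewrite lt_min d0.
  move=> a [/=]; rewrite !lt_min => /andP[a1 a2] /andP[a3 a4].
  by rewrite !fg//; [exact: Hd|exact: Hb].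
split.
  apply: (loc _ (fun a => k a * re (q (toC a)))); last exact: pcontM.
  by move=> a Da; rewrite /rpart kE// !cxE mul0r subr0.
apply: (loc _ (fun a => k a * - im (q (toC a)))); last by apply: pcontM => //; exact: pcontN.
by move=> a Da; rewrite /ipart kE// !cxE mul0r addr0.
Qed.

Lemma beltrami_n2_pcont nu p : beltrami Gam nu -> DD p -> pcont (fun p => n2 (nu (toC p))) p.
Proof.
by move=> bn /(beltrami_pcont bn)[c d]; rewrite /n2; apply: pcontD; apply: pcontM.
Qed.

(** [4 e^r / (e^r + 1)^2 = 1 - tanh (r / 2)^2], which expresses the constant through the Euclidean
    radius [th r]. *)
Lemma bound_const_sq (r : R) : 0 < r ->
  bound_const r ^+ 2 = (4 * pi / 3 * (1 - (1 - th r ^+ 2) ^+ 3))^-1.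
Proof.
move=> r0; rewrite /bound_const; have e0 := expR_gt0 r.
have -> : 4 * expR r / (expR r + 1) ^+ 2 = 1 - th r ^+ 2.
  by rewrite /th; field; rewrite gt_eqF// addr_gt0.
have t0 := th_gt0 r0; have t1 := th_lt1 r.
have x0 : 0 <= 4 * pi / 3 * (1 - (1 - th r ^+ 2) ^+ 3).
  rewrite mulr_ge0// ?divr_ge0 ?mulr_ge0 ?pi_ge0// subr_ge0 exprn_ile1//.
    by rewrite subr_ge0 expr_le1// ltW.
  by rewrite gerBl sqr_ge0.
rewrite -powR_mulrn ?powR_ge0// -powRrM mulNr mulVf// powRN powRr1//.
Qed.

(** Recentred at [z], the disc estimate bounds [|nu z|^2] by the integral of [|nu|^2] over the ball
    of radius [r_X] about [z]; this ball meets each orbit at most once, so its integral is at most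
    that over [F]. *)
Lemma bergman_bound (F : set R[i]) nu z : fundamental_domain Gam F -> beltrami Gam nu -> disc z ->
  n2 (nu z) <= bound_const (inj_radius Gam) ^+ 2 * \int[@hmu R]_(p in fdom F) n2 (nu (toC p)).
Proof.
move=> FD bn z1; have [_ dG _ _] := fG.
have r0 := inj_radius_gt0 fG; set r := inj_radius Gam in r0 *; rewrite bound_const_sq//.
have t0 := th_gt0 r0; have t1 := th_lt1 r; set t := th r in t0 t1 *.
have t21 : t ^+ 2 < 1 by rewrite expr_lt1// ltW.
have [q [hq nuE qA]] := beltrami_holomorphic bn.
have sT := trans_su11 z1.
(* The pullback of the quadratic differential: the derivative of the translation is [den^-2], and it
   enters squared. *)
pose qt w := q (moebius (trans z) w) * ((den (trans z) w)^-1 * (den (trans z) w)^-1) *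
  ((den (trans z) w)^-1 * (den (trans z) w)^-1).
have hd := chol_den_inv sT.
have hqt : chol qt.
  apply: cholM; last exact: cholM.
  apply: cholM; last exact: cholM.
  by apply: (chol_comp hq (chol_moebius sT)) => w w1; exact: moebius_disc.
have qtE p : DD p -> n2 (qt (toC p)) * bweight (nsq p) = n2 (nu (toC (mz (trans z) p))).
  move=> Dp; have Dq := disc_mz sT Dp; have p1 : disc (toC p) by exact/DDE.
  have D0 := den_gt0 sT p1.
  rewrite nuE; last exact/DDE.
  rewrite n2_beltrami// bweight_omega// toC_mz -(omega_mz p sT) /qt !n2M !n2V.
  have : omega (mz (trans z) p) != 0 by rewrite gt_eqF// omega_gt0.
  by move: (omega _) (n2 (den _ _)) D0 => x y /gt_eqF y0 x0; field; rewrite x0 y0.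
have D00 : DD ((0, 0) : R * R) by apply/DDE; exact: disc0.
(* [rho] has value 4 at the origin; the 16 turns [pi / 12] into [4 pi / 3]. *)
have e0 : n2 (qt 0) = 16 * n2 (nu z).
  have := qtE _ D00; rewrite toC_mz -[toC (0, 0)]/(0 : R[i]) trans0// => <-.
  rewrite nsqE -[toC (0, 0)]/(0 : R[i]) n2_0 /bweight subr0.
  by field.
pose f p := ((fun p => (n2 (nu (toC p)))%:E) \_ (@DD R))%E p.
have f0 p : (0 <= f p)%E by rewrite /f patchE; case: ifP => // _; rewrite lee_fin n2_ge0.
have mn : measurable_fun (@DD R) (fun p => n2 (nu (toC p))).
  by apply: pcont_measurable => p Dp; exact: beltrami_n2_pcont.
have mf : measurable_fun setT f.
  by apply/(measurable_restrictT _ _).1; [exact: measurable_DD|exact/measurable_EFinP].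
have fE p : DD p -> f p = (n2 (nu (toC p)))%:E by move=> Dp; rewrite /f patchE mem_set.
have FDD := fdom_DD FD; have mF := measurable_fdom FD.
(* The only use of the injectivity radius: two points of this ball in one orbit coincide. *)
have le1 : (\int[@hmu R]_(p in pball z (t ^+ 2)) f p <= \int[@hmu R]_(p in fdom F) f p)%E.
  apply: (@group_transport _ Gam) => //.
  - exact: measurable_pball.
  - by move=> p [].
  - by move=> p [Dp _]; exact: fdom_cover FD _ Dp.
  - move=> A p GA Ep EAp; have Dp := Ep.1; have DAp := EAp.1.
    have p1 : disc (toC p) by exact/DDE.
    have h1 := (pball_hdist z1 r0 Dp).1 Ep; have h2 := (pball_hdist z1 r0 DAp).1 EAp.
    rewrite toC_mz in h2; have := inj_radius_inj fG z1 p1 GA h1 h2.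
    by rewrite /mz => ->; rewrite toCK.
  - move=> A p GA Dp; rewrite !fE//; last by apply: disc_mz => //; exact: sub.
    by rewrite (beltrami_ginv bn GA Dp).
rewrite ge0_integral_pball// in le1; last exact: ltW.
have le2 := bergman_disc hqt t0 t1.
have e1 : (\int[@hmu R]_(p in nball (t ^+ 2)) f (mz (trans z) p) =
   \int[@hmu R]_(p in nball (t ^+ 2)) (n2 (qt (toC p)) * bweight (nsq p))%:E)%E.
  apply: eq_integral => p; rewrite inE => /(nball_DD (ltW t21)) Dp.
  by rewrite qtE// fE//; exact: disc_mz.
rewrite e1 in le1; have := le_trans le2 le1.
have Flty := hmu_fdom_lty fG FD.
have [M M0 HM] := ginv_bounded fG (beltrami_ginv bn) (fun p Dp => beltrami_n2_pcont bn Dp).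
have inu : (@hmu R).-integrable (fdom F) (EFin \o (fun p => n2 (nu (toC p)))).
  apply: (@bounded_integrable _ _ _ _ _ _ M) => //; last by move=> p /FDD; exact: HM.
  by apply: (measurable_funS (E := @DD R)) => //; exact: measurable_DD.
have -> : (\int[@hmu R]_(p in fdom F) f p = (\int[@hmu R]_(p in fdom F) n2 (nu (toC p)))%:E)%E.
  rewrite /Rintegral fineK; last exact: integrable_fin_num.
  by apply: eq_integral => p; rewrite inE => /FDD; exact: fE.
rewrite lee_fin e0 => h.
have X0 : 0 < 4 * pi / 3 * (1 - (1 - t ^+ 2) ^+ 3).
  have tt : 0 < t ^+ 2 by rewrite exprn_gt0.
  rewrite mulr_gt0// ?divr_gt0 ?mulr_gt0 ?pi_gt0// subr_gt0 expr_lt1//.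
    by rewrite gtrBl.
  by rewrite subr_ge0 ltW.
rewrite mulrC ler_pdivlMr//; apply: le_trans h.
by rewrite le_eqVlt; apply/orP; left; apply/eqP; field.
Qed.

End beltrami_differentials.

Section weighted_integral.
Context (R : realType).
Local Notation dleb2 :=
  ((@lebesgue_measure R \x @lebesgue_measure R)%E : set (R * R) -> \bar R).

Lemma Rintegral_hmu (D : set (R * R)) (g : R * R -> R) : measurable D ->
  measurable_fun D g ->
  Rintegral dleb2 D (fun p => g p * omega p) = \int[@hmu R]_(p in D) g p.
Proof.
move=> mD mg; rewrite -[LHS]/(\int[leb2 R]_(p in D) (g p * omega p)).
have mE : measurable_fun D (EFin \o g) by exact/measurable_EFinP.
rewrite /Rintegral integralE [in RHS]integralE !ge0_integral_hmu//; last 2 first.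
- exact: measurable_funeneg.
- exact: measurable_funepos.
congr (fine (_ - _)); apply: eq_integral => p _.
  rewrite !funeposE /= -[0%E]/(0%:E) -!EFin_max -EFinM; congr (_%:E).
  by rewrite maxr_pMl ?mul0r// omega_ge0.
rewrite !funenegE /= -[0%E]/(0%:E) -!EFin_max -EFinM; congr (_%:E).
by rewrite maxr_pMl ?mul0r ?mulNr// omega_ge0.
Qed.

End weighted_integral.

Section integrals_on_the_quotient.
Context (R : realType) (Gam : set 'M[R[i]]_2) (fG : cocompact_fuchsian Gam).
Context (F : set R[i]) (FD : fundamental_domain Gam F).
Implicit Types (p : R * R) (f g v h : R[i] -> R[i]).
Local Notation FF := (@fdom R F).
Local Notation rint f := ((@hmu R).-integrable FF (EFin \o f)).

Lemma subset_measurable (a : R * R -> R) : measurable_fun (@DD R) a -> measurable_fun FF a.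
Proof.
move=> ma; apply: (measurable_funS (E := @DD R)) => //; first exact: measurable_DD.
exact: fdom_DD FD.
Qed.

Lemma cmeasurableM f g : cmeasurable f -> cmeasurable g -> cmeasurable (fun z => f z * g z).
Proof.
move=> [f1 f2] [g1 g2]; split.
  rewrite (_ : rpart _ = (fun p => rpart f p * rpart g p - ipart f p * ipart g p)).
    by apply: measurable_funB; exact: measurable_funM.
  by apply/funext => p; rewrite /rpart !cxE.
rewrite (_ : ipart _ = (fun p => rpart f p * ipart g p + ipart f p * rpart g p)).
  by apply: measurable_funD; exact: measurable_funM.
by apply/funext => p; rewrite /ipart !cxE.
Qed.

Lemma cmeasurableJ f : cmeasurable f -> cmeasurable (fun z => Num.conj (f z)).
Proof.
move=> [f1 f2]; split.
  by rewrite (_ : rpart _ = rpart f)//; apply/funext => p; rewrite /rpart !cxE.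
rewrite (_ : ipart _ = (fun p => - ipart f p)); first exact: measurable_funN.
by apply/funext => p; rewrite /ipart !cxE.
Qed.

Lemma cmeasurable_cst (c : R[i]) : cmeasurable (fun=> c).
Proof. by split; exact: measurable_cst. Qed.

Lemma integralXE f : cmeasurable f ->
  integralX F (fun z => f z * rho z) =
  Complex (\int[@hmu R]_(p in FF) rpart f p) (\int[@hmu R]_(p in FF) ipart f p).
Proof.
move=> [f1 f2]; have mF := measurable_fdom FD; have FDD := fdom_DD FD.
rewrite -!Rintegral_hmu//; last 2 first.
- exact: subset_measurable.
- exact: subset_measurable.
congr Complex; apply: eq_Rintegral => p; rewrite inE => /FDD Dp; rewrite rho_omega// !cxE.
  by rewrite mulr0 subr0.
by rewrite mulr0 add0r.
Qed.

(** From [|a| <= d + a^2 / d], the integral of [|a|] is at most [d] times the finite area of [F],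
    for every [d > 0]. Later estimates use this vanishing integral in place of an almost everywhere
    statement. *)
Lemma square_integral0 (a : R * R -> R) : measurable_fun FF a -> rint (fun p => a p ^+ 2) ->
  \int[@hmu R]_(p in FF) (a p ^+ 2) <= 0 ->
  rint a /\ \int[@hmu R]_(p in FF) `|a p| = 0.
Proof.
move=> ma ia2 a0; have mF := measurable_fdom FD; have Flty := hmu_fdom_lty fG FD.
have ic (k : R) : rint (fun=> k) by apply: (@bounded_integrable _ _ _ _ _ _ `|k|).
have key (d : R) p : 0 < d -> `|a p| <= d + d^-1 * a p ^+ 2.
  move=> d0; have := young 1 (a p) d0; rewrite mul1r expr1n mulr1 => h.
  have : 0 <= a p ^+ 2 / d by rewrite divr_ge0 ?sqr_ge0// ltW.
  by rewrite mulrC; lra.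
have id_ (d : R) : rint (fun p => d + d^-1 * a p ^+ 2) by apply: rintD => //; exact: rintZ.
have ia : rint a by apply: (le_rint _ _ _ (id_ 1)) => // p _; exact: key.
have iaa := rint_abs ia.
split=> //; apply/eqP; rewrite eq_le Rintegral_ge0// andbT.
apply/ler_addgt0Pl => e e0; rewrite addr0.
pose V := fine (hmu FF); have V0 : 0 <= V by exact: fine_ge0.
have [d d0 h2] : exists2 d : R, 0 < d & d * V <= e.
  have V1 : 0 < V + 1 by rewrite ltr_wpDl.
  exists (e / (V + 1)); first by rewrite divr_gt0.
  by rewrite mulrAC ler_pdivrMr// ler_wpM2l ?(ltW e0)// lerDl.
apply: (@le_trans _ _ (\int[@hmu R]_(p in FF) (d + d^-1 * a p ^+ 2))).
  by apply: le_Rintegral => // p _; exact: key.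
have iz : rint (fun p => d^-1 * a p ^+ 2) by exact: rintZ.
rewrite RintegralD// RintegralZl// Rintegral_cst//.
have h1 : d^-1 * \int[@hmu R]_(p in FF) (a p ^+ 2) <= 0 by rewrite mulr_ge0_le0// invr_ge0 ltW.
by apply: le_trans (lerD h2 h1) _; rewrite addr0.
Qed.

End integrals_on_the_quotient.

(** * Curvature *)

Section resolvent_estimates.
Context (R : realType) (Gam : set 'M[R[i]]_2) (fG : cocompact_fuchsian Gam).
Context (F : set R[i]) (FD : fundamental_domain Gam F).
Implicit Types (p : R * R) (f g v h : R[i] -> R[i]).
Local Notation FF := (@fdom R F).
Local Notation rint f := ((@hmu R).-integrable FF (EFin \o f)).

Lemma half_complex : (2^-1 : R[i]) = ((2^-1 : R)%:C)%C.
Proof. by rewrite fmorphV rmorph_nat. Qed.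

Lemma residual_parts f v p :
  rpart (fun z => f z - 2^-1 * v z) p = rpart f p - 2^-1 * rpart v p /\
  ipart (fun z => f z - 2^-1 * v z) p = ipart f p - 2^-1 * ipart v p.
Proof. by rewrite /rpart /ipart half_complex !cxE; split; ring. Qed.

Lemma graph_L2 v h : laplacian_graph Gam F v h ->
  cmeasurable v /\ rint (fun p => n2 (v (toC p))).
Proof.
move=> [[_ v1 v2 vlty] _ _]; have mv : cmeasurable v by split; rewrite -(DD_preimage R).
by split => //; exact (L2_integrable FD mv vlty).
Qed.

Lemma lipschitz_fst : lipschitz2 (fun x y : R => x).
Proof. by move=> x y x' y'; rewrite lerDl. Qed.

Lemma lipschitz_snd : lipschitz2 (fun x y : R => y).
Proof. by move=> x y x' y'; rewrite lerDr. Qed.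

Lemma lipschitzN (psi : R -> R -> R) : lipschitz2 psi -> lipschitz2 (fun x y => - psi x y).
Proof. by move=> L x y x' y'; rewrite -opprD normrN; exact: L. Qed.

Lemma lipschitz_cst (k : R) : lipschitz2 (fun x y : R => k).
Proof. by move=> x y x' y'; rewrite subrr normr0 addr_ge0. Qed.

Lemma lipschitz_neg_part : lipschitz2 (fun x y : R => Num.min x 0).
Proof.
move=> x y x' y'; apply: (@le_trans _ _ `|x - x'|); last by rewrite lerDl.
rewrite !minEle; have [a|a] := leP x 0; have [b|b] := leP x' 0; rewrite ?subr0 ?sub0r ?subrr ?normr0//.
  by rewrite ler0_norm// ler0_norm; lra.
by rewrite normrN ler0_norm// ger0_norm; lra.
Qed.

Lemma cmeasurable_resolvent f : cmeasurable (resolvent Gam F f).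
Proof.
rewrite /resolvent; case: xgetP => [v _ /graph_L2[]//|_]; exact: cmeasurable_cst.
Qed.

Lemma integralX_real f : cmeasurable f -> \int[@hmu R]_(p in FF) ipart f p = 0 ->
  integralX F (fun z => f z * rho z) = ((\int[@hmu R]_(p in FF) rpart f p)%:C)%C.
Proof. by move=> mf i0; rewrite (integralXE FD)// i0. Qed.

(* The term is [<v, f>/2 = |f|^2 - |h|^2 - <v, h>/2] with [h = Delta v], where
   [<v, h> >= 0]. *)
Lemma resolvent_self_pairing f : cmeasurable f -> rint (fun p => n2 (f (toC p))) ->
  exists2 t : R, integralX F (fun z => Gop Gam F f z * Num.conj (f z) * rho z) = (t%:C)%C &
    t <= \int[@hmu R]_(p in FF) n2 (f (toC p)).
Proof.
move=> mf ifn; have mF := measurable_fdom FD; have FDD := fdom_DD FD.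
have mG : cmeasurable (fun z => Gop Gam F f z * Num.conj (f z)).
  apply: cmeasurableM (cmeasurableJ mf).
  exact: cmeasurableM (@cmeasurable_cst _ _) (cmeasurable_resolvent _).
have I0 : 0 <= \int[@hmu R]_(p in FF) n2 (f (toC p)) by apply: Rintegral_ge0 => p _; exact: n2_ge0.
suff [E0 E1] : \int[@hmu R]_(p in FF) ipart (fun z => Gop Gam F f z * Num.conj (f z)) p = 0 /\
    \int[@hmu R]_(p in FF) rpart (fun z => Gop Gam F f z * Num.conj (f z)) p <=
    \int[@hmu R]_(p in FF) n2 (f (toC p)).
  by eexists; [exact: integralX_real mG E0|exact: E1].
have GE p : rpart (fun z => Gop Gam F f z * Num.conj (f z)) p =
    2^-1 * (rpart (resolvent Gam F f) p * rpart f p + ipart (resolvent Gam F f) p * ipart f p) /\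
  ipart (fun z => Gop Gam F f z * Num.conj (f z)) p =
    2^-1 * (ipart (resolvent Gam F f) p * rpart f p - rpart (resolvent Gam F f) p * ipart f p).
  rewrite /Gop /rpart /ipart half_complex; move: (resolvent _ _ _ _) => w.
  by rewrite !cxE; split; ring.
have -> : \int[@hmu R]_(p in FF) ipart (fun z => Gop Gam F f z * Num.conj (f z)) p =
   \int[@hmu R]_(p in FF) (2^-1 * (ipart (resolvent Gam F f) p * rpart f p - rpart (resolvent Gam F f) p * ipart f p)).
  by apply: eq_Rintegral => p _; rewrite (GE p).2.
have -> : \int[@hmu R]_(p in FF) rpart (fun z => Gop Gam F f z * Num.conj (f z)) p =
   \int[@hmu R]_(p in FF) (2^-1 * (rpart (resolvent Gam F f) p * rpart f p + ipart (resolvent Gam F f) p * ipart f p)).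
  by apply: eq_Rintegral => p _; rewrite (GE p).1.
move=> {GE mG}; rewrite /resolvent; case: xgetP => [v _ gv|_]; last first.
  have e (g : R * R -> R) : (forall p, g p = 0) -> \int[@hmu R]_(p in FF) g p = 0.
    move=> g0; have -> : \int[@hmu R]_(p in FF) g p = \int[@hmu R]_(p in FF) 0.
      by apply: eq_Rintegral => p _; exact: g0.
    by rewrite Rintegral_cst// mul0r.
  by split; rewrite e// => p; rewrite /rpart /ipart re0 im0; ring.
have [mv ivn] := graph_L2 gv.
have [i1 p1] := graph_monotone fG FD lipschitz_fst lipschitz_snd (psi1 := fun x y => x)
  (psi2 := fun x y => y) (fun x y x' y' => addr_ge0 (sqr_ge0 _) (sqr_ge0 _)) gv.
(* The rotation field and its opposite are both monotone, with equality. The two resulting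
   inequalities force the imaginary part of the pairing to vanish, which is the symmetry of the
   operator. *)
have rot_mono (x y x' y' : R) : 0 <= (y - y') * (x - x') + (- x - - x') * (y - y').
  by rewrite le_eqVlt; apply/orP; left; apply/eqP; ring.
have rot_mono' (x y x' y' : R) : 0 <= (- y - - y') * (x - x') + (x - x') * (y - y').
  by rewrite le_eqVlt; apply/orP; left; apply/eqP; ring.
have [i2 p2] := graph_monotone fG FD lipschitz_snd (lipschitzN lipschitz_fst) rot_mono gv.
have [i3 p3] := graph_monotone fG FD (lipschitzN lipschitz_snd) lipschitz_fst rot_mono' gv.
set h := (fun z => f z - _) in i1 p1 i2 p2 i3 p3.
have hE p := residual_parts f v p.
have E2 p : 2^-1 * (ipart v p * rpart f p - rpart v p * ipart f p) =
    2^-1 * pairing (fun x y => y) (fun x y => - x) v h p.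
  by rewrite /pairing (hE p).1 (hE p).2; ring.
have E3 p : pairing (fun x y => - y) (fun x y => x) v h p = - pairing (fun x y => y) (fun x y => - x) v h p.
  by rewrite /pairing; ring.
split.
  have -> : \int[@hmu R]_(p in FF) (2^-1 * (ipart v p * rpart f p - rpart v p * ipart f p)) =
     \int[@hmu R]_(p in FF) (2^-1 * pairing (fun x y => y) (fun x y => - x) v h p).
    by apply: eq_Rintegral => p _; exact: E2.
  rewrite RintegralZl//.
  have e3 : \int[@hmu R]_(p in FF) pairing (fun x y => - y) (fun x y => x) v h p =
     - \int[@hmu R]_(p in FF) pairing (fun x y => y) (fun x y => - x) v h p.
    rewrite -mulN1r -RintegralZl//; apply: eq_Rintegral => p _; rewrite E3; ring.
  rewrite e3 in p3; have /eqP -> : \int[@hmu R]_(p in FF) pairing (fun x y => y) (fun x y => - x) v h p == 0.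
    by rewrite eq_le p2 andbT -oppr_ge0.
  by rewrite mulr0.
have ipair : rint (fun p => 2^-1 * pairing (fun x y => x) (fun x y => y) v h p) by exact: rintZ.
apply: (@le_trans _ _ (\int[@hmu R]_(p in FF) (n2 (f (toC p)) - 2^-1 * pairing (fun x y => x) (fun x y => y) v h p))).
  apply: le_Rintegral => //; last 2 first.
  - exact: rintB.
  - move=> p _; rewrite /pairing (hE p).1 (hE p).2 -[n2 _]/(rpart f p ^+ 2 + ipart f p ^+ 2).
    move: (rpart f p) (ipart f p) (rpart v p) (ipart v p) => a b c d.
    have := sqr_ge0 (a - 2^-1 * c); have := sqr_ge0 (b - 2^-1 * d); nra.
  have i0 : rint (fun p => 2^-1 * pairing (fun x y => x) (fun x y => y) v h p + 4^-1 * n2 (v (toC p))).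
    by apply: rintD => //; exact: rintZ.
  apply: (eq_rint _ _ i0) => // p _; rewrite /pairing (hE p).1 (hE p).2 -[n2 _]/(rpart v p ^+ 2 + ipart v p ^+ 2).
  by field.
rewrite RintegralB// RintegralZl//; lra.
Qed.

End resolvent_estimates.

Lemma rint_sum d (T : measurableType d) (R : realType) (m : {measure set T -> \bar R})
    (D : set T) (n : nat) (a : 'I_n -> T -> R) :
  (forall i, m.-integrable D (EFin \o a i)) -> measurable D ->
  m.-integrable D (EFin \o (fun x => \sum_(i < n) a i x)) /\
  \int[m]_(x in D) (\sum_(i < n) a i x) = \sum_(i < n) \int[m]_(x in D) a i x.
Proof.
move=> ia mD.
elim: (index_enum 'I_n) => [|i s [IH1 IH2]].
  rewrite big_nil; have -> : (fun x => \sum_(i <- [::]) a i x) = (fun=> 0).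
    by apply/funext => x; rewrite big_nil.
  by rewrite Rintegral_cst// mul0r; split => //; exact: integrable0.
have -> : (fun x => \sum_(j <- i :: s) a j x) = (fun x => a i x + \sum_(j <- s) a j x).
  by apply/funext => x; rewrite big_cons.
split; first exact: rintD.
by rewrite RintegralD// IH2 big_cons.
Qed.

(** * Resolvents of nonnegative densities *)

Section resolvent_of_positive.
Context (R : realType) (Gam : set 'M[R[i]]_2) (fG : cocompact_fuchsian Gam).
Context (F : set R[i]) (FD : fundamental_domain Gam F).
Implicit Types (p : R * R) (f g v h : R[i] -> R[i]).
Local Notation FF := (@fdom R F).
Local Notation rint f := ((@hmu R).-integrable FF (EFin \o f)).

Lemma neg_part_monotone (x y : R) : 0 <= (Num.min x 0 - Num.min y 0) * (x - y).
Proof.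
rewrite !minEle; have [a|a] := leP x 0; have [b|b] := leP y 0.
- by rewrite -expr2 sqr_ge0.
- by rewrite subr0 mulr_le0// subr_le0 (le_trans a)// ltW.
- by rewrite sub0r mulr_ge0 ?oppr_ge0// subr_ge0 (le_trans b)// ltW.
- by rewrite subrr mul0r.
Qed.

(** Three monotone fields are tested against [f - v / 2]. The field [(0, y)] shows that the square
    of the imaginary part has integral at most 0; [(min x 0, 0)] does the same for the negative
    part, since [f >= 0]; the constant [(1, 0)] bounds the integral of [v / 2]. *)
Lemma resolvent_positive f : (forall p, DD p -> ipart f p = 0) ->
  (forall p, DD p -> 0 <= rpart f p) -> rint (rpart f) ->
  let v := resolvent Gam F f in
  [/\ rint (rpart v) /\ rint (ipart v), \int[@hmu R]_(p in FF) `|ipart v p| = 0,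
      rint (fun p => Num.min (rpart v p) 0),
      \int[@hmu R]_(p in FF) `|Num.min (rpart v p) 0| = 0 &
      \int[@hmu R]_(p in FF) (2^-1 * rpart v p) <= \int[@hmu R]_(p in FF) rpart f p].
Proof.
move=> fi fr ifr; have mF := measurable_fdom FD; have FDD := fdom_DD FD.
have Flty := hmu_fdom_lty fG FD.
have ic (k : R) : rint (fun=> k) by apply: (@bounded_integrable _ _ _ _ _ _ `|k|).
rewrite /= /resolvent; case: xgetP => [v _ gv|_]; last first.
  have i0 : rint (rpart (fun=> 0)) by apply: (eq_rint _ _ (ic 0)) => // p _; rewrite /rpart re0.
  have z0 (a : R * R -> R) : (forall p, a p = 0) -> \int[@hmu R]_(p in FF) a p = 0.
    move=> a0; have -> : \int[@hmu R]_(p in FF) a p = \int[@hmu R]_(p in FF) 0.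
      by apply: eq_Rintegral => p _; exact: a0.
    by rewrite Rintegral_cst// mul0r.
  split.
  - by split => //; apply: (eq_rint _ _ (ic 0)) => // p _; rewrite /ipart im0.
  - by apply: z0 => p; rewrite /ipart im0 normr0.
  - by apply: (eq_rint _ _ (ic 0)) => // p _; rewrite /rpart re0 minxx.
  - by apply: z0 => p; rewrite /rpart re0 minxx normr0.
  - rewrite z0; first by apply: Rintegral_ge0 => p /FDD; exact: fr.
    by move=> p; rewrite /rpart re0 mulr0.
have [[mv1 mv2] ivn] := graph_L2 FD gv.
have sub := subset_measurable FD.
have sq (a : R * R -> R) : measurable_fun (@DD R) a -> (forall p, a p ^+ 2 <= n2 (v (toC p))) ->
    rint (fun p => a p ^+ 2).
  move=> ma a2; apply: (le_rint _ _ _ ivn) => //; first by apply: measurable_funX; exact: sub.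
  by move=> p _; rewrite ger0_norm ?sqr_ge0.
have mm : measurable_fun (@DD R) (fun p => Num.min (rpart v p) 0).
  exact: (lipschitz2_measurable (@lipschitz_neg_part R) (@measurable_DD R) mv1 mv2).
have ii : rint (fun p => ipart v p ^+ 2).
  by apply: sq => // p; rewrite /n2 lerDr sqr_ge0.
have im_ : rint (fun p => Num.min (rpart v p) 0 ^+ 2).
  apply: sq => // p; apply: (@le_trans _ _ (rpart v p ^+ 2)); last by rewrite /n2 lerDl sqr_ge0.
  by rewrite minEle; case: ifP => //; rewrite expr0n/= sqr_ge0.
have snd_mono (x y x' y' : R) : 0 <= (0 - 0) * (x - x') + (y - y') * (y - y').
  by rewrite subrr mul0r add0r -expr2 sqr_ge0.
have min_mono (x y x' y' : R) : 0 <= (Num.min x 0 - Num.min x' 0) * (x - x') + (0 - 0) * (y - y').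
  by rewrite subrr mul0r addr0 neg_part_monotone.
have cst_mono (k x y x' y' : R) : 0 <= (k - k) * (x - x') + (0 - 0) * (y - y').
  by rewrite !subrr !mul0r addr0.
have [i1 p1] := graph_monotone fG FD (lipschitz_cst 0) (@lipschitz_snd R) snd_mono gv.
have [i2 p2] := graph_monotone fG FD (@lipschitz_neg_part R) (lipschitz_cst 0) min_mono gv.
have [i3 p3] := graph_monotone fG FD (lipschitz_cst 1) (lipschitz_cst 0) (cst_mono 1) gv.
set h := (fun z => f z - _) in i1 p1 i2 p2 i3 p3.
have hE p := residual_parts f v p.
have [iv iv0] : rint (ipart v) /\ \int[@hmu R]_(p in FF) `|ipart v p| = 0.
  apply: (square_integral0 fG FD) => //; first exact: sub.
  have : \int[@hmu R]_(p in FF) pairing (fun _ _ => 0) (fun x y => y) v h p =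
     \int[@hmu R]_(p in FF) (- 2^-1 * ipart v p ^+ 2).
    apply: eq_Rintegral => p; rewrite inE => /FDD Dp.
    by rewrite /pairing (hE p).2 fi//; ring.
  rewrite RintegralZl// => e; rewrite e in p1; lra.
have [imn imn0] : rint (fun p => Num.min (rpart v p) 0) /\
    \int[@hmu R]_(p in FF) `|Num.min (rpart v p) 0| = 0.
  apply: (square_integral0 fG FD) => //; first exact: sub.
  have imZ : rint (fun p => - 2^-1 * Num.min (rpart v p) 0 ^+ 2) by exact: rintZ.
  have : \int[@hmu R]_(p in FF) pairing (fun x y => Num.min x 0) (fun _ _ => 0) v h p <=
     \int[@hmu R]_(p in FF) (- 2^-1 * Num.min (rpart v p) 0 ^+ 2).
    apply: le_Rintegral => // p /FDD Dp.
    rewrite /pairing (hE p).1 (hE p).2; have := fr p Dp.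
    move: (rpart f p) (rpart v p) (ipart f p) (ipart v p) => a b c d a0.
    rewrite minEle; have [b0|b0] := leP b 0; nra.
  rewrite RintegralZl// => e; have := le_trans p2 e; lra.
have c1 : rint (fun p => 1 + n2 (v (toC p))) by exact: rintD.
have ivr : rint (rpart v).
  apply: (le_rint _ _ _ c1) => //; first exact: sub.
  move=> p _; have := young 1 (rpart v p) (@ltr01 R); rewrite !mul1r expr1n divr1.
  have -> : n2 (v (toC p)) = rpart v p ^+ 2 + ipart v p ^+ 2 by [].
  have := sqr_ge0 (rpart v p); have := sqr_ge0 (ipart v p); lra.
split => //.
have iZ : rint (fun p => 2^-1 * rpart v p) by exact: rintZ.
have : \int[@hmu R]_(p in FF) pairing (fun _ _ => 1) (fun _ _ => 0) v h p =
   \int[@hmu R]_(p in FF) (rpart f p - 2^-1 * rpart v p).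
  by apply: eq_Rintegral => p _; rewrite /pairing (hE p).1; ring.
by rewrite RintegralB// => e; rewrite e in p3; lra.
Qed.

(** With [b] the sum of the [|g i|^2] and [x] the real part of [v],
    [x / 2 * b <= K * (x / 2) + K * |min x 0|] pointwise, whatever the sign of [x]. *)
Lemma resolvent_density (n : nat) f (g : 'I_n -> R[i] -> R[i]) (K : R) :
  cmeasurable f -> (forall p, DD p -> ipart f p = 0) ->
  (forall p, DD p -> 0 <= rpart f p) -> rint (rpart f) ->
  (forall i, cmeasurable (g i)) -> 0 <= K ->
  (forall p, DD p -> \sum_(i < n) n2 (g i (toC p)) <= K) ->
  exists2 s : 'I_n -> R,
    forall i, integralX F (fun z => Gop Gam F f z * (g i z * Num.conj (g i z)) * rho z) = ((s i)%:C)%C &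
    \sum_(i < n) s i <= K * \int[@hmu R]_(p in FF) rpart f p.
Proof.
move=> mf fi fr ifr mg K0 gK; have mF := measurable_fdom FD; have FDD := fdom_DD FD.
have [[ivr ivi] vi0 imn imn0 le1] := resolvent_positive fi fr ifr.
have mv := cmeasurable_resolvent FD f.
have gK1 i p : DD p -> n2 (g i (toC p)) <= K.
  move=> Dp; apply: le_trans (gK p Dp); rewrite (bigD1 i)//= lerDl sumr_ge0// => j _.
  exact: n2_ge0.
set v := resolvent Gam F f in ivr ivi vi0 imn imn0 le1 mv.
have mG i : cmeasurable (fun z => Gop Gam F f z * (g i z * Num.conj (g i z))).
  apply: cmeasurableM; last by apply: cmeasurableM => //; exact: cmeasurableJ.
  exact: cmeasurableM (@cmeasurable_cst _ _) mv.
have GE i p : rpart (fun z => Gop Gam F f z * (g i z * Num.conj (g i z))) p =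
    2^-1 * (rpart v p * n2 (g i (toC p))) /\
  ipart (fun z => Gop Gam F f z * (g i z * Num.conj (g i z))) p =
    2^-1 * (ipart v p * n2 (g i (toC p))).
  rewrite /rpart /ipart /Gop half_complex -/v mulJ; move: (v (toC p)) (n2 _) => w k.
  by rewrite !cxE; split; ring.
have mn i : measurable_fun FF (fun p => n2 (g i (toC p))) by exact: (measurable_n2 FD (mg i)).
have bint (a : R * R -> R) i : measurable_fun (@DD R) a -> rint a ->
    rint (fun p => a p * n2 (g i (toC p))).
  move=> ma ia; have iK : rint (fun p => K * `|a p|) by apply: rintZ => //; exact: rint_abs.
  have man : measurable_fun FF (fun p => a p * n2 (g i (toC p))).
    by apply: measurable_funM; [exact: (subset_measurable FD ma)|exact: mn].
  apply: (le_rint _ _ _ iK) => //.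
  move=> p /FDD Dp; rewrite normrM (ger0_norm (n2_ge0 _)) mulrC ler_wpM2r//; exact: gK1.
exists (fun i => \int[@hmu R]_(p in FF) (2^-1 * (rpart v p * n2 (g i (toC p))))).
  move=> i; rewrite (integralX_real FD (mG i)).
    by congr ((_%:C)%C); apply: eq_Rintegral => p _; rewrite (GE i p).1.
  have -> : \int[@hmu R]_(p in FF) ipart (fun z => Gop Gam F f z * (g i z * Num.conj (g i z))) p =
    \int[@hmu R]_(p in FF) (2^-1 * (ipart v p * n2 (g i (toC p)))).
    by apply: eq_Rintegral => p _; rewrite (GE i p).2.
  have ib := bint _ i mv.2 ivi; rewrite RintegralZl//.
  have /eqP -> : \int[@hmu R]_(p in FF) (ipart v p * n2 (g i (toC p))) == 0; last by rewrite mulr0.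
  rewrite -normr_le0; apply: le_trans (le_normr_Rintegral _ _) _ => //.
  have iva := rint_abs ivi.
  have iK : rint (fun p => K * `|ipart v p|) by exact: rintZ.
  have iba := rint_abs ib.
  apply: (@le_trans _ _ (\int[@hmu R]_(p in FF) (K * `|ipart v p|))).
    apply: le_Rintegral => // p /FDD Dp.
    by rewrite normrM (ger0_norm (n2_ge0 _)) mulrC ler_wpM2r//; exact: gK1.
  by rewrite RintegralZl// vi0 mulr0.
have is_ i : rint (fun p => 2^-1 * (rpart v p * n2 (g i (toC p)))).
  by apply: rintZ => //; apply: bint => //; exact: mv.1.
have [//|isum <-] := rint_sum is_.
have ih : rint (fun p => 2^-1 * rpart v p) by exact: rintZ.
have iKh : rint (fun p => K * (2^-1 * rpart v p)) by exact: rintZ.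
have ima := rint_abs imn.
have iKm : rint (fun p => K * `|Num.min (rpart v p) 0|) by exact: rintZ.
(* The last summand pays for the points where [v] is negative, and its integral is zero. *)
apply: (@le_trans _ _ (\int[@hmu R]_(p in FF) (K * (2^-1 * rpart v p) + K * `|Num.min (rpart v p) 0|))).
  apply: le_Rintegral => //; first exact: rintD.
  move=> p /FDD Dp; rewrite -mulr_sumr -mulr_sumr; have := gK p Dp.
  have : 0 <= \sum_(i < n) n2 (g i (toC p)) by rewrite sumr_ge0// => j _; exact: n2_ge0.
  move: (\sum_(i < n) _) (rpart v p) => b x b0 bK.
  rewrite minEle; have [x0|x0] := leP x 0; first by rewrite ler0_norm//; nra.
  by rewrite normr0 mulr0 addr0; nra.
rewrite RintegralD// !RintegralZl// imn0 mulr0 addr0.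
by rewrite -RintegralZl// ler_wpM2l.
Qed.

End resolvent_of_positive.

(** * Orthonormal bases and the Ricci bound *)

Section beltrami_bases.
Context (R : realType) (Gam : set 'M[R[i]]_2) (fG : cocompact_fuchsian Gam).
Context (F : set R[i]) (FD : fundamental_domain Gam F).
Implicit Types (p : R * R) (mu nu : R[i] -> R[i]).
Local Notation FF := (@fdom R F).
Local Notation rint f := ((@hmu R).-integrable FF (EFin \o f)).

Lemma beltrami_lincomb (n : nat) (a : 'I_n -> R[i]) (e : 'I_n -> R[i] -> R[i]) :
  (forall i, beltrami Gam (e i)) -> beltrami Gam (fun z => \sum_(i < n) a i * e i z).
Proof.
move=> be; elim: (index_enum 'I_n) => [|i s [q [hq qinv] qE]].
  exists (fun=> 0); last by move=> z _; rewrite big_nil rmorph0 mulr0.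
  by split; [move=> z _; exact: derivable_cst|move=> *; rewrite mul0r].
have [q' [hq' qinv'] qE'] := be i.
(* A Beltrami differential depends conjugate-linearly on its quadratic differential. *)
exists (fun z => Num.conj (a i) * q' z + q z); last first.
  move=> z z1; rewrite big_cons qE// qE'//; rewrite (_ : Num.conj (_ * _ + _) = a i * Num.conj (q' z) + Num.conj (q z)).
    by ring.
  by apply: complex_ext; rewrite !cxE; ring.
split; last by move=> A z GA z1; rewrite mulrDl -mulrA qinv// qinv'.
move=> z z1; have dq := hq z z1; have dq' := hq' z z1.
have d1 := derivableZ (k := Num.conj (a i)) dq'.
exact: (derivableD d1 dq).
Qed.

Lemma beltrami_cmeasurable mu : beltrami Gam mu -> cmeasurable mu.
Proof.
by move=> bm; split; apply: pcont_measurable => p Dp; have [] := beltrami_pcont fG bm Dp.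
Qed.

Lemma beltrami_bounded mu : beltrami Gam mu ->
  exists2 M, 0 <= M & forall p, DD p -> n2 (mu (toC p)) <= M.
Proof.
move=> bm; have [M M0 HM] := ginv_bounded fG (beltrami_ginv fG bm)
  (fun p Dp => beltrami_n2_pcont fG bm Dp).
by exists M => // p Dp; apply: le_trans (HM p Dp); exact: ler_norm.
Qed.

Lemma bounded_n2_integrable (f : R[i] -> R[i]) (M : R) : cmeasurable f ->
  (forall p, DD p -> n2 (f (toC p)) <= M) ->
  [/\ rint (fun p => n2 (f (toC p))), rint (rpart f) & rint (ipart f)].
Proof.
move=> mf fM; have mF := measurable_fdom FD; have FDD := fdom_DD FD.
have Flty := hmu_fdom_lty fG FD; have [f1 f2] := mf.
have mn := measurable_n2 FD mf; have mr := subset_measurable FD f1; have mi := subset_measurable FD f2.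
have sq (x : R) : `|x| <= 1 + x ^+ 2.
  have := young 1 x (@ltr01 R); rewrite !mul1r expr1n divr1.
  by have := sqr_ge0 x; lra.
split.
- apply: (@bounded_integrable _ _ _ _ _ _ M) => // p /FDD Dp.
  by rewrite ger0_norm ?n2_ge0// fM.
- apply: (@bounded_integrable _ _ _ _ _ _ (1 + M)) => // p /FDD Dp.
  apply: le_trans (sq _) _; rewrite lerD2l; apply: le_trans (fM p Dp).
  by rewrite /n2 lerDl sqr_ge0.
- apply: (@bounded_integrable _ _ _ _ _ _ (1 + M)) => // p /FDD Dp.
  apply: le_trans (sq _) _; rewrite lerD2l; apply: le_trans (fM p Dp).
  by rewrite /n2 lerDr sqr_ge0.
Qed.

Lemma beltrami_product mu nu : beltrami Gam mu -> beltrami Gam nu ->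
  let f z := mu z * Num.conj (nu z) in
  [/\ cmeasurable f, rint (fun p => n2 (f (toC p))), rint (rpart f) & rint (ipart f)].
Proof.
move=> bm bn f; have [M M0 HM] := beltrami_bounded bm; have [N N0 HN] := beltrami_bounded bn.
have mf : cmeasurable f.
  by apply: cmeasurableM; [exact: beltrami_cmeasurable|apply/cmeasurableJ/beltrami_cmeasurable].
have fM p : DD p -> n2 (f (toC p)) <= M * N.
  by move=> Dp; rewrite /f n2M n2J; apply: ler_pM; rewrite ?n2_ge0 ?HM ?HN.
by have [? ? ?] := bounded_n2_integrable mf fM.
Qed.

Lemma self_product mu p : rpart (fun z => mu z * Num.conj (mu z)) p = n2 (mu (toC p)) /\
  ipart (fun z => mu z * Num.conj (mu z)) p = 0.
Proof. by rewrite /rpart /ipart mulJ. Qed.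

Lemma wp_self mu : beltrami Gam mu -> re (wp F mu mu) = \int[@hmu R]_(p in FF) n2 (mu (toC p)).
Proof.
move=> bm; have [mf _ _ _] := beltrami_product bm bm.
rewrite /wp (integralXE FD mf) /=; apply: eq_Rintegral => p _.
exact: (self_product mu p).1.
Qed.

Lemma n2_sum (n : nat) (a e : 'I_n -> R[i]) : n2 (\sum_(i < n) a i * e i) =
  \sum_(i < n) \sum_(j < n) (re (a i * Num.conj (a j)) * re (e i * Num.conj (e j)) -
    im (a i * Num.conj (a j)) * im (e i * Num.conj (e j))).
Proof.
have resum (m : nat) (z : 'I_m -> R[i]) : re (\sum_(i < m) z i) = \sum_(i < m) re (z i).
  exact: (big_morph (@complex.Re R) (@reD R) (@re0 R)).
have -> (z : R[i]) : n2 z = re (z * Num.conj z) by rewrite mulJ.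
rewrite rmorph_sum big_distrlr resum; apply: eq_bigr => i _.
rewrite resum; apply: eq_bigr => j _.
by rewrite rmorphM !cxE; ring.
Qed.

(** Parseval's identity: the double sum is integrated term by term and orthonormality leaves its
    diagonal. *)
Lemma orthonormal_norm (n : nat) (a : 'I_n -> R[i]) (e : 'I_n -> R[i] -> R[i]) :
  (forall i, beltrami Gam (e i)) -> (forall i j, wp F (e i) (e j) = (i == j)%:R) ->
  \int[@hmu R]_(p in FF) n2 (\sum_(i < n) a i * e i (toC p)) = \sum_(i < n) n2 (a i).
Proof.
move=> be on; have mF := measurable_fdom FD.
pose f i j z := e i z * Num.conj (e j z).
have fP i j := beltrami_product (be i) (be j).
have I i j : \int[@hmu R]_(p in FF) rpart (f i j) p = (i == j)%:R /\
    \int[@hmu R]_(p in FF) ipart (f i j) p = 0.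
  have [mf _ _ _] := fP i j; have := on i j; rewrite /wp (integralXE FD mf).
  by case: (i == j) => -[-> ->].
pose c i j p := re (a i * Num.conj (a j)) * rpart (f i j) p - im (a i * Num.conj (a j)) * ipart (f i j) p.
have i1 i j : rint (fun p => re (a i * Num.conj (a j)) * rpart (f i j) p).
  by have [_ _ h _] := fP i j; exact: rintZ.
have i2 i j : rint (fun p => im (a i * Num.conj (a j)) * ipart (f i j) p).
  by have [_ _ _ h] := fP i j; exact: rintZ.
have ic i j : rint (c i j) by apply: rintB.
have Ic i j : \int[@hmu R]_(p in FF) c i j p = re (a i * Num.conj (a j)) * (i == j)%:R.
  have [_ _ h1 h2] := fP i j; rewrite RintegralB// !RintegralZl//.
  by rewrite (I i j).1 (I i j).2 mulr0 subr0.
have is1 i : rint (fun p => \sum_(j < n) c i j p) by have [//|] := rint_sum (ic i).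
transitivity (\int[@hmu R]_(p in FF) (\sum_(i < n) \sum_(j < n) c i j p)).
  by apply: eq_Rintegral => p _; rewrite n2_sum.
have [//|_ ->] := rint_sum is1; apply: eq_bigr => i _.
have [//|_ ->] := rint_sum (ic i); rewrite (bigD1 i)//= Ic eqxx mulr1 mulJ reC.
by rewrite big1 ?addr0// => j ij; rewrite Ic eq_sym (negbTE ij) mulr0.
Qed.

(* Bergman's extremal argument: test the pointwise bound on the differential
   [sum_i (e_i z)^* e_i], whose value at [z] is its squared norm. *)
Lemma bergman_kernel_bound (n : nat) (e : 'I_n -> R[i] -> R[i]) z :
  (forall i, beltrami Gam (e i)) -> (forall i j, wp F (e i) (e j) = (i == j)%:R) ->
  disc z -> \sum_(i < n) n2 (e i z) <= bound_const (inj_radius Gam) ^+ 2.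
Proof.
move=> be on z1; pose a i := Num.conj (e i z).
have := bergman_bound fG FD (beltrami_lincomb a be) z1.
rewrite (orthonormal_norm a be on).
have -> : \sum_(i < n) a i * e i z = ((\sum_(i < n) n2 (e i z))%:C)%C.
  by rewrite rmorph_sum; apply: eq_bigr => i _; rewrite /a mulrC mulJ.
rewrite n2C; under [X in _ * X]eq_bigr do rewrite /a n2J.
have : 0 <= \sum_(i < n) n2 (e i z) by rewrite sumr_ge0// => i _; exact: n2_ge0.
(* The tested inequality reads [B ^+ 2 <= C ^+ 2 * B], with [C] the bound constant; it yields the
   claim after division by [B] unless [B = 0]. *)
move: (\sum_(i < n) _) => B; rewrite le_eqVlt => /predU1P[<- _|B0]; first exact: sqr_ge0.
by rewrite expr2 ler_pM2r.
Qed.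

(** In the order of [R[i]] comparable numbers differ by a real, so every term must also be shown to
    be real: [t i] and [s i] are the real values of its two integrals, and the sum of each family is
    at most [K]. *)
Lemma ricci_bound (n : nat) (e : 'I_n -> R[i] -> R[i]) mu :
  (forall i, beltrami Gam (e i)) -> (forall i j, wp F (e i) (e j) = (i == j)%:R) ->
  beltrami Gam mu -> wp_norm F mu = 1 ->
  ((- (2 * bound_const (inj_radius Gam) ^+ 2))%:C)%C <= wp_ricci Gam F e mu.
Proof.
move=> be on bm nm; set K := bound_const _ ^+ 2; have K0 : 0 <= K by exact: sqr_ge0.
have mF := measurable_fdom FD; have FDD := fdom_DD FD.
have BK p : DD p -> \sum_(i < n) n2 (e i (toC p)) <= K.
  by move=> /DDE; exact: bergman_kernel_bound.
have Imu : \int[@hmu R]_(p in FF) n2 (mu (toC p)) = 1.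
  have := wp_self bm; have I0 : 0 <= \int[@hmu R]_(p in FF) n2 (mu (toC p)).
    by apply: Rintegral_ge0 => p _; exact: n2_ge0.
  by move=> <-; rewrite -[LHS]sqr_sqrtr ?wp_self// -(wp_self bm) -/(wp_norm F mu) nm expr1n.
have [mm inm irm iim] := beltrami_product bm bm.
pose t i := re (integralX F (fun z => Gop Gam F (fun w => mu w * Num.conj (e i w)) z *
  (e i z * Num.conj (mu z)) * rho z)).
have tP i : integralX F (fun z => Gop Gam F (fun w => mu w * Num.conj (e i w)) z *
    (e i z * Num.conj (mu z)) * rho z) = ((t i)%:C)%C /\
    t i <= \int[@hmu R]_(p in FF) n2 (mu (toC p) * Num.conj (e i (toC p))).
  have [mf i_f _ _] := beltrami_product bm (be i).
  have [x + xle] := resolvent_self_pairing fG FD mf i_f.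
  have -> : (fun z => Gop Gam F (fun w => mu w * Num.conj (e i w)) z *
     Num.conj (mu z * Num.conj (e i z)) * rho z) =
     (fun z => Gop Gam F (fun w => mu w * Num.conj (e i w)) z * (e i z * Num.conj (mu z)) * rho z).
    apply/funext => z; congr (_ * _ * _).
    by apply: complex_ext; rewrite !cxE; ring.
  by rewrite /t => ->.
have St : \sum_(i < n) t i <= K.
  apply: (@le_trans _ _ (\sum_(i < n) \int[@hmu R]_(p in FF) n2 (mu (toC p) * Num.conj (e i (toC p))))).
    by apply: ler_sum => i _; exact: (tP i).2.
  have ii i : rint (fun p => n2 (mu (toC p) * Num.conj (e i (toC p)))).
    by have [] := beltrami_product bm (be i).
  have [//|isum <-] := rint_sum ii.
  have [M _ HM] := beltrami_bounded bm.
  have [imu _ _] := bounded_n2_integrable (beltrami_cmeasurable bm) HM.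
  have iK : rint (fun p => K * n2 (mu (toC p))) by exact: rintZ.
  apply: (@le_trans _ _ (\int[@hmu R]_(p in FF) (K * n2 (mu (toC p))))).
    apply: le_Rintegral => // p /FDD Dp.
    under eq_bigr do rewrite n2M n2J.
    by rewrite -mulr_sumr mulrC ler_wpM2r ?n2_ge0// BK.
  by rewrite RintegralZl// Imu mulr1.
have fi p : DD p -> ipart (fun w => mu w * Num.conj (mu w)) p = 0 by rewrite (self_product mu p).2.
have fr p : DD p -> 0 <= rpart (fun w => mu w * Num.conj (mu w)) p.
  by rewrite (self_product mu p).1 n2_ge0.
have [s sP Ss] := resolvent_density fG FD mm fi fr irm (fun i => beltrami_cmeasurable (be i)) K0 BK.
have Irm : \int[@hmu R]_(p in FF) rpart (fun w => mu w * Num.conj (mu w)) p = 1.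
  by rewrite -Imu; apply: eq_Rintegral => p _; rewrite (self_product mu p).1.
rewrite Irm mulr1 in Ss.
have -> : wp_ricci Gam F e mu = ((\sum_(i < n) (- t i - s i))%:C)%C.
  rewrite /wp_ricci rmorph_sum; apply: eq_bigr => i _.
  by rewrite /wp_riemann (tP i).1 sP rmorphB rmorphN.
rewrite lecR big_split /= !sumrN; lra.
Qed.

End beltrami_bases.

Theorem proposition3p4 (R : realType) (g : nat) (Gam : set 'M[R[i]]_2)
    (F : set R[i]) (nu : 'I_(3 * g - 3) -> R[i] -> R[i]) :
  (2 <= g)%N ->
  cocompact_fuchsian Gam ->
  has_genus Gam g ->
  fundamental_domain Gam F ->
  wp_orthonormal_basis Gam F nu ->
  (forall mu : R[i] -> R[i], beltrami Gam mu -> wp_norm F mu = 1 ->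
     ((- (2 * bound_const (inj_radius Gam) ^+ 2))%:C)%C
       <= wp_ricci Gam F nu mu)
  /\ ((- (2 * (3 * g - 3)%:R * bound_const (inj_radius Gam) ^+ 2))%:C)%C
       <= wp_scalar Gam F nu.
Proof.
move=> _ fG _ FD [be on _].
have A (mu : R[i] -> R[i]) : beltrami Gam mu -> wp_norm F mu = 1 ->
    ((- (2 * bound_const (inj_radius Gam) ^+ 2))%:C)%C <= wp_ricci Gam F nu mu.
  exact: ricci_bound.
split => //.
have -> : ((- (2 * (3 * g - 3)%:R * bound_const (inj_radius Gam) ^+ 2))%:C)%C =
    \sum_(i < 3 * g - 3) ((- (2 * bound_const (inj_radius Gam) ^+ 2))%:C)%C :> R[i].
  rewrite sumr_const card_ord -rmorphMn; congr ((_%:C)%C).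
  by rewrite -mulr_natr; move: (3 * g - 3)%N (bound_const _) => k c; ring.
apply: ler_sum => i _; apply: A => //.
by rewrite /wp_norm on eqxx sqrtr1.
Qed.
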